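(* Let $1<p<\infty$. There is a constant $C_p$, depending only on $p$, such that the following holds. If $f\in W^{1,1}(\mathbb{D})\cap L^{2p/(p+1)}(\mathbb{D})$ satisfies $M_1(r,f)=o((1-r)^{-1})$ as $r\to 1^-$ and $S_z(f)\in L^p(\partial\mathbb{D})$, then the Bergman projection $\mathcal{P}(f)$ belongs to the Hardy space $H^p$ and $$\|\mathcal{P}(f)\|_{H^p}\le C_p\left(\|S_z(f)\|_{L^p(\partial\mathbb{D})}+\|f\|_{L^{2p/(p+1)}(\mathbb{D})}\right).$$
   Context: $\mathbb{D}$ is the open unit disc in $\mathbb{C}$, and $dA$ is Lebesgue area measure. The Bergman projection of $f\in L^1(\mathbb{D})$ is $$\mathcal{P}(f)(z)=\int_{\mathbb{D}} f(w)\frac{1}{(1-z\overline{w})^2}\frac{dA(w)}{\pi},\qquad z\in\mathbb{D}.$$ For $0<p<\infty$ and $0\le r<1$, $M_p(r,f)=\left\{\frac{1}{2\pi}\int_0^{2\pi}|f(re^{i\theta})|^p\,d\theta\right\}^{1/p}$. The Hardy space $H^p$ consists of the analytic functions $f$ in $\mathbb{D}$ with $\|f\|_{H^p}=\sup_{0\le r<1}M_p(r,f)<\infty$. $W^{1,1}(\mathbb{D})$ is the usual Sobolev space, and $\partial_z=\frac12(\partial_x-i\partial_y)$. For each $\theta$, $\Gamma_\theta=\{(r,\phi): |\theta-\phi|<(1-r)/2,\ 0<r<1\}$, and $S_z(f)\ge 0$ is the function on $\partial\mathbb{D}$ defined by $$S_z(f)(e^{i\theta})^2=\iint_{\Gamma_\theta}|\partial_z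 f(re^{i\phi})|^2\,dr\,d\phi .$$ $L^p(\partial\mathbb{D})$ is taken with respect to normalized measure $d\theta/(2\pi)$. *)

(* Defs.v *)
From HB Require Import structures.
From mathcomp Require Import all_boot all_order all_algebra.
From mathcomp Require Import all_classical all_reals all_analysis.
From mathcomp Require Import measurable_realfun complex.

Set Implicit Arguments.
Unset Strict Implicit.
Unset Printing Implicit Defensive.

Import Order.TTheory GRing.Theory Num.Theory.
Import numFieldNormedType.Exports.

Local Open Scope classical_set_scope.
Local Open Scope ring_scope.
Local Open Scope complex_scope.

Definition toC (R : realType) (w : R * R) : R[i] := w.1 +i* w.2.

Definition polar (R : realType) (r t : R) : R[i] :=
  (r * cos t) +i* (r * sin t).

(* The modulus with values in [R]: the norm [`|z|] of [R[i]] is in [R[i]]. *)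
Definition modulus (R : realType) (z : R[i]) : R := complex.Re `|z|.

Definition cdisc (R : realType) : set R[i] := [set z | modulus z < 1].

Definition disc (R : realType) : set (R * R) := @toC R @^-1` @cdisc R.

Definition area (R : realType) :
    {measure set (measurableTypeR R * measurableTypeR R) -> \bar R} :=
  ((@lebesgue_measure R) \x (@lebesgue_measure R))%E.
Arguments area : clear implicits.

Definition cintegrable (R : realType) (A : set (R * R)) (g : R * R -> R[i]) :=
  (area R).-integrable A (EFin \o (fun w => complex.Re (g w))) /\
  (area R).-integrable A (EFin \o (fun w => complex.Im (g w))).

Definition cintegral (R : realType) (A : set (R * R)) (g : R * R -> R[i])
    : R[i] :=
  (\int[area R]_(w in A) complex.Re (g w))%R +i*
  (\int[area R]_(w in A) complex.Im (g w))%R.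

Definition bergman (R : realType) (f : R[i] -> R[i]) (z : R[i]) : R[i] :=
  cintegral (@disc R)
    (fun w => f (toC w) * (1 / (1 - z * (toC w)^*) ^+ 2) / (pi : R)%:C).

(* The norm of [L^p] of the unit circle with the measure [dt / (2 pi)], for a
   function of the angle [t]. *)
Definition circle_norm (R : realType) (p : R) (g : R -> \bar R) : \bar R :=
  (((2 * pi)^-1)%:E *
     \int[lebesgue_measure]_(t in `[0%R, (2 * pi)%R]) (`|g t| `^ p))%E
  `^ p^-1.

Definition in_circle_Lp (R : realType) (p : R) (g : R -> \bar R) :=
  measurable_fun `[0, 2 * pi] g /\ (circle_norm p g < +oo)%E.

Definition integral_mean (R : realType) (p r : R) (f : R[i] -> R[i]) : \bar R :=
  circle_norm p (fun t => (modulus (f (polar r t)))%:E).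

Definition hardy_norm (R : realType) (p : R) (f : R[i] -> R[i]) : \bar R :=
  ereal_sup [set integral_mean p r f | r in [set r : R | 0 <= r < 1]].

(* Complex differentiability when [K] is [R[i]]. *)
Definition analytic_on (K : numFieldType) (U : set K) (f : K -> K) :=
  forall z, U z -> derivable (f : K^o -> K^o) z 1.

Definition in_hardy (R : realType) (p : R) (f : R[i] -> R[i]) :=
  analytic_on (@cdisc R) f /\ (hardy_norm p f < +oo)%E.

Definition disc_norm (R : realType) (q : R) (f : R[i] -> R[i]) : \bar R :=
  ('N[area R]_(q%:E)[(fun w => (modulus (f (toC w)))%:E) \_ (@disc R)])%E.

Definition ddx (R : realType) (phi : R * R -> R) : R * R -> R :=
  fun w => 'D_(1, 0) phi w.

Definition ddy (R : realType) (phi : R * R -> R) : R * R -> R :=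
  fun w => 'D_(0, 1) phi w.

Fixpoint Ck (R : realType) (k : nat) (phi : R * R -> R) : Prop :=
  continuous phi /\
  if k is k'.+1 then
    [/\ forall w, derivable phi w (1, 0), forall w, derivable phi w (0, 1),
        Ck k' (ddx phi) & Ck k' (ddy phi)]
  else True.

Definition test_function (R : realType) (phi : R * R -> R) :=
  let supp := closure [set w | phi w != 0] in
  [/\ forall k, Ck k phi, compact supp & supp `<=` @disc R].

(* [f] is in [W^{1,1}] of the disc, and its weak partial derivatives in [x] and
   in [y] are (represented by) [fx] and [fy]. *)
Definition sobolev11 (R : realType) (f fx fy : R[i] -> R[i]) :=
  [/\ cintegrable (@disc R) (f \o @toC R),
      cintegrable (@disc R) (fx \o @toC R),
      cintegrable (@disc R) (fy \o @toC R) &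
      forall phi : R * R -> R, test_function phi ->
        cintegral (@disc R) (fun w => f (toC w) * (ddx phi w)%:C) =
          - cintegral (@disc R) (fun w => fx (toC w) * (phi w)%:C) /\
        cintegral (@disc R) (fun w => f (toC w) * (ddy phi w)%:C) =
          - cintegral (@disc R) (fun w => fy (toC w) * (phi w)%:C)].

Definition dz (R : realType) (fx fy : R[i] -> R[i]) : R[i] -> R[i] :=
  fun z => (fx z - 'i * fy z) / 2.

(* In polar coordinates [(r, phi)]. *)
Definition Gamma (R : realType) (t : R) : set (R * R) :=
  [set u | `|t - u.2| < (1 - u.1) / 2 /\ 0 < u.1 < 1].

(* The area function of [f], for [h] the derivative of [f] in [z]; the measure
   is [dr dphi]. *)
Definition square_fun (R : realType) (h : R[i] -> R[i]) (t : R) : \bar R :=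
  (\int[area R]_(u in Gamma t) ((modulus (h (polar u.1 u.2))) ^+ 2)%:E)%E
  `^ 2^-1.

(* Main.v *)
(* The kernel [k_z(w) = (1 - z conj w)^-2] is antiholomorphic in [w]. With
   [s = |w|^2], integration by parts against [w (1 - s) (2 - s) k_z] gives
     int f k_z = int (dz f) w (1 - s) (2 - s) k_z + 3 int f (1 - s)^2 k_z;
   the growth condition on the means [M_1] removes the boundary term. Since
   [(1 - s)^2 |k_z| <= 4], the last integral is controlled by the [L^1] norm of
   [f]. On the circle of radius [r], the other one is tested against [g] in
   [L^q], [1/p + 1/q = 1]: in polar coordinates this is bounded by
     int (1 - rho) |dz f| |K g(r rho, phi)| drho dphi,
   with [K g] a derivative of the Poisson extension of [g]. By AM-GM with a
   suitable weight, it is at most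
     C (int S_z(f)^p + int |g|^q),
   and taking [g] a small multiple of [sgn(F) |F|^(p-1)] yields the [L^p] bound.
   For [p <= 2] the weight comes from the Poisson extension of [S_z(f)^(p-1)] and
   the part with [K g] from the convex function [(x^2 + z^2)^(q/2)] of the two
   extensions, whose means increase with the radius: their increments over the
   dyadic radii dominate the weighted square function and telescope. For
   [p >= 2] the same argument runs with [x^q], and the weight is controlled by
   the Hardy-Littlewood maximal function. *)
Require Import Defs.
From HB Require Import structures.
From mathcomp Require Import all_boot all_order all_algebra.
From mathcomp Require Import all_classical all_reals all_analysis.
From mathcomp Require Import measurable_realfun complex.
From mathcomp Require Import ring lra.

Set Implicit Arguments.
Unset Strict Implicit.
Unset Printing Implicit Defensive.

Import Order.TTheory GRing.Theory Num.Theory.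
Import numFieldNormedType.Exports.

Local Open Scope classical_set_scope.
Local Open Scope ring_scope.

(** * Integrals of bounded functions over the circle *)

Section bounded_measurable.
Context {R : realType}.
Local Notation mu := (@lebesgue_measure R).
Local Notation J := (`[0, 2 * pi]%classic : set R).

(** Harmonicity enters only through convolution identities: the Poisson kernels of radii [a] and [b]
    convolve to that of radius [a * b], and the derivative kernel of radius [a] against the Poisson
    kernel of radius [b] gives [b] times the derivative kernel of radius [a * b]. Going from radius
    [(1 + x) / 2] down to [x] is then an average against a probability kernel. Quantitative
    convexity of a power at the mean bounds the variance of that average, and the variance controls
    the derivative; this replaces Green's formula. The duality argument absorbs the unknown norm, so
    that norm must be finite beforehand. Hence everything is proved for bounded functions: the
    transform on a circle of radius [r < 1] is bounded, the density in polar coordinates is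
    truncated, and the truncation is removed by monotone convergence. Negative powers of the weights
    call for functions bounded below, whence a shift by [e] that tends to 0 afterwards. Weak
    derivatives admit only compactly supported test functions, which is why a smooth radial cutoff
    appears and why the Bergman kernel is first replaced by polynomials in the conjugate
    variable. *)

Definition circ_int (f : R -> R) : R := (\int[mu]_(t in J) f t)%R.

(** Boundedness is required on all of [T], not only on the circle: the class is then closed under
    products, compositions and convolution with the kernels, and every integral over the circle is a
    finite real number. *)
Definition bmeas (d : measure_display) (T : measurableType d) (f : T -> R) :=
  measurable_fun setT f /\ exists M, forall t, `|f t| <= M.

Lemma twopi_ge0 : 0 <= 2 * pi :> R.
Proof. by rewrite mulr_ge0// pi_ge0. Qed.

Lemma measure_circ : mu J = (2 * pi)%:E.
Proof.
rewrite lebesgue_measure_itv/= lte_fin.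
by rewrite ifT ?mulr_gt0 ?pi_gt0// oppr0 adde0.
Qed.

Section algebra.
Context d (T : measurableType d).
Implicit Types f g : T -> R.

Lemma bmeas_cst c : bmeas (fun _ : T => c).
Proof. by split; [exact: measurable_cst | exists `|c|]. Qed.

Lemma bmeasD f g : bmeas f -> bmeas g -> bmeas (fun x => f x + g x).
Proof.
move=> [mf [M fM]] [mg [N gN]]; split; first exact: measurable_funD.
by exists (M + N) => t; rewrite (le_trans (ler_normD _ _))// lerD.
Qed.

Lemma bmeasN f : bmeas f -> bmeas (fun x => - f x).
Proof.
move=> [mf [M fM]]; split; first exact: measurableT_comp.
by exists M => t; rewrite normrN.
Qed.

Lemma bmeasB f g : bmeas f -> bmeas g -> bmeas (fun x => f x - g x).
Proof. by move=> bf bg; apply: bmeasD => //; exact: bmeasN. Qed.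

Lemma bmeasM f g : bmeas f -> bmeas g -> bmeas (fun x => f x * g x).
Proof.
move=> [mf [M fM]] [mg [N gN]]; split; first exact: measurable_funM.
by exists (M * N) => t; rewrite normrM ler_pM.
Qed.

Lemma bmeasZ c f : bmeas f -> bmeas (fun x => c * f x).
Proof. by move=> bf; apply: bmeasM => //; exact: bmeas_cst. Qed.

Lemma bmeas_norm f : bmeas f -> bmeas (fun x => `|f x|).
Proof.
move=> [mf [M fM]]; split; first exact: measurableT_comp.
by exists M => t; rewrite normr_id.
Qed.

Lemma bmeasX f n : bmeas f -> bmeas (fun x => f x ^+ n).
Proof.
move=> bf; elim: n => [|n IH].
  by under [X in bmeas X]eq_fun do rewrite expr0; exact: bmeas_cst.
by under [X in bmeas X]eq_fun do rewrite exprS; exact: bmeasM.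
Qed.

Lemma bmeas_le f g : measurable_fun setT f -> bmeas g ->
  (forall x, `|f x| <= g x) -> bmeas f.
Proof.
move=> mf [_ [M gM]] fg; split => //; exists M => t.
by rewrite (le_trans (fg t))// (le_trans (ler_norm _)).
Qed.

Lemma bmeas_powR f p : 0 <= p -> (forall x, 0 <= f x) -> bmeas f ->
  bmeas (fun x => f x `^ p).
Proof.
move=> p0 f0 [mf [M fM]]; split.
  exact: (measurableT_comp (measurable_powR p)).
exists (M `^ p) => t; rewrite ger0_norm ?powR_ge0//.
have f0t := f0 t; have fMt : f t <= M by rewrite -(ger0_norm f0t).
by apply: ge0_ler_powR => //; rewrite nnegrE// (le_trans f0t).
Qed.

End algebra.

Lemma bmeas_comp d1 d2 (T1 : measurableType d1) (T2 : measurableType d2)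
    (f : T2 -> R) (g : T1 -> T2) :
  bmeas f -> measurable_fun setT g -> bmeas (f \o g).
Proof.
move=> [mf [M fM]] mg; split; first exact: measurableT_comp.
by exists M => t; exact: fM.
Qed.

Lemma bmeas_integrable f : bmeas f -> mu.-integrable J (EFin \o f).
Proof.
move=> [mf [M fM]]; apply: measurable_bounded_integrable => //.
- by rewrite [X in (X < _)%E]measure_circ ltry.
- exact: measurable_funTS.
- by exists M; split; [exact: num_real | move=> x Mx t _; exact: le_trans (fM t) (ltW Mx)].
Qed.

Lemma circ_intD f g : bmeas f -> bmeas g ->
  circ_int (fun t => f t + g t) = circ_int f + circ_int g.
Proof. by move=> bf bg; apply: RintegralD => //; exact: bmeas_integrable. Qed.

Lemma circ_intB f g : bmeas f -> bmeas g ->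
  circ_int (fun t => f t - g t) = circ_int f - circ_int g.
Proof. by move=> bf bg; apply: RintegralB => //; exact: bmeas_integrable. Qed.

Lemma circ_intZ c f : bmeas f ->
  circ_int (fun t => c * f t) = c * circ_int f.
Proof. by move=> bf; apply: RintegralZl => //; exact: bmeas_integrable. Qed.

Lemma circ_intZr c f : bmeas f ->
  circ_int (fun t => f t * c) = circ_int f * c.
Proof. by move=> bf; apply: RintegralZr => //; exact: bmeas_integrable. Qed.

Lemma circ_int_cst c : circ_int (fun _ => c) = c * (2 * pi).
Proof.
rewrite /circ_int Rintegral_cst//.
by rewrite [X in fine X](measure_circ).
Qed.

Lemma le_circ_int f g : bmeas f -> bmeas g -> (forall t, f t <= g t) ->
  circ_int f <= circ_int g.
Proof.
by move=> bf bg fg; apply: le_Rintegral => //; exact: bmeas_integrable.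
Qed.

Lemma circ_int_ge0 f : (forall t, 0 <= f t) -> 0 <= circ_int f.
Proof. by move=> f0; apply: Rintegral_ge0. Qed.

Lemma le_norm_circ_int f : bmeas f ->
  `|circ_int f| <= circ_int (fun t => `|f t|).
Proof. by move=> bf; apply: le_normr_Rintegral => //; exact: bmeas_integrable. Qed.

Lemma circ_intE f : bmeas f ->
  (circ_int f)%:E = (\int[mu]_(t in J) (f t)%:E)%E.
Proof.
move=> bf; rewrite /circ_int /Rintegral fineK//.
exact: integrable_fin_num (bmeas_integrable bf).
Qed.

Lemma eq_circ_int f g : (forall t, f t = g t) -> circ_int f = circ_int g.
Proof. by move=> fg; congr circ_int; exact/funext. Qed.

End bounded_measurable.

(** * Fubini on the circle *)

Section circ_fubini.
Context {R : realType}.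
Local Notation mu := (@lebesgue_measure R).
Local Notation J := (`[0, 2 * pi]%classic : set R).

Lemma measurable_prodmk1 d1 d2 (T1 : measurableType d1) (T2 : measurableType d2)
  (x : T1) : measurable_fun [set: T2] (fun y : T2 => (x, y)).
Proof. by apply: measurable_fun_pair => //; exact: measurable_cst. Qed.

Lemma bmeas_pair1 d1 d2 (T1 : measurableType d1) (T2 : measurableType d2)
  (f : T1 * T2 -> R) (x : T1) : bmeas f -> bmeas (fun y => f (x, y)).
Proof.
by move=> bf; apply: (bmeas_comp bf); exact: measurable_prodmk1.
Qed.

Lemma measurable_indic_circ d (T : measurableType d) (g : T -> R) :
  measurable_fun setT g -> measurable_fun setT (fun x => (\1_J (g x) : R)%:E).
Proof.
move=> mg; apply/measurable_EFinP; exact: measurableT_comp.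
Qed.

Lemma measurable_tonelli1 d (T : measurableType d) (f : T * R -> \bar R) :
  measurable_fun setT f -> (forall x, (0 <= f x)%E) ->
  measurable_fun setT (fun x => \int[mu]_(t in J) f (x, t))%E.
Proof.
move=> mf f0.
pose g := fun xt : T * R => (f xt * (\1_J xt.2)%:E)%E.
rewrite (_ : (fun x => _) = (fun x => \int[mu]_t g (x, t))%E); last first.
  apply/funext => x; rewrite integral_mkcond; apply: eq_integral => t _.
  by rewrite epatch_indic.
apply: measurable_fun_fubini_tonelli_F => //.
  apply: emeasurable_funM => //.
  exact: measurable_indic_circ.
by move=> x; rewrite mule_ge0// lee_fin.
Qed.

Lemma bmeas_circ_int d (T : measurableType d) (f : T * R -> R) :
  bmeas f -> bmeas (fun x => circ_int (fun t => f (x, t))).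
Proof.
move=> bf; have [mf [M fM]] := bf.
have M0 t : - M <= f t by have := fM t; rewrite ler_norml => /andP[].
have bf1 : bmeas (fun x => f x + M) by apply: bmeasD => //; exact: bmeas_cst.
split; last first.
  exists (M * (2 * pi)) => x.
  apply: (le_trans (le_norm_circ_int (bmeas_pair1 x bf))).
  rewrite -circ_int_cst; apply: le_circ_int => //.
    exact: bmeas_norm (bmeas_pair1 x bf).
  exact: bmeas_cst.
(* Adding the bound [M] makes the integrand nonnegative, so that Tonelli gives measurability; the
   integral of [M] is subtracted again. *)
rewrite (_ : (fun x => _) = (fun x => fine (\int[mu]_(t in J) (f (x, t) + M)%:E)%E
    - M * (2 * pi))); last first.
  apply/funext => x.
  rewrite -(circ_intE (bmeas_pair1 x bf1))/= circ_intD.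
  - by rewrite circ_int_cst addrK.
  - exact: bmeas_pair1.
  - exact: bmeas_cst.
apply: measurable_funB; last exact: measurable_cst.
apply: (@measurableT_comp _ _ _ _ _ _ (@fine R)); first exact: fine_measurable.
apply: (measurable_tonelli1 (f := fun x => (f x + M)%:E)).
  by apply/measurable_EFinP; exact: bf1.1.
by move=> x; rewrite lee_fin -lerBlDr sub0r.
Qed.

Lemma measurable_swap d1 d2 (T1 : measurableType d1) (T2 : measurableType d2) :
  measurable_fun [set: T1 * T2] (fun x => (x.2, x.1)).
Proof. by apply: measurable_fun_pair. Qed.

Lemma tonelli_circ (f : R * R -> \bar R) : measurable_fun setT f ->
  (forall x, 0 <= f x)%E ->
  (\int[mu]_(s in J) \int[mu]_(t in J) f (s, t) =
   \int[mu]_(t in J) \int[mu]_(s in J) f (s, t))%E.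
Proof.
move=> mf f0.
pose g := fun st : R * R => (f st * (\1_J st.2)%:E * (\1_J st.1)%:E)%E.
have m1 : measurable_fun setT (fun x : R * R => (\1_J x.1 : R)%:E).
  exact: measurable_indic_circ.
have m2 : measurable_fun setT (fun x : R * R => (\1_J x.2 : R)%:E).
  exact: measurable_indic_circ.
have mg : measurable_fun setT g by do 2 apply: emeasurable_funM => //.
have g0 x : (0 <= g x)%E by rewrite !mule_ge0// lee_fin.
transitivity (\int[mu]_s \int[mu]_t g (s, t))%E.
  rewrite integral_mkcond; apply: eq_integral => s _; rewrite epatch_indic.
  rewrite integral_mkcond.
  under eq_integral do rewrite epatch_indic.
  rewrite -ge0_integralZr// ?lee_fin//.
  - apply: emeasurable_funM; last by apply/measurable_EFinP.
    by apply: (measurableT_comp mf); exact: measurable_prodmk1.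
  - by move=> t _; rewrite mule_ge0// lee_fin.
transitivity (\int[mu]_t \int[mu]_s g (s, t))%E; last first.
  rewrite [RHS]integral_mkcond; apply: eq_integral => t _; rewrite epatch_indic.
  rewrite [X in (_ = X * _)%E]integral_mkcond.
  under [X in (_ = X * _)%E]eq_integral do rewrite epatch_indic.
  rewrite -ge0_integralZr// ?lee_fin//.
  - by apply: eq_integral => s _; rewrite /g/= -!muleA (muleC (\1_J s)%:E).
  - apply: emeasurable_funM.
      apply: (measurableT_comp mf).
      by apply: measurable_fun_pair => //; exact: measurable_cst.
    by apply/measurable_EFinP.
  - by move=> s _; rewrite mule_ge0// lee_fin.
exact: (fubini_tonelli (m1 := mu) (m2 := mu)).
Qed.

(** Tonelli for the nonnegative function [f + M]; the integral of the constant is the same on both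
    sides and cancels. *)
Lemma circ_int_swap (f : R * R -> R) : bmeas f ->
  circ_int (fun s => circ_int (fun t => f (s, t))) =
  circ_int (fun t => circ_int (fun s => f (s, t))).
Proof.
move=> bf; have [mf [M fM]] := bf.
have M0 t : 0 <= f t + M.
  by have := fM t; rewrite ler_norml -lerBlDr sub0r => /andP[].
have bf1 : bmeas (fun x => f x + M) by apply: bmeasD => //; exact: bmeas_cst.
have bs (g : R * R -> R) : bmeas g -> bmeas (fun x => g (x.2, x.1)).
  by move=> bg; apply: (bmeas_comp bg); exact: measurable_swap.
have b2 (g : R * R -> R) t : bmeas g -> bmeas (fun s => g (s, t)).
  by move=> bg; exact: (bmeas_pair1 t (bs _ bg)).
have bi (g : R * R -> R) : bmeas g -> bmeas (fun t => circ_int (fun s => g (s, t))).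
  by move=> bg; exact: (bmeas_circ_int (bs _ bg)).
have bc (c : R) : bmeas (fun _ : R => c) by exact: bmeas_cst.
suff : circ_int (fun s => circ_int (fun t => f (s, t) + M)) =
  circ_int (fun t => circ_int (fun s => f (s, t) + M)).
  under eq_circ_int => s do rewrite (circ_intD (bmeas_pair1 s bf) (bc _)).
  under [in RHS]eq_circ_int => s do rewrite (circ_intD (b2 _ s bf) (bc _)).
  rewrite (circ_intD (bmeas_circ_int bf) (bc _)) (circ_intD (bi _ bf) (bc _)).
  exact: addIr.
apply: EFin_inj; rewrite circ_intE; last exact: bmeas_circ_int bf1.
rewrite [RHS]circ_intE; last exact: (bi _ bf1).
transitivity (\int[mu]_(s in J) \int[mu]_(t in J) (f (s, t) + M)%:E)%E.
  by apply: eq_integral => s _; rewrite (circ_intE (bmeas_pair1 s bf1)).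
rewrite (tonelli_circ (f := fun x => (f x + M)%:E)).
- by apply: eq_integral => s _; rewrite (circ_intE (b2 _ s bf1)).
- by apply/measurable_EFinP; exact: bf1.1.
- by move=> x; rewrite lee_fin.
Qed.

End circ_fubini.

(** * The real-valued modulus of complex numbers *)

Section complex_modulus.
Context {R : realType}.
Implicit Types (z w : R[i]).

Lemma modulusE z : modulus z = Num.sqrt (complex.Re z ^+ 2 + complex.Im z ^+ 2).
Proof. by rewrite /modulus normc_def. Qed.

Lemma norm_modulus z : `|z| = ((modulus z)%:C)%C.
Proof. by rewrite /modulus normc_def. Qed.

Lemma modulus_ge0 z : 0 <= modulus z.
Proof. by rewrite modulusE sqrtr_ge0. Qed.

Lemma sqr_modulus z : modulus z ^+ 2 = complex.Re z ^+ 2 + complex.Im z ^+ 2.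
Proof. by rewrite modulusE sqr_sqrtr// addr_ge0// sqr_ge0. Qed.

Lemma modulusM z w : modulus (z * w) = modulus z * modulus w.
Proof.
by apply: complexI; rewrite rmorphM/= -!norm_modulus normrM.
Qed.

Lemma modulusN z : modulus (- z) = modulus z.
Proof. by rewrite /modulus normrN. Qed.

Lemma modulusV z : modulus z^-1 = (modulus z)^-1.
Proof. by apply: complexI; rewrite fmorphV/= -!norm_modulus normfV. Qed.

Lemma modulusX z n : modulus (z ^+ n) = modulus z ^+ n.
Proof. by apply: complexI; rewrite rmorphXn/= -!norm_modulus normrX. Qed.

Lemma modulusD z w : modulus (z + w) <= modulus z + modulus w.
Proof. by rewrite -lecR rmorphD/= -!norm_modulus ler_normD. Qed.

Lemma modulusB z w : modulus (z - w) <= modulus z + modulus w.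
Proof. by rewrite -(modulusN w); exact: modulusD. Qed.

Lemma ler_modulusB z w : modulus z - modulus w <= modulus (z - w).
Proof. by rewrite lerBlDr -{1}(subrK w z) modulusD. Qed.

Lemma modulus1 : modulus (1 : R[i]) = 1.
Proof. by rewrite /modulus normr1. Qed.

Lemma modulus_eq0 z : (modulus z == 0) = (z == 0).
Proof. by rewrite -[RHS]normr_eq0 norm_modulus eq_complex/= eqxx andbT. Qed.

Lemma modulus_conj z : modulus (z^*)%C = modulus z.
Proof. by rewrite !modulusE; case: z => a b /=; rewrite sqrrN. Qed.

Lemma modulus_real (x : R) : modulus (x%:C)%C = `|x|.
Proof. by rewrite modulusE/= expr0n/= addr0 sqrtr_sqr. Qed.

Lemma modulus_nat n : modulus (n%:R : R[i]) = n%:R.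
Proof. by rewrite /modulus normr_nat; elim: n => //= n; rewrite -!natr1 => <-; rewrite raddfD. Qed.

Lemma Re_le_modulus z : `|complex.Re z| <= modulus z.
Proof.
rewrite -(ger0_norm (modulus_ge0 z)) -ler_sqr ?nnegrE// !real_normK ?num_real//.
by rewrite sqr_modulus lerDl sqr_ge0.
Qed.

Lemma Im_le_modulus z : `|complex.Im z| <= modulus z.
Proof.
rewrite -(ger0_norm (modulus_ge0 z)) -ler_sqr ?nnegrE// !real_normK ?num_real//.
by rewrite sqr_modulus lerDr sqr_ge0.
Qed.

Lemma modulus_le_ReIm z : modulus z <= `|complex.Re z| + `|complex.Im z|.
Proof.
rewrite -(ger0_norm (modulus_ge0 z)) -ler_sqr ?nnegrE ?addr_ge0//.
rewrite real_normK ?num_real// sqr_modulus sqrrD !real_normK ?num_real//.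
by rewrite addrAC lerDl mulrn_wge0// mulr_ge0.
Qed.

Lemma modulus_polar (r t : R) : modulus (polar r t) = `|r|.
Proof.
rewrite modulusE/= !exprMn -mulrDr cos2Dsin2 mulr1 sqrtr_sqr//.
Qed.

Lemma polarM (r s t u : R) : polar r t * polar s u = polar (r * s) (t + u).
Proof. by rewrite /polar cosD sinD; simpc; congr (_ +i* _)%C; ring. Qed.

Lemma polar0 (r : R) : polar r 0 = (r%:C)%C.
Proof. by rewrite /polar cos0 sin0 mulr1 mulr0. Qed.

Lemma polarX (r t : R) n : polar r t ^+ n = polar (r ^+ n) (t *+ n).
Proof.
by elim: n => [|n IH]; rewrite ?expr0 ?mulr0n ?polar0// !exprS IH polarM mulrS.
Qed.

Lemma conj_polar (r t : R) : ((polar r t)^*)%C = polar r (- t).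
Proof. by rewrite /polar cosN sinN mulrN. Qed.

Lemma Re_sum (I : Type) (s : seq I) (F : I -> R[i]) :
  complex.Re (\sum_(i <- s) F i) = \sum_(i <- s) complex.Re (F i).
Proof. by apply: (big_morph (@complex.Re R)) => //; case=> [? ?] [? ?]. Qed.

Lemma Im_sum (I : Type) (s : seq I) (F : I -> R[i]) :
  complex.Im (\sum_(i <- s) F i) = \sum_(i <- s) complex.Im (F i).
Proof. by apply: (big_morph (@complex.Im R)) => //; case=> [? ?] [? ?]. Qed.

Lemma ReD z w : complex.Re (z + w) = complex.Re z + complex.Re w.
Proof. by case: z w => [? ?] [? ?]. Qed.
Lemma ImD z w : complex.Im (z + w) = complex.Im z + complex.Im w.
Proof. by case: z w => [? ?] [? ?]. Qed.
Lemma ReN z : complex.Re (- z) = - complex.Re z. Proof. by case: z. Qed.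
Lemma ImN z : complex.Im (- z) = - complex.Im z. Proof. by case: z. Qed.
Lemma ReB z w : complex.Re (z - w) = complex.Re z - complex.Re w.
Proof. by rewrite ReD ReN. Qed.
Lemma ImB z w : complex.Im (z - w) = complex.Im z - complex.Im w.
Proof. by rewrite ImD ImN. Qed.
Lemma Re_mul z w : complex.Re (z * w) =
  complex.Re z * complex.Re w - complex.Im z * complex.Im w.
Proof. by case: z w => [? ?] [? ?]. Qed.
Lemma Im_mul z w : complex.Im (z * w) =
  complex.Re z * complex.Im w + complex.Im z * complex.Re w.
Proof. by case: z w => [? ?] [? ?] /=; rewrite addrC. Qed.

Lemma complex_eqP z w : complex.Re z = complex.Re w ->
  complex.Im z = complex.Im w -> z = w.
Proof. by case: z w => [? ?] [? ?] /= -> ->. Qed.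

End complex_modulus.

(** * Two power series with explicit remainders *)

Section power_series.
Context {R : realType}.
Implicit Types (z : R[i]).

(** Each of the [N] terms of the geometric sum is at least [s ^+ N], and the sum is at most
    [(1 - s)^-1]. *)
Lemma geom_bound (s : R) N : 0 <= s < 1 -> N%:R * s ^+ N <= (1 - s)^-1.
Proof.
move=> /andP[s0 s1].
have s10 : 0 < 1 - s by rewrite subr_gt0.
have H : (1 - s) * \sum_(i < N) s ^+ i = 1 - s ^+ N.
  by rewrite -[1 - s]opprB mulNr -subrX1 opprB.
rewrite -[X in _ <= X]mul1r ler_pdivlMr// mulrC.
apply: (@le_trans _ _ ((1 - s) * \sum_(i < N) s ^+ i)).
  rewrite ler_wpM2l ?(ltW s10)//.
  rewrite -[X in X%:R]card_ord -sumr_const mulr_suml.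
  apply: ler_sum => i _; rewrite mul1r; by apply: ler_wiXn2l => //; [exact: ltW|exact: ltnW].
by rewrite H gerBl exprn_ge0.
Qed.

Lemma natX_cvg0 (a : R) : 0 <= a < 1 -> forall e : R, 0 < e ->
  exists N0, forall N, (N0 <= N)%N -> N%:R * a ^+ N <= e /\ a ^+ N <= e.
Proof.
move=> /andP[a0 a1] e e0.
(* Of the two factors [s ^+ N] of [a ^+ N], one absorbs [N] by [geom_bound] and the other tends to
   0. *)
pose s := Num.sqrt a.
have s0 : 0 <= s by rewrite sqrtr_ge0.
have s1 : s < 1 by rewrite -sqrtr1 ltr_sqrt.
have s10 : 0 < 1 - s by rewrite subr_gt0.
have : s ^+ n @[n --> \oo] --> (0 : R) by apply: cvg_expr; rewrite ger0_norm.
move/cvgrPdist_le => /(_ (e * Num.min 1 (1 - s))) [|N0 _ H].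
  by rewrite mulr_gt0// lt_min ltr01.
exists N0 => N /H; rewrite sub0r normrN ger0_norm ?exprn_ge0// => sN.
have Ea : a = s * s by rewrite -expr2 sqr_sqrtr.
split.
  rewrite Ea exprMn mulrA.
  apply: (@le_trans _ _ ((1 - s)^-1 * (e * (1 - s)))).
    rewrite ler_pM ?mulr_ge0 ?exprn_ge0//; first by apply: geom_bound; rewrite s0.
    by rewrite (le_trans sN)// ler_wpM2l ?(ltW e0)// ge_min lexx orbT.
  by rewrite mulrC mulfK// gt_eqF.
rewrite Ea exprMn -[e]mulr1 ler_pM ?exprn_ge0//.
  by rewrite (le_trans sN)// -[X in _ <= X]mulr1 ler_wpM2l ?(ltW e0)// ge_min lexx.
by apply: exprn_ile1 => //; exact: ltW.
Qed.

(** The sums of [z ^+ n] and of [n%:R * z ^+ n]. The first carries the Poisson kernel in its real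
    part, the second the derivative kernels, and [cauchy1 z + cauchy2 z] is the Bergman kernel
    [1 / (1 - z) ^+ 2]. *)
Definition cauchy1 z : R[i] := 1 / (1 - z).
Definition cauchy2 z : R[i] := z / (1 - z) ^+ 2.

Lemma one_sub_modulus (a : R) z : modulus z <= a -> 1 - a <= modulus (1 - z).
Proof.
move=> za; apply: le_trans (ler_modulusB _ _); rewrite modulus1 lerB//.
Qed.

Lemma one_sub_neq0 z : modulus z < 1 -> 1 - z != 0.
Proof.
move=> z1; rewrite -modulus_eq0 gt_eqF//.
by rewrite (lt_le_trans _ (one_sub_modulus (lexx _)))// subr_gt0.
Qed.

Lemma cauchy1_approx (a : R) : 0 <= a < 1 -> forall e : R, 0 < e ->
  exists N0, forall N, (N0 <= N)%N -> forall z, modulus z <= a ->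
  modulus (cauchy1 z - \sum_(n < N) 1 * z ^+ n) <= e.
Proof.
move=> a01 e e0; have /andP[a0 a1] := a01.
have a10 : 0 < 1 - a by rewrite subr_gt0.
have [|N0 H] := natX_cvg0 a01 (e := e * (1 - a)); first by rewrite mulr_gt0.
exists N0 => N /H[_ aN] z za.
have z1 : modulus z < 1 by exact: le_lt_trans a1.
have nz := one_sub_neq0 z1.
have -> : cauchy1 z - \sum_(n < N) 1 * z ^+ n = z ^+ N / (1 - z).
  apply: (mulIf nz); rewrite mulrBl /cauchy1 !divfK//.
  under eq_bigr do rewrite mul1r.
  by rewrite [X in 1 - X]mulrC -[X in X * _]opprB mulNr -subrX1; ring.
rewrite modulusM modulusV modulusX ler_pdivrMr; last first.
  exact: lt_le_trans (one_sub_modulus za).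
rewrite (@le_trans _ _ (a ^+ N))//; first by rewrite lerXn2r// nnegrE modulus_ge0.
by rewrite (le_trans aN)// ler_wpM2l ?(ltW e0)// one_sub_modulus.
Qed.

Lemma cauchy2_approx (a : R) : 0 <= a < 1 -> forall e : R, 0 < e ->
  exists N0, forall N, (N0 <= N)%N -> forall z, modulus z <= a ->
  modulus (cauchy2 z - \sum_(n < N) n%:R * z ^+ n) <= e.
Proof.
move=> a01 e e0; have /andP[a0 a1] := a01.
have a10 : 0 < 1 - a by rewrite subr_gt0.
have e1 : 0 < (e / 2) * (1 - a) ^+ 2 by rewrite mulr_gt0 ?divr_gt0// exprn_gt0.
have [N0 H] := natX_cvg0 a01 e1.
exists N0.+1 => -[//|N] NN z za.
have [aN _] := H _ (leq_trans (leqnSn _) NN).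
have z1 : modulus z < 1 by exact: le_lt_trans a1.
have nz : (1 - z) ^+ 2 != 0 by rewrite expf_neq0// one_sub_neq0.
have S : (\sum_(n < N.+1) n%:R * z ^+ n) * (1 - z) ^+ 2 =
    z - N.+1%:R * z ^+ N.+1 + N%:R * z ^+ N.+2.
  elim: N {NN aN} => [|N IH]; first by rewrite big_ord1 !mul0r; ring.
  rewrite big_ord_recr/= mulrDl IH -!natr1 !exprS; ring.
have -> : cauchy2 z - \sum_(n < N.+1) n%:R * z ^+ n =
    (N.+1%:R * z ^+ N.+1 - N%:R * z ^+ N.+2) / (1 - z) ^+ 2.
  by apply: (mulIf nz); rewrite mulrBl /cauchy2 !divfK// S; ring.
have d0 : 0 < (1 - a) ^+ 2 by rewrite exprn_gt0.
have dz : (1 - a) ^+ 2 <= modulus (1 - z) ^+ 2.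
  by rewrite lerXn2r ?nnegrE ?modulus_ge0 ?(ltW a10)// one_sub_modulus.
rewrite modulusM modulusV modulusX ler_pdivrMr; last exact: lt_le_trans dz.
rewrite (le_trans (modulusB _ _))//.
apply: (@le_trans _ _ (e * (1 - a) ^+ 2)); last by rewrite ler_wpM2l ?(ltW e0).
have zN : modulus z ^+ N.+1 <= a ^+ N.+1 by rewrite lerXn2r// nnegrE modulus_ge0.
rewrite !modulusM !modulus_nat !modulusX.
have -> : e * (1 - a) ^+ 2 = (e / 2) * (1 - a) ^+ 2 + (e / 2) * (1 - a) ^+ 2.
  by field.
apply: lerD; first by rewrite (le_trans _ aN)// ler_wpM2l.
rewrite (le_trans _ aN)// ler_pM ?mulr_ge0 ?exprn_ge0 ?modulus_ge0 ?ler_nat//.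
rewrite (le_trans _ zN)// ler_piMl ?exprn_ge0 ?modulus_ge0//.
exact: ltW.
Qed.

End power_series.

(** * The Poisson kernel and its derivative *)

Section poisson.
Context {R : realType}.
Local Notation mu := (@lebesgue_measure R).
Implicit Types (a b x : R).

Lemma FTC2_is_derive (f F : R -> R) (a b : R) : a < b ->
  (forall x, is_derive x 1 F (f x)) -> continuous f ->
  (\int[mu]_(x in `[a, b]) (f x)%:E = (F b - F a)%:E)%E.
Proof.
move=> ab dF cf.
have cF : continuous F.
  move=> x; apply: differentiable_continuous; apply/derivable1_diffP.
  exact: (@ex_derive _ _ _ _ _ _ _ (dF x)).
rewrite EFinB; apply: continuous_FTC2 => //.
- exact: continuous_subspaceT.
- split.
  + by move=> x _; exact: (@ex_derive _ _ _ _ _ _ _ (dF x)).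
  + by apply: cvg_at_right_filter; exact: cF.
  + by apply: cvg_at_left_filter; exact: cF.
- by move=> x _; rewrite derive1E; exact: derive_val.
Qed.

Lemma circ_int_FTC (f F : R -> R) :
  (forall x, is_derive x 1 F (f x)) -> continuous f ->
  circ_int f = F (2 * pi) - F 0.
Proof.
move=> dF cf; rewrite /circ_int /Rintegral (FTC2_is_derive _ dF)//.
by rewrite mulr_gt0// pi_gt0.
Qed.

Lemma cos_nat_period n (x : R) : cos (n%:R * (2 * pi) + x) = cos x.
Proof.
rewrite addrC; elim: n => [|n IH]; first by rewrite mul0r addr0.
rewrite -natr1 mulrDl mul1r addrA -[RHS]IH.
by rewrite [X in _ + X]mulr_natl; exact: cosD2pi.
Qed.

Lemma sin_nat_period n (x : R) : sin (n%:R * (2 * pi) + x) = sin x.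
Proof.
rewrite addrC; elim: n => [|n IH]; first by rewrite mul0r addr0.
rewrite -natr1 mulrDl mul1r addrA -[RHS]IH.
by rewrite [X in _ + X]mulr_natl; exact: sinD2pi.
Qed.

Lemma continuous_affine (c d : R) : continuous (fun t : R => c * t + d).
Proof.
move=> x; apply: cvgD; last exact: cvg_cst.
by apply: cvgM; [exact: cvg_cst|exact: cvg_id].
Qed.

Lemma is_derive_affine (c d x : R) : is_derive x 1 (fun t : R => c * t + d) c.
Proof.
have -> : (fun t : R => c * t + d) = (c \*: id \+ cst d)%R by apply/funext.
by apply: is_derive_eq; rewrite addr0 /GRing.scale/= mulr1.
Qed.

Lemma circ_int_cos n (tau : R) :
  circ_int (fun t => cos (n.+1%:R * (t - tau))) = 0.
Proof.
pose c : R := n.+1%:R.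
have E t : c * (t - tau) = c * t + - (c * tau) by rewrite mulrBr.
have dF x : is_derive x 1 (fun t => c^-1 * sin (c * t + - (c * tau)))
    (cos (c * (x - tau))).
  have H := is_derive_affine c (- (c * tau)) x.
  have -> : (fun t : R => c^-1 * sin (c * t + - (c * tau))) =
      c^-1 \*: (sin \o (fun t => c * t + - (c * tau))) by [].
  apply: is_derive_eq; rewrite E /GRing.scale/=.
  by rewrite [X in _ * X]mulrC mulrA mulVf ?mul1r// pnatr_eq0.
rewrite (circ_int_FTC dF).
  by rewrite sin_nat_period mulr0 add0r subrr.
move=> x; apply: (@continuous_comp _ _ _ (fun t : R => c * (t - tau))).
  by rewrite (funext E); exact: continuous_affine.
exact: continuous_cos.
Qed.

Lemma circ_int_sin n (tau : R) :
  circ_int (fun t => sin (n%:R * (t - tau))) = 0.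
Proof.
case: n => [|n].
  by under eq_circ_int do rewrite mul0r sin0; rewrite circ_int_cst mul0r.
pose c : R := n.+1%:R.
have E t : c * (t - tau) = c * t + - (c * tau) by rewrite mulrBr.
have dF x : is_derive x 1 (fun t => - c^-1 * cos (c * t + - (c * tau)))
    (sin (c * (x - tau))).
  have H := is_derive_affine c (- (c * tau)) x.
  have -> : (fun t : R => - c^-1 * cos (c * t + - (c * tau))) =
      (- c^-1) \*: (cos \o (fun t => c * t + - (c * tau))) by [].
  apply: is_derive_eq; rewrite E /GRing.scale/=.
  by rewrite !mulNr mulrN opprK [X in _ * X]mulrC mulrA mulVf ?mul1r// pnatr_eq0.
rewrite (circ_int_FTC dF).
  by rewrite cos_nat_period mulr0 add0r subrr.
move=> x; apply: (@continuous_comp _ _ _ (fun t : R => c * (t - tau))).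
  by rewrite (funext E); exact: continuous_affine.
exact: continuous_sin.
Qed.

Definition poisson_den a x : R := 1 - 2 * a * cos x + a ^+ 2.
Definition poisson a x : R := (1 - a ^+ 2) / poisson_den a x.

Lemma poisson_denE a x : poisson_den a x = modulus (1 - polar a x) ^+ 2.
Proof.
rewrite sqr_modulus /polar /poisson_den ReB ImB/= sub0r.
have := cos2Dsin2 x; nra.
Qed.

Lemma poisson_den_ge a x : 0 <= a < 1 -> (1 - a) ^+ 2 <= poisson_den a x.
Proof.
move=> /andP[a0 a1]; rewrite poisson_denE lerXn2r ?nnegrE ?modulus_ge0 ?subr_ge0 ?(ltW a1)//.
by apply: one_sub_modulus; rewrite modulus_polar ger0_norm.
Qed.

Lemma poisson_den_gt0 a x : 0 <= a < 1 -> 0 < poisson_den a x.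
Proof.
move=> a01; apply: lt_le_trans (poisson_den_ge _ a01).
by rewrite exprn_gt0// subr_gt0; case/andP: a01.
Qed.

Lemma poisson_gt0 a x : 0 <= a < 1 -> 0 < poisson a x.
Proof.
move=> a01; rewrite divr_gt0 ?poisson_den_gt0//.
by rewrite subr_gt0 expr_lt1; case/andP: a01.
Qed.

Lemma poisson_ge0 a x : 0 <= a < 1 -> 0 <= poisson a x.
Proof. by move=> a01; exact/ltW/poisson_gt0. Qed.

Lemma poissonN a x : poisson a (- x) = poisson a x.
Proof. by rewrite /poisson /poisson_den cosN. Qed.

Lemma poissonC a x y : poisson a (x - y) = poisson a (y - x).
Proof. by rewrite -poissonN opprB. Qed.

Lemma poisson_denE2 a x :
  (1 - a * cos x) ^+ 2 + (0 - a * sin x) ^+ 2 = poisson_den a x.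
Proof.
have s2 : sin x ^+ 2 = 1 - cos x ^+ 2 by have := cos2Dsin2 x; lra.
by rewrite sub0r sqrrN exprMn s2 /poisson_den; ring.
Qed.

Lemma Re_cauchy1 a x : 0 <= a < 1 ->
  complex.Re (cauchy1 (polar a x)) = (1 + poisson a x) / 2.
Proof.
move=> a01; have := poisson_den_gt0 x a01.
rewrite /cauchy1 /polar /poisson/= poisson_denE2 => /lt0r_neq0 d0.
rewrite mul0r subr0 mul1r; apply: (mulIf d0); rewrite divfK//.
by rewrite mulrAC mulrDl divfK// mul1r /poisson_den; field.
Qed.

(* Real and imaginary parts of [e^(ix) / (1 - a e^(ix))^2]; for [x = phi - t]
   this is, up to a unimodular factor, the derivative of the Poisson kernel in
   [z = a e^(i phi)]. *)
Definition ckern a x : R := ((1 + a ^+ 2) * cos x - 2 * a) / poisson_den a x ^+ 2.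
Definition skern a x : R := (1 - a ^+ 2) * sin x / poisson_den a x ^+ 2.

Lemma cauchy2_kern a x : 0 <= a < 1 ->
  cauchy2 (polar a x) = ((a * ckern a x) +i* (a * skern a x))%C.
Proof.
move=> a01; have /lt0r_neq0 d0 := poisson_den_gt0 x a01.
have nz : (1 - polar a x) ^+ 2 != 0.
  rewrite expf_neq0// one_sub_neq0// modulus_polar.
  by case/andP: a01 => ? ?; rewrite ger0_norm.
apply: (mulIf nz); rewrite /cauchy2 divfK// /ckern /skern.
(* With [1] replaced by [cos^2 + sin^2] in the right places this is a polynomial identity. *)
have -> : (1 + a ^+ 2) * cos x - 2 * a = cos x - 2 * a * (cos x ^+ 2 + sin x ^+ 2)
    + a ^+ 2 * cos x * (cos x ^+ 2 + sin x ^+ 2) by rewrite cos2Dsin2; ring.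
have -> : (1 - a ^+ 2) * sin x = sin x - a ^+ 2 * sin x * (cos x ^+ 2 + sin x ^+ 2).
  by rewrite cos2Dsin2; ring.
have dE : poisson_den a x = 1 - 2 * a * cos x + a ^+ 2 * (cos x ^+ 2 + sin x ^+ 2).
  by rewrite cos2Dsin2 mulr1.
rewrite dE in d0 *; rewrite expr2 /polar; simpc; congr (_ +i* _)%C; field; exact: d0.
Qed.

End poisson.

(** * Convolution identities for the Poisson kernel and its derivative *)

Section poisson_reproducing.
Context {R : realType}.
Local Notation mu := (@lebesgue_measure R).
Implicit Types (a b : R).

Lemma measurable_cos_comp d (T : measurableType d) (f : T -> R) :
  measurable_fun setT f -> measurable_fun setT (fun x => cos (f x)).
Proof.
move=> mf; apply: (measurableT_comp (f := @cos R)) => //.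
by apply: continuous_measurable_fun; exact: continuous_cos.
Qed.

Lemma measurable_sin_comp d (T : measurableType d) (f : T -> R) :
  measurable_fun setT f -> measurable_fun setT (fun x => sin (f x)).
Proof.
move=> mf; apply: (measurableT_comp (f := @sin R)) => //.
by apply: continuous_measurable_fun; exact: continuous_sin.
Qed.

(** The inverse of [x] is [x] times the power [-1] of [x ^+ 2], also at [x = 0], where both sides
    vanish; real powers are known to be measurable. *)
Lemma measurable_inv_comp d (T : measurableType d) (f : T -> R) :
  measurable_fun setT f -> measurable_fun setT (fun x => (f x)^-1).
Proof.
move=> mf; rewrite (_ : (fun x => _) = (fun x => f x * (f x ^+ 2) `^ (-1))).
  apply: measurable_funM => //.
  by apply: (measurableT_comp (measurable_powR (-1))); exact: measurable_funX.
apply/funext => x; rewrite powR_inv1 ?sqr_ge0//.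
have [->|f0] := eqVneq (f x) 0; first by rewrite invr0 mul0r.
by rewrite expr2 invfM mulrA divff// mul1r.
Qed.

Lemma measurable_div_comp d (T : measurableType d) (f g : T -> R) :
  measurable_fun setT f -> measurable_fun setT g ->
  measurable_fun setT (fun x => f x / g x).
Proof. by move=> mf mg; apply: measurable_funM => //; exact: measurable_inv_comp. Qed.

Section comp.
Context d (T : measurableType d) (f g : T -> R).
Hypotheses (mf : measurable_fun setT f) (mg : measurable_fun setT g).

Lemma measurable_poisson_den : measurable_fun setT (fun x => poisson_den (f x) (g x)).
Proof.
rewrite /poisson_den; apply: measurable_funD; last exact: measurable_funX.
apply: measurable_funB => //; apply: measurable_funM; last exact: measurable_cos_comp.
exact: measurable_funM.
Qed.

Lemma measurable_poisson : measurable_fun setT (fun x => poisson (f x) (g x)).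
Proof.
apply: measurable_div_comp; last exact: measurable_poisson_den.
by apply: measurable_funB => //; exact: measurable_funX.
Qed.

Lemma measurable_ckern : measurable_fun setT (fun x => ckern (f x) (g x)).
Proof.
apply: measurable_div_comp; last exact: measurable_funX measurable_poisson_den.
apply: measurable_funB; last exact: measurable_funM.
apply: measurable_funM; last exact: measurable_cos_comp.
by apply: measurable_funD => //; exact: measurable_funX.
Qed.

Lemma measurable_skern : measurable_fun setT (fun x => skern (f x) (g x)).
Proof.
apply: measurable_div_comp; last exact: measurable_funX measurable_poisson_den.
apply: measurable_funM; last exact: measurable_sin_comp.
by apply: measurable_funB => //; exact: measurable_funX.
Qed.

End comp.

Lemma poisson_le a (x : R) : 0 <= a < 1 -> poisson a x <= 2 / (1 - a).
Proof.
move=> a01; have /andP[a0 a1] := a01; have d0 := poisson_den_gt0 x a01.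
rewrite /poisson ler_pdivrMr// mulrAC ler_pdivlMr ?subr_gt0//.
have := poisson_den_ge x a01; nra.
Qed.

Lemma bmeas_poisson a d (T : measurableType d) (g : T -> R) : 0 <= a < 1 ->
  measurable_fun setT g -> bmeas (fun x => poisson a (g x)).
Proof.
move=> a01 mg; split; first exact: (measurable_poisson (measurable_cst a)).
exists (2 / (1 - a)) => x; rewrite ger0_norm ?poisson_ge0//; exact: poisson_le.
Qed.

Lemma measurable_subl (c : R) : measurable_fun setT (fun t : R => c - t).
Proof. exact: measurable_funB. Qed.

Lemma measurable_subr (c : R) : measurable_fun setT (fun t : R => t - c).
Proof. exact: measurable_funB. Qed.

Lemma bmeas_cos d (T : measurableType d) (g : T -> R) :
  measurable_fun setT g -> bmeas (fun x => cos (g x)).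
Proof.
move=> mg; split; first exact: measurable_cos_comp.
by exists 1 => t; rewrite ler_norml cos_geN1 cos_le1.
Qed.

Lemma bmeas_sin d (T : measurableType d) (g : T -> R) :
  measurable_fun setT g -> bmeas (fun x => sin (g x)).
Proof.
move=> mg; split; first exact: measurable_sin_comp.
by exists 1 => t; rewrite ler_norml sin_geN1 sin_le1.
Qed.

Lemma ge0_le_all_eq0 (x M : R) : 0 <= x -> (forall e : R, 0 < e -> x <= M * e) -> x = 0.
Proof.
move=> x0 H; apply/eqP; rewrite eq_le x0 andbT; apply/ler_addgt0Pl => e e0.
have M1 : 0 < `|M| + 1 by rewrite ltr_wpDl.
rewrite addr0; apply: le_trans (H _ (divr_gt0 e0 M1)) _.
rewrite mulrA ler_pdivrMr// mulrC ler_wpM2l ?(ltW e0)//.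
by rewrite (le_trans (ler_norm M))// lerDl.
Qed.

(* The other solution [b^-n] of the recurrence is excluded by boundedness. *)
Lemma bounded_recurrence b (c : nat -> R) (M : R) : 0 <= b < 1 ->
  (forall n, `|c n| <= M) ->
  (forall n, (1 + b ^+ 2) * c n.+1 = b * (c n.+2 + c n)) ->
  forall n, c n.+1 = b * c n.
Proof.
move=> b01 cM rec n; have /andP[b0 b1] := b01.
pose d k := c k.+1 - b * c k.
have dE k : d k = b * d k.+1.
  rewrite /d mulrBr; have := rec k; rewrite !mulrDr mulrDl mul1r expr2 => H.
  by rewrite mulrA; lra.
have dk k : d n = b ^+ k * d (n + k)%N.
  elim: k => [|k IH]; first by rewrite expr0 mul1r addn0.
  by rewrite IH exprSr -mulrA addnS -dE.
have dM k : `|d k| <= 2 * M.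
  rewrite (le_trans (ler_normB _ _))// mulr_natl mulr2n lerD// normrM.
  rewrite -[X in _ <= X]mul1r ler_pM// ger0_norm// ltW//.
suff : `|d n| = 0 by move/eqP; rewrite normr_eq0 subr_eq0 => /eqP.
apply: (@ge0_le_all_eq0 _ (2 * M)) => // e e0.
have [N /(_ N (leqnn _))[_ bN]] := natX_cvg0 b01 e0.
rewrite (dk N) normrM ger0_norm ?exprn_ge0// mulrC ler_pM ?exprn_ge0//.
Qed.

Lemma poisson_mul_den b (x : R) : 0 <= b < 1 ->
  poisson b x * (1 + b ^+ 2) = 1 - b ^+ 2 + 2 * b * (cos x * poisson b x).
Proof.
move=> b01; have d0 := poisson_den_gt0 x b01.
have : poisson b x * poisson_den b x = 1 - b ^+ 2 by rewrite divfK ?gt_eqF.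
rewrite /poisson_den; lra.
Qed.

Lemma cos_nat_rec n (x : R) : cos (n.+2%:R * x) + cos (n%:R * x) =
  2 * cos x * cos (n.+1%:R * x).
Proof.
have -> : n.+2%:R * x = n.+1%:R * x + x by rewrite -natr1; ring.
have -> : n%:R * x = n.+1%:R * x - x by rewrite -natr1; ring.
by rewrite cosD cosB; ring.
Qed.

Lemma sin_nat_rec n (x : R) : sin (n.+2%:R * x) + sin (n%:R * x) =
  2 * cos x * sin (n.+1%:R * x).
Proof.
have -> : n.+2%:R * x = n.+1%:R * x + x by rewrite -natr1; ring.
have -> : n%:R * x = n.+1%:R * x - x by rewrite -natr1; ring.
by rewrite sinD sinB; ring.
Qed.

(** * Fourier coefficients of the Poisson kernel *)

Section moments.
Variables (b tau : R).
Hypothesis b01 : 0 <= b < 1.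
Let P t := poisson b (t - tau).
Let bP : bmeas P.
Proof. exact: (bmeas_poisson b01 (measurable_subr tau)). Qed.

Let bcos n : bmeas (fun t : R => cos (n%:R * (t - tau))).
Proof. by apply: bmeas_cos; apply: measurable_funM => //; exact: measurable_subr. Qed.
Let bsin n : bmeas (fun t : R => sin (n%:R * (t - tau))).
Proof. by apply: bmeas_sin; apply: measurable_funM => //; exact: measurable_subr. Qed.

Let trig_bound (f : R -> R) : bmeas f -> (forall t, `|f t| <= 1) ->
  `|circ_int (fun t => f t * P t)| <= circ_int P.
Proof.
move=> bf f1; apply: le_trans (le_norm_circ_int _) _; first exact: bmeasM.
apply: le_circ_int => //; first by apply/bmeas_norm/bmeasM.
move=> t; rewrite normrM -[X in _ <= X]mul1r ler_pM// ger0_norm//.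
exact: poisson_ge0.
Qed.

(** No expansion of the kernel is needed. Integrating [poisson_mul_den] against a cosine of positive
    frequency, whose own mean is 0, gives a three-term recurrence for the moments, and boundedness
    leaves only the geometric solution. *)
Lemma cos_moment n :
  circ_int (fun t => cos (n%:R * (t - tau)) * P t) = 2 * pi * b ^+ n.
Proof.
have bcP m : bmeas (fun t : R => cos (m%:R * (t - tau)) * P t) by exact: bmeasM.
pose c m := circ_int (fun t => cos (m%:R * (t - tau)) * P t).
have key m : (1 + b ^+ 2) * c m.+1 = b * (c m.+2 + c m).
  rewrite /c -circ_intD// -!circ_intZ//; last exact: bmeasD.
  apply/eqP; rewrite -subr_eq0 -circ_intB; [|exact: bmeasZ|exact/bmeasZ/bmeasD].
  rewrite (@eq_circ_int _ _ (fun t => (1 - b ^+ 2) * cos (m.+1%:R * (t - tau)))).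
    by rewrite circ_intZ// circ_int_cos mulr0.
  move=> t; rewrite -mulrDl cos_nat_rec.
  have := poisson_mul_den (t - tau) b01; rewrite -/(P t) => H.
  transitivity (cos (m.+1%:R * (t - tau)) * (P t * (1 + b ^+ 2) -
    2 * b * (cos (t - tau) * P t))); first by ring.
  by rewrite H; ring.
have cb : forall m, c m.+1 = b * c m.
  apply: (bounded_recurrence (M := circ_int P)) => // m.
  by apply: trig_bound => // t; rewrite ler_norml cos_geN1 cos_le1.
have c0E : c 0%N = circ_int P by apply: eq_circ_int => t; rewrite mul0r cos0 mul1r.
have c1E : c 1%N = circ_int (fun t => cos (t - tau) * P t).
  by apply: eq_circ_int => t; rewrite mul1r.
have b1 : bmeas (fun t : R => cos (t - tau) * P t).
  by have := bcP 1%N; under [X in bmeas X]eq_fun do rewrite mul1r.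
(* At frequency 0 the constant [1 - b ^+ 2] survives the integration; together with [c 1 = b * c 0]
   it fixes the normalization. *)
have c0 : c 0%N = 2 * pi.
  have : c 0%N * (1 + b ^+ 2) = (1 - b ^+ 2) * (2 * pi) + 2 * b * c 1%N.
    rewrite c0E c1E -circ_intZr// -circ_int_cst -circ_intZ//.
    rewrite -circ_intD; [|exact: bmeas_cst|exact: bmeasZ].
    by apply: eq_circ_int => t; exact: poisson_mul_den.
  rewrite cb => H; have /andP[bb0 bb1] := b01.
  have nz : 1 - b ^+ 2 != 0 by rewrite gt_eqF// subr_gt0 expr_lt1.
  by apply: (mulIf nz); lra.
rewrite -/(c n); elim: n => [|n IH]; first by rewrite c0 expr0 mulr1.
by rewrite cb IH exprS; ring.
Qed.

Lemma sin_moment n :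
  circ_int (fun t => sin (n%:R * (t - tau)) * P t) = 0.
Proof.
have bsP m : bmeas (fun t : R => sin (m%:R * (t - tau)) * P t) by exact: bmeasM.
pose c m := circ_int (fun t => sin (m%:R * (t - tau)) * P t).
have key m : (1 + b ^+ 2) * c m.+1 = b * (c m.+2 + c m).
  rewrite /c -circ_intD// -!circ_intZ//; last exact: bmeasD.
  apply/eqP; rewrite -subr_eq0 -circ_intB; [|exact: bmeasZ|exact/bmeasZ/bmeasD].
  rewrite (@eq_circ_int _ _ (fun t => (1 - b ^+ 2) * sin (m.+1%:R * (t - tau)))).
    by rewrite circ_intZ// circ_int_sin mulr0.
  move=> t; rewrite -mulrDl sin_nat_rec.
  have := poisson_mul_den (t - tau) b01; rewrite -/(P t) => H.
  transitivity (sin (m.+1%:R * (t - tau)) * (P t * (1 + b ^+ 2) -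
    2 * b * (cos (t - tau) * P t))); first by ring.
  by rewrite H; ring.
have cb : forall m, c m.+1 = b * c m.
  apply: (bounded_recurrence (M := circ_int P)) => // m.
  by apply: trig_bound => // t; rewrite ler_norml sin_geN1 sin_le1.
rewrite -/(c n); elim: n => [|n IH]; last by rewrite cb IH mulr0.
rewrite /c; under eq_circ_int do rewrite mul0r sin0 mul0r.
by rewrite circ_int_cst mul0r.
Qed.

Lemma cos_poisson phi n :
  circ_int (fun t => cos (n%:R * (phi - t)) * P t) =
  2 * pi * b ^+ n * cos (n%:R * (phi - tau)).
Proof.
rewrite (@eq_circ_int _ _ (fun t =>
  cos (n%:R * (phi - tau)) * (cos (n%:R * (t - tau)) * P t) +
  sin (n%:R * (phi - tau)) * (sin (n%:R * (t - tau)) * P t))); last first.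
  move=> t.
  have -> : n%:R * (phi - t) = n%:R * (phi - tau) - n%:R * (t - tau) by ring.
  by rewrite cosB mulrDl !mulrA.
have b1 : bmeas (fun t : R => cos (n%:R * (t - tau)) * P t) by exact: bmeasM.
have b2 : bmeas (fun t : R => sin (n%:R * (t - tau)) * P t) by exact: bmeasM.
rewrite circ_intD; [|exact: bmeasZ|exact: bmeasZ].
by rewrite !circ_intZ// sin_moment mulr0 addr0 cos_moment mulrC.
Qed.

Lemma sin_poisson phi n :
  circ_int (fun t => sin (n%:R * (phi - t)) * P t) =
  2 * pi * b ^+ n * sin (n%:R * (phi - tau)).
Proof.
rewrite (@eq_circ_int _ _ (fun t =>
  sin (n%:R * (phi - tau)) * (cos (n%:R * (t - tau)) * P t) -
  cos (n%:R * (phi - tau)) * (sin (n%:R * (t - tau)) * P t))); last first.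
  move=> t.
  have -> : n%:R * (phi - t) = n%:R * (phi - tau) - n%:R * (t - tau) by ring.
  by rewrite sinB mulrBl !mulrA.
have b1 : bmeas (fun t : R => cos (n%:R * (t - tau)) * P t) by exact: bmeasM.
have b2 : bmeas (fun t : R => sin (n%:R * (t - tau)) * P t) by exact: bmeasM.
rewrite circ_intB; [|exact: bmeasZ|exact: bmeasZ].
by rewrite !circ_intZ// sin_moment mulr0 subr0 cos_moment mulrC.
Qed.

Lemma circ_int_poisson : circ_int P = 2 * pi.
Proof.
have := cos_moment 0; rewrite expr0 mulr1 => <-.
by apply: eq_circ_int => t; rewrite mul0r cos0 mul1r.
Qed.

(** Here [tg] is [cos] or [sin], and [k], [k'] are uniform sums of trigonometric series with
    coefficients [c n * a ^+ n] and [c n * (a * b) ^+ n]. Convolution with the Poisson kernel of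
    radius [b] multiplies the term of frequency [n] by [2 * pi * b ^+ n], and the uniform error
    survives the integration because the kernel has mass [2 * pi]. *)
Lemma poisson_approx (tg : R -> R) (k k' : R -> R) (c : nat -> R) a phi :
  (forall x, `|tg x| <= 1) ->
  (forall d (T : measurableType d) (g : T -> R), measurable_fun setT g ->
    bmeas (fun x => tg (g x))) ->
  (forall n, circ_int (fun t => tg (n%:R * (phi - t)) * P t) =
    2 * pi * b ^+ n * tg (n%:R * (phi - tau))) ->
  bmeas k ->
  (forall e : R, 0 < e -> exists N0, forall N, (N0 <= N)%N -> forall x,
    `|k x - \sum_(n < N) c n * a ^+ n * tg (n%:R * x)| <= e) ->
  (forall e : R, 0 < e -> exists N0, forall N, (N0 <= N)%N -> forall x,
    `|k' x - \sum_(n < N) c n * (a * b) ^+ n * tg (n%:R * x)| <= e) ->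
  circ_int (fun t => k (phi - t) * P t) = 2 * pi * k' (phi - tau).
Proof.
move=> tg1 btg mom bk apk apk'.
apply/eqP; rewrite -subr_eq0 -normr_eq0; apply/eqP.
apply: (@ge0_le_all_eq0 _ (2 * (2 * pi))) => // e e0.
have [N1 H1] := apk _ e0; have [N2 H2] := apk' _ e0.
pose N := maxn N1 N2.
have {}H1 := H1 N (leq_maxl _ _); have {}H2 := H2 N (leq_maxr _ _).
have btg' n : bmeas (fun t : R => tg (n%:R * (phi - t))).
  by apply: btg; apply: measurable_funM => //; exact: measurable_subl.
have bS M : bmeas (fun t : R => \sum_(n < M) c n * a ^+ n * tg (n%:R * (phi - t))).
  elim: M => [|M IH].
    by under [X in bmeas X]eq_fun do rewrite big_ord0; exact: bmeas_cst.
  under [X in bmeas X]eq_fun do rewrite big_ord_recr/=.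
  by apply: bmeasD => //; exact: bmeasZ.
have SE M : circ_int (fun t => (\sum_(n < M) c n * a ^+ n * tg (n%:R * (phi - t))) * P t)
    = 2 * pi * \sum_(n < M) c n * (a * b) ^+ n * tg (n%:R * (phi - tau)).
  elim: M => [|M IH].
    under eq_circ_int do rewrite big_ord0 mul0r.
    by rewrite circ_int_cst big_ord0 mulr0 mul0r.
  under eq_circ_int do rewrite big_ord_recr/= mulrDl -mulrA.
  rewrite circ_intD; [|exact: (bmeasM (bS M) bP)|exact: (bmeasZ _ (bmeasM (btg' M) bP))].
  rewrite IH circ_intZ; last exact: (bmeasM (btg' M) bP).
  by rewrite mom big_ord_recr/= exprMn; ring.
have bk' : bmeas (fun t : R => k (phi - t)).
  by apply: (bmeas_comp bk); exact: measurable_subl.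
have -> : circ_int (fun t => k (phi - t) * P t) - 2 * pi * k' (phi - tau) =
  circ_int (fun t => (k (phi - t) -
     \sum_(n < N) c n * a ^+ n * tg (n%:R * (phi - t))) * P t)
  - 2 * pi * (k' (phi - tau) - \sum_(n < N) c n * (a * b) ^+ n * tg (n%:R * (phi - tau))).
  under [in RHS]eq_circ_int do rewrite mulrBl.
  by rewrite circ_intB; [rewrite SE; ring|exact: bmeasM|exact: bmeasM].
have bd : bmeas (fun t : R => (k (phi - t) -
     \sum_(n < N) c n * a ^+ n * tg (n%:R * (phi - t))) * P t).
  by apply: bmeasM => //; exact: bmeasB.
apply: le_trans (ler_normB _ _) _.
have -> : 2 * (2 * pi) * e = e * (2 * pi) + 2 * pi * e :> R by ring.
apply: lerD.
  rewrite -circ_int_poisson -circ_intZ//.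
  apply: le_trans (le_norm_circ_int bd) _.
  apply: le_circ_int; [exact: bmeas_norm|exact: bmeasZ|move=> t].
  rewrite normrM ler_pM//.
  by rewrite ger0_norm// poisson_ge0.
by rewrite normrM ger0_norm ?twopi_ge0// ler_wpM2l ?twopi_ge0.
Qed.

End moments.

Lemma sum_polar (c : nat -> R) a x N :
  \sum_(n < N) ((c n)%:C * polar a x ^+ n)%C =
  ((\sum_(n < N) c n * a ^+ n * cos (n%:R * x)) +i*
   (\sum_(n < N) c n * a ^+ n * sin (n%:R * x)))%C.
Proof.
apply: complex_eqP; rewrite /= ?Re_sum ?Im_sum; apply: eq_bigr => n _;
  by rewrite polarX -[x *+ n]mulr_natl /polar/= mul0r ?subr0 ?addr0 mulrA.
Qed.

Definition series_of (F : R[i] -> R[i]) (c : nat -> R) :=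
  forall a : R, 0 <= a < 1 -> forall e : R, 0 < e ->
  exists N0, forall N, (N0 <= N)%N -> forall z, modulus z <= a ->
  modulus (F z - \sum_(n < N) ((c n)%:C * z ^+ n)%C) <= e.

Lemma cauchy1_series : series_of (@cauchy1 R) (fun => 1).
Proof. exact: cauchy1_approx. Qed.

Lemma cauchy2_series : series_of (@cauchy2 R) (fun n => n%:R).
Proof.
move=> a a01 e e0; have [N0 H] := cauchy2_approx a01 e0.
exists N0 => N NN z za; apply: le_trans (H N NN z za).
by under eq_bigr do rewrite rmorph_nat.
Qed.

Lemma series_poisson (F : R[i] -> R[i]) c a b tau phi : 0 <= a < 1 -> 0 <= b < 1 ->
  series_of F c ->
  (bmeas (fun x => complex.Re (F (polar a x))) ->
   circ_int (fun t => complex.Re (F (polar a (phi - t))) * poisson b (t - tau)) =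
   2 * pi * complex.Re (F (polar (a * b) (phi - tau)))) /\
  (bmeas (fun x => complex.Im (F (polar a x))) ->
   circ_int (fun t => complex.Im (F (polar a (phi - t))) * poisson b (t - tau)) =
   2 * pi * complex.Im (F (polar (a * b) (phi - tau)))).
Proof.
move=> a01 b01 Fc; have /andP[a0 a1] := a01; have /andP[b0 b1] := b01.
have ab01 : 0 <= a * b < 1 by rewrite mulr_ge0//= mulr_ilt1.
have apR r : 0 <= r < 1 -> forall e : R, 0 < e ->
    exists N0, forall N, (N0 <= N)%N -> forall x,
    `|complex.Re (F (polar r x)) - \sum_(n < N) c n * r ^+ n * cos (n%:R * x)| <= e.
  move=> r01 e e0; have [N0 H] := Fc _ r01 _ e0; exists N0 => N NN x.
  apply: le_trans (H N NN (polar r x) _).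
    by rewrite sum_polar; apply: le_trans (Re_le_modulus _); rewrite ReB.
  by rewrite modulus_polar ger0_norm//; case/andP: r01.
have apI r : 0 <= r < 1 -> forall e : R, 0 < e ->
    exists N0, forall N, (N0 <= N)%N -> forall x,
    `|complex.Im (F (polar r x)) - \sum_(n < N) c n * r ^+ n * sin (n%:R * x)| <= e.
  move=> r01 e e0; have [N0 H] := Fc _ r01 _ e0; exists N0 => N NN x.
  apply: le_trans (H N NN (polar r x) _).
    by rewrite sum_polar; apply: le_trans (Im_le_modulus _); rewrite ImB.
  by rewrite modulus_polar ger0_norm//; case/andP: r01.
split=> bk.
- apply: (@poisson_approx b tau b01 cos (fun x => complex.Re (F (polar a x)))
    (fun x => complex.Re (F (polar (a * b) x))) c a phi) => //.
  + by move=> x; rewrite ler_norml cos_geN1 cos_le1.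
  + by move=> d T g; exact: bmeas_cos.
  + by move=> n; exact: cos_poisson.
  + exact: apR.
  + exact: apR.
- apply: (@poisson_approx b tau b01 sin (fun x => complex.Im (F (polar a x)))
    (fun x => complex.Im (F (polar (a * b) x))) c a phi) => //.
  + by move=> x; rewrite ler_norml sin_geN1 sin_le1.
  + by move=> d T g; exact: bmeas_sin.
  + by move=> n; exact: sin_poisson.
  + exact: apI.
  + exact: apI.
Qed.

Lemma mul01 (a b : R) : 0 <= a < 1 -> 0 <= b < 1 -> 0 <= a * b < 1.
Proof. by move=> /andP[a0 a1] /andP[b0 b1]; rewrite mulr_ge0//= mulr_ilt1. Qed.

(** The Poisson kernel is twice the real part of [cauchy1] minus 1, so this is the dilation rule for
    the geometric series. *)
Lemma poisson_semigroup a b tau phi : 0 <= a < 1 -> 0 <= b < 1 ->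
  circ_int (fun t => poisson a (phi - t) * poisson b (t - tau)) =
  2 * pi * poisson (a * b) (phi - tau).
Proof.
move=> a01 b01; have ab01 := mul01 a01 b01.
have PE (r x : R) : 0 <= r < 1 -> poisson r x = 2 * complex.Re (cauchy1 (polar r x)) - 1.
  by move=> r01; rewrite Re_cauchy1//; field.
have bk : bmeas (fun x : R => complex.Re (cauchy1 (polar a x))).
  rewrite (_ : (fun x => _) = (fun x => 2^-1 * (1 + poisson a x))).
    by apply/bmeasZ/bmeasD; [exact: bmeas_cst|exact: bmeas_poisson].
  by apply/funext => x; rewrite Re_cauchy1// mulrC.
have bP : bmeas (fun t : R => poisson b (t - tau)).
  by apply: bmeas_poisson => //; exact: measurable_subr.
have bk1 : bmeas (fun t : R => complex.Re (cauchy1 (polar a (phi - t)))).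
  by apply: (bmeas_comp bk); exact: measurable_subl.
have [/(_ bk) H _] := series_poisson tau phi a01 b01 cauchy1_series.
rewrite (@eq_circ_int _ _ (fun t => 2 * (complex.Re (cauchy1 (polar a (phi - t))) *
  poisson b (t - tau)) - poisson b (t - tau))); last first.
  by move=> t; rewrite (PE a)//; ring.
rewrite circ_intB//; last by apply/bmeasZ/bmeasM.
rewrite circ_intZ; last exact: bmeasM.
by rewrite H circ_int_poisson// PE//; ring.
Qed.

(* Abstracts [ckern] and [skern], so that both are treated at once. *)
Definition deriv_kernel (k : R -> R -> R) :=
  [/\ forall a x, 0 <= a < 1 -> `|k a x| <= (poisson_den a x)^-1,
      (forall d (T : measurableType d) (f g : T -> R), measurable_fun setT f ->
        measurable_fun setT g -> measurable_fun setT (fun x => k (f x) (g x))) &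
      forall a b phi tau, 0 < a < 1 -> 0 <= b < 1 ->
        circ_int (fun t => k a (phi - t) * poisson b (t - tau)) =
        2 * pi * (b * k (a * b) (phi - tau))].

Lemma bmeas_kern (k : R -> R -> R) a d (T : measurableType d) (g : T -> R) :
  deriv_kernel k -> 0 <= a < 1 ->
  measurable_fun setT g -> bmeas (fun x => k a (g x)).
Proof.
move=> [kd mk _] a01 mg; split; first exact: (mk _ _ _ _ (measurable_cst a)).
exists ((1 - a) ^- 2) => x; apply: le_trans (kd _ _ a01) _.
rewrite lef_pV2 ?posrE ?poisson_den_gt0//; first exact: poisson_den_ge.
by rewrite exprn_gt0// subr_gt0; case/andP: a01.
Qed.

Lemma ckern_le a x : 0 <= a < 1 -> `|ckern a x| <= (poisson_den a x)^-1.
Proof.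
move=> a01; have d0 := poisson_den_gt0 x a01.
rewrite /ckern normrM [X in _ * X]ger0_norm ?invr_ge0 ?exprn_ge0 ?(ltW d0)//.
rewrite ler_pdivrMr ?exprn_gt0// expr2 mulrA mulVf ?gt_eqF// mul1r.
have := cos_le1 x; have := cos_geN1 x; rewrite ler_norml /poisson_den.
move=> c1 c2.
(* These two products are [poisson_den] plus and minus the numerator of [ckern]. *)
have H1 : 0 <= (1 - a) ^+ 2 * (1 + cos x) by apply: mulr_ge0; [exact: sqr_ge0|lra].
have H2 : 0 <= (1 + a) ^+ 2 * (1 - cos x) by apply: mulr_ge0; [exact: sqr_ge0|lra].
by apply/andP; split; lra.
Qed.

(** The numerators of [ckern] and [skern] are the coordinates of a vector of length
    [poisson_den a x], the kernels being the two parts of a complex number of modulus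
    [(poisson_den a x)^-1]. *)
Lemma skern_le a x : 0 <= a < 1 -> `|skern a x| <= (poisson_den a x)^-1.
Proof.
move=> a01; have d0 := poisson_den_gt0 x a01.
rewrite /skern normrM [X in _ * X]ger0_norm ?invr_ge0 ?exprn_ge0 ?(ltW d0)//.
rewrite ler_pdivrMr ?exprn_gt0// expr2 mulrA mulVf ?gt_eqF// mul1r.
rewrite -(ger0_norm (ltW d0)) -ler_sqr ?nnegrE// !real_normK ?num_real//.
rewrite -subr_ge0.
have -> : poisson_den a x ^+ 2 - ((1 - a ^+ 2) * sin x) ^+ 2 =
   ((1 + a ^+ 2) * cos x - 2 * a) ^+ 2.
  have s2 : sin x ^+ 2 = 1 - cos x ^+ 2 by have := cos2Dsin2 x; lra.
  by rewrite [((1 - _) * _) ^+ 2]exprMn s2 /poisson_den; ring.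
exact: sqr_ge0.
Qed.

Lemma deriv_kernel_ckern : deriv_kernel (@ckern R).
Proof.
split; [exact: ckern_le | move=> d T f g; exact: measurable_ckern |].
move=> a b phi tau /andP[a0 a1] b01.
have a01 : 0 <= a < 1 by rewrite ltW.
have ab01 := mul01 a01 b01.
have bm : bmeas (ckern a : R -> R).
  split; first exact: (measurable_ckern (measurable_cst a)).
  exists ((1 - a) ^- 2) => x; apply: le_trans (ckern_le _ a01) _.
  rewrite lef_pV2 ?posrE ?poisson_den_gt0//; first exact: poisson_den_ge.
  by rewrite exprn_gt0// subr_gt0.
have [H _] := series_poisson tau phi a01 b01 cauchy2_series.
have bP : bmeas (fun t : R => poisson b (t - tau)).
  by apply: bmeas_poisson => //; exact: measurable_subr.
have E r x : 0 <= r < 1 -> complex.Re (cauchy2 (polar r x)) = r * ckern r x.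
  by move=> r01; rewrite cauchy2_kern.
have bm1 : bmeas (fun x : R => complex.Re (cauchy2 (polar a x))).
  by under [X in bmeas X]eq_fun do rewrite E//; exact: bmeasZ.
move: (H bm1); under eq_circ_int do rewrite E// -mulrA.
rewrite circ_intZ; last first.
  by apply: bmeasM => //; apply: (bmeas_comp bm); exact: measurable_subl.
rewrite E// => H1; apply: (mulfI (lt0r_neq0 a0)); rewrite H1; ring.
Qed.

Lemma deriv_kernel_skern : deriv_kernel (@skern R).
Proof.
split; [exact: skern_le | move=> d T f g; exact: measurable_skern |].
move=> a b phi tau /andP[a0 a1] b01.
have a01 : 0 <= a < 1 by rewrite ltW.
have ab01 := mul01 a01 b01.
have bm : bmeas (skern a : R -> R).
  split; first exact: (measurable_skern (measurable_cst a)).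
  exists ((1 - a) ^- 2) => x; apply: le_trans (skern_le _ a01) _.
  rewrite lef_pV2 ?posrE ?poisson_den_gt0//; first exact: poisson_den_ge.
  by rewrite exprn_gt0// subr_gt0.
have [_ H] := series_poisson tau phi a01 b01 cauchy2_series.
have bP : bmeas (fun t : R => poisson b (t - tau)).
  by apply: bmeas_poisson => //; exact: measurable_subr.
have E r x : 0 <= r < 1 -> complex.Im (cauchy2 (polar r x)) = r * skern r x.
  by move=> r01; rewrite cauchy2_kern.
have bm1 : bmeas (fun x : R => complex.Im (cauchy2 (polar a x))).
  by under [X in bmeas X]eq_fun do rewrite E//; exact: bmeasZ.
move: (H bm1); under eq_circ_int do rewrite E// -mulrA.
rewrite circ_intZ; last first.
  by apply: bmeasM => //; apply: (bmeas_comp bm); exact: measurable_subl.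
rewrite E// => H1; apply: (mulfI (lt0r_neq0 a0)); rewrite H1; ring.
Qed.

(** The reproducing formula at [b = 0], where the Poisson kernel is the constant 1. *)
Lemma kern_mean0 (k : R -> R -> R) a phi : deriv_kernel k -> 0 < a < 1 ->
  circ_int (fun t => k a (phi - t)) = 0.
Proof.
move=> [_ _ /(_ a 0 phi 0)] H a01; have /andP[a0 a1] := a01.
have := H a01; rewrite lexx ltr01 mul0r mulr0 => /(_ erefl) <-.
apply: eq_circ_int => t.
by rewrite /poisson /poisson_den expr0n/= subr0 mulr0 mul0r subr0 addr0 divr1 mulr1.
Qed.

End poisson_reproducing.

(** * Quantitative convexity of powers *)

Section bellman.
Context {R : realType}.
Implicit Types (x y z q al th : R).

(** Young's inequality for [x'] and the power [al - 1] of [x], with exponents [al] and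
    [al / (al - 1)], is exactly this tangent inequality; no derivative is taken, so [x = 0] is
    allowed. *)
Lemma powR_tangent al x x' : 1 <= al -> 0 <= x -> 0 <= x' ->
  x `^ al + al * x `^ (al - 1) * (x' - x) <= x' `^ al.
Proof.
move=> al1 x0 x'0; have al0 : 0 < al by exact: lt_le_trans al1.
have [->|aln1] := eqVneq al 1.
  by rewrite subrr powRr0 !powRr1// mulr1 mul1r addrC subrK.
have {aln1}al1 : 1 < al by rewrite lt_neqAle eq_sym aln1.
have a10 : 0 < al - 1 by rewrite subr_gt0.
have := @conjugate_powR R x' (x `^ (al - 1)) al (al / (al - 1)) x'0 (powR_ge0 _ _) al0
  (divr_gt0 al0 a10).
rewrite invf_div; have -> : al^-1 + (al - 1) / al = 1.
  by field; rewrite gt_eqF.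
move=> /(_ erefl); rewrite -powRrM.
have -> : (al - 1) * (al / (al - 1)) = al by field; rewrite gt_eqF.
move=> H.
have E : x * x `^ (al - 1) = x `^ al by exact: mulr_powRB1.
move: H; rewrite -(ler_pM2l al0).
have -> : al * (x' `^ al / al + x `^ al * ((al - 1) / al)) =
   x' `^ al + x `^ al * (al - 1) by field; rewrite gt_eqF.
rewrite -E; nra.
Qed.

(** The tangent inequality with exponent [th^-1], taken at the power [th] of [x] and solved for the
    power [th] of [x']. *)
Lemma powR_concave th x x' : 0 <= th <= 1 -> 0 < x -> 0 <= x' ->
  x' `^ th <= x `^ th + th * x `^ (th - 1) * (x' - x).
Proof.
move=> /andP[th0 th1] x0 x'0.
have [->|thn0] := eqVneq th 0; first by rewrite mul0r mul0r addr0 !powRr0.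
have {thn0}th0 : 0 < th by rewrite lt_neqAle eq_sym thn0.
have t1 : 1 <= th^-1 by rewrite invf_ge1.
have := powR_tangent t1 (powR_ge0 x th) (powR_ge0 x' th).
rewrite -!powRrM divff ?gt_eqF// !powRr1 ?(ltW x0)//.
have -> : th * (th^-1 - 1) = 1 - th by field; rewrite gt_eqF.
have xp : 0 < x `^ (th - 1) by rewrite powR_gt0.
have E : x `^ (1 - th) = (x `^ (th - 1))^-1 by rewrite -powRN opprB.
rewrite E => H; have H2 : th^-1 / x `^ (th - 1) * (x' `^ th - x `^ th) <= x' - x.
  by rewrite lerBrDl.
move: H2; rewrite -invfM mulrC ler_pdivrMr ?mulr_gt0//.
by rewrite lerBlDl mulrC.
Qed.

(** Tangent inequality with exponent [q / 2] at [G = x ^+ 2 + z ^+ 2]. The increment of [G] contains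
    [(x' - x) ^+ 2] beyond its linear part, with the factor [G] to the power [q / 2 - 1], which is
    at least [z] to the power [q - 2]. The second variable thus serves as the weight. *)
Lemma bellman_ge2 q x x' z z' : 2 <= q -> 0 <= x -> 0 <= z ->
  (x ^+ 2 + z ^+ 2) `^ (q / 2)
  + q * (x ^+ 2 + z ^+ 2) `^ (q / 2 - 1) * (x * (x' - x) + z * (z' - z))
  + q / 2 * z `^ (q - 2) * (x' - x) ^+ 2 <= (x' ^+ 2 + z' ^+ 2) `^ (q / 2).
Proof.
move=> q2 x0 z0; pose G := x ^+ 2 + z ^+ 2; pose G' := x' ^+ 2 + z' ^+ 2.
have G0 : 0 <= G by rewrite addr_ge0 ?sqr_ge0.
have G'0 : 0 <= G' by rewrite addr_ge0 ?sqr_ge0.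
have q21 : 1 <= q / 2 by rewrite ler_pdivlMr// mul1r.
apply: le_trans (powR_tangent q21 G0 G'0); rewrite -/G -addrA lerD2l.
have E : G' - G = 2 * (x * (x' - x) + z * (z' - z)) + (x' - x) ^+ 2 + (z' - z) ^+ 2.
  by rewrite /G /G'; ring.
have zG : z `^ (q - 2) <= G `^ (q / 2 - 1).
  have -> : z `^ (q - 2) = (z ^+ 2) `^ (q / 2 - 1).
    by rewrite -powR_mulrn// -powRrM; congr (_ `^ _); field.
  apply: ge0_ler_powR; rewrite ?nnegrE ?sqr_ge0 ?subr_ge0//.
  by rewrite lerDr sqr_ge0.
rewrite E.
have Gp : 0 <= G `^ (q / 2 - 1) := powR_ge0 _ _.
have q0 : 0 <= q / 2 by rewrite (le_trans _ q21).
have H1 : 0 <= q / 2 * (G `^ (q / 2 - 1) - z `^ (q - 2)) * (x' - x) ^+ 2.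
  by apply: mulr_ge0; [apply: mulr_ge0 => //; rewrite subr_ge0|exact: sqr_ge0].
have H2 : 0 <= q / 2 * G `^ (q / 2 - 1) * (z' - z) ^+ 2.
  by apply: mulr_ge0; [exact: mulr_ge0|exact: sqr_ge0].
lra.
Qed.

(* The quadratic gain comes from the tangent inequality applied twice, through the midpoint. *)
Lemma bellman_le2 q x x' : 1 < q <= 2 -> 0 < x -> 0 <= x' ->
  x `^ q + q * x `^ (q - 1) * (x' - x)
  + q * (q - 1) / 4 * Num.max x x' `^ (q - 2) * (x' - x) ^+ 2 <= x' `^ q.
Proof.
move=> /andP[q1 q2] x0 x'0; pose m := (x + x') / 2.
have m0 : 0 < m by rewrite divr_gt0// ltr_wpDr.
have q1' : 1 <= q by exact: ltW.
have T1 := powR_tangent q1' (ltW x0) (ltW m0).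
have T2 := powR_tangent q1' (ltW m0) x'0.
have th : 0 <= q - 1 <= 1 by rewrite subr_ge0 q1'/= lerBlDr.
have mx : m - x = (x' - x) / 2 by rewrite /m; field.
have x'm : x' - m = (x' - x) / 2 by rewrite /m; field.
rewrite mx in T1; rewrite x'm in T2.
suff : (q - 1) / 2 * Num.max x x' `^ (q - 2) * (x' - x) ^+ 2 <=
    (m `^ (q - 1) - x `^ (q - 1)) * (x' - x).
  have q0 : 0 < q / 2 by rewrite divr_gt0// (lt_trans _ q1).
  rewrite -(ler_pM2l q0); lra.
have mono (y : R) : 0 < y -> y <= Num.max x x' ->
    Num.max x x' `^ (q - 2) <= y `^ (q - 2).
  move=> y0 yM; have M0 : 0 < Num.max x x' by exact: lt_le_trans yM.
  have -> : q - 2 = - (2 - q) by rewrite opprB.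
  rewrite !powRN lef_pV2 ?posrE ?powR_gt0//.
  by apply: ge0_ler_powR; rewrite ?nnegrE ?subr_ge0// ltW.
have qq : q - 1 - 1 = q - 2 by ring.
have [xx'|x'x] := leP x x'.
- have := powR_concave th m0 (ltW x0); rewrite qq => H.
  have mM : m <= Num.max x x' by rewrite le_max /m; apply/orP; right; lra.
  have := mono _ m0 mM; rewrite max_r// => HM.
  have d0 : 0 <= x' - x by rewrite subr_ge0.
  have xm : x - m = - ((x' - x) / 2) by rewrite -mx opprB.
  rewrite xm in H.
  apply: (@le_trans _ _ ((q - 1) / 2 * m `^ (q - 2) * (x' - x) ^+ 2)).
    by rewrite ler_wpM2r ?sqr_ge0// ler_wpM2l// divr_ge0// subr_ge0.
  rewrite expr2 mulrA ler_wpM2r//; lra.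
- have := powR_concave th x0 (ltW m0); rewrite qq mx => H.
  have d0 : 0 <= x - x' by rewrite subr_ge0 ltW.
  have -> : (q - 1) / 2 * x `^ (q - 2) * (x' - x) ^+ 2 =
    ((q - 1) / 2 * x `^ (q - 2) * (x - x')) * (x - x') by ring.
  have -> : (m `^ (q - 1) - x `^ (q - 1)) * (x' - x) =
    (x `^ (q - 1) - m `^ (q - 1)) * (x - x') by ring.
  rewrite ler_wpM2r//; lra.
Qed.

(** The choice [l = B / X] gives the product bound; if [B = 0] and [X] is positive, then
    [l = X / (A + 1)] gives a contradiction. *)
Lemma sqr_le_of_weighted (X A B : R) : 0 <= X -> 0 <= A -> 0 <= B ->
  (forall l : R, 0 < l -> 2 * X <= l * A + l^-1 * B) -> X ^+ 2 <= A * B.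
Proof.
move=> X0 A0 B0 H.
have [->|Xn0] := eqVneq X 0; first by rewrite expr0n/= mulr_ge0.
have {}X0 : 0 < X by rewrite lt_neqAle eq_sym Xn0.
have [B0'|Bn0] := eqVneq B 0.
  have A1 : 0 < A + 1 by rewrite ltr_wpDl.
  have := H (X / (A + 1)) (divr_gt0 X0 A1); rewrite B0' mulr0 addr0 => H1.
  have : X / (A + 1) * A <= X.
    by rewrite mulrAC ler_pdivrMr// ler_wpM2l ?(ltW X0)// lerDl.
  by move=> /(le_trans H1); rewrite -subr_ge0 => ?; exfalso; lra.
have {Bn0}B0 : 0 < B by rewrite lt_neqAle eq_sym Bn0.
have := H (B / X) (divr_gt0 B0 X0); rewrite invf_div divfK ?gt_eqF// => H1.
have : X <= B / X * A by lra.
by rewrite mulrAC ler_pdivlMr// -expr2 mulrC.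
Qed.

(** Cauchy-Schwarz for the measure of density [w], with an auxiliary weight [g]. Its inverse [gi] is
    a separate argument so that boundedness can be asked of both. *)
Lemma norm_circ_int_sqr_le (w f g gi : R -> R) :
  bmeas w -> bmeas f -> bmeas g -> bmeas gi ->
  (forall t, 0 <= w t) -> (forall t, 0 < g t) -> (forall t, g t * gi t = 1) ->
  circ_int (fun t => w t * `|f t|) ^+ 2 <=
  circ_int (fun t => w t * (f t ^+ 2 * g t)) * circ_int (fun t => w t * gi t).
Proof.
move=> bw bf bg bgi w0 g0 ggi.
have gi0 t : 0 < gi t by have := g0 t; have := ggi t; nra.
have bf2 := bmeasX 2 bf; have bnf := bmeas_norm bf.
have b1 : bmeas (fun t => w t * `|f t|) by exact: bmeasM.
have b2 : bmeas (fun t => w t * (f t ^+ 2 * g t)) by apply: bmeasM => //; exact: bmeasM.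
have b3 : bmeas (fun t => w t * gi t) by exact: bmeasM.
apply: sqr_le_of_weighted.
- by apply: circ_int_ge0 => t; rewrite mulr_ge0.
- apply: circ_int_ge0 => t; apply: mulr_ge0 => //.
  by apply: mulr_ge0; [exact: sqr_ge0|exact: ltW].
- by apply: circ_int_ge0 => t; rewrite mulr_ge0// ltW.
move=> l l0; rewrite -!circ_intZ// -circ_intD; [|exact: bmeasZ|exact: bmeasZ].
apply: le_circ_int; [exact: bmeasZ|by apply: bmeasD; exact: bmeasZ|move=> t].
have -> : l * (w t * (f t ^+ 2 * g t)) + l^-1 * (w t * gi t) =
  w t * (l * g t * `|f t| ^+ 2 + l^-1 * gi t).
  by rewrite real_normK ?num_real//; ring.
rewrite mulrCA ler_wpM2l//.
have lg : (l * g t) * (l^-1 * gi t) = 1.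
  by rewrite mulrACA divff ?gt_eqF// mul1r.
have lg0 : 0 < l * g t by rewrite mulr_gt0.
rewrite -(ler_pM2l lg0) mulrDr lg.
have := sqr_ge0 (l * g t * `|f t| - 1); lra.
Qed.

End bellman.

(** * Poisson integrals of bounded functions *)

Section poisson_integral.
Context {R : realType}.
Local Notation mu := (@lebesgue_measure R).
Implicit Types (h psi : R -> R) (a b e phi : R).

Definition poisson_int a h (phi : R) : R :=
  (2 * pi)^-1 * circ_int (fun t => poisson a (phi - t) * h t).

Definition kern_int (k : R -> R -> R) a h (phi : R) : R :=
  circ_int (fun t => k a (phi - t) * h t).

Lemma twopi_gt0 : 0 < 2 * pi :> R.
Proof. by rewrite mulr_gt0// pi_gt0. Qed.
Hint Resolve twopi_gt0 : core.

Lemma twopi_neq0 : 2 * pi != 0 :> R.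
Proof. by rewrite gt_eqF. Qed.

Lemma bmeas_poisson_mul a h phi : 0 <= a < 1 -> bmeas h ->
  bmeas (fun t : R => poisson a (phi - t) * h t).
Proof.
by move=> a01 bh; apply: bmeasM => //; apply: bmeas_poisson => //; exact: measurable_subl.
Qed.

Lemma bmeas_kern_mul (k : R -> R -> R) a h phi : deriv_kernel k -> 0 <= a < 1 -> bmeas h ->
  bmeas (fun t : R => k a (phi - t) * h t).
Proof.
by move=> dk a01 bh; apply: bmeasM => //; apply: bmeas_kern => //; exact: measurable_subl.
Qed.

Lemma circ_int_poisson_l a (phi : R) : 0 <= a < 1 ->
  circ_int (fun t => poisson a (phi - t)) = 2 * pi.
Proof.
move=> a01; rewrite -(circ_int_poisson phi a01).
by apply: eq_circ_int => t; rewrite poissonC.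
Qed.

Lemma bmeas_pair_sub (k : R -> R) : bmeas k ->
  bmeas (fun x : R * R => k (x.1 - x.2)).
Proof. by move=> bk; apply: (bmeas_comp bk); exact: measurable_funB. Qed.

Lemma bmeas_snd h : bmeas h -> bmeas (fun x : R * R => h x.2).
Proof. by move=> bh; exact: (bmeas_comp bh). Qed.

Lemma bmeas_fst h : bmeas h -> bmeas (fun x : R * R => h x.1).
Proof. by move=> bh; exact: (bmeas_comp bh). Qed.

Lemma bmeas_swap (f : R * R -> R) : bmeas f -> bmeas (fun x : R * R => f (x.2, x.1)).
Proof. by move=> bf; apply: (bmeas_comp bf); exact: measurable_swap. Qed.

Lemma bmeas_poissonT a : 0 <= a < 1 -> bmeas (fun x : R => poisson a x).
Proof. by move=> a01; exact: (bmeas_poisson a01 (@measurable_id _ _ setT)). Qed.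

Lemma bmeas_poisson_int a h : 0 <= a < 1 -> bmeas h -> bmeas (poisson_int a h).
Proof.
move=> a01 bh; apply: bmeasZ.
apply: (bmeas_circ_int (f := fun x : R * R => poisson a (x.1 - x.2) * h x.2)).
by apply: bmeasM; [exact: (bmeas_pair_sub (bmeas_poissonT a01))|exact: bmeas_snd].
Qed.

Lemma bmeas_kern_int (k : R -> R -> R) a h : deriv_kernel k -> 0 <= a < 1 ->
  bmeas h -> bmeas (kern_int k a h).
Proof.
move=> dk a01 bh.
apply: (bmeas_circ_int (f := fun x : R * R => k a (x.1 - x.2) * h x.2)).
apply: bmeasM; last exact: bmeas_snd.
exact: (bmeas_pair_sub (bmeas_kern dk a01 (@measurable_id _ _ setT))).
Qed.

Lemma poisson_int_ge0 a h phi : 0 <= a < 1 -> (forall t, 0 <= h t) ->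
  0 <= poisson_int a h phi.
Proof.
move=> a01 h0; rewrite mulr_ge0 ?invr_ge0 ?twopi_ge0//.
by apply: circ_int_ge0 => t; rewrite mulr_ge0// poisson_ge0.
Qed.

Lemma poisson_int_gt0 a h phi e : 0 <= a < 1 -> bmeas h -> 0 < e -> (forall t, e <= h t) ->
  e <= poisson_int a h phi.
Proof.
move=> a01 bh e0 eh; rewrite /poisson_int mulrC ler_pdivlMr//.
rewrite -(circ_int_poisson_l phi a01) mulrC -circ_intZr; last first.
  by apply: bmeas_poisson => //; exact: measurable_subl.
apply: le_circ_int; [|exact: bmeas_poisson_mul|].
  by apply: (bmeas_poisson_mul _ a01); exact: bmeas_cst.
by move=> t; rewrite ler_wpM2l// poisson_ge0.
Qed.

Lemma circ_int_poisson_int a h : 0 <= a < 1 -> bmeas h ->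
  circ_int (poisson_int a h) = circ_int h.
Proof.
move=> a01 bh; rewrite /poisson_int.
have bP : bmeas (fun x : R * R => poisson a (x.1 - x.2) * h x.2).
  by apply: bmeasM; [exact: (bmeas_pair_sub (bmeas_poissonT a01))|exact: bmeas_snd].
rewrite circ_intZ; last exact: (bmeas_circ_int bP).
rewrite (circ_int_swap bP)/=.
under eq_circ_int => t.
  rewrite circ_intZr; last by apply: bmeas_poisson => //; exact: measurable_subr.
  rewrite circ_int_poisson//; over.
by rewrite circ_intZ// mulrA mulVf ?mul1r// twopi_neq0.
Qed.

Lemma kern_poisson_int (k : R -> R -> R) a b h phi : deriv_kernel k ->
  0 < a < 1 -> 0 <= b < 1 -> bmeas h ->
  kern_int k a (poisson_int b h) phi = b * kern_int k (a * b) h phi.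
Proof.
move=> dk a01 b01 bh; have [_ _ rep] := dk.
have a01' : 0 <= a < 1 by case/andP: a01 => a0 a1; rewrite ltW.
have bk : bmeas (fun t : R => k a (phi - t)).
  by apply: bmeas_kern => //; exact: measurable_subl.
have bP : bmeas (fun x : R * R => k a (phi - x.1) * (poisson b (x.1 - x.2) * h x.2)).
  apply: bmeasM; first exact: (bmeas_fst bk).
  by apply: bmeasM; [exact: (bmeas_pair_sub (bmeas_poissonT b01))|exact: bmeas_snd].
transitivity ((2 * pi)^-1 * circ_int (fun t => circ_int (fun s =>
    k a (phi - t) * (poisson b (t - s) * h s)))).
  rewrite -circ_intZ; last exact: (bmeas_circ_int bP).
  apply: eq_circ_int => t; rewrite /poisson_int mulrCA; congr (_ * _).
  by rewrite circ_intZ//; exact: bmeas_poisson_mul.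
rewrite (circ_int_swap bP)/= -circ_intZ; last first.
  apply: (bmeas_circ_int (f := fun x : R * R => k a (phi - x.2) * (poisson b (x.2 - x.1) * h x.1))).
  exact: (bmeas_swap bP).
rewrite /kern_int -circ_intZ; last by apply: bmeas_kern_mul => //; exact: mul01.
apply: eq_circ_int => s.
under eq_circ_int do rewrite mulrA.
rewrite circ_intZr; last first.
  by apply: bmeasM => //; apply: bmeas_poisson => //; exact: measurable_subr.
by rewrite rep// -(mulrA (2 * pi)) mulKf ?twopi_neq0// mulrA.
Qed.

Lemma poisson_poisson_int a b h phi : 0 <= a < 1 -> 0 <= b < 1 -> bmeas h ->
  poisson_int a (poisson_int b h) phi = poisson_int (a * b) h phi.
Proof.
move=> a01 b01 bh; rewrite /poisson_int; congr (_ * _).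
have bk : bmeas (fun t : R => poisson a (phi - t)).
  by apply: bmeas_poisson => //; exact: measurable_subl.
have bP : bmeas (fun x : R * R => poisson a (phi - x.1) * (poisson b (x.1 - x.2) * h x.2)).
  apply: bmeasM; first exact: (bmeas_fst bk).
  by apply: bmeasM; [exact: (bmeas_pair_sub (bmeas_poissonT b01))|exact: bmeas_snd].
transitivity ((2 * pi)^-1 * circ_int (fun t => circ_int (fun s =>
    poisson a (phi - t) * (poisson b (t - s) * h s)))).
  rewrite -circ_intZ; last exact: (bmeas_circ_int bP).
  apply: eq_circ_int => t; rewrite /poisson_int mulrCA; congr (_ * _).
  by rewrite circ_intZ//; exact: bmeas_poisson_mul.
rewrite (circ_int_swap bP)/= -circ_intZ; last first.
  apply: (bmeas_circ_int (f := fun x : R * R => poisson a (phi - x.2) * (poisson b (x.2 - x.1) * h x.1))).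
  exact: (bmeas_swap bP).
apply: eq_circ_int => s.
under eq_circ_int do rewrite mulrA.
rewrite circ_intZr; last first.
  by apply: bmeasM => //; apply: bmeas_poisson => //; exact: measurable_subr.
by rewrite poisson_semigroup// -(mulrA (2 * pi)) mulKf ?twopi_neq0.
Qed.

(** Average of the tangent inequality taken at [x], the Poisson mean itself, so that the linear term
    integrates to 0. *)
Lemma poisson_int_jensen a h q : 0 <= a < 1 -> 1 <= q -> bmeas h -> (forall t, 0 <= h t) ->
  forall phi, poisson_int a h phi `^ q <= poisson_int a (fun t => h t `^ q) phi.
Proof.
move=> a01 q1 bh h0 phi; pose x := poisson_int a h phi.
have x0 : 0 <= x by exact: poisson_int_ge0.
have q0 : 0 <= q by rewrite (le_trans _ q1).
have bhq : bmeas (fun t : R => h t `^ q) by exact: bmeas_powR.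
have bw : bmeas (fun t : R => poisson a (phi - t)).
  by apply: bmeas_poisson => //; exact: measurable_subl.
have b1 := bmeas_poisson_mul phi a01 bh.
have b2 := bmeas_poisson_mul phi a01 bhq.
rewrite -/x [X in _ <= X]/poisson_int mulrC ler_pdivlMr//.
have -> : x `^ q * (2 * pi) = circ_int (fun t => (x `^ q - q * x `^ (q - 1) * x) * poisson a (phi - t)
   + q * x `^ (q - 1) * (poisson a (phi - t) * h t)).
  rewrite circ_intD; [|exact: bmeasZ|exact: bmeasZ].
  rewrite (circ_intZ _ bw) (circ_intZ _ b1) circ_int_poisson_l//.
  have -> : circ_int (fun t => poisson a (phi - t) * h t) = 2 * pi * x.
    by rewrite /x /poisson_int mulrA divff ?mul1r// twopi_neq0.
  ring.
apply: le_circ_int => //; first by apply: bmeasD; exact: bmeasZ.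
move=> t; have := powR_tangent q1 x0 (h0 t); have := poisson_ge0 (phi - t) a01; nra.
Qed.

Lemma circ_int_poisson_int_powR a h q : 0 <= a < 1 -> 1 <= q -> bmeas h -> (forall t, 0 <= h t) ->
  circ_int (fun phi => poisson_int a h phi `^ q) <= circ_int (fun t => h t `^ q).
Proof.
move=> a01 q1 bh h0; have q0 : 0 <= q by rewrite (le_trans _ q1).
have bhq : bmeas (fun t : R => h t `^ q) by exact: bmeas_powR.
rewrite -(circ_int_poisson_int a01 bhq); apply: le_circ_int.
- by apply: bmeas_powR => //; [move=> t; exact: poisson_int_ge0|exact: bmeas_poisson_int].
- exact: bmeas_poisson_int.
- exact: poisson_int_jensen.
Qed.

End poisson_integral.
#[global] Hint Resolve twopi_gt0 : core.

(** * Square function estimates for harmonic extensions *)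

Section one_step.
Context {R : realType}.
Variable k : R -> R -> R.
Hypothesis dk : deriv_kernel k.
Implicit Types (u z h psi : R -> R) (s q : R).

Lemma bmeas_powR_pos d (T : measurableType d) (f : T -> R) (e p : R) : 0 < e ->
  (forall x, e <= f x) -> bmeas f -> bmeas (fun x => f x `^ p).
Proof.
move=> e0 ef bf; have f0 x : 0 < f x by exact: lt_le_trans (ef x).
have [p0|p0] := leP 0 p; first by apply: bmeas_powR => // x; exact: ltW.
split; first exact: (measurableT_comp (measurable_powR p) bf.1).
exists (e `^ p) => x; rewrite ger0_norm ?powR_ge0//.
move: p0; rewrite -[p]opprK oppr_lt0; move: (- p) => {}p p0.
rewrite !powRN lef_pV2 ?posrE ?powR_gt0//.
by apply: ge0_ler_powR => //; rewrite ?nnegrE; exact: ltW.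
Qed.

Lemma circ_int_poisson_mul s u (phi : R) :
  circ_int (fun t => poisson s (phi - t) * u t) = 2 * pi * poisson_int s u phi.
Proof. by rewrite /poisson_int mulVKf ?twopi_neq0. Qed.

(** The kernel has mean 0, so any constant [c] may be subtracted from [u]; moreover its modulus is
    at most the Poisson kernel divided by [1 - s ^+ 2]. *)
Lemma norm_kern_int_le s u (phi c : R) : 0 < s < 1 -> bmeas u ->
  `|kern_int k s u phi| * (1 - s ^+ 2) <=
  circ_int (fun t => poisson s (phi - t) * `|u t - c|).
Proof.
move=> s01 bu; have /andP[s0 s1] := s01.
have s01' : 0 <= s < 1 by rewrite ltW.
have bc : bmeas (fun t : R => u t - c) by apply: bmeasB => //; exact: bmeas_cst.
have bk : bmeas (fun t : R => k s (phi - t)).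
  by apply: bmeas_kern => //; exact: measurable_subl.
have s21 : 0 < 1 - s ^+ 2 by rewrite subr_gt0 expr_lt1// ltW.
have -> : kern_int k s u phi = circ_int (fun t => k s (phi - t) * (u t - c)).
  under [RHS]eq_circ_int do rewrite mulrBr.
  rewrite circ_intB; [|exact: bmeasM|by apply: bmeasM => //; exact: bmeas_cst].
  by rewrite (circ_intZr c bk) (kern_mean0 _ dk)// mul0r subr0.
have bm : bmeas (fun t : R => k s (phi - t) * (u t - c)) by exact: bmeasM.
rewrite -ler_pdivlMr//; apply: le_trans (le_norm_circ_int bm) _.
have bw : bmeas (fun t : R => poisson s (phi - t) * `|u t - c|).
  by apply: bmeas_poisson_mul => //; exact: bmeas_norm.
rewrite -circ_intZr//; apply: le_circ_int.
- exact: bmeas_norm.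
- by apply: bmeasM => //; exact: bmeas_cst.
move=> t; rewrite normrM mulrAC ler_wpM2r//.
have [kd _ _] := dk; apply: le_trans (kd _ _ s01') _.
by rewrite /poisson mulrAC divff ?mul1r// gt_eqF.
Qed.

(** With [x] and [y] the Poisson means of [u] and [z], averaging [bellman_ge2] removes the linear
    terms and leaves the variance [I2] of [u], with the power [q - 2] of [y] in front. By
    Cauchy-Schwarz the variance dominates the square of the kernel integral. *)
Lemma step_ge2_pointwise q s u z (phi : R) : 2 <= q -> 0 < s < 1 ->
  bmeas u -> bmeas z -> (forall t, 0 <= u t) -> (forall t, 0 <= z t) ->
  poisson_int s z phi `^ (q - 2) * kern_int k s u phi ^+ 2 * (1 - s ^+ 2) ^+ 2 <=
  8 * pi ^+ 2 / q * (poisson_int s (fun t => (u t ^+ 2 + z t ^+ 2) `^ (q / 2)) phi -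
    (poisson_int s u phi ^+ 2 + poisson_int s z phi ^+ 2) `^ (q / 2)).
Proof.
move=> q2 s01 bu bz u0 z0; have /andP[s0 s1] := s01.
have s01' : 0 <= s < 1 by rewrite ltW.
have q0 : 0 < q by exact: lt_le_trans q2.
set x := poisson_int s u phi; set y := poisson_int s z phi.
have x0 : 0 <= x by exact: poisson_int_ge0.
have y0 : 0 <= y by exact: poisson_int_ge0.
pose B t := (u t ^+ 2 + z t ^+ 2) `^ (q / 2).
have bB : bmeas B.
  apply: bmeas_powR; first by rewrite divr_ge0// ltW.
    by move=> t; rewrite addr_ge0 ?sqr_ge0.
  by apply: bmeasD; exact: bmeasX.
rewrite -/B; set Bx := (x ^+ 2 + y ^+ 2) `^ (q / 2).
have bw : bmeas (fun t : R => poisson s (phi - t)).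
  by apply: bmeas_poisson => //; exact: measurable_subl.
have w0 t : 0 <= poisson s (phi - t) by exact: poisson_ge0.
have bf : bmeas (fun t : R => u t - x) by apply: bmeasB => //; exact: bmeas_cst.
pose I2 := circ_int (fun t => poisson s (phi - t) * (u t - x) ^+ 2).
have HV : (kern_int k s u phi * (1 - s ^+ 2)) ^+ 2 <= I2 * (2 * pi).
  have N0 : 0 <= `|kern_int k s u phi| * (1 - s ^+ 2).
    by rewrite mulr_ge0// subr_ge0 expr_le1// ltW.
  have := norm_kern_int_le phi x s01 bu; rewrite -(ler_pXn2r (n := 2))//; last first.
    rewrite nnegrE; apply: circ_int_ge0 => t; exact: mulr_ge0.
  rewrite exprMn real_normK ?num_real// -exprMn => /le_trans; apply.
  have := norm_circ_int_sqr_le bw bf (bmeas_cst _ 1) (bmeas_cst _ 1) w0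
    (fun=> ltr01) (fun=> mulr1 1).
  rewrite (_ : circ_int (fun t => poisson s (phi - t) * 1) = 2 * pi); last first.
    by rewrite -(circ_int_poisson_l phi s01'); apply: eq_circ_int => t; rewrite mulr1.
  by congr (_ <= _ * _); apply: eq_circ_int => t; rewrite mulr1.
have HB : 2 * pi * Bx + q / 2 * y `^ (q - 2) * I2 <= 2 * pi * poisson_int s B phi.
  rewrite -circ_int_poisson_mul.
  pose c := q * (x ^+ 2 + y ^+ 2) `^ (q / 2 - 1).
  have b1 := bmeas_poisson_mul phi s01' bu.
  have b2 := bmeas_poisson_mul phi s01' bz.
  have b3 : bmeas (fun t : R => poisson s (phi - t) * (u t - x) ^+ 2).
    by apply: bmeasM => //; exact: bmeasX.
  have -> : 2 * pi * Bx + q / 2 * y `^ (q - 2) * I2 = circ_int (fun t =>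
      ((Bx - c * x * x - c * y * y) * poisson s (phi - t)
       + c * x * (poisson s (phi - t) * u t))
       + (c * y * (poisson s (phi - t) * z t) +
       (q / 2 * y `^ (q - 2)) * (poisson s (phi - t) * (u t - x) ^+ 2))).
    rewrite circ_intD; [|by apply: bmeasD; exact: bmeasZ|by apply: bmeasD; exact: bmeasZ].
    rewrite circ_intD; [|exact: bmeasZ|exact: bmeasZ].
    rewrite circ_intD; [|exact: bmeasZ|exact: bmeasZ].
    rewrite (circ_intZ _ bw) (circ_intZ _ b1) (circ_intZ _ b2) (circ_intZ _ b3).
    by rewrite circ_int_poisson_l// (circ_int_poisson_mul s u) (circ_int_poisson_mul s z)
      -/x -/y -/I2; ring.
  apply: le_circ_int; [|exact: bmeas_poisson_mul|].
    by apply: bmeasD; apply: bmeasD; exact: bmeasZ.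
  move=> t; have := bellman_ge2 (u t) (z t) q2 x0 y0; rewrite -/Bx -/(B t) -/c => H.
  have := ler_wpM2l (w0 t) H; lra.
have yq : 0 <= y `^ (q - 2) := powR_ge0 _ _.
rewrite -mulrA -exprMn; apply: le_trans (ler_wpM2l yq HV) _.
have -> : 8 * pi ^+ 2 / q * (poisson_int s B phi - Bx) =
  (4 * pi / q) * (2 * pi * (poisson_int s B phi - Bx)) by field; rewrite gt_eqF.
have -> : y `^ (q - 2) * (I2 * (2 * pi)) = (4 * pi / q) * (q / 2 * y `^ (q - 2) * I2).
  by field; rewrite gt_eqF.
apply: ler_wpM2l; first by rewrite divr_ge0 ?mulr_ge0 ?pi_ge0 ?(ltW q0).
by lra.
Qed.

Lemma bmeas_sum_sqr_powR u z q : 0 <= q -> bmeas u -> bmeas z ->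
  bmeas (fun t : R => (u t ^+ 2 + z t ^+ 2) `^ q).
Proof.
move=> q0 bu bz; apply: bmeas_powR => //.
  by move=> t; rewrite addr_ge0 ?sqr_ge0.
by apply: bmeasD; exact: bmeasX.
Qed.

Lemma step_ge2 q s u z : 2 <= q -> 0 < s < 1 ->
  bmeas u -> bmeas z -> (forall t, 0 <= u t) -> (forall t, 0 <= z t) ->
  circ_int (fun phi => poisson_int s z phi `^ (q - 2) * kern_int k s u phi ^+ 2)
    * (1 - s ^+ 2) ^+ 2 <=
  8 * pi ^+ 2 / q * (circ_int (fun t => (u t ^+ 2 + z t ^+ 2) `^ (q / 2)) -
    circ_int (fun phi => (poisson_int s u phi ^+ 2 + poisson_int s z phi ^+ 2) `^ (q / 2))).
Proof.
move=> q2 s01 bu bz u0 z0; have /andP[s0 s1] := s01.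
have s01' : 0 <= s < 1 by rewrite ltW.
have q0 : 0 <= q / 2 by rewrite divr_ge0// (le_trans _ q2).
have bB := bmeas_sum_sqr_powR q0 bu bz.
have bPu := bmeas_poisson_int s01' bu; have bPz := bmeas_poisson_int s01' bz.
have bB' := bmeas_sum_sqr_powR q0 bPu bPz.
have bPB := bmeas_poisson_int s01' bB.
have b1 : bmeas (fun phi : R => poisson_int s z phi `^ (q - 2) * kern_int k s u phi ^+ 2).
  apply: bmeasM; last by apply: bmeasX; exact: bmeas_kern_int.
  by apply: bmeas_powR => //; [rewrite subr_ge0|move=> t; exact: poisson_int_ge0].
rewrite -(circ_int_poisson_int s01' bB) -circ_intB// -circ_intZ; last exact: bmeasB.
rewrite -circ_intZr//; apply: le_circ_int.
- by apply: bmeasM => //; exact: bmeas_cst.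
- by apply: bmeasZ; exact: bmeasB.
by move=> phi; exact: step_ge2_pointwise.
Qed.

(** As for [q >= 2], but the quadratic gain of [bellman_le2] carries the weight [M t] to the power
    [q - 2], which depends on [t]. Cauchy-Schwarz therefore needs the mean of the inverse weight as
    well. *)
Lemma step_le2_pointwise q s u (e phi : R) : 1 < q <= 2 -> 0 < s < 1 ->
  bmeas u -> 0 < e -> (forall t, e <= u t) ->
  poisson_int s u phi `^ (q - 2) * kern_int k s u phi ^+ 2 * (1 - s ^+ 2) ^+ 2 <=
  32 * pi ^+ 2 / (q * (q - 1)) * (poisson_int s (fun t => u t `^ q) phi -
    poisson_int s u phi `^ q).
Proof.
move=> q12 s01 bu e0 eu; have /andP[s0 s1] := s01; have /andP[q1 q2] := q12.
have s01' : 0 <= s < 1 by rewrite ltW.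
have q0 : 0 < q by exact: lt_trans q1.
have u0 t : 0 <= u t by rewrite (le_trans (ltW e0)).
set x := poisson_int s u phi.
have x0 : 0 < x by exact: lt_le_trans (poisson_int_gt0 phi s01' bu e0 eu).
pose B t := u t `^ q.
have bB : bmeas B by apply: bmeas_powR => //; exact: ltW.
rewrite -/B; set Bx := x `^ q.
have bw : bmeas (fun t : R => poisson s (phi - t)).
  by apply: bmeas_poisson => //; exact: measurable_subl.
have w0 t : 0 <= poisson s (phi - t) by exact: poisson_ge0.
have bf : bmeas (fun t : R => u t - x) by apply: bmeasB => //; exact: bmeas_cst.
pose M t := Num.max x (u t).
have M0 t : 0 < M t by rewrite lt_max x0.
have bM : bmeas M.
  split; first by apply: measurable_maxr => //; exact: bu.1.
  have [N uN] := bu.2; exists (Num.max x N) => t; rewrite ger0_norm ?(ltW (M0 t))//.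
  rewrite /M ge_max le_max lexx/= le_max; apply/orP; right.
  exact: le_trans (ler_norm _) (uN t).
have xM t : x <= M t by rewrite le_max lexx.
have bg : bmeas (fun t : R => M t `^ (q - 2)) by exact: (bmeas_powR_pos _ x0 xM).
have bgi : bmeas (fun t : R => M t `^ (2 - q)) by exact: (bmeas_powR_pos _ x0 xM).
pose I2 := circ_int (fun t => poisson s (phi - t) * ((u t - x) ^+ 2 * M t `^ (q - 2))).
(* The exponent [2 - q] lies between 0 and 1: the power of the maximum is at most the sum of the
   powers of [x] and [u t], and by concavity the mean of the latter is at most the power of the mean
   [x]. This gives twice the total mass [2 * pi]. *)
have HM : circ_int (fun t => poisson s (phi - t) * M t `^ (2 - q)) <=
    4 * pi * x `^ (2 - q).
  have th : 0 <= 2 - q <= 1 by apply/andP; split; lra.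
  have b1 := bmeas_poisson_mul phi s01' bu.
  pose c := (2 - q) * x `^ (2 - q - 1).
  have -> : 4 * pi * x `^ (2 - q) = circ_int (fun t =>
      (2 * x `^ (2 - q) - c * x) * poisson s (phi - t) + c * (poisson s (phi - t) * u t)).
    rewrite circ_intD; [|exact: bmeasZ|exact: bmeasZ].
    by rewrite (circ_intZ _ bw) (circ_intZ _ b1) circ_int_poisson_l//
      circ_int_poisson_mul -/x; ring.
  apply: le_circ_int; [exact: bmeasM|by apply: bmeasD; exact: bmeasZ|move=> t].
  have H := powR_concave th x0 (u0 t); rewrite -/c in H.
  have H2 : M t `^ (2 - q) <= x `^ (2 - q) + u t `^ (2 - q).
    rewrite /M; have [_|_] := leP x (u t); first by rewrite lerDr powR_ge0.
    by rewrite lerDl powR_ge0.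
  have := ler_wpM2l (w0 t) (le_trans H2 (lerD (lexx _) H)); lra.
have HV : (kern_int k s u phi * (1 - s ^+ 2)) ^+ 2 <= I2 * (4 * pi * x `^ (2 - q)).
  have N0 : 0 <= `|kern_int k s u phi| * (1 - s ^+ 2).
    by rewrite mulr_ge0// subr_ge0 expr_le1// ltW.
  have := norm_kern_int_le phi x s01 bu; rewrite -(ler_pXn2r (n := 2))//; last first.
    rewrite nnegrE; apply: circ_int_ge0 => t; exact: mulr_ge0.
  rewrite exprMn real_normK ?num_real// -exprMn => /le_trans; apply.
  apply: le_trans (norm_circ_int_sqr_le bw bf bg bgi w0 _ _) _.
  - by move=> t; rewrite powR_gt0.
  - move=> t; rewrite -powRD; last by apply/implyP => _; rewrite gt_eqF.
    by rewrite addrC subrKA subrr powRr0.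
  - apply: ler_wpM2l => //; apply: circ_int_ge0 => t; apply: mulr_ge0 => //.
    by rewrite mulr_ge0 ?sqr_ge0 ?powR_ge0.
have HB : 2 * pi * Bx + q * (q - 1) / 4 * I2 <= 2 * pi * poisson_int s B phi.
  rewrite -circ_int_poisson_mul.
  pose c := q * x `^ (q - 1).
  have b1 := bmeas_poisson_mul phi s01' bu.
  have b3 : bmeas (fun t : R => poisson s (phi - t) * ((u t - x) ^+ 2 * M t `^ (q - 2))).
    by apply: bmeasM => //; apply: bmeasM => //; exact: bmeasX.
  have -> : 2 * pi * Bx + q * (q - 1) / 4 * I2 = circ_int (fun t =>
      ((Bx - c * x) * poisson s (phi - t) + c * (poisson s (phi - t) * u t))
       + (q * (q - 1) / 4) * (poisson s (phi - t) * ((u t - x) ^+ 2 * M t `^ (q - 2)))).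
    rewrite circ_intD; [|by apply: bmeasD; exact: bmeasZ|exact: bmeasZ].
    rewrite circ_intD; [|exact: bmeasZ|exact: bmeasZ].
    rewrite (circ_intZ _ bw) (circ_intZ _ b1) (circ_intZ _ b3).
    by rewrite circ_int_poisson_l// (circ_int_poisson_mul s u) -/x -/I2; ring.
  apply: le_circ_int; [|exact: bmeas_poisson_mul|].
    by apply: bmeasD; [apply: bmeasD|]; exact: bmeasZ.
  move=> t; have := bellman_le2 q12 x0 (u0 t); rewrite -/Bx -/(B t) -/c -/(M t) => H.
  have := ler_wpM2l (w0 t) H; lra.
have xq : 0 <= x `^ (q - 2) := powR_ge0 _ _.
rewrite -mulrA -exprMn; apply: le_trans (ler_wpM2l xq HV) _.
have -> : x `^ (q - 2) * (I2 * (4 * pi * x `^ (2 - q))) = 4 * pi * I2.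
  rewrite mulrCA mulrA [I2 * _]mulrC.
  have : x `^ (q - 2) * x `^ (2 - q) = 1.
    rewrite -powRD; last by apply/implyP => _; rewrite gt_eqF.
    by rewrite addrC subrKA subrr powRr0.
  move=> E; transitivity (4 * pi * I2 * (x `^ (q - 2) * x `^ (2 - q))); first by ring.
  by rewrite E mulr1.
have q10 : 0 < q - 1 by rewrite subr_gt0.
have -> : 32 * pi ^+ 2 / (q * (q - 1)) * (poisson_int s B phi - Bx) =
  (16 * pi / (q * (q - 1))) * (2 * pi * (poisson_int s B phi - Bx)).
  by field; rewrite !gt_eqF.
have -> : 4 * pi * I2 = (16 * pi / (q * (q - 1))) * (q * (q - 1) / 4 * I2).
  by field; rewrite !gt_eqF.
apply: ler_wpM2l; first by rewrite divr_ge0 ?mulr_ge0 ?pi_ge0 ?(ltW q0) ?(ltW q10).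
by lra.
Qed.

Lemma step_le2 q s u (e : R) : 1 < q <= 2 -> 0 < s < 1 ->
  bmeas u -> 0 < e -> (forall t, e <= u t) ->
  circ_int (fun phi => poisson_int s u phi `^ (q - 2) * kern_int k s u phi ^+ 2)
    * (1 - s ^+ 2) ^+ 2 <=
  32 * pi ^+ 2 / (q * (q - 1)) * (circ_int (fun t => u t `^ q) -
    circ_int (fun phi => poisson_int s u phi `^ q)).
Proof.
move=> q12 s01 bu e0 eu; have /andP[s0 s1] := s01; have /andP[q1 q2] := q12.
have s01' : 0 <= s < 1 by rewrite ltW.
have u0 t : 0 <= u t by rewrite (le_trans (ltW e0)).
have q0 : 0 <= q by rewrite ltW// (lt_trans _ q1).
have bB : bmeas (fun t : R => u t `^ q) by exact: bmeas_powR.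
have bPu := bmeas_poisson_int s01' bu.
have ePu t : e <= poisson_int s u t by exact: (poisson_int_gt0 _ _ bu e0).
have bB' : bmeas (fun t : R => poisson_int s u t `^ q) by exact: (bmeas_powR_pos _ e0 ePu).
have bPB := bmeas_poisson_int s01' bB.
have b1 : bmeas (fun phi : R => poisson_int s u phi `^ (q - 2) * kern_int k s u phi ^+ 2).
  apply: bmeasM; last by apply: bmeasX; exact: bmeas_kern_int.
  exact: (bmeas_powR_pos _ e0 ePu).
rewrite -(circ_int_poisson_int s01' bB) -circ_intB// -circ_intZ; last exact: bmeasB.
rewrite -circ_intZr//; apply: le_circ_int.
- by apply: bmeasM => //; exact: bmeas_cst.
- by apply: bmeasZ; exact: bmeasB.
by move=> phi; exact: (step_le2_pointwise _ q12 s01 bu e0 eu).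
Qed.

End one_step.

Section shells.
Context {R : realType}.
Local Notation mu := (@lebesgue_measure R).

Local Notation I01 := (`]0, 1[%classic : set R).

Let b (n : nat) : R := 1 - 2 ^- n.

(** On the shell from [b n] to [b n.+1] the point [(1 + x) / 2] does not exceed [b n.+2], so [g] is
    at most [2 ^+ n.+1] times [M n.+2 - M n]. The shell has length [2 ^- n.+1], and its integral is
    at most this increment. *)
Lemma dyadic_shells (g m : R -> R) (A : R) :
  measurable_fun I01 g -> (forall x, 0 < x < 1 -> 0 <= g x) ->
  (forall x, 0 < x < 1 -> 0 <= m x <= A) ->
  (forall x y, 0 < x -> x <= y -> y < 1 -> m x <= m y) ->
  (forall x, 0 < x < 1 -> (1 - x) * g x <= m ((1 + x) / 2) - m x) ->
  (\int[mu]_(x in `]0%R, 1%R[) (g x)%:E <= (2 * A)%:E)%E.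
Proof.
move=> mg g0 mA mm gm.
have p2 n : 0 < 2 ^- n :> R by rewrite invr_gt0 exprn_gt0.
have p2S n : 2 ^- n = 2 * 2 ^- n.+1 :> R.
  by rewrite exprS invfM mulrA divff ?mul1r.
have b1 n : b n < 1 by rewrite gtrBl.
have b0 n : 0 < b n.+1.
  by rewrite subr_gt0 invf_lt1 ?exprn_gt0// exprn_egt1// ltr1n.
have b00 : b 0%N = 0 by rewrite /b expr0 invr1 subrr.
have b0' n : 0 <= b n by case: n => [|n]; rewrite ?b00// ltW.
have bS n : b n < b n.+1 by rewrite ltrD2l ltrN2 (p2S n) ltr_pMl// ltr1n.
(* Nothing is known about [m] at [b 0 = 0]; the value 0 is a lower bound of [m] elsewhere, which is
   all that is used. *)
pose M n := if n is n'.+1 then m (b n) else 0.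
have M0 n : 0 <= M n.
  by case: n => // n; have /andP[] := mA (b n.+1) (introT andP (conj (b0 n) (b1 n.+1))).
have MA n : M n.+1 <= A by have /andP[] := mA (b n.+1) (introT andP (conj (b0 n) (b1 n.+1))).
have sub n : (`]0, b n]%classic : set R) `<=` I01.
  by move=> x/=; rewrite !in_itv/= => /andP[-> xb]/=; exact: le_lt_trans xb _.
have mgE : measurable_fun I01 (EFin \o g) by apply/measurable_EFinP.
(* The increments [M n.+2 - M n] span two steps, so the telescoping sum keeps two terms; hence the
   factor 2 in front of [A]. *)
have N n : (\int[mu]_(x in `]0%R, b n]) (g x)%:E <= (M n.+1 + M n)%:E)%E.
  elim: n => [|n IH].
    by rewrite b00 set_itvoc0 integral_set0 addr0 lee_fin.
  have E : (`]0, b n.+1]%classic : set R) = (`]0, b n]%classic : set R) `|` `]b n, b n.+1].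
    rewrite -(@itv_bndbnd_setU _ _ _ (BRight (b n)))// bnd_simp//.
    exact: ltW.
  have sub' : (`]b n, b n.+1]%classic : set R) `<=` `]0, b n.+1] by rewrite E; exact: subsetUr.
  rewrite E ge0_integral_setU//=; last 3 first.
    rewrite -E; apply: measurable_funS mgE => //; exact: sub.
    move=> x Hx; have : (`]0, b n.+1]%classic : set R) x by rewrite E.
    move=> /sub; rewrite /= in_itv/= => x01; rewrite lee_fin; exact: g0.
    rewrite disj_set2E; apply/eqP; rewrite -subset0 => x []/=.
    by rewrite !in_itv/= => /andP[_ xb] /andP[bx _]; have := le_lt_trans xb bx; rewrite ltxx.
  pose c := (M n.+2 - M n) * 2 ^+ n.+1.
  have gc x : (`]b n, b n.+1]%classic : set R) x -> g x <= c.
    move=> xb; have x01 : 0 < x < 1 by have := sub _ _ (sub' _ xb); rewrite /= in_itv.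
    move: xb; rewrite /= in_itv/= => /andP[bx xb].
    have x1 : 2 ^- n.+1 <= 1 - x by move: xb; rewrite /b; lra.
    have H1 : m ((1 + x) / 2) <= M n.+2.
      apply: mm; [|rewrite /b (p2S n.+1) in xb *|exact: b1].
        by have /andP[? ?] := x01; lra.
      rewrite /b; lra.
    have H2 : M n <= m x.
      case: n {IH E sub' c H1 x1} bx xb => [|n] bx xb; first by have /andP[] := mA x x01.
      by apply: mm => //; [exact: ltW|case/andP: x01].
    have := gm x x01; have gx0 := g0 x x01 => H.
    rewrite /c -ler_pdivrMr ?exprn_gt0// mulrC.
    apply: (@le_trans _ _ ((1 - x) * g x)); first by rewrite ler_wpM2r.
    by apply: le_trans H _; rewrite lerB.
  apply: (@le_trans _ _ ((M n.+1 + M n)%:E + (c * 2 ^- n.+1)%:E)%E); last first.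
    rewrite -EFinD lee_fin /c mulfK ?gt_eqF ?exprn_gt0//=; lra.
  apply: leeD => //.
  apply: (@le_trans _ _ (\int[mu]_(x in `]b n, b n.+1]) (cst c%:E) x)%E).
    apply: ge0_le_integral => //.
    - move=> x /sub' /sub; rewrite /= in_itv/= => x01; rewrite lee_fin; exact: g0.
    - by apply: measurable_funS mgE => //; exact: subset_trans sub' (sub _).
  rewrite integral_cst//= lebesgue_measure_itv/= lte_fin bS -EFinB -EFinM lee_fin.
  by rewrite /b opprB addrC subrKA (p2S n) mulr_natl mulr2n addrK.
have U : I01 = \bigcup_n (`]0, b n]%classic : set R).
  apply/seteqP; split => x.
    rewrite /= in_itv/= => /andP[x0 x1].
    have [n _ H] : \forall n \near \oo, 2^-1 ^+ n <= 1 - x.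
      have /cvgrPdist_le/(_ (1 - x)) : 2^-1 ^+ n @[n --> \oo] --> (0 : R).
        by apply: cvg_expr; rewrite ger0_norm ?invf_lt1// ltr1n.
      rewrite subr_gt0 => /(_ x1); apply: filterS => n.
      by rewrite sub0r normrN ger0_norm ?exprn_ge0.
    exists n => //=; rewrite in_itv/= x0 /b; have := H n (leqnn n).
    by rewrite /= exprVn; lra.
  by move=> [n _ /sub].
have nd : nondecreasing_seq (fun n => (`]0, b n]%classic : set R)).
  apply/nondecreasing_seqP => n; apply/subsetPset => x /=; rewrite !in_itv/= => /andP[-> xb]/=.
  by rewrite (le_trans xb)// ltW.
have g0' i x : (`]0, b i]%classic : set R) x -> (0 <= (EFin \o g) x)%E.
  by move=> /sub; rewrite /= in_itv/= => x01; rewrite lee_fin; exact: g0.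
have H : (\int[mu]_(x in (`]0%R, b n])) ((EFin \o g) x))%E @[n --> \oo] -->
    (\int[mu]_(x in \bigcup_n (`]0%R, b n]%classic : set R)) ((EFin \o g) x))%E.
  apply: ge0_nondecreasing_set_cvg_integral => //.
  by move=> n; apply: measurable_funS mgE => //; exact: sub.
rewrite U -(cvg_lim _ H)//; apply: lime_le; first by apply/cvg_ex; eexists; exact: H.
apply: nearW => n; apply: le_trans (N n) _; rewrite lee_fin.
have : M n <= A.
  by case: n => [|n]; [exact: le_trans (M0 1%N) (MA 0%N)|exact: MA].
by have := MA n; lra.
Qed.

End shells.

(** * Weighted square functions, exponents at least 2 *)

Section square_estimates.
Context {R : realType}.
Local Notation mu := (@lebesgue_measure R).
Local Notation J := (`[0, 2 * pi]%classic : set R).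
Local Notation I01 := (`]0, 1[%classic : set R).
Implicit Types (h psi : R -> R) (q r : R).

(* Makes the Poisson kernels globally defined on the level variable. *)
Definition clip (x : R) : R := x * \1_I01 x.

Lemma clipE (x : R) : 0 < x < 1 -> clip x = x.
Proof. by move=> x01; rewrite /clip indicE mem_set ?mulr1//= in_itv. Qed.

Lemma clip01 (x : R) : 0 <= clip x < 1.
Proof.
rewrite /clip indicE; have [|] := boolP (x \in I01); last by rewrite mulr0 lexx ltr01.
by rewrite inE/= in_itv/= mulr1 => /andP[/ltW -> ->].
Qed.

Lemma measurable_clip : measurable_fun setT clip.
Proof. by apply: measurable_funM => //; exact: measurable_indic. Qed.

Lemma measurable_circ_int_ge0 d (T : measurableType d) (f : T * R -> R) :
  measurable_fun setT f -> (forall x, 0 <= f x) ->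
  measurable_fun setT (fun x => circ_int (fun t => f (x, t))).
Proof.
move=> mf f0.
apply: (@measurableT_comp _ _ _ _ _ _ (@fine R)); first exact: fine_measurable.
apply: (measurable_tonelli1 (f := fun x => (f x)%:E)); first exact/measurable_EFinP.
by move=> x; rewrite lee_fin.
Qed.

Lemma measurable_poisson_int h (d : measure_display) (T : measurableType d) (a g : T -> R) :
  bmeas h -> (forall t, 0 <= h t) -> (forall x, 0 <= a x < 1) ->
  measurable_fun setT a -> measurable_fun setT g ->
  measurable_fun setT (fun x => poisson_int (a x) h (g x)).
Proof.
move=> bh h0 a01 ma mg; apply: measurable_funM => //.
apply: (measurable_circ_int_ge0 (f := fun x : T * R =>
  poisson (a x.1) (g x.1 - x.2) * h x.2)).
  apply: measurable_funM; last exact: measurableT_comp bh.1 _.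
  apply: measurable_poisson; first exact: measurableT_comp ma _.
  by apply: measurable_funB => //; exact: measurableT_comp mg _.
by move=> x; rewrite mulr_ge0// poisson_ge0.
Qed.

Lemma bmeas_kern_int2 k h r (d : measure_display) (T : measurableType d) (a g : T -> R) :
  deriv_kernel k -> bmeas h -> 0 <= r < 1 -> (forall x, 0 <= a x <= r) ->
  measurable_fun setT a -> measurable_fun setT g ->
  bmeas (fun x => kern_int k (a x) h (g x)).
Proof.
move=> dk bh r01 ar ma mg; have [kd mk _] := dk; have /andP[r0 r1] := r01.
apply: (bmeas_circ_int (f := fun x : T * R => k (a x.1) (g x.1 - x.2) * h x.2)).
apply: bmeasM; last by apply: (bmeas_comp bh).
split.
  apply: mk; first exact: measurableT_comp ma _.
  by apply: measurable_funB => //; exact: measurableT_comp mg _.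
exists ((1 - r) ^- 2) => x; have /andP[a0 a1] := ar x.1.
have a01 : 0 <= a x.1 < 1 by rewrite a0 (le_lt_trans a1).
apply: le_trans (kd _ _ a01) _.
rewrite lef_pV2 ?posrE ?poisson_den_gt0 ?exprn_gt0 ?subr_gt0//.
apply: le_trans (poisson_den_ge _ a01).
by rewrite lerXn2r ?nnegrE ?subr_ge0 ?(ltW r1)// ?lerB// (le_trans a1)// ltW.
Qed.

(** The level [y] lies halfway between [x] and the boundary, and averaging with ratio [s = x / y]
    leads from [y] down to [x]. Here [1 - s = (1 - x) / (1 + x)] is comparable to [1 - x]. *)
Lemma level_ratio (x : R) : 0 < x < 1 -> exists s y : R,
  y = (1 + x) / 2 /\
  [/\ 0 < s < 1, 0 < y < 1, s * y = x, 2^-1 <= y & (1 - x) ^+ 2 <= 4 * (1 - s ^+ 2) ^+ 2].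
Proof.
move=> /andP[x0 x1]; pose y : R := (1 + x) / 2; pose s := x / y.
have y0 : 0 < y by rewrite /y; lra.
have sE : s * y = x by rewrite /s divfK// gt_eqF.
have s0 : 0 < s by rewrite divr_gt0.
have s1 : s < 1 by rewrite /s ltr_pdivrMr// /y; lra.
exists s, y; split => //; split => //.
- by rewrite s0.
- by rewrite y0/= /y; lra.
- by rewrite /y; lra.
have -> : 4 * (1 - s ^+ 2) ^+ 2 = (2 * (1 - s ^+ 2)) ^+ 2 by ring.
have H : 1 - x <= 2 * (1 - s).
  have : s * (1 + x) = 2 * x.
    by rewrite -[in RHS]sE /y mulrCA [2 * _]mulrC divfK.
  nra.
by rewrite lerXn2r ?nnegrE//; [lra|nra|nra].
Qed.

Lemma mulr_lt1_lt1 (r y : R) : 0 < r < 1 -> 0 < y < 1 -> 0 <= r * y < 1.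
Proof.
move=> /andP[r0 r1] /andP[y0 y1]; apply: mul01; apply/andP; split => //; exact: ltW.
Qed.

Lemma sum_sqr_powR_le q (x z : R) : 2 <= q -> 0 <= x -> 0 <= z ->
  (x ^+ 2 + z ^+ 2) `^ (q / 2) <= 2 `^ q * (x `^ q + z `^ q).
Proof.
move=> q2 x0 z0; have q0 : 0 <= q by rewrite (le_trans _ q2).
pose M := Num.max x z.
have M0 : 0 <= M by rewrite le_max x0.
apply: (@le_trans _ _ (((2 * M) ^+ 2) `^ (q / 2))).
  apply: ge0_ler_powR; rewrite ?nnegrE ?addr_ge0 ?sqr_ge0 ?divr_ge0//.
  have xM : x <= M by rewrite le_max lexx.
  have zM : z <= M by rewrite le_max lexx orbT.
  nra.
rewrite -powR_mulrn ?mulr_ge0// -powRrM.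
have -> : 2%:R * (q / 2) = q by field.
rewrite powRM// ler_wpM2l ?powR_ge0// /M.
by have [_|_] := leP x z; rewrite ?lerDl ?lerDr powR_ge0.
Qed.

(** The factor [(r * y) ^+ 2] comes from the reproducing formula of the derivative kernel and is at
    least 1/16; with the 4 of [level_ratio] this makes 64. *)
Lemma absorb_sqr (X S r y K : R) : 2^-1 <= r -> 2^-1 <= y -> 0 <= K ->
  X ^+ 2 <= 4 * S ^+ 2 -> X ^+ 2 * K <= 64 * ((r * y) ^+ 2 * K * S ^+ 2).
Proof.
move=> r2 y2 K0 XS; have S0 := sqr_ge0 S.
have ry : 4^-1 <= r * y.
  have -> : 4^-1 = 2^-1 * 2^-1 :> R by rewrite -invfM; congr (_^-1); ring.
  by rewrite ler_pM.
have H : 1 <= 16 * (r * y) ^+ 2.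
  have : 0 <= (4 * (r * y) - 1) * (4 * (r * y) + 1) by apply: mulr_ge0; lra.
  lra.
apply: (@le_trans _ _ (4 * S ^+ 2 * K)); first by rewrite ler_wpM2r.
have KS : 0 <= 4 * S ^+ 2 * K by rewrite mulr_ge0// mulr_ge0.
have := ler_wpM2r KS H; lra.
Qed.

Lemma square_est_ge2 q : 2 <= q -> exists2 C : R, 0 <= C &
  forall k r h psi, deriv_kernel k -> 2^-1 <= r < 1 ->
  bmeas h -> (forall t, 0 <= h t) -> bmeas psi -> (forall t, 0 <= psi t) ->
  (\int[mu]_(x in `]0%R, 1%R[) (circ_int (fun phi => (1 - x) *
     (poisson_int x psi phi `^ (q - 2) * kern_int k (r * x) h phi ^+ 2)))%:E <=
   (C * (circ_int (fun t => h t `^ q) + circ_int (fun t => psi t `^ q)))%:E)%E.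
Proof.
move=> q2; have q0 : 0 < q by rewrite (lt_le_trans _ q2).
have q1 : 1 <= q by rewrite (le_trans _ q2)// ler1n.
have q20 : 0 <= q / 2 by rewrite divr_ge0// ltW.
have [C8 [C80 stepq]] : exists C8 : R, 0 < C8 /\ forall k s u z, deriv_kernel k ->
    0 < s < 1 -> bmeas u -> bmeas z -> (forall t, 0 <= u t) -> (forall t, 0 <= z t) ->
    circ_int (fun phi => poisson_int s z phi `^ (q - 2) * kern_int k s u phi ^+ 2)
      * (1 - s ^+ 2) ^+ 2 <=
    C8 * (circ_int (fun t => (u t ^+ 2 + z t ^+ 2) `^ (q / 2)) -
      circ_int (fun phi => (poisson_int s u phi ^+ 2 + poisson_int s z phi ^+ 2) `^ (q / 2))).
  exists (8 * pi ^+ 2 / q); split.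
    by rewrite divr_gt0// mulr_gt0// exprn_gt0// pi_gt0.
  by move=> k s u z dk s01 bu bz u0 z0; exact: step_ge2.
have [c [c0 cE]] : exists c : R, 0 <= c /\ c = 64 * C8.
  by exists (64 * C8); rewrite mulr_ge0// ltW.
exists (2 * (c * 2 `^ q)); first by apply: mulr_ge0 => //; apply: mulr_ge0 => //; exact: powR_ge0.
move=> k r h psi dk /andP[r2 r1] bh h0 bpsi psi0.
have r01 : 0 < r < 1 by rewrite r1 andbT (lt_le_trans _ r2).
(* The radius is [r * x] for [h] but [x] for [psi]: both arise from the level [y] by averaging with
   the same ratio [s]. *)
pose m (x : R) := c * circ_int (fun t => (poisson_int (r * x) h t ^+ 2 + poisson_int x psi t ^+ 2) `^ (q / 2)).
have step (x : R) : 0 < x < 1 ->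
  (1 - x) * circ_int (fun phi => (1 - x) *
     (poisson_int x psi phi `^ (q - 2) * kern_int k (r * x) h phi ^+ 2)) <=
   m ((1 + x) / 2) - m x.
  move=> x01; have [s [y [<- [s01 y01 sE y2 sx]]]] := level_ratio x01.
  have y01' : 0 <= y < 1 by case/andP: y01 => /ltW -> ->.
  have s01' : 0 <= s < 1 by case/andP: s01 => /ltW -> ->.
  have ry01 := mulr_lt1_lt1 r01 y01.
  have bu := bmeas_poisson_int ry01 bh; have bz := bmeas_poisson_int y01' bpsi.
  have ksE phi : kern_int k s (poisson_int (r * y) h) phi = r * y * kern_int k (r * x) h phi.
    by rewrite kern_poisson_int// [s * (r * y)]mulrCA sE.
  have puE phi : poisson_int s (poisson_int (r * y) h) phi = poisson_int (r * x) h phi.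
    by rewrite poisson_poisson_int// [s * (r * y)]mulrCA sE.
  have pzE phi : poisson_int s (poisson_int y psi) phi = poisson_int x psi phi.
    by rewrite poisson_poisson_int// sE.
  have bI : bmeas (fun phi : R => poisson_int x psi phi `^ (q - 2) * kern_int k (r * x) h phi ^+ 2).
    have x01' : 0 <= x < 1 by case/andP: x01 => /ltW -> ->.
    apply: bmeasM; last by apply: bmeasX; apply: bmeas_kern_int => //; exact: mulr_lt1_lt1.
    apply: bmeas_powR; [by rewrite subr_ge0|by move=> t; exact: poisson_int_ge0|].
    exact: bmeas_poisson_int.
  have := stepq _ _ _ _ dk s01 bu bz (fun t => poisson_int_ge0 t ry01 h0)
    (fun t => poisson_int_ge0 t y01' psi0).
  rewrite [X in X * _](_ : _ = circ_int (fun phi => (r * y) ^+ 2 *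
    (poisson_int x psi phi `^ (q - 2) * kern_int k (r * x) h phi ^+ 2))); last first.
    by apply: eq_circ_int => phi; rewrite ksE pzE exprMn mulrCA.
  rewrite [X in _ * (_ - X)](_ : _ = circ_int (fun phi =>
    (poisson_int (r * x) h phi ^+ 2 + poisson_int x psi phi ^+ 2) `^ (q / 2))); last first.
    by apply: eq_circ_int => phi; rewrite puE pzE.
  rewrite (circ_intZ _ bI) (circ_intZ _ bI) [(1 - x) * ((1 - x) * _)]mulrA -[(1 - x) * (1 - x)]expr2 /m -mulrBr.
  set K := circ_int _; set D := _ - _ => H.
  have K0 : 0 <= K.
    by apply: circ_int_ge0 => t; rewrite mulr_ge0 ?powR_ge0// sqr_ge0.
  rewrite cE -[64 * C8 * D]mulrA.
  apply: (@le_trans _ _ (64 * ((r * y) ^+ 2 * K * (1 - s ^+ 2) ^+ 2))).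
    by apply: absorb_sqr.
  by rewrite ler_wpM2l.
have gge0 (x : R) : 0 < x < 1 -> 0 <= circ_int (fun phi => (1 - x) *
     (poisson_int x psi phi `^ (q - 2) * kern_int k (r * x) h phi ^+ 2)).
  move=> /andP[x0 x1]; apply: circ_int_ge0 => t.
  by rewrite mulr_ge0 ?subr_ge0 ?(ltW x1)// mulr_ge0 ?powR_ge0// sqr_ge0.
rewrite -(mulrA 2) -(mulrA c).
apply: (@dyadic_shells R (fun x => circ_int (fun phi => (1 - x) *
     (poisson_int x psi phi `^ (q - 2) * kern_int k (r * x) h phi ^+ 2))) m).
- pose F := fun z : R * R => (1 - clip z.1) * (poisson_int (clip z.1) psi z.2 `^ (q - 2) *
    kern_int k (r * clip z.1) h z.2 ^+ 2).
  apply: (eq_measurable_fun (fun x => circ_int (fun phi => F (x, phi)))).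
    by move=> x; rewrite inE/= in_itv/= => x01; rewrite /F/= clipE.
  apply: measurable_funTS; apply: measurable_circ_int_ge0.
  + apply: measurable_funM.
      by apply: measurable_funB => //; exact: (measurableT_comp measurable_clip).
    apply: measurable_funM.
      apply: (measurableT_comp (measurable_powR (q - 2))).
      apply: measurable_poisson_int => //; first by move=> z; exact: clip01.
      exact: (measurableT_comp measurable_clip).
    apply: measurable_funX.
    have [rp r1'] := andP r01.
    apply: (@bmeas_kern_int2 k h r _ _ (fun z : R * R => r * clip z.1) snd dk bh _ _ _ _).1 => //.
    * by rewrite ltW.
    * move=> z; have /andP[c0' c1'] := clip01 z.1.
      by rewrite mulr_ge0 ?(ltW rp)//= ler_piMr ?ltW.
    * by apply: measurable_funM => //; exact: (measurableT_comp measurable_clip).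
  + move=> z; have /andP[_ c1] := clip01 z.1.
    by rewrite mulr_ge0 ?subr_ge0 ?(ltW c1)// mulr_ge0 ?powR_ge0// sqr_ge0.
- exact: gge0.
- move=> x x01; have x01' : 0 <= x < 1 by case/andP: x01 => /ltW -> ->.
  have rx01 := mulr_lt1_lt1 r01 x01.
  rewrite mulr_ge0//=; last by apply: circ_int_ge0 => t; exact: powR_ge0.
  rewrite ler_wpM2l//.
  have b1 := bmeas_poisson_int rx01 bh; have b2 := bmeas_poisson_int x01' bpsi.
  have u0 t : 0 <= poisson_int (r * x) h t by exact: poisson_int_ge0.
  have z0 t : 0 <= poisson_int x psi t by exact: poisson_int_ge0.
  have b1q : bmeas (fun t : R => poisson_int (r * x) h t `^ q) by apply: bmeas_powR => //; exact: ltW.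
  have b2q : bmeas (fun t : R => poisson_int x psi t `^ q) by apply: bmeas_powR => //; exact: ltW.
  apply: (@le_trans _ _ (circ_int (fun t =>
     2 `^ q * (poisson_int (r * x) h t `^ q + poisson_int x psi t `^ q)))).
    apply: (le_circ_int (bmeas_sum_sqr_powR q20 b1 b2) (bmeasZ _ (bmeasD b1q b2q))).
    by move=> t; exact: sum_sqr_powR_le.
  rewrite (circ_intZ _ (bmeasD b1q b2q)) (circ_intD b1q b2q).
  apply: ler_wpM2l; first exact: powR_ge0.
  by apply: lerD; exact: circ_int_poisson_int_powR.
(* Monotonicity is again the one-step estimate, now with ratio [x / y]: its left-hand side is
   nonnegative. *)
- move=> x y x0 xy y1.
  have [->//|xny] := eqVneq x y.
  have x1 : x < 1 by exact: le_lt_trans y1.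
  have y0 : 0 < y by exact: lt_le_trans xy.
  have y01 : 0 < y < 1 by rewrite y0.
  have s01 : 0 < x / y < 1.
    by rewrite divr_gt0//= ltr_pdivrMr// mul1r lt_neqAle xny.
  have y01' : 0 <= y < 1 by case/andP: y01 => /ltW -> ->.
  have s01' : 0 <= x / y < 1 by case/andP: s01 => /ltW -> ->.
  have ry01 := mulr_lt1_lt1 r01 y01.
  have bu := bmeas_poisson_int ry01 bh; have bz := bmeas_poisson_int y01' bpsi.
  have sE : x / y * y = x by rewrite divfK// gt_eqF.
  have puE phi : poisson_int (x / y) (poisson_int (r * y) h) phi = poisson_int (r * x) h phi.
    by rewrite poisson_poisson_int// [x / y * (r * y)]mulrCA sE.
  have pzE phi : poisson_int (x / y) (poisson_int y psi) phi = poisson_int x psi phi.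
    by rewrite poisson_poisson_int// sE.
  have := stepq _ _ _ _ dk s01 bu bz (fun t => poisson_int_ge0 t ry01 h0)
    (fun t => poisson_int_ge0 t y01' psi0).
  rewrite [X in _ * (_ - X)](_ : _ = circ_int (fun phi =>
    (poisson_int (r * x) h phi ^+ 2 + poisson_int x psi phi ^+ 2) `^ (q / 2))); last first.
    by apply: eq_circ_int => phi; rewrite puE pzE.
  move=> H; rewrite /m; apply: (ler_wpM2l c0).
  have L0 : 0 <= circ_int (fun phi => poisson_int (x / y) (poisson_int y psi) phi `^ (q - 2) *
     kern_int k (x / y) (poisson_int (r * y) h) phi ^+ 2) * (1 - (x / y) ^+ 2) ^+ 2.
    rewrite mulr_ge0 ?sqr_ge0//; apply: circ_int_ge0 => t.
    by rewrite mulr_ge0 ?powR_ge0// sqr_ge0.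
  by move: (le_trans L0 H); rewrite pmulr_rge0 ?subr_ge0.
- exact: step.
Qed.

End square_estimates.

(** * Weighted square functions, exponents at most 2 *)

Section square_estimate_le2.
Context {R : realType}.
Local Notation mu := (@lebesgue_measure R).
Implicit Types (h psi : R -> R) (q r : R).

(** The weight is a nonpositive power of the extension of [h] itself, so [h] has to stay above some
    [e > 0]; the constant does not depend on [e]. *)
Lemma square_est_le2 q : 1 < q <= 2 -> exists2 C : R, 0 <= C &
  forall k r h (e : R), deriv_kernel k -> 2^-1 <= r < 1 ->
  bmeas h -> 0 < e -> (forall t, e <= h t) ->
  (\int[mu]_(x in `]0%R, 1%R[) (circ_int (fun phi => (1 - x) *
     (poisson_int (r * x) h phi `^ (q - 2) * kern_int k (r * x) h phi ^+ 2)))%:E <=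
   (C * circ_int (fun t => h t `^ q))%:E)%E.
Proof.
move=> q12; have /andP[q1 q2] := q12.
have q0 : 0 < q by rewrite (lt_trans _ q1).
have q10 : 0 < q - 1 by rewrite subr_gt0.
have [C8 [C80 stepq]] : exists C8 : R, 0 < C8 /\ forall k s u (e : R), deriv_kernel k ->
    0 < s < 1 -> bmeas u -> 0 < e -> (forall t, e <= u t) ->
    circ_int (fun phi => poisson_int s u phi `^ (q - 2) * kern_int k s u phi ^+ 2)
      * (1 - s ^+ 2) ^+ 2 <=
    C8 * (circ_int (fun t => u t `^ q) -
      circ_int (fun phi => poisson_int s u phi `^ q)).
  exists (32 * pi ^+ 2 / (q * (q - 1))); split.
    apply: divr_gt0; last exact: mulr_gt0.
    by apply: mulr_gt0; [rewrite ltr0n|rewrite exprn_gt0// pi_gt0].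
  by move=> k s u e dk s01 bu e0 eu; exact: (step_le2 dk q12 s01 bu e0 eu).
have [c [c0 cE]] : exists c : R, 0 <= c /\ c = 64 * C8.
  by exists (64 * C8); rewrite mulr_ge0// ltW.
exists (2 * c); first by apply: mulr_ge0.
move=> k r h e dk /andP[r2 r1] bh e0 eh.
have h0 t : 0 <= h t by rewrite (le_trans (ltW e0)).
have r01 : 0 < r < 1 by rewrite r1 andbT (lt_le_trans _ r2).
pose m (x : R) := c * circ_int (fun t => poisson_int (r * x) h t `^ q).
have step (x : R) : 0 < x < 1 ->
  (1 - x) * circ_int (fun phi => (1 - x) *
     (poisson_int (r * x) h phi `^ (q - 2) * kern_int k (r * x) h phi ^+ 2)) <=
   m ((1 + x) / 2) - m x.
  move=> x01; have [s [y [<- [s01 y01 sE y2 sx]]]] := level_ratio x01.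
  have s01' : 0 <= s < 1 by case/andP: s01 => /ltW -> ->.
  have ry01 := mulr_lt1_lt1 r01 y01; have rx01 := mulr_lt1_lt1 r01 x01.
  have bu := bmeas_poisson_int ry01 bh.
  have eu t : e <= poisson_int (r * y) h t := poisson_int_gt0 t ry01 bh e0 eh.
  have ex t : e <= poisson_int (r * x) h t := poisson_int_gt0 t rx01 bh e0 eh.
  have ksE phi : kern_int k s (poisson_int (r * y) h) phi = r * y * kern_int k (r * x) h phi.
    by rewrite kern_poisson_int// [s * (r * y)]mulrCA sE.
  have puE phi : poisson_int s (poisson_int (r * y) h) phi = poisson_int (r * x) h phi.
    by rewrite poisson_poisson_int// [s * (r * y)]mulrCA sE.
  have bI : bmeas (fun phi : R => poisson_int (r * x) h phi `^ (q - 2) * kern_int k (r * x) h phi ^+ 2).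
    apply: bmeasM; last by apply: bmeasX; apply: bmeas_kern_int.
    exact: (bmeas_powR_pos _ e0 ex (bmeas_poisson_int rx01 bh)).
  have := stepq _ _ _ _ dk s01 bu e0 eu.
  rewrite [X in X * _](_ : _ = circ_int (fun phi => (r * y) ^+ 2 *
    (poisson_int (r * x) h phi `^ (q - 2) * kern_int k (r * x) h phi ^+ 2))); last first.
    by apply: eq_circ_int => phi; rewrite ksE puE exprMn mulrCA.
  rewrite [X in _ * (_ - X)](_ : _ = circ_int (fun phi => poisson_int (r * x) h phi `^ q)); last first.
    by apply: eq_circ_int => phi; rewrite puE.
  rewrite (circ_intZ _ bI) (circ_intZ _ bI) [(1 - x) * ((1 - x) * _)]mulrA
    -[(1 - x) * (1 - x)]expr2 /m -mulrBr.
  set K := circ_int _; set D := _ - _ => H.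
  have K0 : 0 <= K.
    by apply: circ_int_ge0 => t; rewrite mulr_ge0 ?powR_ge0// sqr_ge0.
  rewrite cE -[64 * C8 * D]mulrA.
  apply: (@le_trans _ _ (64 * ((r * y) ^+ 2 * K * (1 - s ^+ 2) ^+ 2))).
    by apply: absorb_sqr.
  by rewrite ler_wpM2l.
have gge0 (x : R) : 0 < x < 1 -> 0 <= circ_int (fun phi => (1 - x) *
     (poisson_int (r * x) h phi `^ (q - 2) * kern_int k (r * x) h phi ^+ 2)).
  move=> /andP[x0 x1]; apply: circ_int_ge0 => t.
  by rewrite mulr_ge0 ?subr_ge0 ?(ltW x1)// mulr_ge0 ?powR_ge0// sqr_ge0.
rewrite -(mulrA 2).
apply: (@dyadic_shells R (fun x => circ_int (fun phi => (1 - x) *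
     (poisson_int (r * x) h phi `^ (q - 2) * kern_int k (r * x) h phi ^+ 2))) m).
- pose F := fun z : R * R => (1 - clip z.1) * (poisson_int (r * clip z.1) h z.2 `^ (q - 2) *
    kern_int k (r * clip z.1) h z.2 ^+ 2).
  apply: (eq_measurable_fun (fun x => circ_int (fun phi => F (x, phi)))).
    by move=> x; rewrite inE/= in_itv/= => x01; rewrite /F/= clipE.
  have [rp r1'] := andP r01.
  have mrc : measurable_fun setT (fun z : R * R => r * clip z.1).
    by apply: measurable_funM => //; exact: (measurableT_comp measurable_clip).
  have rc (z : R * R) : 0 <= r * clip z.1 <= r.
    have /andP[c0' c1'] := clip01 z.1.
    by rewrite mulr_ge0 ?(ltW rp)//= ler_piMr ?ltW.
  apply: measurable_funTS; apply: measurable_circ_int_ge0.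
  + apply: measurable_funM.
      by apply: measurable_funB => //; exact: (measurableT_comp measurable_clip).
    apply: measurable_funM.
      apply: (measurableT_comp (measurable_powR (q - 2))).
      apply: measurable_poisson_int => //.
      by move=> z; have /andP[-> zr] := rc z; rewrite (le_lt_trans zr).
    apply: measurable_funX.
    apply: (@bmeas_kern_int2 _ k h r _ _ (fun z : R * R => r * clip z.1) snd dk bh _ _ _ _).1 => //.
    by rewrite ltW.
  + move=> z; have /andP[_ c1] := clip01 z.1.
    by rewrite mulr_ge0 ?subr_ge0 ?(ltW c1)// mulr_ge0 ?powR_ge0// sqr_ge0.
- exact: gge0.
- move=> x x01; have rx01 := mulr_lt1_lt1 r01 x01.
  apply/andP; split.
    by apply: mulr_ge0; [exact: c0|apply: circ_int_ge0 => t; exact: powR_ge0].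
  by apply: (ler_wpM2l c0); apply: circ_int_poisson_int_powR => //; exact: ltW.
- move=> x y x0 xy y1.
  have [->//|xny] := eqVneq x y.
  have x1 : x < 1 by exact: le_lt_trans y1.
  have y0 : 0 < y by exact: lt_le_trans xy.
  have y01 : 0 < y < 1 by rewrite y0.
  have s01 : 0 < x / y < 1.
    by rewrite divr_gt0//= ltr_pdivrMr// mul1r lt_neqAle xny.
  have s01' : 0 <= x / y < 1 by case/andP: s01 => /ltW -> ->.
  have ry01 := mulr_lt1_lt1 r01 y01.
  have bu := bmeas_poisson_int ry01 bh.
  have eu t : e <= poisson_int (r * y) h t := poisson_int_gt0 t ry01 bh e0 eh.
  have sE : x / y * y = x by rewrite divfK// gt_eqF.
  have puE phi : poisson_int (x / y) (poisson_int (r * y) h) phi = poisson_int (r * x) h phi.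
    by rewrite poisson_poisson_int// [x / y * (r * y)]mulrCA sE.
  have := stepq _ _ _ _ dk s01 bu e0 eu.
  rewrite [X in _ * (_ - X)](_ : _ = circ_int (fun phi => poisson_int (r * x) h phi `^ q)); last first.
    by apply: eq_circ_int => phi; rewrite puE.
  move=> H; rewrite /m; apply: (ler_wpM2l c0).
  have L0 : 0 <= circ_int (fun phi => poisson_int (x / y) (poisson_int (r * y) h) phi `^ (q - 2) *
     kern_int k (x / y) (poisson_int (r * y) h) phi ^+ 2) * (1 - (x / y) ^+ 2) ^+ 2.
    rewrite mulr_ge0 ?sqr_ge0//; apply: circ_int_ge0 => t.
    by rewrite mulr_ge0 ?powR_ge0// sqr_ge0.
  by move: (le_trans L0 H); rewrite pmulr_rge0 ?subr_ge0.
- exact: step.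
Qed.

End square_estimate_le2.

(** * Tents over the polar rectangle *)

Lemma areaX (R : realType) (A B : set R) : measurable A -> measurable B ->
  area R (A `*` B) = (lebesgue_measure A * lebesgue_measure B)%E.
Proof. by move=> mA mB; rewrite /area/= product_measure1E. Qed.

Lemma area_sigma_finite (R : realType) : sigma_finite setT (area R).
Proof.
have /sigma_finiteP[F [TF ndF Foo]] := sigma_finiteT (@lebesgue_measure R).
exists (fun n => F n `*` F n).
 rewrite -setXTT TF predeqE => -[x y]; split.
    move=> [/= [n _ Fnx] [k _ Gky]]; exists (maxn n k) => //; split.
    - by move: x Fnx; exact/subsetPset/ndF/leq_maxl.
    - by move: y Gky; exact/subsetPset/ndF/leq_maxr.
  by move=> [n _ []/= ? ?]; split; exists n.
move=> k; have [? ?] := Foo k. 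
split; first exact: measurableX.
by rewrite areaX// lte_mul_pinfty// ge0_fin_numE.
Qed.

(* [area] itself is only packed as a measure; Tonelli needs sigma-finiteness. *)
Definition area_raw (R : realType) : set (measurableTypeR R * measurableTypeR R)%type -> \bar R := (@product_measure1 _ _ _ _ R (@lebesgue_measure R) (@lebesgue_measure R))%E.
HB.instance Definition _ (R : realType) := Measure.copy (@area_raw R) (area R).
HB.instance Definition _ (R : realType) := Measure_isSigmaFinite.Build _ _ _ (@area_raw R) (area_sigma_finite R).

Section tent_space.
Context {R : realType}.
Local Notation mu := (@lebesgue_measure R).
Local Notation J := (`[0, 2 * pi]%classic : set R).
Local Notation I01 := (`]0, 1[%classic : set R).

Definition polar_rect : set (R * R) := [set u | 0 < u.1 < 1 /\ 0 <= u.2 <= 2 * pi].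

Lemma polar_rectE : polar_rect = I01 `*` J.
Proof. by apply/seteqP; split => u /=; rewrite !in_itv/=. Qed.

Lemma measurable_polar_rect : measurable polar_rect.
Proof. by rewrite polar_rectE; exact: measurableX. Qed.

Lemma area_polar_rect : area R polar_rect = (2 * pi)%:E.
Proof.
rewrite polar_rectE areaX//.
by rewrite [X in (_ * X)%E](measure_circ (R := R)) lebesgue_measure_itv/= lte_fin ltr01 oppr0 adde0 mul1e.
Qed.

Lemma area_tonelli (f : R * R -> \bar R) : measurable_fun setT f ->
  (forall u, 0 <= f u)%E ->
  (\int[area R]_u f u = \int[mu]_x \int[mu]_y f (x, y))%E.
Proof. by move=> mf f0; rewrite /area (fubini_tonelli1 (m1 := mu) (m2 := mu)). Qed.

Lemma indic_polar_rect (u : R * R) :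
  \1_polar_rect u = \1_I01 u.1 * \1_J u.2 :> R.
Proof. by rewrite !indicE polar_rectE in_setX; case: (_ \in _); case: (_ \in _);
  rewrite ?mulr1 ?mulr0. Qed.

Lemma area_rect_integral (F : R * R -> R) : measurable_fun setT F ->
  (forall u, 0 <= F u) -> (forall x, bmeas (fun y => F (x, y))) ->
  (\int[area R]_u (\1_polar_rect u * F u)%:E =
   \int[mu]_(x in `]0%R, 1%R[) (circ_int (fun y => F (x, y)))%:E)%E.
Proof.
move=> mF F0 bF; rewrite area_tonelli.
- rewrite [RHS]integral_mkcond; apply: eq_integral => x _; rewrite epatch_indic.
  rewrite (circ_intE (bF x)) [in RHS]integral_mkcond -ge0_integralZr//; last 3 first.
    apply/(measurable_restrictT _ (measurable_itv _)).
    by apply/measurable_EFinP; apply: measurable_funTS; exact: (bF x).1.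
    by move=> y _; apply: erestrict_ge0 => t _; rewrite lee_fin.
    by rewrite lee_fin.
  apply: eq_integral => y _; rewrite epatch_indic -!EFinM indic_polar_rect/=.
  by congr (_%:E); ring.
- apply/measurable_EFinP; apply: measurable_funM => //.
  exact: measurable_indic measurable_polar_rect.
- by move=> u; rewrite lee_fin mulr_ge0.
Qed.

(** Indicator of the cone with vertex [t], without the bounds on the radius: these are supplied by
    densities vanishing outside [polar_rect]. Angles are not taken modulo [2 * pi]. *)
Definition gam (t : R) (u : R * R) : R := if `|t - u.2| < (1 - u.1) / 2 then 1 else 0.

Lemma gam_ge0 t u : 0 <= gam t u.
Proof. by rewrite /gam; case: ifP. Qed.

Lemma gam_le1 t u : gam t u <= 1.
Proof. by rewrite /gam; case: ifP. Qed.

Lemma measurable_gam : measurable_fun setT (fun z : (R * R) * R => gam z.2 z.1).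
Proof.
have -> : (fun z : (R * R) * R => gam z.2 z.1) =
  \1_[set z : (R * R) * R | `|z.2 - z.1.2| < (1 - z.1.1) / 2].
  by apply/funext => z; rewrite indicE /gam; case: ifPn => [?|/negP ?];
    [rewrite mem_set|rewrite memNset].
apply: measurable_indic.
have mf : measurable_fun setT (fun z : (R * R) * R => `|z.2 - z.1.2| - (1 - z.1.1) / 2).
  apply: measurable_funB; last first.
    apply: measurable_funM => //; apply: measurable_funB => //.
    exact: (measurableT_comp (f := fst)).
  apply: measurableT_comp => //.
  apply: measurable_funB => //.
  exact: (measurableT_comp (f := snd)).
rewrite (_ : [set z | _] = setT `&` (fun z : (R * R) * R =>
    `|z.2 - z.1.2| - (1 - z.1.1) / 2) @^-1` `]-oo, 0[); last first.
  by apply/seteqP; split => z /=; rewrite in_itv/= subr_lt0 => //; case.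
exact: mf.
Qed.

Lemma bmeas_gam2 t : bmeas (fun u : R * R => gam t u).
Proof.
split.
  apply: (@measurableT_comp _ _ _ _ _ _ (fun z : (R * R) * R => gam z.2 z.1) _
    (fun u : R * R => (u, t)) measurable_gam).
  by apply: measurable_fun_pair => //; exact: measurable_cst.
by exists 1 => u; rewrite ger0_norm ?gam_ge0// gam_le1.
Qed.

Lemma bmeas_gam1 u : bmeas (fun t : R => gam t u).
Proof.
split.
  exact: (@measurableT_comp _ _ _ _ _ _ (fun z : (R * R) * R => gam z.2 z.1) _
    (fun t : R => (u, t)) measurable_gam (measurable_prodmk1 _)).
by exists 1 => t; rewrite ger0_norm ?gam_ge0// gam_le1.
Qed.

Lemma itv_circ_int_ge (a b : R) (f : R -> R) : bmeas f -> (forall t, 0 <= f t) ->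
  0 <= a -> a <= b -> b <= 2 * pi -> (forall t, a < t < b -> 1 <= f t) ->
  b - a <= circ_int f.
Proof.
move=> bf f0 a0 ab b2 f1; rewrite -lee_fin (circ_intE bf).
have -> : (b - a)%:E = (\int[mu]_(t in `]a, b[) (1 : R)%:E)%E.
  rewrite integral_cst//= mul1e lebesgue_measure_itv/= lte_fin.
  move: ab; rewrite le_eqVlt => /predU1P[->|ab]; first by rewrite ltxx subrr.
  by rewrite ab.
have sub : (`]a, b[%classic : set R) `<=` J.
  by move=> t /=; rewrite !in_itv/= => /andP[ta tb]; rewrite (le_trans a0 (ltW ta)) (le_trans (ltW tb)).
have mfE : measurable_fun J (EFin \o f).
  by apply/measurable_EFinP; apply: measurable_funTS; exact: bf.1.
apply: (@le_trans _ _ (\int[mu]_(t in `]a, b[) (f t)%:E)%E).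
  apply: ge0_le_integral => //.
  exact: measurable_funS mfE.
apply: ge0_subset_integral => //.
by move=> t _; rewrite lee_fin.
Qed.

(** The vertices that see [u] form an interval of length [1 - u.1] around [u.2], which may stick out
    of [[0, 2 * pi]]. One of its two halves always stays inside, whence half the length. *)
Lemma gam_mass (u : R * R) : polar_rect u -> (1 - u.1) / 2 <= circ_int (fun t => gam t u).
Proof.
move=> [/andP[u0 u1] /andP[v0 v1]].
have bg := bmeas_gam1 u; have g0 t := gam_ge0 t u.
set l := (1 - u.1) / 2; have l0 : 0 <= l by rewrite /l; lra.
have pi2 : 2 <= pi :> R := pi_ge2 R.
have l1 : l <= 1 by rewrite /l; lra.
have g1 t : `|t - u.2| < l -> 1 <= gam t u by rewrite /gam => ->.
have [v|v] := leP u.2 pi.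
  have -> : l = (u.2 + l) - u.2 by ring.
  apply: itv_circ_int_ge => //; [by rewrite lerDl|lra|].
  by move=> t /andP[t1 t2]; apply: g1; rewrite gtr0_norm; lra.
have -> : l = u.2 - (u.2 - l) by ring.
apply: itv_circ_int_ge => //; [lra|by rewrite gerBl|].
by move=> t /andP[t1 t2]; apply: g1; rewrite ltr0_norm; lra.
Qed.

Lemma norm_sin_le (x : R) : `|sin x| <= `|x|.
Proof.
wlog x0 : x / 0 < x.
  move=> H; have [x0|x0] := ltP 0 x; first exact: H.
  move: x0; rewrite le_eqVlt => /predU1P[->|x0]; first by rewrite sin0 normr0.
  by rewrite -normrN -sinN -[`|x|]normrN; apply: H; rewrite oppr_gt0.
have [c _] := @MVT R sin cos 0 x x0 (fun y _ => is_derive_sin y)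
  (continuous_subspaceT (@continuous_sin R)).
rewrite sin0 !subr0 => ->; rewrite normrM ler_piMl//.
by rewrite ler_norml cos_geN1 cos_le1.
Qed.

Lemma one_sub_cos_le (x : R) : 2 * (1 - cos x) <= x ^+ 2.
Proof.
have -> : cos x = 1 - 2 * sin (x / 2) ^+ 2.
  have {1}-> : x = x / 2 + x / 2 by field.
  by rewrite cosD; have := cos2Dsin2 (x / 2); nra.
have H := norm_sin_le (x / 2).
have : sin (x / 2) ^+ 2 <= (x / 2) ^+ 2.
  rewrite -(real_normK (num_real (sin _))) -(real_normK (num_real (x / 2))).
  by rewrite lerXn2r ?nnegrE.
lra.
Qed.

Lemma gam_le_poisson t (u : R * R) : polar_rect u ->
  gam t u <= 5 / 4 * ((1 - u.1) * poisson u.1 (u.2 - t)).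
Proof.
move=> [/andP[u0 u1] _].
have u01 : 0 <= u.1 < 1 by rewrite ltW.
have d0 := poisson_den_gt0 (u.2 - t) u01.
have P0 := poisson_ge0 (u.2 - t) u01.
rewrite /gam; case: ifPn => H; last first.
  by apply: mulr_ge0 => //; apply: mulr_ge0 => //; rewrite subr_ge0 ltW.
(* The denominator is [(1 - u.1) ^+ 2] plus [2 * u.1 * (1 - cos (u.2 - t))]; inside the cone the
   second term is at most [((1 - u.1) / 2) ^+ 2]. *)
have : poisson_den u.1 (u.2 - t) <= 5 / 4 * (1 - u.1) ^+ 2.
  have : (u.2 - t) ^+ 2 <= ((1 - u.1) / 2) ^+ 2.
    have l0 : 0 <= (1 - u.1) / 2 by lra.
    by rewrite -(real_normK (num_real (u.2 - t))) distrC lerXn2r ?nnegrE// ltW.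
  have := one_sub_cos_le (u.2 - t); rewrite /poisson_den; move: (u.2 - t) => x H1 H2.
  have : u.1 * (2 * (1 - cos x)) <= ((1 - u.1) / 2) ^+ 2.
    rewrite -[X in _ <= X]mul1r; apply: ler_pM; [exact: ltW| |exact: ltW|exact: le_trans H2].
    by rewrite mulr_ge0// subr_ge0 cos_le1.
  lra.
rewrite /poisson !mulrA ler_pdivlMr// mul1r => /le_trans; apply.
have : 0 <= (1 - u.1) ^+ 2 * u.1 by rewrite mulr_ge0 ?sqr_ge0// ltW.
lra.
Qed.

(** Tangent line at [y0] of the power [- ka]. By homogeneity it follows from the tangent line at 1
    of the power [ka + 1], evaluated at [y0 / y]. *)
Lemma powRN_tangent (ka y y0 : R) : 0 <= ka -> 0 < y -> 0 < y0 ->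
  y0 `^ (- ka) * (1 + ka) - ka * y0 `^ (- ka - 1) * y <= y `^ (- ka).
Proof.
move=> ka0 yp y0p; have al : 1 <= ka + 1 by rewrite lerDr.
have v0 : 0 <= y0 / y by rewrite divr_ge0// ltW.
have := powR_tangent al (ler01 : 0 <= (1 : R)) v0; rewrite !powR1 mulr1.
rewrite powRM ?invr_ge0 ?(ltW y0p) ?(ltW yp)// -[y^-1]powR_inv1 ?(ltW yp)// -powRrM mulN1r.
move=> H.
have w0 : 0 < y * y0 `^ (- ka - 1) by rewrite mulr_gt0 ?powR_gt0.
move: H; rewrite -(ler_pM2l w0).
have -> : y * y0 `^ (- ka - 1) * (y0 `^ (ka + 1) * y `^ (- (ka + 1))) = y `^ (- ka).
  have E1 : y0 `^ (- ka - 1) * y0 `^ (ka + 1) = 1.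
    rewrite -powRD; last by apply/implyP => _; rewrite gt_eqF.
    by rewrite -[- ka - 1]opprD addNr powRr0.
  have E2 : y * y `^ (- (ka + 1)) = y `^ (- ka).
    rewrite -{1}(powRr1 (ltW yp)) -powRD; last by apply/implyP => _; rewrite gt_eqF.
    by congr (_ `^ _); ring.
  transitivity ((y0 `^ (- ka - 1) * y0 `^ (ka + 1)) * (y * y `^ (- (ka + 1)))); first by ring.
  by rewrite E1 E2 mul1r.
have E3 : y0 `^ (- ka) = y0 * y0 `^ (- ka - 1).
  rewrite -{2}(powRr1 (ltW y0p)) -powRD; last by apply/implyP => _; rewrite gt_eqF.
  by congr (_ `^ _); ring.
apply: le_trans; rewrite E3 powR_inv1 ?(ltW yp)//.
have -> : y * y0 `^ (- ka - 1) * (1 + (ka + 1) * (y0 / y - 1)) =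
  y0 `^ (- ka - 1) * (y * (1 + (ka + 1) * (y0 / y - 1))) by ring.
have -> : y * (1 + (ka + 1) * (y0 / y - 1)) = (ka + 1) * y0 - ka * y by field; rewrite gt_eqF.
by rewrite le_eqVlt; apply/orP; left; apply/eqP; ring.
Qed.

End tent_space.

(** * The area function of a bounded density *)

Section area_function.
Context {R : realType}.
Local Notation mu := (@lebesgue_measure R).
Local Notation J := (`[0, 2 * pi]%classic : set R).
Variables (D : R * R -> R) (M : R).
Hypotheses (mD : measurable_fun setT D) (D0 : forall u, 0 <= D u).
Hypotheses (DM : forall u, D u <= M) (Dout : forall u, ~ polar_rect u -> D u = 0).

Definition tent_int (t : R) : \bar R :=
  (\int[area R]_u (gam t u * D u ^+ 2)%:E)%E.

Lemma measurable_gamD : measurable_fun setT (fun z : (R * R) * R => gam z.2 z.1 * D z.1 ^+ 2).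
Proof.
apply: measurable_funM; first exact: measurable_gam.
by apply: measurable_funX; exact: (measurableT_comp mD).
Qed.

Lemma measurable_gamD1 t : measurable_fun setT (fun u => gam t u * D u ^+ 2).
Proof.
by apply: measurable_funM; [exact: (bmeas_gam2 t).1|exact: measurable_funX].
Qed.

Lemma tent_int_le t : (tent_int t <= (M ^+ 2 * (2 * pi))%:E)%E.
Proof.
apply: (@le_trans _ _ (\int[area R]_(u in polar_rect) (cst (M ^+ 2)%:E) u)%E); last first.
  by rewrite integral_cst//= ?area_polar_rect//; exact: measurable_polar_rect.
rewrite [leRHS]integral_mkcond; apply: ge0_le_integral => //.
- by move=> u _; rewrite lee_fin mulr_ge0 ?gam_ge0 ?sqr_ge0.
- by apply/measurable_EFinP; exact: measurable_gamD1.
- by apply/(measurable_restrictT _ measurable_polar_rect); exact: measurable_cst.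
move=> u _; rewrite patchE; case: ifPn => [_|].
  rewrite lee_fin -[leRHS]mul1r ler_pM ?gam_ge0 ?sqr_ge0 ?gam_le1//.
  by rewrite lerXn2r ?nnegrE//; exact: le_trans (D0 u) (DM u).
by rewrite notin_setE => /Dout ->; rewrite expr0n/= mulr0.
Qed.

Lemma tent_int_ge0 t : (0 <= tent_int t)%E.
Proof. by apply: integral_ge0 => u _; rewrite lee_fin mulr_ge0 ?gam_ge0 ?sqr_ge0. Qed.

Lemma tent_int_fin t : tent_int t \is a fin_num.
Proof.
rewrite ge0_fin_numE ?tent_int_ge0//; exact: le_lt_trans (tent_int_le t) (ltry _).
Qed.

Definition area_fun (t : R) : R := Num.sqrt (fine (tent_int t)).

Lemma area_fun_sqr t : (area_fun t ^+ 2)%:E = tent_int t.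
Proof. by rewrite sqr_sqrtr ?fine_ge0 ?tent_int_ge0// fineK// tent_int_fin. Qed.

Lemma area_fun_ge0 t : 0 <= area_fun t. Proof. exact: sqrtr_ge0. Qed.

Lemma measurable_tent_int : measurable_fun setT tent_int.
Proof.
apply: (@measurable_fun_fubini_tonelli_G _ _ _ _ _ (@area_raw R)
  (fun z : (R * R) * R => (gam z.2 z.1 * D z.1 ^+ 2)%:E)).
  by apply/measurable_EFinP; exact: measurable_gamD.
by move=> z; rewrite lee_fin mulr_ge0 ?gam_ge0 ?sqr_ge0.
Qed.

Lemma bmeas_area_fun : bmeas area_fun.
Proof.
split.
  rewrite (_ : area_fun = fun t => fine (tent_int t) `^ 2^-1); last first.
    by apply/funext => t; rewrite powR12_sqrt// fine_ge0// tent_int_ge0.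
  apply: (measurableT_comp (measurable_powR 2^-1)).
  apply: (@measurableT_comp _ _ _ _ _ _ (@fine R)); first exact: fine_measurable.
  exact: measurable_tent_int.
exists (Num.sqrt (M ^+ 2 * (2 * pi))) => t; rewrite ger0_norm ?area_fun_ge0// ler_wsqrtr//.
by rewrite -lee_fin fineK ?tent_int_fin// tent_int_le.
Qed.

(** Fubini between the points [u] and the vertices [t] of the cones: a weight on the circle is
    exchanged for its integral over the vertices that see [u]. *)
Lemma tent_swap (w : R -> R) : bmeas w -> (forall t, 0 <= w t) ->
  (\int[area R]_u (D u ^+ 2 * circ_int (fun t => gam t u * w t))%:E)%E =
  (circ_int (fun t => w t * area_fun t ^+ 2))%:E.
Proof.
move=> bw w0; have bwA : bmeas (fun t : R => w t * area_fun t ^+ 2).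
  by apply: bmeasM => //; apply: bmeasX; exact: bmeas_area_fun.
pose f := fun z : (R * R) * R => (gam z.2 z.1 * D z.1 ^+ 2 * (w z.2 * \1_J z.2))%:E.
have mf : measurable_fun setT f.
  apply/measurable_EFinP; apply: measurable_funM; first exact: measurable_gamD.
  apply: measurable_funM; first exact: (measurableT_comp bw.1).
  exact: (measurableT_comp (measurable_indic (measurable_itv _))).
have f0 z : (0 <= f z)%E.
  by rewrite lee_fin mulr_ge0// mulr_ge0 ?gam_ge0 ?sqr_ge0.
have E : (\int[area R]_u \int[mu]_t f (u, t) = \int[mu]_t \int[area R]_u f (u, t))%E.
  exact: (fubini_tonelli (m1 := @area_raw R) (m2 := mu)).
transitivity (\int[area R]_u \int[mu]_t f (u, t))%E.
  apply: eq_integral => u _; rewrite EFinM circ_intE; last first.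
    by apply: bmeasM => //; exact: bmeas_gam1.
  rewrite [X in (_ * X)%E]integral_mkcond -ge0_integralZl//; last 3 first.
    apply/(measurable_restrictT _ (measurable_itv _)).
    apply/measurable_EFinP; apply: measurable_funTS.
    exact: (bmeasM (bmeas_gam1 u) bw).1.
    by move=> t _; apply: erestrict_ge0 => s _; rewrite lee_fin mulr_ge0// gam_ge0.
    by rewrite lee_fin sqr_ge0.
  apply: eq_integral => t _; rewrite epatch_indic -!EFinM /f/=.
  by congr (_%:E); ring.
rewrite E (circ_intE bwA) [RHS]integral_mkcond; apply: eq_integral => t _.
rewrite epatch_indic EFinM area_fun_sqr.
transitivity (tent_int t * (w t * \1_J t)%:E)%E; last first.
  by rewrite EFinM muleA [(tent_int t * _)%E]muleC.
rewrite /tent_int -ge0_integralZr//.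
- by apply/measurable_EFinP; exact: measurable_gamD1.
- by move=> u _; rewrite lee_fin mulr_ge0 ?gam_ge0 ?sqr_ge0.
- by rewrite lee_fin mulr_ge0.
Qed.

End area_function.

(** * The bilinear estimate for exponents at most 2 *)

Section tent_estimate_le2.
Context {R : realType}.
Local Notation mu := (@lebesgue_measure R).

(** Jensen's inequality for a negative power on the set of vertices that see [u]. The mass of this
    set is bounded below by [gam_mass], and the integral of [psi] over it is bounded above by the
    Poisson extension at [u]. *)
Lemma box_jensen (u : R * R) (psi : R -> R) (d ka : R) : polar_rect u -> bmeas psi ->
  0 < d -> (forall t, d <= psi t) -> 0 <= ka ->
  (1 - u.1) * poisson_int u.1 psi u.2 `^ (- ka) <=
  2 * (5 * pi) `^ ka * circ_int (fun t => gam t u * psi t `^ (- ka)).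
Proof.
move=> Qu bpsi d0 dpsi ka0; have [/andP[u0 u1] _] := Qu.
have u01 : 0 <= u.1 < 1 by rewrite ltW.
have u1' : 0 < 1 - u.1 by rewrite subr_gt0.
set z := poisson_int u.1 psi u.2.
have z0 : 0 < z by exact: lt_le_trans (poisson_int_gt0 u.2 u01 bpsi d0 dpsi).
have psi0 t : 0 < psi t by exact: lt_le_trans (dpsi t).
have pi0 := pi_gt0 R.
have L0 : 0 < 5 * pi :> R by rewrite mulr_gt0.
(* An upper bound for the mean of [psi] over these vertices: the factor 5/4 of [gam_le_poisson]
   times [2 * pi], divided by the factor 1/2 of [gam_mass]. The tangent is taken there, so that its
   linear part contributes with the right sign. *)
pose y0 := 5 * pi * z; have y00 : 0 < y0 by rewrite mulr_gt0.
have bg := bmeas_gam1 u.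
have bgp : bmeas (fun t : R => gam t u * psi t) by exact: bmeasM.
have bpk : bmeas (fun t : R => psi t `^ (- ka)) by exact: (bmeas_powR_pos _ d0 dpsi).
have bgk : bmeas (fun t : R => gam t u * psi t `^ (- ka)) by exact: bmeasM.
have Hpsi : circ_int (fun t => gam t u * psi t) <= (1 - u.1) * (y0 / 2).
  have bP := bmeas_poisson_mul u.2 u01 bpsi.
  have -> : (1 - u.1) * (y0 / 2) = circ_int (fun t =>
      (5 / 4 * (1 - u.1)) * (poisson u.1 (u.2 - t) * psi t)).
    by rewrite (circ_intZ _ bP) circ_int_poisson_mul /y0 -/z; field.
  apply: (le_circ_int bgp (bmeasZ _ bP)) => t.
  rewrite mulrA; apply: ler_wpM2r; first exact: ltW.
  by rewrite -(mulrA (5 / 4)); exact: gam_le_poisson.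
pose a := y0 `^ (- ka) * (1 + ka); pose c := ka * y0 `^ (- ka - 1).
have a0 : 0 <= a by rewrite mulr_ge0 ?powR_ge0// addr_ge0.
have c0 : 0 <= c by rewrite mulr_ge0 ?powR_ge0.
have H1 : a * circ_int (fun t => gam t u) - c * circ_int (fun t => gam t u * psi t) <=
    circ_int (fun t => gam t u * psi t `^ (- ka)).
  rewrite -(circ_intZ _ bg) -(circ_intZ _ bgp) -(circ_intB (bmeasZ _ bg) (bmeasZ _ bgp)).
  apply: (le_circ_int (bmeasB (bmeasZ _ bg) (bmeasZ _ bgp)) bgk) => t.
  have := ler_wpM2l (gam_ge0 t u) (powRN_tangent ka0 (psi0 t) y00).
  by apply: le_trans; rewrite le_eqVlt /a /c; apply/orP; left; apply/eqP; ring.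
have H2 : y0 `^ (- ka) * ((1 - u.1) / 2) <= circ_int (fun t => gam t u * psi t `^ (- ka)).
  apply: le_trans H1.
  have E : c * y0 = ka * y0 `^ (- ka).
    rewrite /c -mulrA; congr (_ * _); rewrite mulrC -{1}(powRr1 (ltW y00)) -powRD.
      by congr (_ `^ _); ring.
    by apply/implyP => _; rewrite gt_eqF.
  have h1 := ler_wpM2l a0 (gam_mass Qu); have h2 := ler_wpM2l c0 Hpsi.
  have E2 : c * ((1 - u.1) * (y0 / 2)) = (c * y0) * ((1 - u.1) / 2) by field.
  rewrite E2 E in h2; rewrite /a in h1 *; lra.
move: H2; rewrite /y0 powRM ?(ltW L0) ?(ltW z0)// powRN => H2.
have Lk : 0 < (5 * pi : R) `^ ka by rewrite powR_gt0.
have := ler_wpM2l (ltW Lk) H2.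
have -> : (5 * pi) `^ ka * (((5 * pi) `^ ka)^-1 * z `^ (- ka) * ((1 - u.1) / 2)) =
  (1 - u.1) * z `^ (- ka) / 2 by field; rewrite gt_eqF.
by rewrite ler_pdivrMr// -mulrA [_ * 2]mulrC mulrA.
Qed.

Lemma am_gm_weight (a b w : R) : 0 < w -> a * b <= a ^+ 2 * w^-1 + w * b ^+ 2.
Proof.
move=> w0; have := sqr_ge0 (a - w * b).
have := sqr_ge0 (w * b); have := sqr_ge0 a => H1 H2 H3.
rewrite -(ler_pM2r w0) mulrDl divfK ?gt_eqF//; lra.
Qed.

Lemma conj_exp (p : R) : 1 < p -> let q := p / (p - 1) in
  [/\ 1 < q, (p - 1) * q = p & (p - 1) * (q - 2) = 2 - p].
Proof.
move=> p1 q; have p10 : 0 < p - 1 by rewrite subr_gt0.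
have E : (p - 1) * q = p by rewrite /q mulrC divfK// gt_eqF.
split => //; last by rewrite mulrBr E; ring.
by rewrite /q ltr_pdivlMr//; lra.
Qed.

(** [D] stands for the modulus of the derivative in polar coordinates. The integral runs over the
    whole plane, [D] being 0 outside [polar_rect]; [clip] keeps the kernel meaningful there. *)
Definition tent_bilinear (k : R -> R -> R) (r : R) (h : R -> R) (D : R * R -> R) : \bar R :=
  (\int[area R]_u ((1 - u.1) * D u * `|kern_int k (r * clip u.1) h u.2|)%:E)%E.

Lemma measurable_kern_clip k r h : deriv_kernel k -> 2^-1 <= r < 1 -> bmeas h ->
  measurable_fun setT (fun u : R * R => kern_int k (r * clip u.1) h u.2).
Proof.
move=> dk /andP[r2 r1] bh; have r0 : 0 <= r by rewrite (le_trans _ r2).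
apply: (@bmeas_kern_int2 _ k h r _ _ (fun u : R * R => r * clip u.1) snd dk bh _ _ _ _).1 => //.
- by rewrite r0.
- by move=> u; have /andP[c0 c1] := clip01 u.1; rewrite mulr_ge0//= ler_piMr// ltW.
- by apply: measurable_funM => //; exact: (measurableT_comp measurable_clip).
Qed.

Lemma measurable_tent_integrand k r h (D : R * R -> R) : deriv_kernel k -> 2^-1 <= r < 1 ->
  bmeas h -> measurable_fun setT D ->
  measurable_fun setT (fun u : R * R => (1 - u.1) * D u * `|kern_int k (r * clip u.1) h u.2|).
Proof.
move=> dk r12 bh mD; apply: measurable_funM.
  by apply: measurable_funM => //; exact: measurable_funB.
by apply: measurableT_comp => //; exact: measurable_kern_clip.
Qed.

Lemma measurable_gam_int (w : R -> R) : bmeas w -> (forall t, 0 <= w t) ->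
  measurable_fun setT (fun u : R * R => circ_int (fun t => gam t u * w t)).
Proof.
move=> bw w0.
apply: (measurable_circ_int_ge0 (f := fun z : (R * R) * R => gam z.2 z.1 * w z.2)).
  by apply: measurable_funM; [exact: measurable_gam|exact: (measurableT_comp bw.1)].
by move=> z; rewrite mulr_ge0// gam_ge0.
Qed.

Lemma tent_est_le2 (p : R) : 1 < p <= 2 -> exists2 C : R, 0 <= C &
  forall (k : R -> R -> R) (r : R) (h : R -> R) (D : R * R -> R) (M e : R), deriv_kernel k -> 2^-1 <= r < 1 ->
  bmeas h -> (forall t, 0 <= h t) ->
  measurable_fun setT D -> (forall u, 0 <= D u) -> (forall u, D u <= M) ->
  (forall u, ~ polar_rect u -> D u = 0) -> 0 < e ->
  (tent_bilinear k r h D <= (C * (circ_int (fun t => (area_fun D t + e) `^ p) +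
     circ_int (fun t => h t `^ (p / (p - 1)))))%:E)%E.
Proof.
move=> /andP[p1 p2]; have [] := conj_exp p1; set q := p / (p - 1) => q1 pq pq2.
have p10 : 0 < p - 1 by rewrite subr_gt0.
have q2 : 2 <= q.
  by rewrite -subr_ge0 -(pmulr_rge0 _ p10) pq2 subr_ge0.
have p0 : 0 <= p by lra.
have [C2 C20 sq] := square_est_ge2 q2.
have [C1 [C10 C1E]] : exists C1 : R, 0 <= C1 /\ C1 = 2 * (5 * pi) `^ (q - 2).
  by exists (2 * (5 * pi) `^ (q - 2)); split => //; rewrite mulr_ge0// powR_ge0.
exists (C1 + C2 + C2); first by rewrite !addr_ge0.
move=> k r h D M e dk r12 bh h0 mD D0 DM Dout e0.
have bS := bmeas_area_fun mD D0 DM Dout.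
have S0 t : 0 <= area_fun D t := area_fun_ge0 D t.
have bSe : bmeas (fun t : R => area_fun D t + e) by apply: bmeasD => //; exact: bmeas_cst.
have Se t : e <= area_fun D t + e by rewrite lerDr.
have Se0 t : 0 < area_fun D t + e by exact: lt_le_trans (Se t).
(* This exponent balances the two halves of AM-GM. As [(p - 1) * q = p], the power [q] of [psi] is
   the power [p] of the shifted area function; as [(p - 1) * (q - 2) = 2 - p], the power [-(q - 2)]
   of [psi] times the square of the area function is again at most that power [p]. *)
pose psi t := (area_fun D t + e) `^ (p - 1).
have d0 : 0 < e `^ (p - 1) by rewrite powR_gt0.
have bpsi : bmeas psi by exact: (bmeas_powR_pos _ e0 Se bSe).
have dpsi t : e `^ (p - 1) <= psi t.
  by apply: ge0_ler_powR; rewrite ?nnegrE ?(ltW p10) ?(ltW e0) ?(ltW (Se0 t)).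
have psi0 t : 0 <= psi t := powR_ge0 _ _.
pose w t := psi t `^ (- (q - 2)).
have w0 t : 0 <= w t := powR_ge0 _ _.
have bw : bmeas w by exact: (bmeas_powR_pos _ d0 dpsi bpsi).
have q20 : 0 <= q - 2 by rewrite subr_ge0.
pose z u := poisson_int (clip u.1) psi u.2.
have mz : measurable_fun setT z.
  apply: measurable_poisson_int => //; first by move=> u; exact: clip01.
  exact: (measurableT_comp measurable_clip).
have z0 u : 0 < z u by exact: lt_le_trans (poisson_int_gt0 u.2 (clip01 u.1) bpsi d0 dpsi).
pose K u := kern_int k (r * clip u.1) h u.2.
have mK : measurable_fun setT K by exact: measurable_kern_clip.
pose F u := (1 - clip u.1) * (z u `^ (q - 2) * K u ^+ 2).
have F0 u : 0 <= F u.
  have /andP[_ c1] := clip01 u.1.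
  by rewrite mulr_ge0 ?subr_ge0 ?(ltW c1)// mulr_ge0 ?powR_ge0// sqr_ge0.
have mF : measurable_fun setT F.
  apply: measurable_funM.
    by apply: measurable_funB => //; exact: (measurableT_comp measurable_clip).
  apply: measurable_funM; last exact: measurable_funX.
  exact: (measurableT_comp (measurable_powR (q - 2))).
pose G u := C1 * (D u ^+ 2 * circ_int (fun t => gam t u * w t)).
have Gc0 u : 0 <= circ_int (fun t => gam t u * w t).
  by apply: circ_int_ge0 => t; rewrite mulr_ge0// gam_ge0.
have G0 u : 0 <= D u ^+ 2 * circ_int (fun t => gam t u * w t) by rewrite mulr_ge0 ?sqr_ge0.
have mG : measurable_fun setT (fun u => D u ^+ 2 * circ_int (fun t => gam t u * w t)).
  by apply: measurable_funM; [exact: measurable_funX|exact: measurable_gam_int].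
have mQ : measurable_fun setT (fun u : R * R => \1_polar_rect u : R).
  exact: measurable_indic measurable_polar_rect.
have pw u : (1 - u.1) * D u * `|K u| <= G u + \1_polar_rect u * F u.
  have [Qu|nQ] := pselect (polar_rect u); last first.
    rewrite (Dout u nQ) mulr0 mul0r; apply: addr_ge0; first exact: (mulr_ge0 C10 (G0 u)).
    by rewrite indicE memNset// mul0r.
  have [u01 _] := Qu; have u1 : 0 <= 1 - u.1 by case/andP: u01 => _ /ltW; rewrite subr_ge0.
  rewrite indicE mem_set// mul1r /F /G /K /z clipE// -/(K u).
  have zz : z u = poisson_int u.1 psi u.2 by rewrite /z clipE.
  rewrite -zz -mulrA; have wz0 : 0 < z u `^ (q - 2) by rewrite powR_gt0.
  have := am_gm_weight (D u) `|kern_int k (r * u.1) h u.2| wz0.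
  rewrite real_normK ?num_real// => /(ler_wpM2l u1); rewrite mulrDr => /le_trans; apply.
  rewrite lerD2r mulrCA -powRN C1E; apply: le_trans.
    by apply: ler_wpM2l; [exact: sqr_ge0|rewrite zz; exact: (box_jensen Qu bpsi d0 dpsi q20)].
  by rewrite mulrCA.
have bD2 : measurable_fun setT (fun u => (G u)%:E).
  by apply/measurable_EFinP; apply: measurable_funM.
apply: (@le_trans _ _ (\int[area R]_u ((G u)%:E + (\1_polar_rect u * F u)%:E))%E).
  apply: ge0_le_integral => //.
  - move=> u _; have [Qu|nQ] := pselect (polar_rect u); last by rewrite Dout// mulr0 mul0r.
    rewrite lee_fin mulr_ge0// mulr_ge0//; have [/andP[_ u1] _] := Qu.
    by rewrite subr_ge0 ltW.
  - by apply/measurable_EFinP; exact: measurable_tent_integrand.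
  - by apply: emeasurable_funD => //; apply/measurable_EFinP; exact: measurable_funM.
  - by move=> u _; rewrite -EFinD lee_fin; exact: pw.
rewrite ge0_integralD//; last 3 first.
- by move=> u _; rewrite lee_fin mulr_ge0.
- by move=> u _; rewrite lee_fin mulr_ge0.
- by apply/measurable_EFinP; exact: measurable_funM.
have wS t : w t * area_fun D t ^+ 2 <= (area_fun D t + e) `^ p.
  have -> : w t = (area_fun D t + e) `^ (p - 2).
    rewrite /w /psi -powRrM; congr (_ `^ _); rewrite mulrN pq2; ring.
  have -> : (area_fun D t + e) `^ p = (area_fun D t + e) `^ (p - 2) * (area_fun D t + e) ^+ 2.
    rewrite -powR_mulrn ?(ltW (Se0 t))// -powRD; first by congr (_ `^ _); ring.
    by apply/implyP => _; rewrite gt_eqF.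
  by rewrite ler_wpM2l ?powR_ge0// lerXn2r ?nnegrE ?(ltW (Se0 t))// lerDl ltW.
have bSep : bmeas (fun t : R => (area_fun D t + e) `^ p) by exact: (bmeas_powR_pos _ e0 Se bSe).
have first : (\int[area R]_u (G u)%:E <= (C1 * circ_int (fun t => (area_fun D t + e) `^ p))%:E)%E.
  rewrite /G; under eq_integral do rewrite EFinM.
  rewrite ge0_integralZl//; last 2 first.
    by apply/measurable_EFinP.
    by move=> u _; rewrite lee_fin.
  rewrite EFinM (tent_swap mD D0 DM Dout bw w0) lee_wpmul2l ?lee_fin//.
  apply: (le_circ_int _ bSep wS); apply: bmeasM => //; exact: bmeasX.
have second : (\int[area R]_u (\1_polar_rect u * F u)%:E <=
   (C2 * (circ_int (fun t => h t `^ q) + circ_int (fun t => psi t `^ q)))%:E)%E.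
  rewrite (area_rect_integral mF F0); last first.
    move=> x.
    have x01 := clip01 x.
    have rx01 : 0 <= r * clip x < 1.
      by have /andP[r2 r1] := r12; apply: mul01 => //; rewrite r1 (le_trans _ r2).
    have bz : bmeas (fun y : R => z (x, y)) by exact: (bmeas_poisson_int x01 bpsi).
    have bK : bmeas (fun y : R => K (x, y)) by exact: (bmeas_kern_int dk rx01 bh).
    exact: (bmeasZ (1 - clip x) (bmeasM (bmeas_powR q20 (fun y => ltW (z0 (x, y))) bz) (bmeasX 2 bK))).
  apply: le_trans (sq k r h psi dk r12 bh h0 bpsi psi0).
  rewrite le_eqVlt; apply/orP; left; apply/eqP; apply: eq_integral => x.
  by rewrite inE/= in_itv/= => x01; rewrite /F /z /K/= clipE.
apply: le_trans (leeD first second) _; rewrite -EFinD lee_fin.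
have -> : circ_int (fun t => psi t `^ q) = circ_int (fun t => (area_fun D t + e) `^ p).
  by apply: eq_circ_int => t; rewrite /psi -powRrM pq.
have H0 : 0 <= circ_int (fun t => h t `^ q) by apply: circ_int_ge0 => t; exact: powR_ge0.
have H1 : 0 <= circ_int (fun t => (area_fun D t + e) `^ p).
  by apply: circ_int_ge0 => t; exact: powR_ge0.
have h1 := mulr_ge0 C10 H0; have h2 := mulr_ge0 C20 H0; have h3 := mulr_ge0 C20 H1.
by move: H0 H1 h1 h2 h3; move: (circ_int _) (circ_int _); clear => x y; lra.
Qed.

End tent_estimate_le2.

(** * Maximal functions *)

Section affine_substitution.
Context {R : realType}.
Local Notation mu := (@lebesgue_measure R).

Lemma measurable_affine_map (a b : R) : measurable_fun setT (fun x : R => a * x + b).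
Proof. by apply: measurable_funD => //; exact: measurable_funM. Qed.

Lemma lebesgue_measure_affine (a b : R) (A : set R) : 0 < a -> measurable A ->
  (a%:E * pushforward mu (fun x : R => (a * x + b)%R : measurableTypeR R) A)%E = mu A.
Proof.
move=> a0 mA.
have mm : @measurable_fun _ _ (measurableTypeR R) (measurableTypeR R) setT
    (fun x : R => a * x + b).
  exact: measurable_affine_map.
pose nu := measure_function_pushforward__canonical__measure_function_Measure mu mm.
transitivity (mscale (NngNum (ltW a0)) nu A); first by [].
apply/esym; apply: lebesgue_measure_unique => // _ [[c d]] _ <-.
change (mu `]c, d]%classic = (a%:E * mu ((fun x : R => (a * x + b)%R) @^-1` `]c, d]%classic))%E).
have -> : (fun x : R => a * x + b) @^-1` `]c, d]%classic = `](c - b) / a, (d - b) / a]%classic.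
  by apply/seteqP; split => x /=; rewrite !in_itv/= ltr_pdivrMr// ler_pdivlMr// ltrBlDr lerBrDr mulrC.
rewrite !lebesgue_measure_itv/= !lte_fin ltr_pM2r ?invr_gt0// ltrD2r.
case: ifPn => _; last by rewrite mule0.
by rewrite -!EFinD -EFinM; congr EFin; field; rewrite gt_eqF.
Qed.

Lemma integral_affine (a b : R) (f : R -> \bar R) : 0 < a -> measurable_fun setT f ->
  (forall x, 0 <= f x)%E ->
  (a%:E * \int[mu]_x f (a * x + b)%R)%E = (\int[mu]_x f x)%E.
Proof.
move=> a0 mf f0.
have mm : @measurable_fun _ _ (measurableTypeR R) (measurableTypeR R) setT
    (fun x : R => a * x + b).
  exact: measurable_affine_map.
rewrite -[X in (_ * X)%E](ge0_integral_pushforward mm mu measurableT mf)//.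
rewrite -(ge0_integral_mscale _ measurableT (NngNum (ltW a0)))//.
apply: eq_measure_integral => A mA _.
exact: (lebesgue_measure_affine b a0 mA).
Qed.

End affine_substitution.

(** * Interpolation from a weak type inequality *)

Section weak_to_strong.
Context {R : realType}.

Lemma two_powRN_lt1 (s : R) : 0 < s -> (2 : R) `^ (- s) < 1.
Proof.
move=> s0; rewrite powRN invf_lt1 ?powR_gt0//.
have := gt0_ltr_powR s0 (_ : 1 \is Num.nneg) (_ : (2 : R) \is Num.nneg); rewrite powR1.
by apply; rewrite ?nnegrE// ltr1n.
Qed.

Lemma geometric_powR_sum (s e : R) (n : nat) : 0 < s -> 0 < e ->
  \sum_(i < n.+1) (2 ^+ i * e) `^ s <= (1 - 2 `^ (- s))^-1 * (2 ^+ n * e) `^ s.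
Proof.
move=> s0 e0; have l1 := two_powRN_lt1 s0.
have c0 : 0 < 1 - (2 : R) `^ (- s) by rewrite subr_gt0.
elim: n => [|n IH].
  rewrite big_ord_recr big_ord0 /= add0r ler_peMl ?powR_ge0//.
  by rewrite invf_ge1// gerBl powR_ge0.
rewrite big_ord_recr/=; apply: le_trans (lerD IH (lexx _)) _.
have -> : (2 ^+ n.+1 * e) `^ s = 2 `^ s * (2 ^+ n * e) `^ s.
  by rewrite exprS -mulrA powRM// mulr_ge0 ?exprn_ge0 ?(ltW e0).
set y := (_ * e) `^ s.
have wv : 2 `^ (- s) * 2 `^ s = 1 :> R by rewrite powRN mulVf// gt_eqF// powR_gt0.
set v := 2 `^ s in wv *; set w := 2 `^ (- s) in wv l1 c0 *.
have e1 : (1 - w)^-1 * y = (1 - w)^-1 * (w * v) * y by rewrite wv mulr1.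
have e2 : (1 - w)^-1 * (v * y) = ((1 - w)^-1 * w + 1) * (v * y).
  by congr (_ * _); field; rewrite gt_eqF.
by rewrite e2 e1 le_eqVlt; apply/orP; left; apply/eqP; ring.
Qed.

(** Discrete form of the integral of the power [s - 1] over [[0, y]]: the last level below [y]
    dominates the geometric sum. *)
Lemma dyadic_powR_sum_lt (s e y : R) (n : nat) : 0 < s -> 0 < e -> 0 <= y ->
  \sum_(i < n) (2 ^+ i * e) `^ s * (2 ^+ i * e < y)%R%:R <= (1 - 2 `^ (- s))^-1 * y `^ s.
Proof.
move=> s0 e0 y0; have l1 := two_powRN_lt1 s0.
have c0 : 0 < 1 - (2 : R) `^ (- s) by rewrite subr_gt0.
elim: n => [|n IH].
  by rewrite big_ord0 mulr_ge0 ?powR_ge0// invr_ge0 ltW.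
have [ly|ny] := ltP (2 ^+ n * e) y; last first.
  by rewrite big_ord_recr/= ltNge ny mulr0 addr0.
apply: (@le_trans _ _ (\sum_(i < n.+1) (2 ^+ i * e) `^ s)).
  apply: ler_sum => i _; rewrite ler_piMr ?powR_ge0//; by case: (_ < _).
apply: le_trans (geometric_powR_sum n s0 e0) _.
apply: ler_wpM2l; first by rewrite invr_ge0 ltW.
by apply: ge0_ler_powR; rewrite ?nnegrE ?mulr_ge0 ?exprn_ge0 ?(ltW ly) ?(ltW e0) ?(ltW s0).
Qed.

(** Discrete layer cake formula: the highest level exceeded by [m] alone accounts for its power, up
    to the replacement of [2 ^+ i] by [2 ^+ i.+1]. *)
Lemma dyadic_powR_layers (q e m : R) (n : nat) : 0 < q -> 0 < e -> 0 <= m ->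
  m <= 2 ^+ n * e ->
  m `^ q <= e `^ q + \sum_(i < n) (2 ^+ i.+1 * e) `^ q * (2 ^+ i * e < m)%R%:R.
Proof.
move=> q0 e0 m0; have S0 k : 0 <= \sum_(i < k) (2 ^+ i.+1 * e) `^ q * (2 ^+ i * e < m)%R%:R.
  by apply: sumr_ge0 => i _; rewrite mulr_ge0 ?powR_ge0.
have mono (x y : R) : 0 <= x -> x <= y -> x `^ q <= y `^ q.
  move=> x0 xy; apply: ge0_ler_powR; rewrite ?nnegrE ?(ltW q0)//.
  exact: le_trans xy.
elim: n => [|n IH] mn.
  by rewrite big_ord0 addr0; apply: mono; rewrite // -[e]mul1r -(expr0 2).
have [ly|ny] := ltP (2 ^+ n * e) m; last first.
  by apply: le_trans (IH ny) _; rewrite lerD2l big_ord_recr/= lerDl mulr_ge0// powR_ge0.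
rewrite big_ord_recr/= ly mulr1 addrA; apply: le_trans (mono _ _ m0 mn) _.
by rewrite lerDr addr_ge0 ?powR_ge0 ?S0.
Qed.

Lemma bmeas_lt (f : R -> R) (c : R) : measurable_fun setT f ->
  bmeas (fun t : R => (c < f t)%R%:R : R).
Proof.
move=> mf; split; last by exists 1 => t; case: (_ < _); rewrite ?normr1 ?normr0.
have -> : (fun t : R => (c < f t)%R%:R : R) = \1_[set t | c < f t].
  by apply/funext => t; rewrite indicE; case: ltP => H; [rewrite mem_set|rewrite memNset//= ltNge H].
apply: measurable_indic; rewrite -[X in measurable X]setTI.
by apply: (measurable_fun_ltr (f := cst c) (g := f)) => //; exact: measurable_cst.
Qed.

Lemma bmeas_sum n (f : nat -> R -> R) : (forall i, bmeas (f i)) ->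
  bmeas (fun t => \sum_(i < n) f i t).
Proof.
move=> bf; elim: n => [|n IH].
  by rewrite (_ : (fun _ => _) = cst 0); [exact: bmeas_cst|apply/funext => t; rewrite big_ord0].
rewrite (_ : (fun _ => _) = fun t => \sum_(i < n) f i t + f n t); first exact: bmeasD.
by apply/funext => t; rewrite big_ord_recr.
Qed.

Lemma circ_int_sum n (f : nat -> R -> R) : (forall i, bmeas (f i)) ->
  circ_int (fun t => \sum_(i < n) f i t) = \sum_(i < n) circ_int (f i).
Proof.
move=> bf; elim: n => [|n IH].
  rewrite big_ord0 (_ : (fun _ => _) = fun=> 0); first by rewrite circ_int_cst mul0r.
  by apply/funext => t; rewrite big_ord0.
rewrite big_ord_recr/= -IH -circ_intD//; last exact: bmeas_sum.
by apply: eq_circ_int => t; rewrite big_ord_recr.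
Qed.

(** Marcinkiewicz interpolation over the dyadic levels [2 ^+ i * e]. The weak inequality only sees
    [h] where [lam < 2 * h], so for fixed [t] the levels above [2 * h t] drop out, and the sum of
    the powers [q - 1] of the others is at most a constant times that power of [2 * h t]. *)
Lemma strong_of_weak (q A : R) : 1 < q -> 0 <= A -> exists2 C : R, 0 <= C &
  forall m h : R -> R, bmeas m -> (forall t, 0 <= m t) -> bmeas h -> (forall t, 0 <= h t) ->
  (forall lam : R, 0 < lam -> circ_int (fun t => (lam < m t)%R%:R) <=
     A / lam * circ_int (fun t => h t * (lam < 2 * h t)%R%:R)) ->
  circ_int (fun t => m t `^ q) <= C * circ_int (fun t => h t `^ q).
Proof.
move=> q1 A0; have s0 : 0 < q - 1 by rewrite subr_gt0.
have q0 : 0 < q by lra.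
have [c [c0 cE]] : exists c : R, 0 <= c /\ c = (1 - 2 `^ (- (q - 1)))^-1.
  eexists; split; last by []; by rewrite invr_ge0 subr_ge0 ltW// two_powRN_lt1.
have [B [B0 BE]] : exists B : R, 0 <= B /\ B = A * 2 `^ q * c * 2 `^ (q - 1).
  eexists; split; last by []; rewrite !mulr_ge0 ?powR_ge0//.
exists B => // m h bm m0 bh h0 weak.
have bmq : bmeas (fun t => m t `^ q) by exact: bmeas_powR (ltW q0) m0 bm.
have bhq : bmeas (fun t => h t `^ q) by exact: bmeas_powR (ltW q0) h0 bh.
have mh2 : measurable_fun setT (fun t => 2 * h t) by exact: (bmeasZ 2 bh).1.
suff main (e : R) : 0 < e -> circ_int (fun t => m t `^ q) <=
    e `^ q * (2 * pi) + B * circ_int (fun t => h t `^ q).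
  apply/ler_addgt0Pl => d d0.
  have P0 : 0 < d / (2 * pi) by rewrite divr_gt0// twopi_gt0.
  have := main ((d / (2 * pi)) `^ q^-1) (powR_gt0 _ P0).
  rewrite -powRrM mulVf ?gt_eqF// powRr1 ?(ltW P0)// divfK//.
  exact: twopi_neq0.
move=> e0; have [M mM] : exists M : R, forall t, m t <= M.
  by have [_ [M H]] := bm; exists M => t; apply: le_trans (H t); exact: ler_norm.
(* [m] is bounded, so finitely many levels suffice. *)
have [n nM] : exists n : nat, M <= 2 ^+ n * e.
  exists (Num.truncn (M / e)).+1; rewrite -ler_pdivrMr//.
  apply: le_trans (ltW (truncnS_gt _)) _.
  by rewrite -natrX ler_nat ltnW// ltn_expl.
have blt i : bmeas (fun t : R => (2 ^+ i * e < m t)%R%:R : R) by exact: bmeas_lt bm.1.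
pose F i (t : R) := (2 ^+ i.+1 * e) `^ q * (2 ^+ i * e < m t)%R%:R.
pose G i (t : R) := (A * 2 `^ q) * (2 ^+ i * e) `^ (q - 1) * (h t * (2 ^+ i * e < 2 * h t)%R%:R).
have bf i : bmeas (F i) by exact: bmeasZ.
have bhl i : bmeas (fun t : R => h t * (2 ^+ i * e < 2 * h t)%R%:R).
  by apply: bmeasM => //; exact: bmeas_lt.
have bg i : bmeas (G i) by exact: bmeasZ.
have bC : bmeas (fun _ : R => e `^ q) by exact: bmeas_cst.
have bF := bmeas_sum n bf; have bG := bmeas_sum n bg.
apply: (@le_trans _ _ (circ_int (fun t => e `^ q + \sum_(i < n) F i t))).
  apply: (le_circ_int bmq (bmeasD bC bF)) => t.
  by apply: dyadic_powR_layers => //; exact: le_trans (mM t) nM.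
rewrite (circ_intD bC bF) circ_int_cst lerD2l.
rewrite (circ_int_sum n bf).
apply: (@le_trans _ _ (circ_int (fun t => \sum_(i < n) G i t))).
  rewrite (circ_int_sum n bg); apply: ler_sum => i _.
  rewrite (circ_intZ _ (blt i)) (circ_intZ _ (bhl i)).
  have x0 : 0 < 2 ^+ i * e by rewrite mulr_gt0// exprn_gt0.
  apply: le_trans (ler_wpM2l (powR_ge0 _ _) (weak _ x0)) _.
  rewrite mulrA le_eqVlt; apply/orP; left; apply/eqP; congr (_ * _).
  rewrite exprS -mulrA powRM ?(ltW x0)// powRB; last by rewrite gt_eqF ?implybT.
  by rewrite powRr1 ?(ltW x0)//; field; rewrite gt_eqF//= expf_neq0.
rewrite -(circ_intZ _ bhq); apply: (le_circ_int bG (bmeasZ _ bhq)) => t.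
have -> : \sum_(i < n) G i t =
  A * 2 `^ q * h t * \sum_(i < n) (2 ^+ i * e) `^ (q - 1) * (2 ^+ i * e < 2 * h t)%R%:R.
  by rewrite big_distrr/=; apply: eq_bigr => i _; rewrite /G; ring.
have th0 : 0 <= 2 * h t by rewrite mulr_ge0.
apply: le_trans.
  apply: ler_wpM2l (dyadic_powR_sum_lt n s0 e0 th0).
  by rewrite !mulr_ge0 ?powR_ge0.
rewrite -cE powRM// BE.
have -> : h t `^ q = h t * h t `^ (q - 1).
  have [->|hn] := eqVneq (h t) 0; first by rewrite powR0 ?gt_eqF// mul0r.
  rewrite -{2}(powRr1 (h0 t)) -powRD; first by congr (_ `^ _); ring.
  by apply/implyP => _.
rewrite le_eqVlt; apply/orP; left; apply/eqP; ring.
Qed.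

End weak_to_strong.

(** * Domination of the Poisson kernel by dyadic step functions *)

Section poisson_layers.
Context {R : realType}.

Lemma sin_ge_half (z : R) : 0 <= z <= 1 -> z / 2 <= sin z.
Proof.
move=> /andP[z0 z1]; move: z0; rewrite le_eqVlt => /predU1P[<-|z0]; first by rewrite sin0 mul0r.
have [c] := @MVT R sin cos 0 z z0 (fun y _ => is_derive_sin y)
  (continuous_subspaceT (@continuous_sin R)).
rewrite in_itv/= => /andP[c0 cz]; rewrite sin0 !subr0 => ->.
have := one_sub_cos_le c; have : c ^+ 2 <= 1 by rewrite expr_le1// ltW ?(lt_le_trans cz).
nra.
Qed.

Lemma poisson_den_ge_sqr (a x : R) : 0 <= a < 1 -> `|x| <= pi -> x ^+ 2 / 64 <= poisson_den a x.
Proof.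
move=> a01 xpi; have /andP[a0 a1] := a01.
have pi4 : pi <= 4 :> R by have := pihalf_lt2 R; lra.
have x16 : x ^+ 2 <= 16.
  rewrite -(real_normK (num_real x)); have := normr_ge0 x; nra.
have [ah|ah] := leP a 2^-1.
  have := poisson_den_ge x a01; nra.
(* The quarter angle is at most 1, where [sin y >= y / 2] and [cos y >= 1 / 2]. Doubling twice gives
   [1 - cos x = 2 * (2 * sin y * cos y) ^+ 2]. *)
pose y := `|x| / 4.
have y0 : 0 <= y by rewrite divr_ge0.
have y1 : y <= 1 by rewrite /y; lra.
have hs : y / 2 <= sin y by apply: sin_ge_half; rewrite y0 y1.
have hc : 1 / 2 <= cos y by have := one_sub_cos_le y; nra.
have E : cos x = 1 - 2 * (2 * sin y * cos y) ^+ 2.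
  have {1}-> : cos x = cos `|x|.
    by case: (ger0P x) => // _; rewrite cosN.
  have -> : `|x| = (y + y) + (y + y) by rewrite /y; field.
  rewrite cosD cosD sinD; have := cos2Dsin2 y => H.
  transitivity ((cos y ^+ 2 + sin y ^+ 2) ^+ 2 - 2 * (2 * sin y * cos y) ^+ 2); first by ring.
  by rewrite H expr1n.
have h : y / 2 <= 2 * sin y * cos y by nra.
have h2 : (y / 2) ^+ 2 <= (2 * sin y * cos y) ^+ 2.
  by rewrite lerXn2r ?nnegrE ?divr_ge0// (le_trans _ h)// divr_ge0.
have xy : x ^+ 2 = 16 * y ^+ 2.
  by rewrite /y -(real_normK (num_real x)); field.
rewrite /poisson_den E; set S := _ ^+ 2 in h2 *.
have := sqr_ge0 (1 - a); have y20 := sqr_ge0 y.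
have : (y / 2) ^+ 2 = y ^+ 2 / 4 by field.
nra.
Qed.

(* The sum is a step function, constant on the dyadic annuli of inner radius
   [2 ^ j * (1 - a)]. *)
Definition dyadic_bound (a : R) (n : nat) (x : R) : R :=
  \sum_(j < n) 4^-1 ^+ j / (1 - a) * (`|x| < 2 ^+ j * (1 - a))%R%:R.

Lemma dyadic_bound_ge0 a n x : a < 1 -> 0 <= dyadic_bound a n x.
Proof.
move=> a1; apply: sumr_ge0 => i _; rewrite mulr_ge0// divr_ge0 ?subr_ge0 ?(ltW a1)//.
Qed.

(** On the annulus from [2 ^+ n * (1 - a)] to twice that radius the kernel is at most [2 * (1 - a)]
    divided by [x ^+ 2 / 64], that is 512 times the single term of index [n.+1]. In the innermost
    interval it is at most [2 / (1 - a)]. *)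
Lemma poisson_le_dyadic : exists2 C : R, 0 <= C & forall (a : R) (n : nat) (x : R), 0 <= a < 1 -> `|x| <= pi ->
  `|x| < 2 ^+ n * (1 - a) -> poisson a x <= C * dyadic_bound a n.+1 x.
Proof.
have [C [C0 [C2 C512]]] : exists C : R, 0 <= C /\ 2 <= C /\ 512 <= C by exists 512; lra.
exists C => // a n x a01 xpi; have /andP[a0 a1] := a01.
have d0 : 0 < 1 - a by rewrite subr_gt0.
elim: n => [|n IH] xn.
  rewrite /dyadic_bound big_ord_recr big_ord0/= add0r xn expr0 mulr1 mulrA mulr1.
  apply: le_trans (poisson_le x a01) _; rewrite ler_wpM2r// invr_ge0 ltW//.
have [lx|gx] := ltP `|x| (2 ^+ n * (1 - a)).
  apply: le_trans (IH lx) _; rewrite ler_wpM2l// /dyadic_bound [leRHS]big_ord_recr/= lerDl.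
  by rewrite mulr_ge0// divr_ge0// ltW.
apply: (@le_trans _ _ (C * (4^-1 ^+ n.+1 / (1 - a)))); last first.
  rewrite ler_wpM2l// /dyadic_bound big_ord_recr/= xn mulr1 lerDr.
  exact: dyadic_bound_ge0.
have p0 : 0 < 2 ^+ n :> R by rewrite exprn_gt0.
have den := poisson_den_ge_sqr a01 xpi.
have x2 : (2 ^+ n * (1 - a)) ^+ 2 <= x ^+ 2.
  by rewrite -(real_normK (num_real x)) lerXn2r ?nnegrE// mulr_ge0 ?(ltW p0) ?(ltW d0).
have E4 : 4^-1 ^+ n.+1 = (4 * (2 ^+ n) ^+ 2)^-1 :> R.
  by rewrite exprVn; congr (_^-1); rewrite exprS -exprM mulnC exprM; congr (_ * _ ^+ _); ring.
rewrite E4 /poisson ler_pdivrMr; last exact: poisson_den_gt0.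
apply: (@le_trans _ _ (2 * (1 - a))).
  have : 0 <= (1 - a) * (1 - a) by rewrite mulr_ge0// ltW.
  by nra.
have H : (2 ^+ n * (1 - a)) ^+ 2 / 64 <= poisson_den a x.
  by apply: le_trans den; rewrite ler_wpM2r.
have c1 : 0 <= C * ((4 * (2 ^+ n) ^+ 2)^-1 / (1 - a)).
  by rewrite mulr_ge0// divr_ge0 ?(ltW d0)// invr_ge0 mulr_ge0// sqr_ge0.
apply: le_trans (ler_wpM2l c1 H).
have -> : C * ((4 * (2 ^+ n) ^+ 2)^-1 / (1 - a)) * ((2 ^+ n * (1 - a)) ^+ 2 / 64) =
  C / 256 * (1 - a) by field; rewrite gt_eqF//= gt_eqF.
by rewrite ler_wpM2r ?(ltW d0)//; lra.
Qed.

Lemma poisson_shift a (x : R) : poisson a (x + 2 * pi) = poisson a x.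
Proof. by rewrite /poisson /poisson_den (_ : 2 * pi = pi *+ 2) ?cosD2pi// mulr_natl. Qed.

(** A difference of two angles of [[0, 2 * pi]] may leave [[- pi, pi]], where the dyadic bound
    holds; a translate by [- 2 * pi], 0 or [2 * pi] comes back to it, and the kernel is periodic. *)
Lemma poisson_le_dyadic3 : exists2 C : R, 0 <= C & forall (a : R) (n : nat) (x : R), 0 <= a < 1 -> `|x| <= 2 * pi ->
  pi < 2 ^+ n * (1 - a) -> poisson a x <= C * (dyadic_bound a n.+1 (x - 2 * pi) +
    dyadic_bound a n.+1 x + dyadic_bound a n.+1 (x + 2 * pi)).
Proof.
have [C C0 H] := poisson_le_dyadic; exists C => // a n x a01 x2 np.
have a1 : a < 1 by case/andP: a01.
have D0 y := dyadic_bound_ge0 n.+1 y a1.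
move: x2; rewrite ler_norml => /andP[x1 x2].
have main y : `|y| <= pi -> poisson a y <= C * dyadic_bound a n.+1 y.
  by move=> yp; apply: H => //; exact: le_lt_trans np.
have [x3|x3] := leP x (- pi).
  rewrite -poisson_shift; apply: le_trans (main _ _) _.
    by rewrite ler_norml; lra.
  by rewrite ler_wpM2l// lerDr addr_ge0.
have [x4|x4] := leP x pi.
  apply: le_trans (main _ _) _; first by rewrite ler_norml x4 ltW.
  by rewrite ler_wpM2l// addrAC lerDr addr_ge0.
rewrite -[in leLHS](subrK (2 * pi) x) poisson_shift; apply: le_trans (main _ _) _.
  by rewrite ler_norml; lra.
by rewrite ler_wpM2l// -addrA lerDl addr_ge0.
Qed.

End poisson_layers.

(** * The maximal function and radial domination of Poisson integrals *)

Section maximal_function.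
Context {R : realType}.
Local Notation mu := (@lebesgue_measure R).
Local Notation J := (`[0, 2 * pi]%classic : set R).
Implicit Types h : R -> R.

Let measurableJ : measurable J. Proof. exact: measurable_itv. Qed.

Lemma le_circ_int_in (f g : R -> R) : bmeas f -> bmeas g ->
  (forall t : R, 0 <= t <= 2 * pi -> f t <= g t) -> circ_int f <= circ_int g.
Proof.
move=> bf bg fg; apply: (le_Rintegral _ (bmeas_integrable bf) (bmeas_integrable bg)) => //.
Qed.

Lemma circ_int_le_integral (f : R -> R) : bmeas f -> (forall t, 0 <= f t) ->
  ((circ_int f)%:E <= \int[mu]_t (f t)%:E)%E.
Proof.
move=> bf f0; rewrite (circ_intE bf); apply: ge0_subset_integral => //.
  by apply/measurable_EFinP; exact: bf.1.
by move=> t _; rewrite lee_fin.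
Qed.

Lemma bmeas_dist_lt (x r : R) : bmeas (fun s : R => (`|x - s| < r)%R%:R : R).
Proof.
have -> : (fun s : R => (`|x - s| < r)%R%:R : R) = fun s => (- r < - `|x - s|)%R%:R.
  by apply/funext => s; rewrite ltrN2.
apply: bmeas_lt; apply: measurableT_comp => //; apply: measurableT_comp => //.
exact: measurable_funB.
Qed.

Lemma bmeas_ball h (x r : R) : bmeas h -> bmeas (fun s : R => h s * (`|x - s| < r)%R%:R).
Proof. by move=> bh; apply: bmeasM => //; exact: bmeas_dist_lt. Qed.

Lemma iavg_circ h (x r : R) : bmeas h -> (forall t, 0 <= h t) -> 0 < r ->
  iavg (h \_ J) (ball x r) = ((r * 2)^-1 * circ_int (fun s => h s * (`|x - s| < r)%R%:R))%:E.
Proof.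
move=> bh h0 r0; rewrite iavg_restrict//; last exact: measurable_ball.
rewrite lebesgue_measure_ball ?(ltW r0)// inver mulrn_eq0/= gt_eqF// EFinM.
rewrite -[r *+ 2]mulr_natr; congr (_ * _)%E.
rewrite (circ_intE (bmeas_ball x r bh)).
rewrite integral_mkcondr; apply: eq_integral => s _; rewrite patchE.
rewrite ball_itv; case: ifPn => [|/negP] H.
  have -> : `|x - s| < r.
    by move: H; rewrite inE/= in_itv/= ltr_norml => /andP[? ?]; apply/andP; split; lra.
  by rewrite mulr1 ger0_norm.
have -> : `|x - s| < r = false; last by rewrite mulr0.
apply/negP => H2; apply: H; rewrite inE/= in_itv/=.
by move: H2; rewrite ltr_norml => /andP[? ?]; apply/andP; split; lra.
Qed.

Lemma circ_int_ball (x r : R) : 0 < r -> circ_int (fun s : R => (`|x - s| < r)%R%:R) <= r * 2.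
Proof.
move=> r0; rewrite -lee_fin (circ_intE (bmeas_dist_lt x r)).
have <- : mu (ball x r) = (r * 2)%:E by rewrite lebesgue_measure_ball ?(ltW r0)// mulr_natr.
rewrite -[ball x r]setIT -integral_indic//; last exact: measurable_ball.
rewrite [leLHS]integral_mkcond; apply: ge0_le_integral => //.
- by move=> s _; rewrite patchE; case: ifP => // _; rewrite lee_fin.
- apply/(measurable_restrictT _ measurableJ); apply/measurable_EFinP.
  exact: measurable_funTS (bmeas_dist_lt x r).1.
- by apply/measurable_EFinP; apply: measurable_indic; exact: measurable_ball.
- move=> s _; rewrite patchE; case: ifP => _; rewrite lee_fin// indicE.
  by rewrite mem_setE/= /ball/=.
Qed.

Lemma locally_integrable_circ h : bmeas h -> locally_integrable setT (h \_ J).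
Proof. by move=> bh; apply: integrable_locally_restrict => //; exact: bmeas_integrable. Qed.

Lemma HL_maximal_le h (x M : R) : bmeas h -> (forall t, 0 <= h t) ->
  (forall r : R, 0 < r -> (r * 2)^-1 * circ_int (fun s => h s * (`|x - s| < r)%R%:R) <= M) ->
  (HL_maximal (h \_ J) x <= M%:E)%E.
Proof.
move=> bh h0 H; apply: ge_ereal_sup => _ /= [r + <-]; rewrite in_itv/= andbT => r0.
by rewrite iavg_circ// lee_fin H.
Qed.

Lemma avg_le_sup h (x r M : R) : bmeas h -> (forall t, h t <= M) -> 0 <= M -> 0 < r ->
  (r * 2)^-1 * circ_int (fun s => h s * (`|x - s| < r)%R%:R) <= M.
Proof.
move=> bh hM M0 r0; rewrite mulrC ler_pdivrMr ?mulr_gt0//.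
have bd := bmeas_dist_lt x r.
apply: le_trans (ler_wpM2l M0 (circ_int_ball x r0)).
rewrite -(circ_intZ _ bd); apply: (le_circ_int (bmeas_ball x r bh) (bmeasZ M bd)) => t.
exact: ler_wpM2r.
Qed.

(** The maximal function on the line of [h] cut off to [[0, 2 * pi]]. For bounded nonnegative [h] it
    is finite, so that [fine] loses nothing. *)
Definition hl_max h (x : R) : R := fine (HL_maximal (h \_ J) x).

Lemma hl_maxE h x : bmeas h -> (forall t, 0 <= h t) -> (hl_max h x)%:E = HL_maximal (h \_ J) x.
Proof.
move=> bh h0; rewrite /hl_max fineK// ge0_fin_numE; last first.
  by apply: HL_maximalT_ge0; exact: locally_integrable_circ.
have [_ [M hM]] := bh; apply: (@le_lt_trans _ _ M%:E); last exact: ltry.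
apply: HL_maximal_le => // r r0; apply: avg_le_sup => //.
- by move=> t; apply: le_trans (hM t); exact: ler_norm.
- exact: le_trans (hM 0).
Qed.

Lemma hl_max_ge0 h x : bmeas h -> 0 <= hl_max h x.
Proof.
move=> bh; apply: fine_ge0; apply: HL_maximalT_ge0; exact: locally_integrable_circ.
Qed.

Lemma bmeas_hl_max h : bmeas h -> (forall t, 0 <= h t) -> bmeas (hl_max h).
Proof.
move=> bh h0; split.
  apply: (@measurableT_comp _ _ _ _ _ _ (@fine R)); first exact: fine_measurable.
  by apply: measurable_HL_maximal; exact: locally_integrable_circ.
have [_ [M hM]] := bh; exists M => x; rewrite ger0_norm ?hl_max_ge0//.
rewrite -lee_fin hl_maxE//; apply: HL_maximal_le => // r r0; apply: avg_le_sup => //.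
- by move=> t; apply: le_trans (hM t); exact: ler_norm.
- exact: le_trans (hM 0).
Qed.

Lemma avg_le_hl_max h (x r : R) : bmeas h -> (forall t, 0 <= h t) -> 0 < r ->
  circ_int (fun s => h s * (`|x - s| < r)%R%:R) <= r * 2 * hl_max h x.
Proof.
move=> bh h0 r0; have r2 : 0 < r * 2 by rewrite mulr_gt0.
rewrite -ler_pdivrMl// -lee_fin hl_maxE// -iavg_circ//.
by apply: ereal_sup_ubound; exists r => //=; rewrite in_itv/= r0.
Qed.

(** [h] is at most [h1 + lam / 2] with [h1] the part of [h] where [lam < 2 * h]; where the maximal
    function of [h] exceeds [lam], that of [h1] exceeds [lam / 2]. The weak type constant 3 at level
    [lam / 2] gives 6. The translation [c] is there for the periodic copies. *)
Lemma hl_max_weak h (c lam : R) : bmeas h -> (forall t, 0 <= h t) -> 0 < lam ->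
  circ_int (fun t => (lam < hl_max h (1 * t + c))%R%:R) <=
  6 / lam * circ_int (fun t => h t * (lam < 2 * h t)%R%:R).
Proof.
move=> bh h0 lam0; have bH := bmeas_hl_max bh h0.
pose h1 t := h t * (lam < 2 * h t)%R%:R.
have bh1 : bmeas h1 by apply: bmeasM => //; apply: bmeas_lt; exact: (bmeasZ 2 bh).1.
have h10 t : 0 <= h1 t by rewrite mulr_ge0.
have lam2 : 0 <= lam / 2 by rewrite divr_ge0// ltW.
have hh1 t : h t <= h1 t + lam / 2.
  by rewrite /h1; case: ltP => H; rewrite ?mulr1 ?mulr0 ?lerDl// add0r ler_pdivlMr// mulrC.
have mA : measurable [set x : R | (lam / 2)%:E < HL_maximal (h1 \_ J) x]%E.
  rewrite -[X in measurable X]setTI; apply: emeasurable_fun_o_infty => //.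
  by apply: measurable_HL_maximal; exact: locally_integrable_circ.
have sub x : lam < hl_max h x -> ((lam / 2)%:E < HL_maximal (h1 \_ J) x)%E.
  rewrite -hl_maxE// lte_fin => H; have : hl_max h x <= hl_max h1 x + lam / 2; last by move: H; move: (hl_max h x) (hl_max h1 x); clear => a b; lra.
  rewrite -lee_fin hl_maxE//; apply: HL_maximal_le => // r r0.
  have r2 : 0 < r * 2 by rewrite mulr_gt0.
  rewrite ler_pdivrMl// mulrDr.
  have bd := bmeas_dist_lt x r; have bhb := bmeas_ball x r bh1.
  apply: le_trans (lerD (avg_le_hl_max x bh1 h10 r0) (ler_wpM2r lam2 (circ_int_ball x r0))).
  have bdl : bmeas (fun s : R => (`|x - s| < r)%R%:R * (lam / 2)).
    by apply: bmeasM => //; exact: bmeas_cst.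
  rewrite -(circ_intZr _ bd) -(circ_intD bhb bdl).
  apply: (le_circ_int (bmeas_ball x r bh) (bmeasD bhb bdl)) => t.
  rewrite (mulrC _ (lam / 2)) -mulrDl; exact: ler_wpM2r.
have bL (f : R -> R) : measurable_fun setT f -> bmeas (fun t : R => (lam < f t)%R%:R : R).
  exact: bmeas_lt.
have mH : measurable_fun setT (fun t : R => hl_max h (1 * t + c)).
  exact: (measurableT_comp bH.1 (measurable_affine_map 1 c)).
pose f (t : R) : \bar R := ((lam < hl_max h t)%R%:R)%:E.
have f0 t : (0 <= f t)%E by rewrite lee_fin.
have mf : measurable_fun setT f by apply/measurable_EFinP; exact: (bL _ bH.1).1.
rewrite -lee_fin; apply: (@le_trans _ _ (\int[mu]_t f (1 * t + c)%R)%E).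
  exact: (circ_int_le_integral (bL _ mH) (fun t => ler0n _ _)).
rewrite -[leLHS]mul1e (integral_affine c ltr01 mf f0).
apply: (@le_trans _ _ (\int[mu]_t (\1_[set x : R | (lam / 2)%:E < HL_maximal (h1 \_ J) x]%E t)%:E)%E).
  apply: ge0_le_integral => //.
    by apply/measurable_EFinP; exact: measurable_indic.
  move=> t _; rewrite /f lee_fin indicE; case: ltP => // H.
  by rewrite mem_set//=; exact: sub.
rewrite integral_indic// setIT; apply: le_trans.
  apply: maximal_inequality; first exact: locally_integrable_circ.
  by rewrite divr_gt0.
rewrite [leRHS]EFinM (circ_intE bh1).
have -> : (3 / (lam / 2))%R = 6 / lam by field; rewrite gt_eqF.
apply: lee_wpmul2l; first by rewrite lee_fin divr_ge0// ltW.
rewrite [leRHS]integral_mkcond; apply: ge0_le_integral => //.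
- apply/measurable_EFinP; apply: measurableT_comp => //.
  by apply/(measurable_restrictT _ measurableJ); exact: measurable_funTS bh1.1.
- by apply/(measurable_restrictT _ measurableJ); apply/measurable_EFinP; exact: measurable_funTS bh1.1.
- move=> t _; rewrite !patchE; case: ifP => _; last by rewrite abse0.
  by rewrite /= lee_fin ger0_norm.
Qed.

(** One function [N] dominates the Poisson integrals of all radii. Three translates of the maximal
    function on the line stand in for a periodic one. *)
Lemma poisson_maximal (q : R) : 1 < q -> exists2 C : R, 0 <= C &
  forall h, bmeas h -> (forall t, 0 <= h t) -> exists N : R -> R,
  [/\ bmeas N, forall t, 0 <= N t,
      forall a t : R, 0 <= a < 1 -> 0 <= t <= 2 * pi -> poisson_int a h t <= N t &
      circ_int (fun t => N t `^ q) <= C * circ_int (fun t => h t `^ q)].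
Proof.
move=> q1; have q0 : 0 < q by lra.
have [Cp Cp0 HP] := @poisson_le_dyadic3 R.
have c6 : 0 <= 6 :> R by [].
have [Cs Cs0 HS] := strong_of_weak q1 c6.
have [K [K0 KE]] : exists K : R, 0 <= K /\ K = Cp * 4.
  by exists (Cp * 4); rewrite mulr_ge0.
exists (3 * (K * 3) `^ q * Cs); first by rewrite !mulr_ge0 ?powR_ge0.
move=> h bh h0; have bH := bmeas_hl_max bh h0.
pose m c (t : R) := hl_max h (1 * t + c).
have bm c : bmeas (m c) by apply: (bmeas_comp bH); exact: measurable_affine_map.
have m0 c t : 0 <= m c t by exact: hl_max_ge0.
pose N t := K * (m (- (2 * pi)) t + m 0 t + m (2 * pi) t).
have bN : bmeas N by apply: (bmeasZ K (bmeasD (bmeasD (bm _) (bm _)) (bm _))).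
have N0 t : 0 <= N t by rewrite mulr_ge0// !addr_ge0.
exists N; split => //.
  move=> a t a01 /andP[t0 t2]; have /andP[a0 a1] := a01.
  have d0 : 0 < 1 - a by rewrite subr_gt0.
  have [n np] : exists n : nat, pi < 2 ^+ n * (1 - a).
    exists (Num.truncn (pi / (1 - a))).+1; rewrite -ltr_pdivrMr//.
    apply: lt_le_trans (truncnS_gt _) _.
    by rewrite -natrX ler_nat ltnW// ltn_expl.
  pose G c (j : nat) (s : R) := (4^-1 ^+ j / (1 - a)) * (h s * (`|1 * t + c - s| < 2 ^+ j * (1 - a))%R%:R).
  have bG c j : bmeas (G c j) by apply: bmeasZ; exact: bmeas_ball.
  have GE c s : h s * dyadic_bound a n.+1 (1 * t + c - s) = \sum_(j < n.+1) G c j s.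
    by rewrite /dyadic_bound mulr_sumr; apply: eq_bigr => j _; rewrite /G mulrCA.
  have intG c : circ_int (fun s => h s * dyadic_bound a n.+1 (1 * t + c - s)) <= 4 * m c t.
    rewrite (eq_circ_int (GE c)) (circ_int_sum _ (bG c)).
    (* The coefficient [4^-1 ^+ j / (1 - a)] meets an interval of length [2 * 2 ^+ j * (1 - a)];
       what remains is summable in [j], uniformly in [a]. *)
    apply: (@le_trans _ _ (\sum_(j < n.+1) 2 * 2^-1 ^+ j * m c t)).
      apply: ler_sum => j _; rewrite /G (circ_intZ _ (bmeas_ball _ _ bh)).
      have r0 : 0 < 2 ^+ j * (1 - a) by rewrite mulr_gt0// exprn_gt0.
      have c0 : 0 <= 4^-1 ^+ j / (1 - a) by rewrite divr_ge0 ?exprn_ge0 ?invr_ge0 ?(ltW d0).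
      apply: le_trans (ler_wpM2l c0 (avg_le_hl_max _ bh h0 r0)) _.
      rewrite -/(m c t) le_eqVlt; apply/orP; left; apply/eqP.
      have -> : 4^-1 ^+ j = 2^-1 ^+ j * 2^-1 ^+ j :> R by rewrite -exprMn; congr (_ ^+ _); field.
      have e2 : 2^-1 ^+ j * 2 ^+ j = 1 :> R by rewrite -exprMn mulVf// expr1n.
      move: (2^-1 ^+ j) (2 ^+ j) (m c t) e2 => w v M e2.
      transitivity ((w * v) * (2 * w * M)); last by rewrite e2 mul1r.
      by field; rewrite gt_eqF.
    rewrite -mulr_suml ler_wpM2r// -mulr_sumr.
    suff : \sum_(j < n.+1) 2^-1 ^+ j = 2 - 2^-1 ^+ n :> R.
      by move=> ->; have : 0 <= 2^-1 ^+ n :> R; [rewrite exprn_ge0// invr_ge0|lra].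
    elim: n {np GE} => [|k IH]; first by rewrite big_ord_recr big_ord0/= expr0; lra.
    by rewrite big_ord_recr/= IH exprS; field.
  have bD c : bmeas (fun s : R => h s * dyadic_bound a n.+1 (1 * t + c - s)).
    by rewrite (funext (GE c)); exact: bmeas_sum.
  rewrite /poisson_int.
  have bP := bmeas_poisson_mul t a01 bh.
  have bS := bmeasZ Cp (bmeasD (bmeasD (bD (- (2 * pi))) (bD 0)) (bD (2 * pi))).
  have H1 : circ_int (fun s => poisson a (t - s) * h s) <= N t.
    apply: (@le_trans _ _ (circ_int _)).
      apply: (le_circ_int_in bP bS) => s /andP[s0 s2].
      have := HP a n (t - s) a01 _ np.
      rewrite ler_norml => /(_ _)/(ler_wpM2l (h0 s)) H.
      rewrite mulrC; apply: le_trans (H _) _; first by apply/andP; split; lra.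
      rewrite le_eqVlt; apply/orP; left; apply/eqP.
      rewrite mul1r addr0 (addrAC t (- s)) (addrAC t (- s) (2 * pi)); ring.
    rewrite (circ_intZ _ (bmeasD (bmeasD (bD (- (2 * pi))) (bD 0)) (bD (2 * pi)))).
    rewrite (circ_intD (bmeasD (bD (- (2 * pi))) (bD 0)) (bD (2 * pi))) (circ_intD (bD (- (2 * pi))) (bD 0)).
    rewrite /N KE -mulrA ler_wpM2l// !mulrDr.
    by rewrite !lerD.
  apply: le_trans H1; rewrite -[leRHS]mul1r ler_wpM2r//.
    by apply: circ_int_ge0 => s; rewrite mulr_ge0// poisson_ge0.
  by rewrite invf_le1 ?twopi_gt0//; have := pi_ge2 R; lra.
have bmq c : bmeas (fun t : R => m c t `^ q) by exact: bmeas_powR (ltW q0) (m0 c) (bm c).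
have Hc c : circ_int (fun t => m c t `^ q) <= Cs * circ_int (fun t => h t `^ q).
  exact: (HS (m c) h (bm c) (m0 c) bh h0 (fun lam lam0 => hl_max_weak c bh h0 lam0)).
have bNq : bmeas (fun t : R => N t `^ q) by exact: bmeas_powR (ltW q0) N0 bN.
have bS := bmeasD (bmeasD (bmq (- (2 * pi))) (bmq 0)) (bmq (2 * pi)).
apply: (@le_trans _ _ (circ_int (fun t => (K * 3) `^ q *
   (m (- (2 * pi)) t `^ q + m 0 t `^ q + m (2 * pi) t `^ q)))).
  apply: (le_circ_int bNq (bmeasZ _ bS)) => t.
  have pm (x y z : R) : 0 <= x -> 0 <= y -> 0 <= z ->
      (K * (x + y + z)) `^ q <= (K * 3) `^ q * (x `^ q + y `^ q + z `^ q).
    move=> x0 y0 z0.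
    have mono (u v : R) : 0 <= u -> u <= v -> u `^ q <= v `^ q.
      by move=> u0 uv; apply: ge0_ler_powR; rewrite ?nnegrE ?(ltW q0)// (le_trans u0).
    have X : forall M : R, 0 <= M -> x <= M -> y <= M -> z <= M ->
        (K * (x + y + z)) `^ q <= (K * 3) `^ q * M `^ q.
      move=> M M0 xM yM zM; rewrite -powRM ?mulr_ge0//; apply: mono.
        by rewrite mulr_ge0// !addr_ge0.
      by rewrite -mulrA ler_wpM2l//; lra.
    have KK : 0 <= (K * 3) `^ q by exact: powR_ge0.
    have [xy|xy] := leP x y; have [yz|yz] := leP y z.
    - apply: le_trans (X z z0 (le_trans xy yz) yz (lexx _)) _.
      by rewrite ler_wpM2l// lerDr addr_ge0 ?powR_ge0.
    - apply: le_trans (X y y0 xy (lexx _) (ltW yz)) _.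
      by rewrite ler_wpM2l// -addrA addrCA lerDl addr_ge0 ?powR_ge0.
    - have [xz|xz] := leP x z.
        apply: le_trans (X z z0 xz yz (lexx _)) _.
        by rewrite ler_wpM2l// lerDr addr_ge0 ?powR_ge0.
      apply: le_trans (X x x0 (lexx _) (ltW xy) (ltW xz)) _.
      by rewrite ler_wpM2l// -addrA lerDl addr_ge0 ?powR_ge0.
    - apply: le_trans (X x x0 (lexx _) (ltW xy) (ltW (lt_trans yz xy))) _.
      by rewrite ler_wpM2l// -addrA lerDl addr_ge0 ?powR_ge0.
  exact: pm.
rewrite (circ_intZ _ bS) (circ_intD (bmeasD (bmq (- (2 * pi))) (bmq 0)) (bmq (2 * pi))).
rewrite (circ_intD (bmq (- (2 * pi))) (bmq 0)).
have KK : 0 <= (K * 3) `^ q by exact: powR_ge0.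
apply: le_trans (ler_wpM2l KK (lerD (lerD (Hc _) (Hc _)) (Hc _))) _.
rewrite le_eqVlt; apply/orP; left; apply/eqP; ring.
Qed.

End maximal_function.

(** * The bilinear estimate for exponents at least 2, and all exponents *)

Section tent_estimate_ge2.
Context {R : realType}.
Local Notation mu := (@lebesgue_measure R).

Lemma norm_derive_le1 (f g : R -> R) (x y : R) : (forall z : R, is_derive z 1 f (g z)) ->
  (forall z, `|g z| <= 1) -> `|f x - f y| <= `|x - y|.
Proof.
move=> df g1; wlog xy : x y / y < x.
  move=> H; have [yx|xy] := ltP y x; first exact: H.
  move: xy; rewrite le_eqVlt => /predU1P[->|xy]; first by rewrite !subrr.
  by rewrite distrC (distrC x); exact: H.
have cf : continuous f.
  by move=> z; apply: differentiable_continuous; apply/derivable1_diffP; exact: ex_derive.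
have [c _ ->] := @MVT R f g y x xy (fun z _ => df z) (continuous_subspaceT cf).
by rewrite normrM ler_piMl.
Qed.

(** Moving the angle by at most [(1 - a) / 2] moves [polar a x] by at most [1 - a], which is at most
    the modulus of [1 - polar a x]; the modulus at most doubles and the denominator at most
    quadruples. *)
Lemma poisson_harnack (a x y : R) : 0 <= a < 1 -> `|x - y| <= (1 - a) / 2 ->
  poisson a x <= 4 * poisson a y.
Proof.
move=> a01 xy; have /andP[a0 a1] := a01.
have d0 := poisson_den_gt0 x a01; have e0 := poisson_den_gt0 y a01.
have n1 : 0 <= 1 - a ^+ 2 by rewrite subr_ge0 expr_le1// ltW.
suff H : poisson_den a y <= 4 * poisson_den a x.
  rewrite /poisson mulrCA; apply: ler_wpM2l => //.
  by rewrite -div1r ler_pdivrMr// mulrAC ler_pdivlMr// mul1r.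
rewrite !poisson_denE.
have M0 := modulus_ge0 (1 - polar a x).
have H : modulus (1 - polar a y) <= 2 * modulus (1 - polar a x).
  have E : 1 - polar a y = (1 - polar a x) + (polar a x - polar a y) by ring.
  rewrite E; apply: le_trans (modulusD _ _) _.
  rewrite mulr_natl mulr2n lerD2l.
  apply: (@le_trans _ _ (1 - a)); last first.
    by apply: one_sub_modulus; rewrite modulus_polar ger0_norm.
  apply: le_trans (modulus_le_ReIm _) _; rewrite /polar ReB ImB/= -!mulrBr !normrM.
  rewrite (ger0_norm a0).
  have h1 : `|cos x - cos y| <= `|x - y|.
    apply: (norm_derive_le1 (g := fun z => - sin z)) => z.
    by rewrite normrN ler_norml sin_geN1 sin_le1.
  have h2 : `|sin x - sin y| <= `|x - y|.
    by apply: (norm_derive_le1 (g := fun z => cos z)) => z; rewrite ler_norml cos_geN1 cos_le1.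
  have := normr_ge0 (x - y); nra.
have -> : 4 * modulus (1 - polar a x) ^+ 2 = (2 * modulus (1 - polar a x)) ^+ 2 by ring.
by rewrite lerXn2r ?nnegrE ?modulus_ge0// mulr_ge0.
Qed.

Lemma poisson_int_harnack (a phi t : R) (h : R -> R) : 0 <= a < 1 -> bmeas h ->
  (forall s, 0 <= h s) -> `|t - phi| <= (1 - a) / 2 ->
  poisson_int a h phi <= 4 * poisson_int a h t.
Proof.
move=> a01 bh h0 tp; rewrite /poisson_int mulrCA ler_wpM2l ?invr_ge0 ?twopi_ge0//.
have b1 := bmeas_poisson_mul phi a01 bh; have b2 := bmeas_poisson_mul t a01 bh.
rewrite -(circ_intZ _ b2); apply: (le_circ_int b1 (bmeasZ _ b2)) => s.
rewrite mulrA ler_wpM2r//; apply: poisson_harnack => //.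
by rewrite opprB addrA subrK distrC.
Qed.

(** Compare the power [p] of [S] with the power [q] of [N]. If the former is larger, the power
    [2 - q] of [N] is at most the power [p - 2] of [S]; otherwise [S ^+ 2] is at most the power
    [2 * q - 2] of [N]. Either way the larger of the two bounds the product. *)
Lemma powR_young (q p S N : R) : 1 < q <= 2 -> (p - 1) * (2 - q) = p - 2 -> (p - 1) * q = p ->
  2 <= p -> 0 <= S -> 0 <= N ->
  N `^ (2 - q) * S ^+ 2 <= S `^ p + N `^ q.
Proof.
move=> /andP[q1 q2] pq2 pq p2 S0 N0.
have q0 : 0 < q by lra.
have p0 : 0 < p by lra.
have mono (c u v : R) : 0 <= c -> 0 <= u -> u <= v -> u `^ c <= v `^ c.
  by move=> c0 u0 uv; apply: ge0_ler_powR; rewrite ?nnegrE// (le_trans u0).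
have [Sz|Sn] := eqVneq S 0.
  by rewrite Sz expr0n/= mulr0 addr_ge0 ?powR_ge0.
have [Nz|Nn] := eqVneq N 0.
  rewrite Nz; have [qe|qn] := eqVneq q 2.
    have pe : p = 2 by have := pq2; rewrite qe subrr mulr0 => H; lra.
    rewrite qe subrr powRr0 mul1r pe -powR_mulrn// lerDl powR_ge0//.
  by rewrite powR0 ?subr_eq0 1?eq_sym// mul0r addr_ge0 ?powR_ge0.
rewrite -(powR_mulrn 2 S0).
have [NS|SN] := leP (N `^ q) (S `^ p).
  apply: (@le_trans _ _ (S `^ p)); last by rewrite lerDl powR_ge0.
  have -> : S `^ p = S `^ (p - 2) * S `^ 2%:R.
    by rewrite -powRD ?subrK//; apply/implyP.
  rewrite ler_wpM2r ?powR_ge0//.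
  have c0 : 0 <= (2 - q) / q by rewrite divr_ge0 ?subr_ge0// ltW.
  have := mono _ _ _ c0 (powR_ge0 _ _) NS; rewrite -!powRrM.
  have -> : q * ((2 - q) / q) = 2 - q by field; rewrite gt_eqF.
  have -> // : p * ((2 - q) / q) = p - 2.
  by rewrite -[X in X * _]pq -pq2; field; rewrite gt_eqF.
apply: (@le_trans _ _ (N `^ q)); last by rewrite lerDr powR_ge0.
have -> : N `^ q = N `^ (2 - q) * N `^ (2 * q - 2).
  rewrite -powRD; first by congr (_ `^ _); ring.
  by apply/implyP.
rewrite ler_wpM2l ?powR_ge0//.
have c0 : 0 <= 2 / p by rewrite divr_ge0// ltW.
have := mono _ _ _ c0 (powR_ge0 _ _) (ltW SN); rewrite -!powRrM.
have -> : p * (2 / p) = 2 by field; rewrite gt_eqF.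
have -> // : q * (2 / p) = 2 * q - 2.
have -> : 2 * q - 2 = 2 * (q * (p - (p - 1))  - 1) by ring.
have p0' : p != 0 by rewrite gt_eqF.
apply: (mulIf p0'); have -> : q * (2 / p) * p = q * 2 by field.
nra.
Qed.

Lemma tent_est_ge2 (p : R) : 2 <= p -> exists2 C : R, 0 <= C &
  forall (k : R -> R -> R) (r : R) (h : R -> R) (D : R * R -> R) (M e : R), deriv_kernel k -> 2^-1 <= r < 1 ->
  bmeas h -> (forall t, 0 <= h t) ->
  measurable_fun setT D -> (forall u, 0 <= D u) -> (forall u, D u <= M) ->
  (forall u, ~ polar_rect u -> D u = 0) -> 0 < e ->
  (tent_bilinear k r h D <= (C * (circ_int (fun t => area_fun D t `^ p) +
     circ_int (fun t => (h t + e) `^ (p / (p - 1)))))%:E)%E.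
Proof.
move=> p2; have p1 : 1 < p by lra.
have [] := conj_exp p1; set q := p / (p - 1) => q1 pq pq2.
have p10 : 0 < p - 1 by rewrite subr_gt0.
have q2 : q <= 2.
  by rewrite -subr_le0 -(pmulr_rle0 _ p10) pq2 subr_le0.
have q12 : 1 < q <= 2 by rewrite q1.
have q20 : 0 <= 2 - q by rewrite subr_ge0.
have q0 : 0 < q by lra.
have p0 : 0 <= p by lra.
have pq3 : (p - 1) * (2 - q) = p - 2 by move: pq2; lra.
have [C2 C20 sq] := square_est_le2 q12.
have [Cm Cm0 maxl] := poisson_maximal q1.
have [C3 [C30 C3E]] : exists C3 : R, 0 <= C3 /\ C3 = 4 `^ q * Cm.
  by exists (4 `^ q * Cm); rewrite mulr_ge0 ?powR_ge0.
exists (2 + 2 * C3 + C2); first by rewrite !addr_ge0// mulr_ge0.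
move=> k r h0 D M e dk r12 bh0 h00 mD D0 DM Dout e0.
have /andP[r2 r1] := r12; have r0 : 0 <= r by rewrite (le_trans _ r2).
pose h t := h0 t + e.
have bce : bmeas (fun _ : R => e) by exact: bmeas_cst.
have bh : bmeas h by exact: bmeasD.
have he t : e <= h t by rewrite /h lerDr.
have hp t : 0 <= h t by rewrite (le_trans (ltW e0)).
have [N [bN N0 Nge Nq]] := maxl h bh hp.
have bS := bmeas_area_fun mD D0 DM Dout.
have S0 t : 0 <= area_fun D t := area_fun_ge0 D t.
(* The weight must live on the circle for [tent_swap] to apply. Harnack's inequality moves the
   extension of [h] from [u] to a vertex [t] that sees [u], at the cost of the factor 4, and there
   [N] dominates it. *)
pose w t := (4 * N t) `^ (2 - q).
have b4N : bmeas (fun t : R => 4 * N t) by exact: bmeasZ.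
have N40 t : 0 <= 4 * N t by rewrite mulr_ge0.
have w0 t : 0 <= w t := powR_ge0 _ _.
have bw : bmeas w by exact: bmeas_powR.
have rc u : 0 <= r * clip u < 1.
  by apply: mul01; [rewrite r0|exact: clip01].
pose z (u : R * R) := poisson_int (r * clip u.1) h u.2.
have mc : measurable_fun setT (fun u : R * R => r * clip u.1).
  by apply: measurable_funM => //; exact: (measurableT_comp measurable_clip).
have mz : measurable_fun setT z.
  by apply: measurable_poisson_int => //; move=> u; exact: rc.
have z0 u : 0 < z u by exact: lt_le_trans (poisson_int_gt0 u.2 (rc u.1) bh e0 he).
pose K u := kern_int k (r * clip u.1) h u.2.
have mK : measurable_fun setT K by exact: measurable_kern_clip.
pose F u := (1 - clip u.1) * (z u `^ (q - 2) * K u ^+ 2).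
have F0 u : 0 <= F u.
  have /andP[_ c1] := clip01 u.1.
  by rewrite mulr_ge0 ?subr_ge0 ?(ltW c1)// mulr_ge0 ?powR_ge0// sqr_ge0.
have mF : measurable_fun setT F.
  apply: measurable_funM.
    by apply: measurable_funB => //; exact: (measurableT_comp measurable_clip).
  apply: measurable_funM; last exact: measurable_funX.
  exact: (measurableT_comp (measurable_powR (q - 2))).
pose G u := 2 * (D u ^+ 2 * circ_int (fun t => gam t u * w t)).
have Gc0 u : 0 <= circ_int (fun t => gam t u * w t).
  by apply: circ_int_ge0 => t; rewrite mulr_ge0// gam_ge0.
have G0 u : 0 <= D u ^+ 2 * circ_int (fun t => gam t u * w t) by rewrite mulr_ge0 ?sqr_ge0.
have mG : measurable_fun setT (fun u => D u ^+ 2 * circ_int (fun t => gam t u * w t)).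
  by apply: measurable_funM; [exact: measurable_funX|exact: measurable_gam_int].
have mQ : measurable_fun setT (fun u : R * R => \1_polar_rect u : R).
  exact: measurable_indic measurable_polar_rect.
have weight u : polar_rect u -> (1 - u.1) * z u `^ (2 - q) <= 2 * circ_int (fun t => gam t u * w t).
  move=> Qu; have [u01 _] := Qu; have /andP[u0 u1] := u01.
  have bg := bmeas_gam1 u.
  apply: (@le_trans _ _ (2 * circ_int (fun t => gam t u * z u `^ (2 - q)))).
    rewrite (circ_intZr _ bg) mulrA ler_wpM2r ?powR_ge0// -ler_pdivrMl// mulrC.
    exact: gam_mass.
  have bgz : bmeas (fun t : R => gam t u * z u `^ (2 - q)).
    by apply: bmeasM => //; exact: bmeas_cst.
  apply: ler_wpM2l => //; apply: (le_circ_int_in bgz (bmeasM bg bw)) => t t2.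
  rewrite /gam; case: ifPn => [tu|_]; last by rewrite !mul0r.
  rewrite !mul1r /w; apply: ge0_ler_powR; rewrite ?nnegrE ?(ltW (z0 u))//.
  have := Nge (r * clip u.1) t (rc u.1) t2; rewrite -(ler_pM2l (_ : 0 < 4))//.
  apply: le_trans; apply: poisson_int_harnack => //.
  rewrite clipE//; apply: (le_trans (ltW tu)).
  by rewrite ler_wpM2r// lerB// ler_piMl// ltW.
have pw u : (1 - u.1) * D u * `|kern_int k (r * clip u.1) h0 u.2| <= G u + \1_polar_rect u * F u.
  have [Qu|nQ] := pselect (polar_rect u); last first.
    rewrite (Dout u nQ) mulr0 mul0r; apply: addr_ge0; first exact: (mulr_ge0 _ (G0 u)).
    by rewrite indicE memNset// mul0r.
  have [u01 _] := Qu; have u1 : 0 <= 1 - u.1 by case/andP: u01 => _ /ltW; rewrite subr_ge0.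
  (* The shift by [e] is invisible to the derivative kernel, which has mean 0. *)
  have Kh : kern_int k (r * clip u.1) h0 u.2 = K u.
    rewrite /K /kern_int.
    have a01 : 0 < r * clip u.1 < 1.
      have /andP[_ ->] := rc u.1; rewrite andbT clipE// mulr_gt0//; last by case/andP: u01.
      by rewrite (lt_le_trans _ r2).
    have bk1 := bmeas_kern_mul u.2 dk (rc u.1) bh0.
    have bk2 := bmeas_kern_mul u.2 dk (rc u.1) bce.
    have -> : (fun t : R => k (r * clip u.1) (u.2 - t) * h t) =
       fun t => k (r * clip u.1) (u.2 - t) * h0 t + k (r * clip u.1) (u.2 - t) * e.
      by apply/funext => t; rewrite /h mulrDr.
    rewrite (circ_intD bk1 bk2).
    have bk3 : bmeas (fun t : R => k (r * clip u.1) (u.2 - t)).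
      apply: (bmeas_kern dk (rc u.1)); exact: measurable_subl.
    by rewrite (circ_intZr _ bk3) (kern_mean0 _ dk a01) mul0r addr0.
  rewrite Kh indicE mem_set// mul1r /F clipE//.
  rewrite -mulrA; have wz0 : 0 < z u `^ (q - 2) by rewrite powR_gt0.
  have := am_gm_weight (D u) `|K u| wz0.
  rewrite real_normK ?num_real// => /(ler_wpM2l u1); rewrite mulrDr => /le_trans; apply.
  rewrite lerD2r mulrCA -powRN opprB /G [leRHS]mulrCA ler_wpM2l ?sqr_ge0//.
  exact: weight.
have bD2 : measurable_fun setT (fun u => (G u)%:E).
  by apply/measurable_EFinP; apply: measurable_funM.
apply: (@le_trans _ _ (\int[area R]_u ((G u)%:E + (\1_polar_rect u * F u)%:E))%E).
  apply: ge0_le_integral => //.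
  - move=> u _; have [Qu|nQ] := pselect (polar_rect u); last by rewrite Dout// mulr0 mul0r.
    rewrite lee_fin mulr_ge0// mulr_ge0//; have [/andP[_ u1] _] := Qu.
    by rewrite subr_ge0 ltW.
  - by apply/measurable_EFinP; exact: measurable_tent_integrand.
  - by apply: emeasurable_funD => //; apply/measurable_EFinP; exact: measurable_funM.
  - by move=> u _; rewrite -EFinD lee_fin; exact: pw.
rewrite ge0_integralD//; last 3 first.
- by move=> u _; rewrite lee_fin mulr_ge0.
- by move=> u _; rewrite lee_fin mulr_ge0.
- by apply/measurable_EFinP; exact: measurable_funM.
have bSp : bmeas (fun t : R => area_fun D t `^ p) by exact: bmeas_powR.
have bNq : bmeas (fun t : R => (4 * N t) `^ q) by exact: bmeas_powR (ltW q0) N40 b4N.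
have bNq1 : bmeas (fun t : R => N t `^ q) by exact: bmeas_powR (ltW q0) N0 bN.
have first : (\int[area R]_u (G u)%:E <= (2 * (circ_int (fun t => area_fun D t `^ p) +
    C3 * circ_int (fun t => h t `^ q)))%:E)%E.
  rewrite /G; under eq_integral do rewrite EFinM.
  rewrite ge0_integralZl//; last 2 first.
    by apply/measurable_EFinP.
    by move=> u _; rewrite lee_fin.
  rewrite EFinM (tent_swap mD D0 DM Dout bw w0) lee_wpmul2l ?lee_fin//.
  apply: (@le_trans _ _ (circ_int (fun t => area_fun D t `^ p + (4 * N t) `^ q))).
    apply: (le_circ_int (bmeasM bw (bmeasX 2 bS)) (bmeasD bSp bNq)) => t.
    exact: powR_young.
  rewrite (circ_intD bSp bNq) lerD2l C3E -mulrA.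
  apply: (@le_trans _ _ (4 `^ q * circ_int (fun t => N t `^ q))).
    rewrite -(circ_intZ _ bNq1); apply: (le_circ_int bNq (bmeasZ _ bNq1)) => t.
    by rewrite powRM.
  by rewrite ler_wpM2l ?powR_ge0.
have second : (\int[area R]_u (\1_polar_rect u * F u)%:E <=
   (C2 * circ_int (fun t => h t `^ q))%:E)%E.
  rewrite (area_rect_integral mF F0); last first.
    move=> x.
    have bz : bmeas (fun y : R => z (x, y)) by exact: (bmeas_poisson_int (rc x) bh).
    have bz2 : bmeas (fun y : R => z (x, y) `^ (q - 2)).
      apply: (bmeas_powR_pos _ e0 _ bz) => y.
      exact: (poisson_int_gt0 y (rc x) bh e0 he).
    have bK : bmeas (fun y : R => K (x, y)) by exact: (bmeas_kern_int dk (rc x) bh).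
    exact: (bmeasZ (1 - clip x) (bmeasM bz2 (bmeasX 2 bK))).
  apply: le_trans (sq k r h e dk r12 bh e0 he).
  rewrite le_eqVlt; apply/orP; left; apply/eqP; apply: eq_integral => x.
  by rewrite inE/= in_itv/= => x01; rewrite /F /z /K/= clipE.
apply: le_trans (leeD first second) _; rewrite -EFinD lee_fin.
have H0 : 0 <= circ_int (fun t => h t `^ q) by apply: circ_int_ge0 => t; exact: powR_ge0.
have H1 : 0 <= circ_int (fun t => area_fun D t `^ p).
  by apply: circ_int_ge0 => t; exact: powR_ge0.
change (circ_int (fun t => (h0 t + e) `^ q)) with (circ_int (fun t => h t `^ q)).
have h1 := mulr_ge0 C30 H1; have h2 := mulr_ge0 C20 H1; have h3 := mulr_ge0 C30 H0.
move: H0 H1 h1 h2 h3.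
move: (circ_int (fun t => h t `^ q)) (circ_int (fun t => area_fun D t `^ p)) => X Y.
by clear; lra.
Qed.

Lemma powR_addl_le (p x e : R) : 0 <= p -> 0 <= x -> 0 <= e ->
  (x + e) `^ p <= 2 `^ p * (x `^ p + e `^ p).
Proof.
move=> p0 x0 e0; have mono (u v : R) : 0 <= u -> u <= v -> u `^ p <= v `^ p.
  by move=> u0 uv; apply: ge0_ler_powR; rewrite ?nnegrE// (le_trans u0).
have c0 : 0 <= (2 : R) `^ p := powR_ge0 _ _.
have [xe|ex] := leP x e.
  apply: (@le_trans _ _ (2 `^ p * e `^ p)); last by rewrite ler_wpM2l// lerDr powR_ge0.
  by rewrite -powRM//; apply: mono; [exact: addr_ge0|lra].
apply: (@le_trans _ _ (2 `^ p * x `^ p)); last by rewrite ler_wpM2l// lerDl powR_ge0.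
by rewrite -powRM//; apply: mono; [exact: addr_ge0|lra].
Qed.

Lemma circ_int_powR_addl (p e : R) (f : R -> R) : 0 <= p -> bmeas f -> (forall t, 0 <= f t) ->
  0 < e -> circ_int (fun t => (f t + e) `^ p) <=
  2 `^ p * (circ_int (fun t => f t `^ p) + e `^ p * (2 * pi)).
Proof.
move=> p0 bf f0 e0.
have bfe : bmeas (fun t : R => f t + e) by apply: bmeasD => //; exact: bmeas_cst.
have bfp : bmeas (fun t : R => f t `^ p) by exact: bmeas_powR.
have bc : bmeas (fun _ : R => e `^ p) by exact: bmeas_cst.
have bfep : bmeas (fun t : R => (f t + e) `^ p).
  by apply: (bmeas_powR p0 _ bfe) => t; rewrite addr_ge0// ltW.
rewrite -circ_int_cst -(circ_intD bfp bc) -(circ_intZ _ (bmeasD bfp bc)).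
apply: (le_circ_int bfep (bmeasZ _ (bmeasD bfp bc))) => t.
by apply: powR_addl_le => //; exact: ltW.
Qed.

(** The shift [e] sits on the area function for [p <= 2] and on [h] for [p >= 2]. Both are traded
    for an additive error in powers of [e], which is then made arbitrarily small. *)
Lemma tent_est (p : R) : 1 < p -> exists2 C : R, 0 <= C &
  forall (k : R -> R -> R) (r : R) (h : R -> R) (D : R * R -> R) (M : R), deriv_kernel k -> 2^-1 <= r < 1 ->
  bmeas h -> (forall t, 0 <= h t) ->
  measurable_fun setT D -> (forall u, 0 <= D u) -> (forall u, D u <= M) ->
  (forall u, ~ polar_rect u -> D u = 0) ->
  (tent_bilinear k r h D <= (C * (circ_int (fun t => area_fun D t `^ p) +
     circ_int (fun t => h t `^ (p / (p - 1)))))%:E)%E.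
Proof.
move=> p1; have [] := conj_exp p1; set q := p / (p - 1) => q1 pq pq2.
have p0 : 0 < p by lra.
have q0 : 0 < q by lra.
have [C C0 main] : exists2 C : R, 0 <= C &
  forall (k : R -> R -> R) (r : R) (h : R -> R) (D : R * R -> R) (M e : R), deriv_kernel k -> 2^-1 <= r < 1 ->
  bmeas h -> (forall t, 0 <= h t) ->
  measurable_fun setT D -> (forall u, 0 <= D u) -> (forall u, D u <= M) ->
  (forall u, ~ polar_rect u -> D u = 0) -> 0 < e ->
  (tent_bilinear k r h D <= (C * ((circ_int (fun t => area_fun D t `^ p) +
     circ_int (fun t => h t `^ q)) + (e `^ p + e `^ q)))%:E)%E.
  have [A [A0 [A1 [A2 [A3 A4]]]]] : exists A : R,
      0 <= A /\ 1 <= A /\ 2 `^ p * (1 + 2 * pi) <= A /\ 2 `^ q * (1 + 2 * pi) <= A /\ 1 <= A.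
    have t0 := @twopi_ge0 R; have z1 := powR_ge0 2 p; have z2 := powR_ge0 2 q.
    have z3 : 0 <= 2 `^ p * (1 + 2 * pi) by rewrite mulr_ge0// addr_ge0.
    have z4 : 0 <= 2 `^ q * (1 + 2 * pi) by rewrite mulr_ge0// addr_ge0.
    by exists (1 + 2 `^ p * (1 + 2 * pi) + 2 `^ q * (1 + 2 * pi)); do !split; lra.
  have up (c X y : R) : 0 <= X -> 0 <= y -> 0 <= c -> c * (1 + 2 * pi) <= A ->
      c * (X + y * (2 * pi)) <= A * (X + y).
    move=> X0 y0 c0 cA; have t0 := @twopi_ge0 R.
    apply: (@le_trans _ _ (c * (1 + 2 * pi) * (X + y))).
      by rewrite -mulrA ler_wpM2l//; nra.
    by rewrite ler_wpM2r// addr_ge0.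
  have I0 (f : R -> R) s : 0 <= circ_int (fun t => f t `^ s).
    by apply: circ_int_ge0 => t; exact: powR_ge0.
  have [p2|p2] := leP p 2.
    have p12 : 1 < p <= 2 by rewrite p1.
    have [C C0 H] := tent_est_le2 p12.
    exists (C * A); first exact: mulr_ge0.
    move=> k r h D M e dk r12 bh h0 mD D0 DM Dout e0.
    apply: le_trans (H k r h D M e dk r12 bh h0 mD D0 DM Dout e0) _.
    rewrite lee_fin -mulrA ler_wpM2l//.
    have bS := bmeas_area_fun mD D0 DM Dout.
    have := circ_int_powR_addl (ltW p0) bS (area_fun_ge0 D) e0.
    have := up (2 `^ p) _ _ (I0 (area_fun D) p) (powR_ge0 e p) (powR_ge0 _ _) A2.
    have := I0 h q; have := powR_ge0 e q.
    move: (circ_int (fun t => h t `^ q)) (circ_int (fun t => area_fun D t `^ p))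
      (e `^ q) (e `^ p) => x y v w v0 x0 a1 a2.
    apply: le_trans (lerD a2 (lexx _)) _; apply: le_trans (lerD a1 (lexx _)) _.
    nra.
  have [C C0 H] := tent_est_ge2 (ltW p2).
  exists (C * A); first exact: mulr_ge0.
  move=> k r h D M e dk r12 bh h0 mD D0 DM Dout e0.
  apply: le_trans (H k r h D M e dk r12 bh h0 mD D0 DM Dout e0) _.
  rewrite lee_fin -mulrA ler_wpM2l//.
  have := circ_int_powR_addl (ltW q0) bh h0 e0.
  have := up (2 `^ q) _ _ (I0 h q) (powR_ge0 e q) (powR_ge0 _ _) A3.
  have := I0 (area_fun D) p; have := powR_ge0 e p.
  rewrite -/q.
  move: (circ_int (fun t => h t `^ q)) (circ_int (fun t => area_fun D t `^ p))
    (e `^ q) (e `^ p) => x y v w v0 x0 a1 a2.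
  apply: le_trans (lerD (lexx _) a2) _; apply: le_trans (lerD (lexx _) a1) _.
  nra.
exists C => // k r h D M dk r12 bh h0 mD D0 DM Dout.
set T := tent_bilinear k r h D in main *; set X := circ_int _ + circ_int _.
apply/lee_addgt0Pr => d d0.
pose b := d / (C + 1) / 2.
have C1 : 0 < C + 1 by rewrite ltr_wpDl.
have b0 : 0 < b by rewrite !divr_gt0.
have [e [e0 ep eq]] : exists e : R, [/\ 0 < e, e `^ p <= b & e `^ q <= b].
  exists (Num.min (b `^ p^-1) (b `^ q^-1)); split.
  - by rewrite lt_min !powR_gt0.
  - apply: (@le_trans _ _ ((b `^ p^-1) `^ p)); last first.
      by rewrite -powRrM mulVf ?gt_eqF// powRr1// ltW.
    by apply: ge0_ler_powR; rewrite ?nnegrE ?le_min ?powR_ge0 ?(ltW p0)// ge_min lexx.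
  - apply: (@le_trans _ _ ((b `^ q^-1) `^ q)); last first.
      by rewrite -powRrM mulVf ?gt_eqF// powRr1// ltW.
    by apply: ge0_ler_powR; rewrite ?nnegrE ?le_min ?powR_ge0 ?(ltW q0)// ge_min lexx orbT.
apply: le_trans (main k r h D M e dk r12 bh h0 mD D0 DM Dout e0) _.
rewrite -EFinD lee_fin -/X mulrDr lerD2l.
apply: (@le_trans _ _ (C * (b + b))); first by rewrite ler_wpM2l// lerD.
have -> : C * (b + b) = C * (d / (C + 1)) by rewrite /b; field; rewrite gt_eqF.
by rewrite mulrA ler_pdivrMr// mulrDr mulr1 mulrC lerDl ltW.
Qed.

End tent_estimate_ge2.

(** * Polar coordinates *)

Section density_substitution.
Import HBNNSimple.
Context {R : realType}.
Local Notation mu := (@lebesgue_measure R).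
Variables (phi f : R -> R).
Hypotheses (mphi : measurable_fun setT phi) (mf : measurable_fun setT f).
Hypothesis f0 : forall x, 0 <= f x.

(** Image under [phi] of the measure with density [f]. If it gives half-open intervals their length,
    it is Lebesgue measure by uniqueness, and the change of variables follows by approximation with
    simple functions. *)
Definition density_push (A : set (measurableTypeR R)) : \bar R :=
  (\int[mu]_(x in phi @^-1` A) (f x)%:E)%E.

Let mphiA (A : set R) : measurable A -> measurable (phi @^-1` A).
Proof. by move=> mA; rewrite -[X in measurable X]setTI; exact: mphi. Qed.

Let density_push0 : density_push set0 = 0%E.
Proof. by rewrite /density_push preimage_set0 integral_set0. Qed.

Let density_push_ge0 A : (0 <= density_push A)%E.
Proof. by apply: integral_ge0 => x _; rewrite lee_fin. Qed.

Let density_push_sigma_additive : semi_sigma_additive density_push.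
Proof.
move=> F mF tF mUF; rewrite /density_push preimage_bigcup.
have mfE : measurable_fun setT (fun x : R => (f x)%:E) by exact/measurable_EFinP.
have fE0 (x : R) : (0 <= (f x)%:E)%E by rewrite lee_fin.
apply: (@semi_sigma_additive_nng_induced _ _ R mu _ mfE fE0 (fun n => phi @^-1` F n)).
- by move=> n; exact: (mphiA (mF n)).
- apply/trivIsetP => /= i j _ _ ij; rewrite -preimage_setI.
  by move/trivIsetP : tF => /(_ _ _ _ _ ij) ->//; rewrite preimage_set0.
- by rewrite -preimage_bigcup; exact: (mphiA mUF).
Qed.

HB.instance Definition _ := isMeasure.Build _ _ _ density_push
  density_push0 density_push_ge0 density_push_sigma_additive.

Hypothesis lenE : forall c d : R, c < d ->
  density_push `]c, d]%classic = (d - c)%:E.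

Lemma density_pushE (A : set R) : measurable A -> density_push A = mu A.
Proof.
move=> mA; apply/esym/lebesgue_measure_unique => // _ [[c d]] _ <-.
have [cd|dc] := ltP c d.
  by rewrite [RHS]lenE//= lebesgue_measure_itv/= lte_fin cd.
by rewrite set_itv_ge ?bnd_simp -?leNgt//= density_push0 measure0.
Qed.

Lemma integral_density (g : R -> \bar R) : measurable_fun setT g -> (forall x, 0 <= g x)%E ->
  (\int[mu]_x g x = \int[mu]_x (g (phi x) * (f x)%:E))%E.
Proof.
move=> mg g0; pose h := nnsfun_approx measurableT mg.
have hh a b x : (a <= b)%N -> h a x <= h b x.
  by move=> ab; have /lefP := nd_nnsfun_approx measurableT mg ab; exact.
have cvgh x : (EFin \o h ^~ x) @ \oo --> g x by exact: cvg_nnsfun_approx.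
have gE x : g x = limn (fun n => (h n x)%:E) by apply/esym/cvg_lim => //; exact: cvgh.
have mh n : measurable_fun setT (fun x => (h n x)%:E) by apply/measurable_EFinP.
have mhp n : measurable_fun setT (fun x => (h n (phi x) * f x)%:E).
  apply/measurable_EFinP; apply: measurable_funM => //.
  exact: (@measurableT_comp _ _ _ _ _ _ (h n)).
have -> : (\int[mu]_x g x = limn (fun n => \int[mu]_x (h n x)%:E))%E.
  transitivity (\int[mu]_x limn (fun n => (h n x)%:E))%E.
    by apply: eq_integral => x _; exact: gE.
  apply: monotone_convergence => //.
  - by move=> n x _; rewrite lee_fin.
  - by move=> x _ a b ab; rewrite lee_fin; exact: hh.
have -> : (\int[mu]_x (g (phi x) * (f x)%:E) =
    limn (fun n => \int[mu]_x (h n (phi x) * f x)%:E))%E.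
  have E x : (g (phi x) * (f x)%:E)%E = limn (fun n => (h n (phi x) * f x)%:E).
    have fx : (f x)%:E \is a fin_num by [].
    by apply/esym/cvg_lim => //; exact: (cvgeZr fx (cvgh (phi x))).
  transitivity (\int[mu]_x limn (fun n => (h n (phi x) * f x)%:E))%E.
    by apply: eq_integral => x _; exact: E.
  apply: monotone_convergence => //.
  - by move=> n x _; rewrite lee_fin mulr_ge0.
  - by move=> x _ a b ab; rewrite lee_fin ler_wpM2r//; exact: hh.
congr (limn _); apply/funext => n.
have mS y : measurable (h n @^-1` [set y]).
  rewrite -[X in measurable X]setTI.
  exact: (measurable_funP (h n) measurableT _ (measurable_set1 y)).
transitivity (\int[mu]_x (\sum_(y \in range (h n)) (y * \1_(h n @^-1` [set y]) x)%:E))%E.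
  by apply: eq_integral => t _; rewrite fimfunE -fsumEFin.
rewrite ge0_integral_fsum//; last 2 first.
- move=> y; apply/measurable_EFinP; apply: measurable_funM => //.
  exact: measurable_indic (mS y).
- by move=> y x _; exact: nnfun_muleindic_ge0.
transitivity (\int[mu]_x (\sum_(y \in range (h n))
    (y * (\1_(h n @^-1` [set y]) (phi x) * f x))%:E))%E; last first.
  apply: eq_integral => t _; rewrite fsumEFin//; congr EFin.
  rewrite (fimfunE (h n) (phi t)).
  by rewrite !fsbig_finite//= mulr_suml; apply: eq_bigr => y _; rewrite mulrA.
rewrite ge0_integral_fsum//; last 2 first.
- move=> y; apply/measurable_EFinP; apply: measurable_funM => //.
  apply: measurable_funM => //; exact: (measurableT_comp (measurable_indic (mS y))).
- move=> y x _; rewrite mulrA EFinM mule_ge0// ?lee_fin//.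
  exact: nnfun_muleindic_ge0.
apply: eq_fsbigr => y /set_mem[x _ <-].
have hx0 : 0 <= h n x by [].
have mI : measurable_fun setT (fun z : R => \1_(h n @^-1` [set h n x]) (phi z) : R).
  exact: (measurableT_comp (measurable_indic (mS _))).
have mIf : measurable_fun setT (fun z : R => (\1_(h n @^-1` [set h n x]) (phi z) * f z)%:E).
  by apply/measurable_EFinP; exact: measurable_funM.
transitivity ((h n x)%:E * \int[mu]_z (\1_(h n @^-1` [set h n x]) z)%:E)%E.
  rewrite -ge0_integralZl//; apply/measurable_EFinP; exact: (measurable_indic (mS (h n x))).
transitivity ((h n x)%:E * \int[mu]_z (\1_(h n @^-1` [set h n x]) (phi z) * f z)%:E)%E; last first.
  rewrite -ge0_integralZl//; by move=> z _; rewrite lee_fin mulr_ge0.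
congr (_ * _)%E; rewrite integral_indic//; last exact: mS.
rewrite setIT; transitivity (density_push (h n @^-1` [set h n x])).
  by rewrite (density_pushE (mS _)).
rewrite /density_push integral_mkcond; apply: eq_integral => z _.
by rewrite epatch_indic -EFinM indicE/= mulrC.
Qed.

End density_substitution.

Section polar_coordinates.
Context {R : realType}.
Local Notation mu := (@lebesgue_measure R).
Local Notation J := (`[0, 2 * pi]%classic : set R).
Local Notation I := (`](- (pi / 2)), (pi / 2)[%classic : set R).

Lemma ge0_integral_opp (f : R -> \bar R) : measurable_fun setT f -> (forall x, 0 <= f x)%E ->
  (\int[mu]_x f (- x)%R = \int[mu]_x f x)%E.
Proof.
move=> mf f0; have mN : @measurable_fun _ _ (measurableTypeR R) (measurableTypeR R) setT -%R.
  exact: oppr_measurable.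
rewrite -[LHS](ge0_integral_pushforward mN mu measurableT mf)//.
by apply: eq_measure_integral => A mA _; exact: lebesgue_measureN.
Qed.

(** The derivative of [tan] on its principal branch, extended by 0. *)
Definition tan_density (x : R) : R := (cos x) ^- 2 * \1_I x.

Lemma cos_neq0_I (x : R) : - (pi / 2) < x < pi / 2 -> cos x != 0.
Proof. by move=> xI; rewrite gt_eqF// cos_gt0_pihalf. Qed.

Lemma measurable_tan : measurable_fun setT (@tan R).
Proof.
rewrite (_ : @tan R = fun x => sin x / cos x); last by apply/funext => x; rewrite /tan.
by apply: measurable_div_comp;
  [exact: (bmeas_sin (@measurable_id _ _ setT)).1|exact: (bmeas_cos (@measurable_id _ _ setT)).1].
Qed.

Lemma measurable_tan_density : measurable_fun setT tan_density.
Proof.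
apply: measurable_funM; last exact: measurable_indic.
apply: measurable_inv_comp; apply: measurable_funX.
exact: (bmeas_cos (@measurable_id _ _ setT)).1.
Qed.

Lemma tan_density_ge0 x : 0 <= tan_density x.
Proof. by rewrite mulr_ge0// invr_ge0 sqr_ge0. Qed.

Lemma tan_density_push (c d : R) : c < d ->
  density_push (@tan R) tan_density `]c, d]%classic = (d - c)%:E.
Proof.
move=> cd; rewrite /density_push.
have ac := atan_gtNpi2 c; have ad := atan_ltpi2 d; have acd := lt_atan cd.
have inI x : atan c <= x <= atan d -> - (pi / 2) < x < pi / 2.
  by move=> /andP[h1 h2]; rewrite (lt_le_trans ac)// (le_lt_trans h2).
transitivity (\int[mu]_(x in `](atan c), (atan d)]) ((cos x) ^- 2)%:E)%E.
  rewrite integral_mkcond [RHS]integral_mkcond; apply: eq_integral => x _.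
  rewrite !patchE; have [xI|xI] := boolP (x \in I); last first.
    rewrite /tan_density indicE (negbTE xI) mulr0 if_same.
    case: ifPn => //; rewrite inE/= in_itv/= => /andP[h1 h2].
    by move: xI; rewrite notin_setE/= in_itv/= => -[]; apply: inI; rewrite ltW.
  rewrite /tan_density indicE xI mulr1.
  have xI' : - (pi / 2) < x < pi / 2 by move: xI; rewrite inE/= in_itv.
  suff -> : (x \in tan @^-1` `]c, d]%classic) = (x \in `](atan c), (atan d)]%classic) by [].
  apply/idP/idP; rewrite !inE/= !in_itv/=.
    move=> /andP[h1 h2]; rewrite -[x in atan c < x]tanK ?in_itv//= -[x in x <= atan d]tanK ?in_itv//=.
    by rewrite lt_atan// le_atan.
  move=> /andP[h1 h2]; rewrite -[c]atanK -[d]atanK.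
  have cI : atan c \in `](- (pi/2)), (pi/2)[ by rewrite in_itv/= ac atan_ltpi2.
  have dI : atan d \in `](- (pi/2)), (pi/2)[ by rewrite in_itv/= ad atan_gtNpi2.
  have xI2 : x \in `](- (pi/2)), (pi/2)[ by rewrite in_itv.
  by rewrite ltr_tan// h1/= leNgt ltr_tan// -leNgt.
have cont x : atan c <= x <= atan d -> {for x, continuous (fun x : R => (cos x) ^- 2)}.
  move=> /inI xI; apply: cvgV; first by rewrite expf_neq0// cos_neq0_I.
  by under eq_fun do rewrite expr2; rewrite expr2; apply: cvgM; exact: continuous_cos.
rewrite integral_itv_obnd_cbnd; last first.
  apply/measurable_EFinP; apply: measurable_funTS; apply: measurable_inv_comp; apply: measurable_funX.
  exact: (bmeas_cos (@measurable_id _ _ setT)).1.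
rewrite (@continuous_FTC2 _ (fun x => (cos x) ^- 2) (@tan R))//.
- by rewrite !atanK.
- apply: continuous_in_subspaceT => x; rewrite inE/= in_itv/=; exact: cont.
- split.
  + by move=> x; rewrite in_itv/= => /andP[h1 h2]; apply/derivable_tan/cos_neq0_I/inI; rewrite !ltW.
  + by apply: cvg_at_right_filter; apply/continuous_tan/cos_neq0_I/inI; rewrite lexx ltW.
  + by apply: cvg_at_left_filter; apply/continuous_tan/cos_neq0_I/inI; rewrite lexx ltW.
- move=> x; rewrite in_itv/= => /andP[h1 h2]; rewrite derive1E.
  by apply: derive_val; apply/is_derive_tan/cos_neq0_I/inI; rewrite !ltW.
Qed.

Lemma integral_tan (g : R -> \bar R) : measurable_fun setT g -> (forall x, 0 <= g x)%E ->
  (\int[mu]_x g x = \int[mu]_x (g (tan x) * (tan_density x)%:E))%E.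
Proof.
exact: (integral_density measurable_tan measurable_tan_density tan_density_ge0 tan_density_push).
Qed.

End polar_coordinates.

(** * Integration over the disc in polar coordinates *)

Section polar_inequality.
Context {R : realType}.
Local Notation mu := (@lebesgue_measure R).
Local Notation J := (`[0, 2 * pi]%classic : set R).
Local Notation I := (`](- (pi / 2)), (pi / 2)[%classic : set R).

Lemma measurable_prodmk2 (psi : R) : measurable_fun setT (fun x : R => (x, psi)).
Proof. by apply: measurable_fun_pair => //; exact: measurable_cst. Qed.

Definition polar_map (u : R * R) : R * R := (u.1 * cos u.2, u.1 * sin u.2).

Lemma measurable_polar_map : measurable_fun setT polar_map.
Proof.
apply: measurable_fun_pair; apply: measurable_funM => //.
- exact: (bmeas_cos measurable_snd).1.
- exact: (bmeas_sin measurable_snd).1.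
Qed.

(** [Num.max 0 u.1] is the Jacobian of polar coordinates and at the same time discards the negative
    radii. *)
Definition radial_density (G : R * R -> \bar R) (u : R * R) : \bar R :=
  ((Num.max 0 u.1)%:E * G (polar_map u))%E.

Lemma max0_ge0 (r : R) : 0 <= Num.max 0 r. Proof. by rewrite le_max lexx. Qed.

Lemma measurable_max0 d (T : measurableType d) (g : T -> R) : measurable_fun setT g ->
  measurable_fun setT (fun x => Num.max 0 (g x)).
Proof. by move=> mg; apply: measurable_maxr => //; exact: measurable_cst. Qed.

Section one_function.
Variable G : R * R -> \bar R.
Hypotheses (mG : measurable_fun setT G) (G0 : forall w, (0 <= G w)%E).

Lemma measurable_radial_density : measurable_fun setT (radial_density G).
Proof.
apply: emeasurable_funM; first by apply/measurable_EFinP; exact: measurable_max0.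
exact: (measurableT_comp mG measurable_polar_map).
Qed.

Lemma radial_density_ge0 u : (0 <= radial_density G u)%E.
Proof. by rewrite mule_ge0// lee_fin max0_ge0. Qed.

Definition radial_int (psi : R) : \bar R := (\int[mu]_r radial_density G (r, psi))%E.

Lemma radial_int_ge0 psi : (0 <= radial_int psi)%E.
Proof. by apply: integral_ge0 => r _; exact: radial_density_ge0. Qed.

Lemma measurable_radial_int : measurable_fun setT radial_int.
Proof.
apply: (measurable_fun_fubini_tonelli_G (m1 := mu) (fun u : R * R => radial_density G u)).
  exact: measurable_radial_density.
exact: radial_density_ge0.
Qed.

(** Two substitutions in one variable replace the Jacobian theorem: [y = x * tan psi] for fixed
    [x > 0], then, after Tonelli, [x = r * cos psi] for fixed [psi]. The densities multiply to
    [x / cos psi = r]. *)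
Lemma right_half_plane :
  (\int[mu]_x ((\1_(`]0, +oo[%classic) x : R)%:E * \int[mu]_y G (x, y)) =
   \int[mu]_psi ((\1_I psi : R)%:E * radial_int psi))%E.
Proof.
pose f (u : R * R) := ((Num.max 0 u.1)%:E * G (u.1, u.1 * tan u.2)%R * (tan_density u.2)%:E)%E.
have mtan : measurable_fun setT (fun u : R * R => (u.1, u.1 * tan u.2)).
  apply: measurable_fun_pair => //; apply: measurable_funM => //.
  exact: (measurableT_comp measurable_tan).
have mf : measurable_fun setT f.
  apply: emeasurable_funM; last first.
    by apply/measurable_EFinP; exact: (measurableT_comp measurable_tan_density).
  apply: emeasurable_funM; first by apply/measurable_EFinP; exact: measurable_max0.
  exact: (measurableT_comp mG mtan).
have f0 u : (0 <= f u)%E.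
  by rewrite !mule_ge0// lee_fin ?max0_ge0 ?tan_density_ge0.
transitivity (\int[mu]_x \int[mu]_psi f (x, psi))%E.
  apply: eq_integral => x _; rewrite indicE.
  have [x0|x0] := ltP 0 x; last first.
    rewrite memNset ?mul0e; last by rewrite /= in_itv/= andbT ltNge x0.
    rewrite integral0_eq// => psi _; rewrite /f/=.
    by have /max_idPl -> := x0; rewrite !mul0e.
  rewrite mem_set ?mul1e; last by rewrite /= in_itv/= x0.
  have mGx : measurable_fun setT (fun y : R => G (x, y)).
    exact: (measurableT_comp mG (measurable_prodmk1 x)).
  rewrite -(integral_affine 0 x0 mGx (fun y => G0 _)).
  have mGx2 : measurable_fun setT (fun y : R => G (x, x * y + 0)).
    exact: (measurableT_comp mGx (measurable_affine_map x 0)).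
  rewrite (integral_tan mGx2 (fun y => G0 _)) -ge0_integralZl//; last 3 first.
  - apply: emeasurable_funM; first exact: (measurableT_comp mGx2 measurable_tan).
    by apply/measurable_EFinP; exact: measurable_tan_density.
  - by move=> y _; rewrite mule_ge0// lee_fin tan_density_ge0.
  - by rewrite lee_fin ltW.
  apply: eq_integral => y _; rewrite /f/= addr0 muleA.
  by have /ltW/max_idPr -> := x0.
rewrite (fubini_tonelli (m1 := mu) (m2 := mu) f mf f0).
apply: eq_integral => psi _; rewrite indicE.
have [psiI|psiI] := boolP (psi \in I); last first.
  rewrite mul0e integral0_eq// => x _.
  by rewrite /f/= /tan_density indicE (negbTE psiI) mulr0 mule0.
rewrite mul1e; have c0 : 0 < cos psi.
  by apply: cos_gt0_pihalf; move: psiI; rewrite inE/= in_itv.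
have mfp : measurable_fun setT (fun x : R => f (x, psi)).
  exact: (measurableT_comp mf (measurable_prodmk2 psi)).
rewrite -(integral_affine 0 c0 mfp (fun x => f0 _)) -ge0_integralZl//; last 2 first.
- exact: (measurableT_comp mfp (measurable_affine_map (cos psi) 0)).
- by rewrite lee_fin ltW.
apply: eq_integral => r _; rewrite /f /radial_density /polar_map/= addr0.
have -> : Num.max 0 (cos psi * r) = cos psi * Num.max 0 r.
  by rewrite -[in LHS](mulr0 (cos psi)) maxr_pMr// ltW.
rewrite (mulrC (cos psi) r) -mulrA.
have -> : cos psi * tan psi = sin psi by rewrite /tan mulrC divfK// gt_eqF.
rewrite /tan_density indicE psiI mulr1 muleC -!muleA.
rewrite -EFinM [(G _ * _)%E]muleC muleA -EFinM.
congr (_%:E * _)%E; field; exact: lt0r_neq0.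
Qed.

Lemma radial_int_shift psi : radial_int (psi + 2 * pi) = radial_int psi.
Proof.
apply: eq_integral => r _; rewrite /radial_density /polar_map/=.
have -> : 2 * pi = pi *+ 2 :> R by rewrite mulr_natl.
by rewrite cosD2pi sinD2pi.
Qed.

End one_function.

Lemma left_half_plane G : measurable_fun setT G -> (forall w, (0 <= G w)%E) ->
  (\int[mu]_x ((\1_(`]-oo, 0[%classic) x : R)%:E * \int[mu]_y G (x, y)) =
   \int[mu]_psi ((\1_I (psi - pi) : R)%:E * radial_int G psi))%E.
Proof.
move=> mG G0; pose G' (w : R * R) := G (- w.1, - w.2)%R.
have mG' : measurable_fun setT G'.
  apply: (measurableT_comp mG); apply: measurable_fun_pair; exact: measurableT_comp.
have mF : measurable_fun setT (fun x : R => \int[mu]_y G (x, y))%E.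
  exact: (measurable_fun_fubini_tonelli_F (m2 := mu) G mG G0).
have mind (A : set R) : measurable A -> measurable_fun setT (fun x : R => (\1_A x : R)%:E).
  by move=> mA; apply/measurable_EFinP; exact: measurable_indic.
transitivity (\int[mu]_x ((\1_(`]0, +oo[%classic) x : R)%:E * \int[mu]_y G' (x, y)))%E.
  rewrite -ge0_integral_opp; last 2 first.
  - by apply: emeasurable_funM => //; exact: mind.
  - by move=> x; rewrite mule_ge0 ?lee_fin//; exact: integral_ge0.
  apply: eq_integral => x _; congr (_ * _)%E.
    congr EFin; rewrite !indicE; congr (nat_of_bool _)%:R.
    by apply/idP/idP; rewrite !inE/= !in_itv/= andbT oppr_lt0.
  rewrite -ge0_integral_opp//.
  exact: (measurableT_comp mG (measurable_prodmk1 (- x))).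
have G'0 (w : R * R) : (0 <= G' w)%E by exact: G0.
rewrite (right_half_plane mG' G'0).
have mr : measurable_fun setT (fun psi : R => ((\1_I (psi - pi) : R)%:E * radial_int G psi)%E).
  apply: emeasurable_funM; last exact: measurable_radial_int.
  apply: (measurableT_comp (mind _ _)) => //; exact: measurable_funB.
rewrite -[RHS](integral_affine pi ltr01 mr); last first.
  by move=> psi; rewrite mule_ge0 ?lee_fin// radial_int_ge0.
rewrite mul1e; apply: eq_integral => psi _; rewrite mul1r addrK; congr (_ * _)%E.
apply: eq_integral => r _; rewrite /radial_density /G' /polar_map/=.
by rewrite cosDpi sinDpi !mulrN.
Qed.

(** The angles of the two half-planes, with those in [](- (pi / 2)), 0[] moved up by the period,
    form disjoint subsets of [[0, 2 * pi]]. An upper bound is all that the estimates require. *)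
Lemma polar_plane G : measurable_fun setT G -> (forall w, (0 <= G w)%E) ->
  (\int[area R]_w G w <= \int[mu]_psi ((\1_J psi : R)%:E * radial_int G psi))%E.
Proof.
move=> mG G0; rewrite area_tonelli//.
set F := fun x : R => (\int[mu]_y G (x, y))%E.
have mF : measurable_fun setT F.
  exact: (measurable_fun_fubini_tonelli_F (m2 := mu) G mG G0).
have F0 x : (0 <= F x)%E by exact: integral_ge0.
have mind (A : set R) : measurable A -> measurable_fun setT (fun x : R => (\1_A x : R)%:E).
  by move=> mA; apply/measurable_EFinP; exact: measurable_indic.
have mk := measurable_radial_int mG G0; have k0 := radial_int_ge0 G0.
have mindk (A : set R) : measurable A ->
    measurable_fun setT (fun x : R => (\1_A x : R)%:E * radial_int G x)%E.
  by move=> mA; apply: emeasurable_funM => //; exact: mind.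
have indk0 (A : set R) x : (0 <= (\1_A x : R)%:E * radial_int G x)%E.
  by rewrite mule_ge0// lee_fin.
have -> : (\int[mu]_x F x = \int[mu]_x ((\1_(`]0, +oo[%classic) x : R)%:E * F x +
    (\1_(`]-oo, 0[%classic) x : R)%:E * F x))%E.
  (* The line [x = 0] between the two half-planes is negligible. *)
  have off0 (K : R -> \bar R) : measurable_fun setT K -> (forall x, 0 <= K x)%E ->
      (\int[mu]_x K x = \int[mu]_(x in setT `\` [set 0%R]) K x)%E.
    move=> mK K0; apply: ge0_negligible_integral => //.
    exact: lebesgue_measure_set1.
  rewrite (off0 _ mF F0) [RHS]off0; last 2 first.
  - by apply: emeasurable_funD; apply: emeasurable_funM => //; exact: mind.
  - by move=> x; rewrite adde_ge0// mule_ge0// lee_fin.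
  apply: eq_integral => x; rewrite inE => -[_ /= /eqP x0].
  rewrite !indicE; case: (ltgtP x 0) x0 => // [xn|xp] _.
    have -> : (x \in (`]0, +oo[%classic : set R)) = false.
      by apply: memNset; rewrite /= in_itv/= andbT; apply/negP; rewrite -leNgt ltW.
    by rewrite mem_set ?mul1e ?mul0e ?add0e//= in_itv/=.
  have -> : (x \in (`]-oo, 0[%classic : set R)) = false.
    by apply: memNset; rewrite /= in_itv/=; apply/negP; rewrite -leNgt ltW.
  by rewrite mem_set ?mul1e ?mul0e ?adde0//= in_itv/= andbT.
rewrite ge0_integralD//; last 4 first.
- by move=> x _; rewrite mule_ge0// lee_fin.
- by apply: emeasurable_funM => //; exact: mind.
- by move=> x _; rewrite mule_ge0// lee_fin.
- by apply: emeasurable_funM => //; exact: mind.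
rewrite right_half_plane// left_half_plane//.
pose N := `](- (pi / 2)), 0[%classic : set R.
pose P := `[0, (pi / 2)[%classic : set R.
have mN : measurable N by exact: measurable_itv.
have mP : measurable P by exact: measurable_itv.
have mI : measurable I by exact: measurable_itv.
have pi0 := pi_gt0 R.
have splitI x : \1_I x = \1_N x + \1_P x :> R.
  rewrite !indicE /N /P !mem_setE !in_itv/=.
  have [a0|/negP a0] := boolP (- (pi / 2) < x < pi / 2);
  have [b0|/negP b0] := boolP (- (pi / 2) < x < 0);
  have [c0|/negP c0] := boolP (0 <= x < pi / 2); rewrite /= ?addr0 ?add0r//; exfalso.
  - by move: b0 c0 => /andP[? ?] /andP[? ?]; lra.
  - move: a0 => /andP[? ?]; have [x0|x0] := ltP x 0; first by apply: b0; apply/andP; split; lra.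
    by apply: c0; apply/andP; split; lra.
  - by move: b0 c0 => /andP[? ?] /andP[? ?]; lra.
  - by apply: a0; move: b0 => /andP[? ?]; apply/andP; split; lra.
  - by apply: a0; move: c0 => /andP[? ?]; apply/andP; split; lra.
have H1 : (\int[mu]_psi ((\1_I psi : R)%:E * radial_int G psi) =
   \int[mu]_psi ((\1_N (psi - 2 * pi) : R)%:E * radial_int G psi) +
   \int[mu]_psi ((\1_P psi : R)%:E * radial_int G psi))%E.
  transitivity (\int[mu]_psi ((\1_N psi : R)%:E * radial_int G psi +
    (\1_P psi : R)%:E * radial_int G psi))%E.
    apply: eq_integral => x _; rewrite splitI EFinD ge0_muleDl// lee_fin//.
  rewrite ge0_integralD//; [|exact: (mindk _ mN)|exact: (mindk _ mP)].
  congr (_ + _)%E.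
  have mr : measurable_fun setT (fun psi : R => ((\1_N (psi - 2 * pi) : R)%:E * radial_int G psi)%E).
    apply: emeasurable_funM => //.
    by apply: (measurableT_comp (mind N _)) => //; exact: measurable_funB.
  rewrite -[RHS](integral_affine (2 * pi) ltr01 mr); last first.
    by move=> psi; rewrite mule_ge0 ?lee_fin.
  by rewrite mul1e; apply: eq_integral => psi _; rewrite mul1r addrK radial_int_shift.
have mS (A : set R) c : measurable A ->
    measurable_fun setT (fun psi : R => ((\1_A (psi - c) : R)%:E * radial_int G psi)%E).
  move=> mA; apply: emeasurable_funM => //.
  by apply: (measurableT_comp (mind A _)) => //; exact: measurable_funB.
have S0 (A : set R) c x : (0 <= (\1_A (x - c) : R)%:E * radial_int G x)%E.
  by rewrite mule_ge0// lee_fin.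
rewrite H1 -ge0_integralD//; [|exact: (mS _ _ mN)|exact: (mindk _ mP)].
rewrite -ge0_integralD//; last 3 first.
- by move=> x _; rewrite adde_ge0.
- by apply: emeasurable_funD; [exact: (mS _ _ mN)|exact: (mindk _ mP)].
- exact: (mS _ _ mI).
apply: ge0_le_integral => //.
- by move=> x _; rewrite !adde_ge0.
- by apply: emeasurable_funD; [apply: emeasurable_funD; [exact: (mS _ _ mN)|exact: (mindk _ mP)]|exact: (mS _ _ mI)].
- exact: mindk.
move=> x _; rewrite -!ge0_muleDl ?lee_fin ?addr_ge0//.
apply: lee_wpmul2r => //; rewrite -!EFinD lee_fin !indicE.
rewrite /N /P !mem_setE !in_itv/=.
have [/andP[a1 a2]|_] := boolP (- (pi / 2) < x - 2 * pi < 0);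
have [/andP[b1 b2]|_] := boolP (0 <= x < pi / 2);
have [/andP[c1 c2]|_] := boolP (- (pi / 2) < x - pi < pi / 2);
have [_|/negP d] := boolP (0 <= x <= 2 * pi); rewrite /= ?addr0 ?add0r ?lexx ?ler01//; exfalso;
  by [lra|apply: d; apply/andP; split; lra].
Qed.

Lemma discE : @disc R = [set w | w.1 ^+ 2 + w.2 ^+ 2 < 1].
Proof.
apply/seteqP; split => w; rewrite /disc /cdisc /= => H.
  have := modulus_ge0 (toC w) => m0.
  by have := sqr_modulus (toC w); rewrite /= => <-; rewrite expr_lt1.
by rewrite -[modulus _ < 1](expr_lt1 (n := 2)) ?modulus_ge0// sqr_modulus.
Qed.

Lemma measurable_disc : measurable (@disc R).
Proof.
rewrite discE -[X in measurable X]setTI.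
apply: (measurable_fun_ltr (f := fun w : R * R => w.1 ^+ 2 + w.2 ^+ 2) (g := cst 1)) => //.
  by apply: measurable_funD; exact: measurable_funX.
Qed.

Lemma polar_le (G : R * R -> \bar R) : measurable_fun setT G -> (forall w, (0 <= G w)%E) ->
  (forall w, ~ disc w -> G w = 0%E) ->
  (\int[area R]_w G w <=
   \int[area R]_u ((\1_polar_rect u * u.1 : R)%:E * G (polar_map u)))%E.
Proof.
move=> mG G0 Gd; apply: le_trans (polar_plane mG G0) _.
have mH : measurable_fun setT (fun u : R * R => ((\1_polar_rect u * u.1 : R)%:E * G (polar_map u))%E).
  apply: emeasurable_funM; last exact: (measurableT_comp mG measurable_polar_map).
  apply/measurable_EFinP; apply: measurable_funM => //.
  exact: measurable_indic measurable_polar_rect.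
have H0 (u : R * R) : (0 <= (\1_polar_rect u * u.1 : R)%:E * G (polar_map u))%E.
  rewrite mule_ge0// lee_fin indicE; have [|_] := boolP (u \in polar_rect).
    by rewrite inE => -[/andP[u0 _] _]; rewrite mul1r ltW.
  by rewrite mul0r.
rewrite /area (fubini_tonelli2 (m1 := mu) (m2 := mu) _ mH H0).
rewrite le_eqVlt; apply/orP; left; apply/eqP; apply: eq_integral => psi _.
rewrite /radial_int -ge0_integralZl//; last 2 first.
- exact: (measurableT_comp (measurable_radial_density mG) (measurable_prodmk2 psi)).
- by move=> r _; exact: radial_density_ge0.
apply: eq_integral => r _; rewrite /radial_density/= indic_polar_rect/= !indicE.
have [r0|r0] := leP r 0.
  rewrite mul0e mule0.
  by rewrite memNset ?mul0r ?mul0e//= in_itv/= ltNge r0.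
have [r1|r1] := ltP r 1.
  by rewrite [r \in _]mem_set ?mul1r/= ?in_itv/= ?r0// muleA -EFinM.
rewrite Gd ?mule0//; rewrite discE /polar_map/= => H.
have : (r * cos psi) ^+ 2 + (r * sin psi) ^+ 2 = r ^+ 2.
  by rewrite !exprMn -mulrDr cos2Dsin2 mulr1.
by move=> E; move: H; rewrite E; nra.
Qed.

End polar_inequality.

(** * Complex-valued integrals over the disc *)

Section complex_measurable.
Local Open Scope complex_scope.
Context {R : realType} {d : measure_display} {T : measurableType d}.
Implicit Types f g : T -> R[i].

Definition cmeas f :=
  measurable_fun setT (fun x => complex.Re (f x)) /\
  measurable_fun setT (fun x => complex.Im (f x)).

Lemma cmeas_cst (c : R[i]) : cmeas (fun=> c).
Proof. by split; exact: measurable_cst. Qed.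

Lemma cmeas_real (h : T -> R) : measurable_fun setT h -> cmeas (fun x => (h x)%:C).
Proof. by move=> mh; split => //; exact: measurable_cst. Qed.

Lemma cmeasD f g : cmeas f -> cmeas g -> cmeas (fun x => f x + g x).
Proof.
move=> [f1 f2] [g1 g2]; split.
  by under eq_fun do rewrite ReD; exact: measurable_funD.
by under eq_fun do rewrite ImD; exact: measurable_funD.
Qed.

Lemma cmeasN f : cmeas f -> cmeas (fun x => - f x).
Proof.
move=> [f1 f2]; split.
  by under eq_fun do rewrite ReN; exact: measurableT_comp.
by under eq_fun do rewrite ImN; exact: measurableT_comp.
Qed.

Lemma cmeasB f g : cmeas f -> cmeas g -> cmeas (fun x => f x - g x).
Proof. by move=> mf mg; apply: cmeasD => //; exact: cmeasN. Qed.

Lemma cmeasM f g : cmeas f -> cmeas g -> cmeas (fun x => f x * g x).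
Proof.
move=> [f1 f2] [g1 g2]; split.
  by under eq_fun do rewrite Re_mul; apply: measurable_funB; exact: measurable_funM.
by under eq_fun do rewrite Im_mul; apply: measurable_funD; exact: measurable_funM.
Qed.

Lemma cmeasX f n : cmeas f -> cmeas (fun x => f x ^+ n).
Proof.
move=> mf; elim: n => [|n IH]; first by under eq_fun do rewrite expr0; exact: cmeas_cst.
by under eq_fun do rewrite exprS; exact: cmeasM.
Qed.

Lemma cmeas_conj f : cmeas f -> cmeas (fun x => (f x)^*).
Proof.
move=> [f1 f2]; split.
  by rewrite (_ : (fun x => _) = fun x => complex.Re (f x))//; apply/funext => x; case: (f x).
rewrite (_ : (fun x => _) = fun x => - complex.Im (f x)); first exact: measurableT_comp.
by apply/funext => x; case: (f x).
Qed.

Lemma ReV (z : R[i]) : complex.Re z^-1 = complex.Re z / (complex.Re z ^+ 2 + complex.Im z ^+ 2).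
Proof. by case: z. Qed.

Lemma ImV (z : R[i]) : complex.Im z^-1 = - complex.Im z / (complex.Re z ^+ 2 + complex.Im z ^+ 2).
Proof. by case: z => a b /=; rewrite mulNr. Qed.

Lemma cmeasV f : cmeas f -> cmeas (fun x => (f x)^-1).
Proof.
move=> [f1 f2].
have mden : measurable_fun setT (fun x => complex.Re (f x) ^+ 2 + complex.Im (f x) ^+ 2).
  by apply: measurable_funD; exact: measurable_funX.
split.
  by under eq_fun do rewrite ReV; exact: measurable_div_comp.
under eq_fun do rewrite ImV; apply: measurable_div_comp => //.
exact: measurableT_comp.
Qed.

Lemma cmeas_modulus f : cmeas f -> measurable_fun setT (fun x => modulus (f x)).
Proof.
move=> [f1 f2].
rewrite (_ : (fun x => _) = fun x => (complex.Re (f x) ^+ 2 + complex.Im (f x) ^+ 2) `^ 2^-1).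
  apply: (measurableT_comp (measurable_powR _)).
  by apply: measurable_funD; exact: measurable_funX.
by apply/funext => x; rewrite modulusE powR12_sqrt// addr_ge0 ?sqr_ge0.
Qed.

End complex_measurable.

(** * Complex integrals over the disc and analyticity of the Bergman projection *)

Section disc_integral.
Local Open Scope complex_scope.
Context {R : realType}.
Local Notation D := (@disc R).
Local Notation A := (area R).
Implicit Types V W m : R * R -> R[i].

Let mD : measurable (D : set (measurableTypeR R * measurableTypeR R)).
Proof. exact: measurable_disc. Qed.

Lemma cmeas_toC : cmeas (@toC R).
Proof. by split => /=; [exact: measurable_fst|exact: measurable_snd]. Qed.

Lemma disc_modulus w : D w -> modulus (toC w) < 1. Proof. by []. Qed.

Lemma area_disc_lty : (A D < +oo)%E.
Proof.
apply: (@le_lt_trans _ _ (A (`[-1, 1]%classic `*` `[-1, 1]%classic))).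
  apply: le_measure; rewrite ?inE//; first exact: measurableX.
  move=> w /disc_modulus w1; have := Re_le_modulus (toC w); have := Im_le_modulus (toC w).
  rewrite /= => h1 h2; split => /=; rewrite in_itv/= -ler_norml.
    by rewrite (le_trans h2)// ltW.
  by rewrite (le_trans h1)// ltW.
rewrite areaX// !lebesgue_measure_itv/= !lte_fin.
have -> : (-1 < 1 :> R) by lra.
by rewrite -EFinD -EFinM ltry.
Qed.

Lemma integrable_bound (f g : R * R -> R) (M : R) : A.-integrable D (EFin \o f) ->
  measurable_fun setT g -> (forall w, D w -> `|g w| <= M) ->
  A.-integrable D (EFin \o (fun w => f w * g w)).
Proof.
move=> intf mg gM.
have mf : measurable_fun D f by apply/measurable_EFinP; exact: measurable_int intf.
have mfg : measurable_fun D (EFin \o (fun w => f w * g w)).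
  apply/measurable_EFinP; apply: measurable_funM => //; exact: measurable_funTS.
apply: (le_integrable mD mfg _ (integrableZl mD M intf)) => w Dw /=.
rewrite lee_fin mulrC [leRHS]normrM normrM ler_wpM2r//.
by rewrite (le_trans (gM w Dw))// ler_norm.
Qed.

Lemma integrable_scale (f : R * R -> R) (c : R) : A.-integrable D (EFin \o f) ->
  A.-integrable D (EFin \o (fun w => c * f w)).
Proof. by move=> intf; exact: (integrableZl mD c intf). Qed.

Definition cbounded m := exists M : R, forall w, D w -> modulus (m w) <= M.

Lemma cintegrableM V m : cintegrable D V -> cmeas m -> cbounded m ->
  cintegrable D (fun w => V w * m w).
Proof.
move=> [V1 V2] [m1 m2] [M mM].
have b1 w : D w -> `|complex.Re (m w)| <= M.
  by move=> Dw; rewrite (le_trans (Re_le_modulus _))// mM.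
have b2 w : D w -> `|complex.Im (m w)| <= M.
  by move=> Dw; rewrite (le_trans (Im_le_modulus _))// mM.
split.
  have -> : EFin \o (fun w => complex.Re (V w * m w)) =
    ((EFin \o (fun w => (complex.Re (V w) * complex.Re (m w))%R)) \-
     (EFin \o (fun w => (complex.Im (V w) * complex.Im (m w))%R)))%E.
    by apply/funext => w /=; rewrite Re_mul.
  by apply: (integrableB mD); [exact: (integrable_bound V1 m1 b1)|exact: (integrable_bound V2 m2 b2)].
have -> : EFin \o (fun w => complex.Im (V w * m w)) =
  ((EFin \o (fun w => (complex.Re (V w) * complex.Im (m w))%R)) \+
   (EFin \o (fun w => (complex.Im (V w) * complex.Re (m w))%R)))%E.
  by apply/funext => w /=; rewrite Im_mul.
by apply: (integrableD mD); [exact: (integrable_bound V1 m2 b2)|exact: (integrable_bound V2 m1 b1)].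
Qed.

Lemma cintegrableD V W : cintegrable D V -> cintegrable D W ->
  cintegrable D (fun w => V w + W w).
Proof.
move=> [V1 V2] [W1 W2]; split.
  rewrite (_ : _ \o _ = ((EFin \o (fun w => complex.Re (V w))) \+
    (EFin \o (fun w => complex.Re (W w))))%E); first exact: integrableD.
  by apply/funext => w /=; rewrite ReD.
rewrite (_ : _ \o _ = ((EFin \o (fun w => complex.Im (V w))) \+
  (EFin \o (fun w => complex.Im (W w))))%E); first exact: integrableD.
by apply/funext => w /=; rewrite ImD.
Qed.

Lemma cintegralD V W : cintegrable D V -> cintegrable D W ->
  cintegral D (fun w => V w + W w) = cintegral D V + cintegral D W.
Proof.
move=> [V1 V2] [W1 W2]; rewrite /cintegral.
have -> : (\int[A]_(w in D) complex.Re (V w + W w))%R =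
    (\int[A]_(w in D) (complex.Re (V w) + complex.Re (W w)))%R.
  by apply: eq_Rintegral => w _; rewrite ReD.
have -> : (\int[A]_(w in D) complex.Im (V w + W w))%R =
    (\int[A]_(w in D) (complex.Im (V w) + complex.Im (W w)))%R.
  by apply: eq_Rintegral => w _; rewrite ImD.
by rewrite !RintegralD.
Qed.

Lemma cintegralZ V (c : R[i]) : cintegrable D V ->
  cintegral D (fun w => V w * c) = cintegral D V * c.
Proof.
move=> [V1 V2]; rewrite /cintegral; case: c => a b.
have -> : (\int[A]_(w in D) complex.Re (V w * (a +i* b)))%R =
    (\int[A]_(w in D) (a * complex.Re (V w) - b * complex.Im (V w)))%R.
  by apply: eq_Rintegral => w _; rewrite Re_mul/= mulrC (mulrC b).
have -> : (\int[A]_(w in D) complex.Im (V w * (a +i* b)))%R =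
    (\int[A]_(w in D) (b * complex.Re (V w) + a * complex.Im (V w)))%R.
  by apply: eq_Rintegral => w _; rewrite Im_mul/= mulrC (mulrC a).
rewrite (RintegralB mD (integrable_scale a V1) (integrable_scale b V2)) (RintegralD mD (integrable_scale b V1) (integrable_scale a V2)).
rewrite !RintegralZl//; simpc; congr (_ +i* _); ring.
Qed.

Lemma cintegrableZ V (c : R[i]) : cintegrable D V -> cintegrable D (fun w => V w * c).
Proof.
move=> iV; have bc : cbounded (fun=> c) by exists (modulus c).
exact: (cintegrableM iV (cmeas_cst c) bc).
Qed.

Lemma cintegrableN V : cintegrable D V -> cintegrable D (fun w => - V w).
Proof. by move=> /(cintegrableZ (-1)); under eq_fun do rewrite mulrN1. Qed.

Lemma cintegralN V : cintegrable D V -> cintegral D (fun w => - V w) = - cintegral D V.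
Proof. by move=> /(cintegralZ (-1)); under eq_fun do rewrite mulrN1; rewrite mulrN1. Qed.

Lemma cintegrableB V W : cintegrable D V -> cintegrable D W ->
  cintegrable D (fun w => V w - W w).
Proof. by move=> iV iW; apply: cintegrableD => //; exact: cintegrableN. Qed.

Lemma cintegralB V W : cintegrable D V -> cintegrable D W ->
  cintegral D (fun w => V w - W w) = cintegral D V - cintegral D W.
Proof.
by move=> iV iW; rewrite cintegralD ?cintegralN//; exact: cintegrableN.
Qed.

Lemma eq_cintegral V W : (forall w, D w -> V w = W w) -> cintegral D V = cintegral D W.
Proof.
by move=> VW; congr (_ +i* _); apply: eq_Rintegral => w; rewrite inE => /VW ->.
Qed.

Lemma eq_cintegrable V W : (forall w, D w -> V w = W w) -> cintegrable D V -> cintegrable D W.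
Proof.
move=> VW [V1 V2]; split.
  by apply: (eq_integrable mD _ _ _ V1) => w; rewrite inE => /VW /= ->.
by apply: (eq_integrable mD _ _ _ V2) => w; rewrite inE => /VW /= ->.
Qed.

Definition l1 V : R := (\int[A]_(w in D) modulus (V w))%R.

Lemma l1_ge0 V : 0 <= l1 V.
Proof. by apply: Rintegral_ge0 => w _; exact: modulus_ge0. Qed.

Lemma integrable_modulus V : cintegrable D V -> A.-integrable D (EFin \o (fun w => modulus (V w))).
Proof.
move=> [V1 V2].
have m1 : measurable_fun D (fun w => complex.Re (V w)).
  by apply/measurable_EFinP; exact: measurable_int V1.
have m2 : measurable_fun D (fun w => complex.Im (V w)).
  by apply/measurable_EFinP; exact: measurable_int V2.
have mm : measurable_fun D (EFin \o (fun w => modulus (V w))).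
  apply/measurable_EFinP.
  rewrite (_ : (fun x => _) = fun x => (complex.Re (V x) ^+ 2 + complex.Im (V x) ^+ 2) `^ 2^-1).
    apply: (measurableT_comp (measurable_powR _)).
    by apply: measurable_funD; exact: measurable_funX.
  by apply/funext => x; rewrite modulusE powR12_sqrt// addr_ge0 ?sqr_ge0.
apply: (le_integrable mD mm _ (integrableD mD (integrable_norm V1) (integrable_norm V2))).
move=> w _ /=; rewrite lee_fin ger0_norm ?modulus_ge0// ger0_norm ?addr_ge0//.
exact: modulus_le_ReIm.
Qed.

(** The factor 2 comes from treating the real and imaginary parts of the integral separately. *)
Lemma modulus_cintegral_le V m (M : R) : cintegrable D V -> cmeas m ->
  (forall w, D w -> modulus (m w) <= M) ->
  modulus (cintegral D (fun w => V w * m w)) <= 2 * M * l1 V.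
Proof.
move=> iV mm mM; have bm : cbounded m by exists M.
have [i1 i2] := cintegrableM iV mm bm; have iM := integrable_modulus iV.
have iMM : A.-integrable D (EFin \o (fun w => M * modulus (V w))) by exact: integrable_scale.
have H w : D w -> modulus (V w * m w) <= M * modulus (V w).
  by move=> Dw; rewrite modulusM mulrC ler_wpM2r ?modulus_ge0// mM.
rewrite -mulrA mulr_natl mulr2n -(RintegralZl _ mD iM); apply: le_trans (modulus_le_ReIm _) _ => /=.
apply: lerD.
  apply: le_trans (le_normr_Rintegral mD i1) _.
  apply: (le_Rintegral mD (integrable_norm i1) iMM) => w Dw.
  by apply: le_trans (Re_le_modulus _) _; exact: H.
apply: le_trans (le_normr_Rintegral mD i2) _.
apply: (le_Rintegral mD (integrable_norm i2) iMM) => w Dw.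
by apply: le_trans (Im_le_modulus _) _; exact: H.
Qed.

Definition bkern (z : R[i]) (w : R * R) : R[i] := 1 / (1 - z * (toC w)^*) ^+ 2.

Lemma cmeas_one_sub (z : R[i]) : cmeas (fun w => 1 - z * (@toC R w)^*).
Proof.
apply: cmeasB; first exact: cmeas_cst.
by apply: cmeasM; [exact: cmeas_cst|apply: cmeas_conj; exact: cmeas_toC].
Qed.

Lemma cmeas_bkern z : cmeas (bkern z).
Proof.
apply: cmeasM; first exact: cmeas_cst.
by apply: cmeasV; apply: cmeasX; exact: cmeas_one_sub.
Qed.

Lemma modulus_mul_conj z w : D w -> modulus (z * (toC w)^*) <= modulus z.
Proof.
move=> /disc_modulus Dw; rewrite modulusM modulus_conj ler_piMr ?modulus_ge0//.
exact: ltW.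
Qed.

Lemma one_sub_ge z w : D w -> 1 - modulus z <= modulus (1 - z * (toC w)^*).
Proof. by move=> Dw; apply: one_sub_modulus; exact: modulus_mul_conj. Qed.

Lemma bkern_le z w : modulus z < 1 -> D w -> modulus (bkern z w) <= (1 - modulus z) ^- 2.
Proof.
move=> z1 Dw; have z0 : 0 < 1 - modulus z by rewrite subr_gt0.
rewrite /bkern modulusM modulus1 mul1r modulusV modulusX lef_pV2 ?posrE ?exprn_gt0//.
  by rewrite lerXn2r ?nnegrE ?modulus_ge0 ?(ltW z0)// one_sub_ge.
exact: lt_le_trans (one_sub_ge z Dw).
Qed.

Lemma cbounded_bkern z : modulus z < 1 -> cbounded (bkern z).
Proof. by move=> z1; exists ((1 - modulus z) ^- 2) => w; exact: bkern_le. Qed.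

Lemma bergmanE (f : R[i] -> R[i]) z : cintegrable D (f \o @toC R) -> modulus z < 1 ->
  bergman f z = cintegral D (fun w => f (toC w) * bkern z w) / (pi : R)%:C.
Proof.
move=> fi z1; rewrite -cintegralZ//.
exact: (cintegrableM fi (cmeas_bkern z) (cbounded_bkern z1)).
Qed.

(** The derivative of the kernel in [z]. *)
Definition bkern' (z : R[i]) (w : R * R) : R[i] :=
  2 * (toC w)^* / (1 - z * (toC w)^*) ^+ 3.

Lemma cmeas_bkern' z : cmeas (bkern' z).
Proof.
apply: cmeasM.
  by apply: cmeasM; [exact: cmeas_cst|apply: cmeas_conj; exact: cmeas_toC].
by apply: cmeasV; apply: cmeasX; exact: cmeas_one_sub.
Qed.

Lemma cbounded_bkern' z : modulus z < 1 -> cbounded (bkern' z).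
Proof.
move=> z1; have z0 : 0 < 1 - modulus z by rewrite subr_gt0.
exists (2 * (1 - modulus z) ^- 3) => w Dw.
rewrite /bkern' !modulusM modulus_nat modulus_conj modulusV modulusX.
have d0 := one_sub_ge z Dw; have d1 := lt_le_trans z0 d0.
apply: ler_pM; rewrite ?mulr_ge0 ?modulus_ge0 ?invr_ge0 ?exprn_ge0 ?modulus_ge0//.
  by rewrite ler_piMr// ltW// disc_modulus.
rewrite lef_pV2 ?posrE ?exprn_gt0// lerXn2r ?nnegrE ?modulus_ge0 ?(ltW z0)//.
Qed.

Lemma bkern_taylor z h w : modulus z < 1 -> modulus h <= (1 - modulus z) / 2 -> D w ->
  modulus (bkern (z + h) w - bkern z w - bkern' z w * h) <=
  8 * ((1 - modulus z) / 2) ^- 5 * modulus h ^+ 2.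
Proof.
move=> z1 hz Dw; have z0 : 0 < 1 - modulus z by rewrite subr_gt0.
have h1 : modulus h <= 1 by have := modulus_ge0 z; lra.
set b := (toC w)^*; set t := h * b; set a := 1 - z * b.
have b1 : modulus b <= 1 by rewrite modulus_conj ltW// disc_modulus.
have t1 : modulus t <= modulus h by rewrite modulusM ler_piMr ?modulus_ge0.
have a1 : 1 - modulus z <= modulus a by exact: one_sub_ge.
have a2 : modulus a <= 2.
  apply: le_trans (modulusB _ _) _; rewrite modulus1.
  have := modulus_mul_conj z Dw; rewrite -/b; lra.
have at2 : (1 - modulus z) / 2 <= modulus (a - t).
  have := ler_modulusB a t; lra.
have c0 : 0 < (1 - modulus z) / 2 by rewrite divr_gt0.
have an0 : a != 0 by rewrite -modulus_eq0 gt_eqF// (lt_le_trans z0).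
have atn0 : a - t != 0 by rewrite -modulus_eq0 gt_eqF// (lt_le_trans c0).
(* The exact first order remainder of [1 / (a - t) ^+ 2] in [t]. Its factor [3 * a - 2 * t] has
   modulus at most 8 because [a] has modulus at most 2 and [t] at most 1. *)
have -> : bkern (z + h) w - bkern z w - bkern' z w * h =
    t ^+ 2 * (3 * a - 2 * t) / (a ^+ 3 * (a - t) ^+ 2).
  have E y : bkern y w = 1 / (1 - y * b) ^+ 2 by [].
  have E' : bkern' z w = 2 * b / a ^+ 3 by [].
  rewrite !E E' -/a; have -> : 1 - (z + h) * b = a - t by rewrite /a /t; ring.
  have -> : 2 * b / a ^+ 3 * h = 2 * t / a ^+ 3 by rewrite /t; ring.
  by field; rewrite atn0.
rewrite modulusM (modulusM (t ^+ 2)) modulusV (modulusM (a ^+ 3)) !modulusX.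
have n1 : modulus (3 * a - 2 * t) <= 8.
  apply: le_trans (modulusB _ _) _; rewrite (modulusM 3) (modulusM 2) !modulus_nat; lra.
have d1 : ((1 - modulus z) / 2) ^+ 5 <= modulus a ^+ 3 * modulus (a - t) ^+ 2.
  rewrite (exprD _ 3 2); apply: ler_pM; rewrite ?exprn_ge0 ?(ltW c0)//.
    rewrite lerXn2r ?nnegrE ?modulus_ge0 ?(ltW c0)//; lra.
  by rewrite lerXn2r ?nnegrE ?modulus_ge0 ?(ltW c0).
have p5 : 0 < ((1 - modulus z) / 2) ^+ 5 by rewrite exprn_gt0.
have real_le (T N Q P H : R) : 0 <= T -> T <= H -> 0 <= N -> N <= 8 -> 0 < P -> P <= Q ->
    T ^+ 2 * N / Q <= 8 * P^-1 * H ^+ 2.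
  move=> T0 TH N0 N8 P0 PQ; rewrite mulrAC mulrC -(mulrA 8) (mulrC P^-1).
  apply: ler_pM => //; first by rewrite mulr_ge0 ?sqr_ge0// invr_ge0 ltW// (lt_le_trans P0).
  apply: ler_pM; rewrite ?sqr_ge0//.
  - by rewrite invr_ge0 ltW// (lt_le_trans P0).
  - by rewrite lerXn2r ?nnegrE// (le_trans T0).
  - by rewrite lef_pV2 ?posrE// (lt_le_trans P0).
exact: (real_le _ _ _ _ _ (modulus_ge0 t) t1 (modulus_ge0 _) n1 p5 d1).
Qed.

(** The quadratic remainder of the kernel is uniform in [w], so it can be integrated against [f];
    this avoids a theorem on differentiation under the integral sign. *)
Lemma bergman_taylor (f : R[i] -> R[i]) z : cintegrable D (f \o @toC R) -> modulus z < 1 ->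
  exists (l : R[i]) (C : R), 0 <= C /\ forall h, modulus h <= (1 - modulus z) / 2 ->
    modulus (bergman f (z + h) - bergman f z - l * h) <= C * modulus h ^+ 2.
Proof.
move=> fi z1; have z0 : 0 < 1 - modulus z by rewrite subr_gt0.
have c0 : 0 < (1 - modulus z) / 2 by rewrite divr_gt0.
have pi0 := pi_gt0 R.
pose F z := cintegral D (fun w => f (toC w) * bkern z w).
have iK y : modulus y < 1 -> cintegrable D (fun w => f (toC w) * bkern y w).
  by move=> y1; exact: (cintegrableM fi (cmeas_bkern y) (cbounded_bkern y1)).
have iK' := cintegrableM fi (cmeas_bkern' z) (cbounded_bkern' z1).
exists (cintegral D (fun w => f (toC w) * bkern' z w) / (pi : R)%:C).
exists (2 * (8 * ((1 - modulus z) / 2) ^- 5) * l1 (f \o @toC R) / pi); split.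
  by rewrite divr_ge0 ?(ltW pi0)// mulr_ge0 ?l1_ge0// !mulr_ge0// invr_ge0 exprn_ge0 ?ltW.
move=> h hz; have zh1 : modulus (z + h) < 1.
  apply: le_lt_trans (modulusD _ _) _; lra.
rewrite !bergmanE// -!/(F _).
have -> : F (z + h) / pi%:C - F z / pi%:C - cintegral D (fun w => f (toC w) * bkern' z w) / pi%:C * h =
  cintegral D (fun w => f (toC w) * (bkern (z + h) w - bkern z w - bkern' z w * h)) / pi%:C.
  have -> : cintegral D (fun w => f (toC w) * (bkern (z + h) w - bkern z w - bkern' z w * h)) =
    F (z + h) - F z - cintegral D (fun w => f (toC w) * bkern' z w) * h.
    have i1 := iK _ zh1; have i2 := iK _ z1; have i3 := cintegrableZ h iK'.
    rewrite -(cintegralZ h iK') /F -(cintegralB i1 i2) -(cintegralB (cintegrableB i1 i2) i3).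
    by apply: eq_cintegral => w _; rewrite [RHS]/= -mulrA -!mulrBr.
  by rewrite !mulrBl; congr (_ - _); rewrite mulrAC.
rewrite modulusM modulusV modulus_real ger0_norm ?(ltW pi0)//.
rewrite mulrAC ler_wpM2r ?invr_ge0 ?(ltW pi0)//.
have mm : cmeas (fun w => bkern (z + h) w - bkern z w - bkern' z w * h).
  apply: cmeasB; first by apply: cmeasB; exact: cmeas_bkern.
  by apply: cmeasM; [exact: cmeas_bkern'|exact: cmeas_cst].
apply: le_trans (modulus_cintegral_le fi mm (fun w => bkern_taylor z1 hz (w := w))) _.
by rewrite le_eqVlt; apply/orP; left; apply/eqP; ring.
Qed.

Lemma bergman_analytic (f : R[i] -> R[i]) : cintegrable D (f \o @toC R) ->
  analytic_on (@cdisc R) (bergman f).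
Proof.
move=> fi z z1; have [l [C [C0 H]]] := bergman_taylor fi z1.
have z0 : 0 < 1 - modulus z by rewrite subr_gt0.
apply/cvg_ex; exists l; apply/cvgrPdist_le => e e0.
have [er [er0 eE]] : exists er : R, 0 < er /\ e = er%:C.
  by exists (complex.Re e); move: e0; case: (e) => a b; rewrite ltcE/= => /andP[/eqP -> ->].
have d0 : 0 < Num.min ((1 - modulus z) / 2) (er / (C + 1)).
  by rewrite lt_min !divr_gt0// ltr_wpDl.
have dC : 0 < (Num.min ((1 - modulus z) / 2) (er / (C + 1)))%:C :> R[i] by rewrite ltcR.
near=> h.
have hn0 : h != 0 by near: h; exact: nbhs_dnbhs_neq.
have hd : `|h| <= (Num.min ((1 - modulus z) / 2) (er / (C + 1)))%:C by near: h; exact: dnbhs0_le.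
rewrite norm_modulus lecR in hd; rewrite le_min in hd; case/andP: hd => h1 h2.
rewrite norm_modulus eE lecR.
have hm : 0 < modulus h by rewrite lt_neqAle modulus_ge0 andbT eq_sym modulus_eq0.
have -> : l - h^-1 *: (bergman f (h *: 1 + z) - bergman f z) =
    - (bergman f (z + h) - bergman f z - l * h) / h.
  rewrite /GRing.scale/= mulr1 (addrC h).
  by move: (bergman f (z + h)) (bergman f z) => u v; field.
rewrite modulusM modulusN modulusV ler_pdivrMr//.
apply: le_trans (H h h1) _; rewrite expr2 mulrA ler_wpM2r ?modulus_ge0//.
have C1 : 0 < C + 1 by rewrite ltr_wpDl.
move: h2; rewrite ler_pdivlMr//; have := modulus_ge0 h; nra.
Unshelve. all: by end_near. Qed.

End disc_integral.

(** * Test functions and integration by parts *)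

Section bump.
Context {R : realType}.

(** The flat function [exp (- d / t)] times a negative power of [t]. The index [j] makes the family
    stable under differentiation up to linear combinations. *)
Definition flat_bump (d : R) (j : nat) (t : R) : R :=
  if 0 < t then t^-1 ^+ j * expR (- d * t^-1) else 0.

Lemma bump_ge0 d j t : 0 <= flat_bump d j t.
Proof.
rewrite /flat_bump; case: ltP => // t0.
by rewrite mulr_ge0 ?expR_ge0// exprn_ge0// invr_ge0 ltW.
Qed.

(** With [m = j + 2], the exponential of [d / t] is at least [d / (m * t)] to the power [m]. This
    compensates the [j] negative powers of [t] with two to spare, enough for the derivative at 0 to
    exist and vanish. *)
Lemma bump_le d j : 0 < d -> exists2 C : R, 0 <= C & forall t, flat_bump d j t <= C * t ^+ 2.
Proof.
move=> d0; pose m : R := j.+2%:R.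
have m0 : 0 < m by rewrite ltr0n.
exists ((m / d) ^+ j.+2); first by rewrite exprn_ge0// divr_ge0// ltW.
move=> t; rewrite /flat_bump; case: ltP => [t0|_]; last first.
  by rewrite mulr_ge0 ?sqr_ge0// exprn_ge0// divr_ge0// ltW.
have dt : 0 < d / (m * t) by rewrite divr_gt0// mulr_gt0.
have e1 : (d / (m * t)) ^+ j.+2 <= expR (d * t^-1).
  have -> : d * t^-1 = d / (m * t) *+ j.+2.
    by rewrite -mulr_natr -/m; field; rewrite !gt_eqF.
  rewrite -mulr_natl expRM_natl lerXn2r ?nnegrE ?expR_ge0 ?(ltW dt)//.
  by apply: le_trans (expR_ge1Dx _); rewrite lerDr.
have e2 : expR (- d * t^-1) <= (m * t / d) ^+ j.+2.
  rewrite mulNr expRN -[m * t / d]invrK exprVn lef_pV2 ?posrE ?expR_gt0 ?exprn_gt0//.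
  - by rewrite invf_div.
  - by rewrite invf_div.
have ti : 0 <= t^-1 ^+ j by rewrite exprn_ge0// invr_ge0 ltW.
apply: le_trans (ler_wpM2l ti e2) _.
have -> : (m * t / d) ^+ j.+2 = (m / d) ^+ j.+2 * t ^+ j.+2.
  by rewrite -exprMn; congr (_ ^+ _); field; rewrite gt_eqF.
rewrite mulrCA ler_wpM2l//; first by rewrite exprn_ge0// divr_ge0// ltW.
rewrite -addn2 exprD mulrA -exprMn mulVf ?gt_eqF// expr1n mul1r//.
Qed.

Lemma is_derive0_sqr (f : R -> R) (C : R) : 0 <= C -> (forall t, `|f t| <= C * t ^+ 2) ->
  is_derive (0 : R) (1 : R) f 0.
Proof.
move=> C0 fC; have f0 : f 0 = 0.
  by apply/eqP; rewrite -normr_le0 (le_trans (fC 0))// expr0n/= mulr0.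
have H : (fun h : R => h^-1 *: ((f \o shift 0) (h *: 1) - f 0)) @ 0^' --> (0 : R).
  apply/cvgrPdist_le => e e0; near=> h.
  have hn0 : h != 0 by near: h; exact: nbhs_dnbhs_neq.
  have hd : `|h| <= e / (C + 1).
    by near: h; apply: dnbhs0_le; rewrite divr_gt0// ltr_wpDl.
  rewrite sub0r normrN /= f0 subr0 addr0 /GRing.scale/= mulr1 normrM normfV.
  have h0 : 0 < `|h| by rewrite normr_gt0.
  rewrite mulrC ler_pdivrMr//; apply: le_trans (fC h) _.
  rewrite -(real_normK (num_real h)) expr2 mulrA ler_wpM2r//.
  move: hd; rewrite ler_pdivlMr ?ltr_wpDl//; have := normr_ge0 h; nra.
apply: DeriveDef; first by apply: cvgP H.
exact: cvg_lim H.
Unshelve. all: by end_near. Qed.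

Definition flat_bump' (d : R) (j : nat) (t : R) : R := - j%:R * flat_bump d j.+1 t + d * flat_bump d j.+2 t.

Lemma is_derive_bump d j (t : R) : 0 < d -> is_derive t 1 (flat_bump d j) (flat_bump' d j t).
Proof.
move=> d0; have [t0|t0|->] := ltgtP t 0.
- have E : flat_bump' d j t = 0 by rewrite /flat_bump' /flat_bump ltNge (ltW t0)/= !mulr0 addr0.
  have dc : is_derive t 1 (fun _ : R => 0 : R) 0 by exact: is_derive_cst.
  rewrite E; apply: near_eq_is_derive dc.
  by near=> s; rewrite /flat_bump ltNge ltW//; near: s; exact: lt_nbhsl.
- have tn0 : t != 0 by rewrite gt_eqF.
  have dV : is_derive t 1 (fun s : R => s^-1) (- t ^- 2 *: 1).
    exact: (@is_deriveV _ id t 1 1 tn0 (is_derive_id t 1)).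
  have dX : is_derive t 1 (fun s : R => s^-1 ^+ j) ((j%:R * t^-1 ^+ j.-1) *: (- t ^- 2 *: 1)).
    rewrite (_ : (fun s : R => s^-1 ^+ j) = ((fun s : R => s^-1) ^+ j)%R); first exact: is_deriveX.
    by apply/funext => s; elim: j => [//|i IH]; rewrite exprS IH [in RHS]exprS.
  have dS : is_derive t 1 (fun s : R => - d * s^-1) (- d *: (- t ^- 2 *: 1)).
    exact: is_deriveZ.
  have dE : is_derive t 1 (fun s : R => expR (- d * s^-1)) (expR (- d * t^-1) * (- d *: (- t ^- 2 *: 1))).
    exact: (@is_derive1_comp _ expR (fun s : R => - d * s^-1)).
  have dF : is_derive t 1 (fun s : R => s^-1 ^+ j * expR (- d * s^-1)) (flat_bump' d j t); last first.
    apply: near_eq_is_derive dF.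
    by near=> s; rewrite /flat_bump ifT//; near: s; exact: lt_nbhsr.
  apply: (is_derive_eq (is_deriveM dX dE)).
  rewrite /flat_bump' /flat_bump t0 /GRing.scale/= !mulr1 -!exprVn.
  by case: j {dX} => [|j]; rewrite ?mul0r ?expr0 ?expr1/=; [ring|rewrite !exprS; ring].
- have [C C0 H] := bump_le j d0.
  have -> : flat_bump' d j 0 = 0 by rewrite /flat_bump' /flat_bump ltxx !mulr0 addr0.
  by apply: (is_derive0_sqr C0) => t'; rewrite ger0_norm ?bump_ge0.
Unshelve. all: by end_near. Qed.

Lemma continuous_bump d j : 0 < d -> continuous (flat_bump d j).
Proof.
move=> d0 t; apply: differentiable_continuous; apply/derivable1_diffP.
exact: (@ex_derive _ _ _ _ _ _ _ (is_derive_bump j t d0)).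
Qed.

Lemma measurable_bump d j : 0 < d -> measurable_fun setT (flat_bump d j).
Proof. by move=> d0; apply: continuous_measurable_fun; exact: continuous_bump. Qed.

End bump.

(** * Smooth functions of two variables with their partial derivatives *)

Section smooth.
Context {R : realType}.
Implicit Types f g : R * R -> R.

Lemma CkW k f : Ck k.+1 f -> Ck k f.
Proof.
elim: k f => [|k IH] f [cf [d1 d2 Cx Cy]]; first by split.
exact: (conj cf (And4 d1 d2 (IH _ Cx) (IH _ Cy))).
Qed.

Lemma Ck_cst k (c : R) : Ck k (cst c : R * R -> R).
Proof.
elim: k c => [|k IH] c; first by split => // x; exact: cvg_cst.
split; first by move=> x; exact: cvg_cst.
have E v : (fun w => 'D_v (cst c : R * R -> R) w) = cst 0.
  by apply/funext => w; exact: derive_cst.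
split; [by move=> w; exact: derivable_cst|by move=> w; exact: derivable_cst| |].
- by rewrite /ddx E; exact: IH.
- by rewrite /ddy E; exact: IH.
Qed.

Lemma CkD k f g : Ck k f -> Ck k g -> Ck k (f \+ g).
Proof.
elim: k f g => [|k IH] f g [cf Hf] [cg Hg].
  by split => // x; apply: cvgD; [exact: cf|exact: cg].
split; first by move=> x; apply: cvgD; [exact: cf|exact: cg].
have [f1 f2 f3 f4] := Hf; have [g1 g2 g3 g4] := Hg.
have Ex : ddx (f \+ g) = ddx f \+ ddx g by apply/funext => w; exact: deriveD.
have Ey : ddy (f \+ g) = ddy f \+ ddy g by apply/funext => w; exact: deriveD.
split; [by move=> w; exact: derivableD|by move=> w; exact: derivableD| |].
- by rewrite Ex; exact: IH.
- by rewrite Ey; exact: IH.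
Qed.

Lemma CkM k f g : Ck k f -> Ck k g -> Ck k (f \* g).
Proof.
elim: k f g => [|k IH] f g Cf Cg.
  by split => // x; apply: cvgM; [exact: Cf.1|exact: Cg.1].
have [cf [f1 f2 f3 f4]] := Cf; have [cg [g1 g2 g3 g4]] := Cg.
have Ex : ddx (f \* g) = (f \* ddx g) \+ (g \* ddx f) by apply/funext => w; exact: deriveM.
have Ey : ddy (f \* g) = (f \* ddy g) \+ (g \* ddy f) by apply/funext => w; exact: deriveM.
have Cfk := CkW Cf; have Cgk := CkW Cg.
split; first by move=> x; apply: cvgM; [exact: cf|exact: cg].
split; [by move=> w; exact: derivableM|by move=> w; exact: derivableM| |].
- by rewrite Ex; apply: CkD; exact: IH.
- by rewrite Ey; apply: CkD; exact: IH.
Qed.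

Lemma is_derive_x f (w : R * R) (d : R) : is_derive w.1 1 (fun t => f (t, w.2)) d ->
  is_derive w (1, 0) f d.
Proof.
case: w => x y /= H.
have E : (fun h : R => h^-1 *: ((f \o shift (x, y)) (h *: (1, 0)) - f (x, y))) =
  (fun h : R => h^-1 *: (((fun t => f (t, y)) \o shift x) (h *: 1) - f (x, y))).
  apply/funext => h; congr (_ *: (f _ - _)).
  by apply: injective_projections; rewrite /= /GRing.scale/= ?mulr0 ?add0r.
apply: DeriveDef; first by rewrite /derivable E; exact: (@ex_derive _ _ _ _ _ _ _ H).
by rewrite /derive E; exact: (@derive_val _ _ _ _ _ _ _ H).
Qed.

Lemma is_derive_y f (w : R * R) (d : R) : is_derive w.2 1 (fun t => f (w.1, t)) d ->
  is_derive w (0, 1) f d.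
Proof.
case: w => x y /= H.
have E : (fun h : R => h^-1 *: ((f \o shift (x, y)) (h *: (0, 1)) - f (x, y))) =
  (fun h : R => h^-1 *: (((fun t => f (x, t)) \o shift y) (h *: 1) - f (x, y))).
  apply/funext => h; congr (_ *: (f _ - _)).
  by apply: injective_projections; rewrite /= /GRing.scale/= ?mulr0 ?add0r.
apply: DeriveDef; first by rewrite /derivable E; exact: (@ex_derive _ _ _ _ _ _ _ H).
by rewrite /derive E; exact: (@derive_val _ _ _ _ _ _ _ H).
Qed.

Definition smooth_with f fx fy :=
  [/\ forall k, Ck k f, ddx f = fx, ddy f = fy,
      forall w : R * R, derivable f w (1, 0) & forall w : R * R, derivable f w (0, 1)].

Lemma smooth_withE f fx fy : continuous f ->
  (forall w : R * R, is_derive w (1, 0) f (fx w)) -> (forall w : R * R, is_derive w (0, 1) f (fy w)) ->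
  (forall k, Ck k fx) -> (forall k, Ck k fy) -> smooth_with f fx fy.
Proof.
move=> cf dx dy Cx Cy.
have Ex : ddx f = fx by apply/funext => w; exact: (@derive_val _ _ _ _ _ _ _ (dx w)).
have Ey : ddy f = fy by apply/funext => w; exact: (@derive_val _ _ _ _ _ _ _ (dy w)).
have D1 w : derivable f w (1, 0) by exact: (@ex_derive _ _ _ _ _ _ _ (dx w)).
have D2 w : derivable f w (0, 1) by exact: (@ex_derive _ _ _ _ _ _ _ (dy w)).
have Cx' k : Ck k (ddx f) by rewrite Ex.
have Cy' k : Ck k (ddy f) by rewrite Ey.
have C k : Ck k f.
  by case: k => [|k]; [exact: (conj cf I)|exact: (conj cf (And4 D1 D2 (Cx' k) (Cy' k)))].
exact: (And5 C Ex Ey D1 D2).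
Qed.

Lemma smooth_with_cst (c : R) : smooth_with (cst c) (cst 0) (cst 0).
Proof.
split; [by move=> k; exact: Ck_cst| | |by move=> w; exact: derivable_cst|by move=> w; exact: derivable_cst];
  by apply/funext => w; exact: derive_cst.
Qed.

Lemma smooth_withD f fx fy g gx gy : smooth_with f fx fy -> smooth_with g gx gy ->
  smooth_with (f \+ g) (fx \+ gx) (fy \+ gy).
Proof.
move=> [C1 <- <- d1 d2] [C2 <- <- d3 d4]; split; [by move=> k; exact: CkD| | | |].
- by apply/funext => w; exact: deriveD.
- by apply/funext => w; exact: deriveD.
- by move=> w; exact: derivableD.
- by move=> w; exact: derivableD.
Qed.

Lemma smooth_withM f fx fy g gx gy : smooth_with f fx fy -> smooth_with g gx gy ->
  smooth_with (f \* g) ((f \* gx) \+ (g \* fx)) ((f \* gy) \+ (g \* fy)).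
Proof.
move=> [C1 <- <- d1 d2] [C2 <- <- d3 d4]; split; [by move=> k; exact: CkM| | | |].
- by apply/funext => w; exact: deriveM.
- by apply/funext => w; exact: deriveM.
- by move=> w; exact: derivableM.
- by move=> w; exact: derivableM.
Qed.

Lemma smooth_with_fst : smooth_with fst (cst 1) (cst 0).
Proof.
apply: smooth_withE.
- by move=> x; exact: cvg_fst.
- by move=> w; apply: is_derive_x; exact: is_derive_id.
- by move=> w; apply: is_derive_y; exact: is_derive_cst.
- by move=> k; exact: Ck_cst.
- by move=> k; exact: Ck_cst.
Qed.

Lemma smooth_with_snd : smooth_with snd (cst 0) (cst 1).
Proof.
apply: smooth_withE.
- by move=> x; exact: cvg_snd.
- by move=> w; apply: is_derive_x; exact: is_derive_cst.
- by move=> w; apply: is_derive_y; exact: is_derive_id.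
- by move=> k; exact: Ck_cst.
- by move=> k; exact: Ck_cst.
Qed.

Definition radial_gap (rho : R) (w : R * R) : R := rho - (w.1 ^+ 2 + w.2 ^+ 2).

Lemma continuous_radial_gap rho : continuous (radial_gap rho).
Proof.
move=> w; apply: cvgB; first exact: cvg_cst.
by apply: cvgD; rewrite expr2; apply: cvgM; first [exact: cvg_fst|exact: cvg_snd].
Qed.

Lemma is_derive_radial_bump d j rho (w : R * R) : 0 < d ->
  is_derive w (1, 0) (flat_bump d j \o radial_gap rho) (flat_bump' d j (radial_gap rho w) * (-2 * w.1)) /\
  is_derive w (0, 1) (flat_bump d j \o radial_gap rho) (flat_bump' d j (radial_gap rho w) * (-2 * w.2)).
Proof.
move=> d0; have sq (c t : R) : is_derive t 1 (fun s : R => rho - (s ^+ 2 + c)) (-2 * t) /\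
    is_derive t 1 (fun s : R => rho - (c + s ^+ 2)) (-2 * t).
  have dX : is_derive t 1 (fun s : R => s ^+ 2) ((2%:R * t ^+ 1) *: 1).
    exact: (@is_deriveX _ _ id 2).
  split.
    apply: (is_derive_eq (is_deriveB (is_derive_cst rho t 1) (is_deriveD dX (is_derive_cst c t 1)))).
    by rewrite /GRing.scale/=; ring.
  apply: (is_derive_eq (is_deriveB (is_derive_cst rho t 1) (is_deriveD (is_derive_cst c t 1) dX))).
  by rewrite /GRing.scale/=; ring.
split.
  apply: is_derive_x; case: w => x y /=.
  exact: (@is_derive1_comp _ (flat_bump d j) _ _ _ _ (is_derive_bump j _ d0) (sq (y ^+ 2) x).1).
apply: is_derive_y; case: w => x y /=.
exact: (@is_derive1_comp _ (flat_bump d j) _ _ _ _ (is_derive_bump j _ d0) (sq (x ^+ 2) y).2).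
Qed.

(** Induction on [k] for all [j] at once, since the derivative of index [j] involves the indices
    [j + 1] and [j + 2]. *)
Lemma Ck_radial_bump d j rho k : 0 < d -> Ck k (flat_bump d j \o radial_gap rho).
Proof.
move=> d0; elim: k j => [|k IH] j.
  split=> // w; apply: continuous_comp; [exact: continuous_radial_gap|exact: continuous_bump].
have D w := is_derive_radial_bump j rho w d0.
split; first by move=> w; apply: continuous_comp; [exact: continuous_radial_gap|exact: continuous_bump].
have C' : Ck k (flat_bump' d j \o radial_gap rho).
  have -> : flat_bump' d j \o radial_gap rho =
    (cst (- j%:R) \* (flat_bump d j.+1 \o radial_gap rho)) \+ (cst d \* (flat_bump d j.+2 \o radial_gap rho)).
    by apply/funext.
  by apply: CkD; apply: CkM => //; exact: Ck_cst.
split.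
- by move=> w; exact: (@ex_derive _ _ _ _ _ _ _ (D w).1).
- by move=> w; exact: (@ex_derive _ _ _ _ _ _ _ (D w).2).
- have -> : ddx (flat_bump d j \o radial_gap rho) = (flat_bump' d j \o radial_gap rho) \* (cst (-2) \* fst).
    by apply/funext => w; exact: (@derive_val _ _ _ _ _ _ _ (D w).1).
  apply: CkM => //; apply: CkM; first exact: Ck_cst.
  by case: smooth_with_fst.
- have -> : ddy (flat_bump d j \o radial_gap rho) = (flat_bump' d j \o radial_gap rho) \* (cst (-2) \* snd).
    by apply/funext => w; exact: (@derive_val _ _ _ _ _ _ _ (D w).2).
  apply: CkM => //; apply: CkM; first exact: Ck_cst.
  by case: smooth_with_snd.
Qed.

Lemma smooth_with_radial_bump d rho : 0 < d ->
  smooth_with (flat_bump d 0 \o radial_gap rho) (fun w => flat_bump' d 0 (radial_gap rho w) * (-2 * w.1))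
    (fun w => flat_bump' d 0 (radial_gap rho w) * (-2 * w.2)).
Proof.
move=> d0; have D w := is_derive_radial_bump 0 rho w d0.
split.
- by move=> k; exact: Ck_radial_bump.
- by apply/funext => w; exact: (@derive_val _ _ _ _ _ _ _ (D w).1).
- by apply/funext => w; exact: (@derive_val _ _ _ _ _ _ _ (D w).2).
- by move=> w; exact: (@ex_derive _ _ _ _ _ _ _ (D w).1).
- by move=> w; exact: (@ex_derive _ _ _ _ _ _ _ (D w).2).
Qed.

End smooth.

(** * Complex test functions and the weak derivative in z *)

Section complex_test_functions.
Local Open Scope complex_scope.
Context {R : realType}.
Local Notation D := (@disc R).
Local Notation A := (area R).

(** Unlike [bmeas], boundedness is asked on the disc only, so that the coordinates qualify. *)
Definition dbmeas (g : R * R -> R) :=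
  measurable_fun setT g /\ exists M : R, forall w, D w -> `|g w| <= M.

Lemma dbmeas_cst (c : R) : dbmeas (cst c).
Proof. by split; [exact: measurable_cst|exists `|c|]. Qed.

Lemma dbmeasD f g : dbmeas f -> dbmeas g -> dbmeas (f \+ g).
Proof.
move=> [mf [M fM]] [mg [N gN]]; split; first exact: measurable_funD.
by exists (M + N) => w Dw; rewrite (le_trans (ler_normD _ _))// lerD ?fM ?gN.
Qed.

Lemma dbmeasM f g : dbmeas f -> dbmeas g -> dbmeas (f \* g).
Proof.
move=> [mf [M fM]] [mg [N gN]]; split; first exact: measurable_funM.
by exists (M * N) => w Dw; rewrite normrM ler_pM ?fM ?gN.
Qed.

Lemma disc_coord (w : R * R) : D w -> `|w.1| <= 1 /\ `|w.2| <= 1.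
Proof.
move=> /disc_modulus w1; split; first exact: le_trans (Re_le_modulus (toC w)) (ltW w1).
exact: le_trans (Im_le_modulus (toC w)) (ltW w1).
Qed.

Lemma dbmeas_fst : dbmeas fst.
Proof. by split; [exact: measurable_fst|exists 1 => w /disc_coord[]]. Qed.

Lemma dbmeas_snd : dbmeas snd.
Proof. by split; [exact: measurable_snd|exists 1 => w /disc_coord[]]. Qed.

Lemma dbmeas_bump (d : R) (j : nat) (rho : R) : 0 < d -> dbmeas (flat_bump d j \o radial_gap rho).
Proof.
move=> d0; split.
  apply: (measurableT_comp (measurable_bump j d0)); apply: measurable_funB => //.
  by apply: measurable_funD; exact: measurable_funX.
have [C C0 H] := bump_le j d0; exists (C * (`|rho| + 1) ^+ 2) => w.
rewrite discE /= => w1; rewrite ger0_norm ?bump_ge0// (le_trans (H _))// ler_wpM2l//.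
rewrite -(real_normK (num_real (radial_gap rho w))) lerXn2r ?nnegrE ?addr_ge0//.
apply: le_trans (ler_normB _ _) _; rewrite lerD2l ger0_norm ?addr_ge0 ?sqr_ge0//.
exact: ltW.
Qed.

(** Partial derivatives are carried as data: the derivative of a concrete test function is assembled
    by the sum and product rules together with its smoothness and bounds. *)
Definition tracked (f fx fy : R * R -> R) :=
  smooth_with f fx fy /\ [/\ dbmeas f, dbmeas fx & dbmeas fy].

Lemma tracked_cst (c : R) : tracked (cst c) (cst 0) (cst 0).
Proof. by split; [exact: smooth_with_cst|split; exact: dbmeas_cst]. Qed.

Lemma trackedD f fx fy g gx gy : tracked f fx fy -> tracked g gx gy ->
  tracked (f \+ g) (fx \+ gx) (fy \+ gy).
Proof.
move=> [s1 [a1 a2 a3]] [s2 [b1 b2 b3]]; split; first exact: smooth_withD.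
by split; exact: dbmeasD.
Qed.

Lemma trackedM f fx fy g gx gy : tracked f fx fy -> tracked g gx gy ->
  tracked (f \* g) ((f \* gx) \+ (g \* fx)) ((f \* gy) \+ (g \* fy)).
Proof.
move=> [s1 [a1 a2 a3]] [s2 [b1 b2 b3]]; split; first exact: smooth_withM.
by split; [exact: dbmeasM|apply: dbmeasD; exact: dbmeasM|apply: dbmeasD; exact: dbmeasM].
Qed.

Lemma tracked_fst : tracked fst (cst 1) (cst 0).
Proof.
split; first exact: smooth_with_fst.
by split; [exact: dbmeas_fst|exact: dbmeas_cst|exact: dbmeas_cst].
Qed.

Lemma tracked_snd : tracked snd (cst 0) (cst 1).
Proof.
split; first exact: smooth_with_snd.
by split; [exact: dbmeas_snd|exact: dbmeas_cst|exact: dbmeas_cst].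
Qed.

Lemma tracked_bump (d rho : R) : 0 < d ->
  tracked (flat_bump d 0 \o radial_gap rho) (fun w => flat_bump' d 0 (radial_gap rho w) * (-2 * w.1))
    (fun w => flat_bump' d 0 (radial_gap rho w) * (-2 * w.2)).
Proof.
move=> d0; have b' : dbmeas (flat_bump' d 0 \o radial_gap rho).
  have -> : flat_bump' d 0 \o radial_gap rho =
    (cst (- 0%:R) \* (flat_bump d 1 \o radial_gap rho)) \+ (cst d \* (flat_bump d 2 \o radial_gap rho)).
    by apply/funext.
  by apply: dbmeasD; apply: dbmeasM; by [exact: dbmeas_cst|exact: dbmeas_bump].
split; first exact: smooth_with_radial_bump.
split; first exact: dbmeas_bump.
- by apply: (dbmeasM b'); apply: (dbmeasM (dbmeas_cst (-2))); exact: dbmeas_fst.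
- by apply: (dbmeasM b'); apply: (dbmeasM (dbmeas_cst (-2))); exact: dbmeas_snd.
Qed.

(* [dPhi] is the Wirtinger derivative in [z] of the smooth function [Phi]. *)
Definition smoothz (Phi dPhi : R * R -> R[i]) := exists p px py q qx qy,
  [/\ tracked p px py, tracked q qx qy, forall w, Phi w = p w +i* q w &
      forall w, dPhi w = ((px w + qy w) / 2) +i* ((qx w - py w) / 2)].

Lemma eq_smoothz Phi dPhi Psi dPsi : smoothz Phi dPhi -> (forall w, Phi w = Psi w) ->
  (forall w, dPhi w = dPsi w) -> smoothz Psi dPsi.
Proof.
move=> [p [px [py [q [qx [qy [tp tq E dE]]]]]]] E1 E2.
by exists p, px, py, q, qx, qy; split => // w; rewrite -?E1 -?E2.
Qed.

Lemma smoothz_cst (c : R[i]) : smoothz (fun=> c) (fun=> 0).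
Proof.
exists (cst (complex.Re c)), (cst 0), (cst 0), (cst (complex.Im c)), (cst 0), (cst 0).
split; [exact: tracked_cst|exact: tracked_cst|by case: c|].
by move=> w /=; rewrite addr0 subr0 mul0r.
Qed.

Lemma smoothz_toC : smoothz (@toC R) (fun=> 1).
Proof.
exists fst, (cst 1), (cst 0), snd, (cst 0), (cst 1).
split; [exact: tracked_fst|exact: tracked_snd|by []|].
by move=> w /=; rewrite subr0 mul0r; congr (_ +i* _); field.
Qed.

Lemma smoothz_conj : smoothz (fun w => (@toC R w)^*) (fun=> 0).
Proof.
have t := trackedM (tracked_cst (-1)) tracked_snd.
do 3 eexists; exists (cst (-1) \* snd); do 2 eexists; split; [exact: tracked_fst|exact: t| |].
  by move=> w /=; rewrite mulN1r.
by move=> w /=; congr (_ +i* _); field.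
Qed.

Lemma smoothzD P dP Q dQ : smoothz P dP -> smoothz Q dQ ->
  smoothz (fun w => P w + Q w) (fun w => dP w + dQ w).
Proof.
move=> [p [px [py [q [qx [qy [tp tq E dE]]]]]]] [s [sx [sy [t [tx [ty [ts tt E' dE']]]]]]].
do 6 eexists; split; [exact: (trackedD tp ts)|exact: (trackedD tq tt)| |].
  by move=> w; rewrite E E'; simpc.
by move=> w; rewrite dE dE'; simpc => /=; congr (_ +i* _); field.
Qed.

Lemma smoothzM P dP Q dQ : smoothz P dP -> smoothz Q dQ ->
  smoothz (fun w => P w * Q w) (fun w => P w * dQ w + Q w * dP w).
Proof.
move=> [p [px [py [q [qx [qy [tp tq E dE]]]]]]] [s [sx [sy [t [tx [ty [ts tt E' dE']]]]]]].
have r1 := trackedD (trackedM tp ts) (trackedM (tracked_cst (-1)) (trackedM tq tt)).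
have r2 := trackedD (trackedM tp tt) (trackedM tq ts).
do 6 eexists; split; [exact: r1|exact: r2| |].
  by move=> w; rewrite E E'; simpc => /=; congr (_ +i* _); ring.
by move=> w; rewrite E E' dE dE'; simpc => /=; congr (_ +i* _); field.
Qed.

Lemma smoothz_bump (d rho : R) : 0 < d ->
  smoothz (fun w => (flat_bump d 0 (radial_gap rho w))%:C)
    (fun w => - (flat_bump' d 0 (radial_gap rho w))%:C * (toC w)^*).
Proof.
move=> d0; have t := tracked_bump rho d0.
exists (flat_bump d 0 \o radial_gap rho); do 2 eexists; exists (cst 0), (cst 0), (cst 0).
split; [exact: t|exact: tracked_cst|by []|].
by move=> w /=; simpc => /=; congr (_ +i* _); field.
Qed.

Lemma smoothz_conjX n : smoothz (fun w => (@toC R w)^* ^+ n) (fun=> 0).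
Proof.
elim: n => [|n IH]; first by apply: eq_smoothz (smoothz_cst 1) _ _ => w.
apply: eq_smoothz (smoothzM smoothz_conj IH) _ _ => w; first by rewrite exprS.
by rewrite !mulr0 addr0.
Qed.

Lemma test_function_tracked f fx fy (rho : R) : tracked f fx fy -> rho < 1 ->
  (forall w, f w != 0 -> w.1 ^+ 2 + w.2 ^+ 2 <= rho) -> test_function f.
Proof.
move=> tf rho1 H; have [[C _ _ _ _] _] := tf.
pose K := radial_gap rho @^-1` `[0, +oo[%classic.
have clK : closed K.
  apply: preimage_closed; first by move=> w _; exact: continuous_radial_gap.
  exact: interval_closed.
have sub : closure [set w | f w != 0] `<=` K.
  rewrite (closure_id K).1//; apply: closure_subset => w /= fw.
  by rewrite /K/= in_itv/= andbT subr_ge0; exact: H.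
have KE w : K w -> w.1 ^+ 2 + w.2 ^+ 2 <= rho.
  by rewrite /K/= in_itv/= andbT subr_ge0.
split; first exact: C.
  have cS : compact (`[-1, 1]%classic `*` `[-1, 1]%classic : set (R * R)).
    exact: (compact_setX (@segment_compact R (-1) 1) (@segment_compact R (-1) 1)).
  have subS : closure [set w : R * R | f w != 0] `<=` `[-1, 1]%classic `*` `[-1, 1]%classic.
    move=> w /sub/KE Kw; have w1 := sqr_ge0 w.1; have w2 := sqr_ge0 w.2.
    by split; rewrite /= in_itv/=; apply/andP; split; nra.
  have cl : closed (closure [set w : R * R | f w != 0]) by exact: closed_closure.
  exact: (subclosed_compact cl cS subS).
by move=> w /sub/KE Kw; rewrite discE/=; exact: le_lt_trans rho1.
Qed.

Lemma invC2 : (2 : R[i])^-1 = (2^-1 : R)%:C.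
Proof. by rewrite -(rmorph_nat (real_complex R) 2) -(fmorphV (real_complex R)). Qed.

Lemma cintegrable_dbmeas V (g : R * R -> R) : cintegrable D V -> dbmeas g ->
  cintegrable D (fun w => V w * (g w)%:C).
Proof.
move=> iV [mg [M gM]]; apply: (cintegrableM iV (cmeas_real mg)).
by exists M => w Dw; rewrite modulus_real gM.
Qed.

(** The weak derivatives are tested against the real and imaginary parts of [P], which are real test
    functions, and the four identities are recombined with the coefficients [1 / 2] and ['i / 2]. *)
Lemma disc_by_parts (f fx fy : R[i] -> R[i]) P dP (rho : R) :
  sobolev11 f fx fy -> smoothz P dP -> rho < 1 ->
  (forall w, P w != 0 -> w.1 ^+ 2 + w.2 ^+ 2 <= rho) ->
  cintegral D (fun w => f (toC w) * dP w) = - cintegral D (fun w => dz fx fy (toC w) * P w).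
Proof.
move=> [fi fxi fyi W] [p [px [py [q [qx [qy [tp tq E dE]]]]]]] rho1 supp.
have [[_ pxE pyE _ _] [bp bpx bpy]] := tp; have [[_ qxE qyE _ _] [bq bqx bqy]] := tq.
have tfp : test_function p.
  apply: (test_function_tracked tp rho1) => w pw; apply: supp; rewrite E eq_complex/=.
  by rewrite negb_and pw.
have tfq : test_function q.
  apply: (test_function_tracked tq rho1) => w qw; apply: supp; rewrite E eq_complex/=.
  by rewrite negb_and qw orbT.
have [px1 py1] := W p tfp; have [qx1 qy1] := W q tfq.
rewrite pxE in px1; rewrite pyE in py1; rewrite qxE in qx1; rewrite qyE in qy1.
have I g := @cintegrable_dbmeas (f \o @toC R) g fi.
have Ix g := @cintegrable_dbmeas (fx \o @toC R) g fxi.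
have Iy g := @cintegrable_dbmeas (fy \o @toC R) g fyi.
have i1 := I _ bpx; have i2 := I _ bqy; have i3 := I _ bqx; have i4 := I _ bpy.
have j1 := Ix _ bp; have j2 := Iy _ bq; have j3 := Ix _ bq; have j4 := Iy _ bp.
pose c1 : R[i] := 2^-1; pose c2 : R[i] := 'i / 2.
have L : cintegral D (fun w => f (toC w) * dP w) =
  (cintegral D (fun w => f (toC w) * (px w)%:C) + cintegral D (fun w => f (toC w) * (qy w)%:C)) * c1 +
  (cintegral D (fun w => f (toC w) * (qx w)%:C) - cintegral D (fun w => f (toC w) * (py w)%:C)) * c2.
  rewrite -(cintegralD i1 i2) -(cintegralB i3 i4).
  have k1 := cintegrableD i1 i2; have k2 := cintegrableB i3 i4.
  rewrite -(cintegralZ c1 k1) -(cintegralZ c2 k2).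
  rewrite -(cintegralD (cintegrableZ c1 k1) (cintegrableZ c2 k2)).
  apply: eq_cintegral => w _ /=; rewrite dE /c1 /c2; case: (f (toC w)) => a b.
  rewrite invC2.
  by simpc => /=; congr (_ +i* _); field.
have Rr : cintegral D (fun w => dz fx fy (toC w) * P w) =
  (cintegral D (fun w => fx (toC w) * (p w)%:C) + cintegral D (fun w => fy (toC w) * (q w)%:C)) * c1 +
  (cintegral D (fun w => fx (toC w) * (q w)%:C) - cintegral D (fun w => fy (toC w) * (p w)%:C)) * c2.
  rewrite -(cintegralD j1 j2) -(cintegralB j3 j4).
  have k1 := cintegrableD j1 j2; have k2 := cintegrableB j3 j4.
  rewrite -(cintegralZ c1 k1) -(cintegralZ c2 k2).
  rewrite -(cintegralD (cintegrableZ c1 k1) (cintegrableZ c2 k2)).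
  apply: eq_cintegral => w _ /=; rewrite E /dz /c1 /c2.
  case: (fx (toC w)) => a b; case: (fy (toC w)) => a' b'.
  rewrite invC2.
  by simpc => /=; congr (_ +i* _); field.
rewrite L Rr px1 py1 qx1 qy1; ring.
Qed.

End complex_test_functions.

(** * The radial cutoff and its boundary term *)

Section cutoff.
Local Open Scope complex_scope.
Context {R : realType}.
Local Notation D := (@disc R).
Local Notation A := (area R).
Local Notation mu := (@lebesgue_measure R).
Local Notation J := (`[0, 2 * pi]%classic : set R).

Let mD : measurable (D : set (measurableTypeR R * measurableTypeR R)).
Proof. exact: measurable_disc. Qed.

(** The parameter [d] plays two roles: it keeps the support away from the unit circle, and it scales
    the exponent, so that the cutoff tends to 1 at every point of the disc as [d] tends to 0. *)
Definition cutoff (d : R) (w : R * R) : R := flat_bump d 0 (radial_gap (1 - d) w).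
Definition cutoff' (d : R) (w : R * R) : R := flat_bump' d 0 (radial_gap (1 - d) w).

Lemma bump'0E (d t : R) : flat_bump' d 0 t = d * flat_bump d 2 t.
Proof. by rewrite /flat_bump' oppr0 mul0r add0r. Qed.

Lemma cutoff'_ge0 d w : 0 < d -> 0 <= cutoff' d w.
Proof. by move=> d0; rewrite /cutoff' bump'0E mulr_ge0 ?bump_ge0// ltW. Qed.

Lemma bump0_le1 (d t : R) : 0 < d -> flat_bump d 0 t <= 1.
Proof.
move=> d0; rewrite /flat_bump; case: ltP => // t0.
by rewrite expr0 mul1r -expR0 ler_expR mulNr oppr_le0 divr_ge0// ltW.
Qed.

Lemma bump2_le (d t c : R) : 0 < d -> 0 < c -> c <= t -> flat_bump d 2 t <= c^-1 ^+ 2.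
Proof.
move=> d0 c0 ct; have t0 : 0 < t by exact: lt_le_trans ct.
rewrite /flat_bump t0; apply: (@le_trans _ _ (t^-1 ^+ 2)).
  rewrite ler_piMr ?exprn_ge0 ?invr_ge0 ?(ltW t0)//.
  by rewrite -expR0 ler_expR mulNr oppr_le0 divr_ge0// ltW.
by rewrite lerXn2r ?nnegrE ?invr_ge0 ?(ltW t0) ?(ltW c0)// lef_pV2.
Qed.

Lemma measurable_cutoff' d : 0 < d -> measurable_fun setT (cutoff' d).
Proof.
move=> d0; rewrite (_ : cutoff' d = fun w => d * flat_bump d 2 (radial_gap (1 - d) w)).
  apply: measurable_funM => //; exact: (dbmeas_bump 2 (1 - d) d0).1.
by apply/funext => w; rewrite /cutoff' bump'0E.
Qed.

Lemma mean1_bound (f : R[i] -> R[i]) (e : R) : 0 < e ->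
  (\forall r \near 1^'-, (integral_mean 1 r f <= (e * (1 - r)^-1)%:E)%E) ->
  exists r0 : R, 0 < r0 < 1 /\ forall r, r0 < r < 1 ->
    (\int[mu]_(t in J) (modulus (f (polar r t)))%:E <= (2 * pi * e / (1 - r))%:E)%E.
Proof.
move=> e0 [d /= d0 H].
exists (Num.max (1 - d) 2^-1); split.
  by rewrite lt_max gt_max; apply/andP; split; [apply/orP; right; lra|apply/andP; split; lra].
move=> r /andP[]; rewrite gt_max => /andP[dr _] r1.
have : (integral_mean 1 r f <= (e * (1 - r)^-1)%:E)%E.
  by apply: H => //=; rewrite ger0_norm; lra.
have pi2 : 0 < 2 * pi :> R by rewrite mulr_gt0 ?pi_gt0.
rewrite /integral_mean /circle_norm invr1 poweRe1; last first.
  apply: mule_ge0; first by rewrite lee_fin invr_ge0 ltW.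
  by apply: integral_ge0 => t _; exact: poweR_ge0.
rewrite -(lee_pdivlMl _ _ (_ : 0 < (2 * pi)^-1)%R) ?invr_gt0// invrK.
move=> H1; rewrite -mulrA EFinM; apply: le_trans H1.
rewrite le_eqVlt; apply/orP; left; apply/eqP; apply: eq_integral => t _.
by rewrite abse_EFin poweRe1// ger0_norm ?modulus_ge0// lee_fin modulus_ge0.
Qed.

Lemma continuous_one_sub_sqr (d : R) : continuous (fun x : R => 1 - d - x ^+ 2).
Proof.
by move=> x; apply: cvgB; [exact: cvg_cst|rewrite expr2; apply: cvgM; exact: cvg_id].
Qed.

(** The integrand is the derivative of [- 1 / 2] times the cutoff along a radius, and the cutoff
    stays between 0 and 1; this is why the bound does not depend on [d]. *)
Lemma radial_integral (d : R) : 0 < d ->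
  (\int[mu]_(x in `[0%R, 1%R]) (x * (d * flat_bump d 2 (1 - d - x ^+ 2)))%:E <= (2^-1)%:E)%E.
Proof.
move=> d0.
have dF (x : R) : is_derive x 1 (fun x : R => - 2^-1 * flat_bump d 0 (1 - d - x ^+ 2))
    (x * (d * flat_bump d 2 (1 - d - x ^+ 2))).
  have dX : is_derive x 1 (fun s : R => s ^+ 2) ((2%:R * x ^+ 1) *: 1).
    exact: (@is_deriveX _ _ id 2).
  have dS : is_derive x 1 (fun s : R => 1 - d - s ^+ 2) (- 2 * x).
    apply: (is_derive_eq (is_deriveB (is_derive_cst (1 - d) x 1) dX)).
    by rewrite /GRing.scale/=; ring.
  have dB : is_derive x 1 (fun x : R => flat_bump d 0 (1 - d - x ^+ 2))
      (flat_bump' d 0 (1 - d - x ^+ 2) * (- 2 * x)).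
    exact: (@is_derive1_comp _ (flat_bump d 0) (fun s : R => 1 - d - s ^+ 2) x _ _
      (is_derive_bump 0 (1 - d - x ^+ 2) d0) dS).
  have dZ : is_derive x 1 (fun x : R => - 2^-1 * flat_bump d 0 (1 - d - x ^+ 2))
      (- 2^-1 *: (flat_bump' d 0 (1 - d - x ^+ 2) * (- 2 * x))).
    exact: is_deriveZ.
  by apply: (is_derive_eq dZ); rewrite bump'0E /GRing.scale/=; field.
have cf : continuous (fun x : R => x * (d * flat_bump d 2 (1 - d - x ^+ 2))).
  have cs := @continuous_one_sub_sqr d.
  have cb : continuous (flat_bump d 2 \o (fun x : R => 1 - d - x ^+ 2)).
    move=> x; apply: continuous_comp; first exact: cs.
    by apply: continuous_bump.
  move=> x; apply: cvgM; first exact: cvg_id.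
  by apply: cvgM; [exact: cvg_cst|exact: cb].
rewrite (FTC2_is_derive ltr01 dF cf) lee_fin.
have := bump_ge0 d 0 (1 - d - 1 ^+ 2); have := bump0_le1 (1 - d - 0 ^+ 2) d0; lra.
Qed.

Definition abs_disc (f : R[i] -> R[i]) : R * R -> R := (fun w => modulus (f (toC w))) \_ D.

Lemma abs_disc_ge0 f w : 0 <= abs_disc f w.
Proof. by rewrite /abs_disc patchE; case: ifP => // _; exact: modulus_ge0. Qed.

Lemma measurable_abs_disc f : cintegrable D (f \o @toC R) -> measurable_fun setT (abs_disc f).
Proof.
move=> fi; apply/(measurable_restrictT _ mD).
by apply/measurable_EFinP; exact: measurable_int (integrable_modulus fi).
Qed.

Lemma l1E (V : R * R -> R[i]) : cintegrable D V ->
  (l1 V)%:E = (\int[A]_(w in D) (modulus (V w))%:E)%E.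
Proof.
move=> iV; rewrite /l1 /Rintegral fineK//.
exact: integrable_fin_num (integrable_modulus iV).
Qed.

Lemma integral_abs_disc f : cintegrable D (f \o @toC R) ->
  (\int[A]_w (abs_disc f w)%:E = (l1 (f \o @toC R))%:E)%E.
Proof.
move=> fi; rewrite l1E// [RHS]integral_mkcond; apply: eq_integral => w _.
by rewrite /abs_disc !patchE; case: ifP.
Qed.

Lemma measurable_cutoff_integrand f d : cintegrable D (f \o @toC R) -> 0 < d ->
  measurable_fun setT (fun w => abs_disc f w * (cutoff' d w * (1 - (w.1 ^+ 2 + w.2 ^+ 2)))).
Proof.
move=> fi d0; apply: measurable_funM; first exact: measurable_abs_disc.
apply: measurable_funM; first exact: measurable_cutoff'.
by apply: measurable_funB => //; apply: measurable_funD; exact: measurable_funX.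
Qed.

Lemma cutoff_error (f : R[i] -> R[i]) : cintegrable D (f \o @toC R) ->
  (forall e : R, 0 < e ->
     \forall r \near 1^'-, (integral_mean 1 r f <= (e * (1 - r)^-1)%:E)%E) ->
  forall ka : R, 0 < ka -> exists2 d0 : R, 0 < d0 & forall d, 0 < d <= d0 ->
  (\int[A]_w (abs_disc f w * (cutoff' d w * (1 - (w.1 ^+ 2 + w.2 ^+ 2))))%:E <= ka%:E)%E.
Proof.
move=> fi Hf ka ka0; have pi0 := pi_gt0 R.
(* The annulus contributes [4 * pi * e] times the radial mass 1/2, that is [ka / 4]. *)
pose e := ka / (8 * pi); have e0 : 0 < e by rewrite divr_gt0// mulr_gt0.
have [r0 [/andP[r00 r01] Hr]] := mean1_bound e0 (Hf e e0).
(* For [d <= c] the gap [1 - d - |w|^2] is still at least [c] when [|w| <= r0]. *)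
have [c [c0 c1 cE]] : exists c : R, [/\ 0 < c, c <= 1 & c = (1 - r0 ^+ 2) / 2].
  exists ((1 - r0 ^+ 2) / 2); have : r0 ^+ 2 < 1 by rewrite expr_lt1// ltW.
  by have := sqr_ge0 r0; split => //; lra.
set L := l1 (f \o @toC R); have L0 : 0 <= L by exact: l1_ge0.
have L1 : 0 < L + 1 by rewrite ltr_wpDl.
exists (Num.min c (ka * c ^+ 2 / (4 * (L + 1)))).
  by rewrite lt_min c0 divr_gt0 ?mulr_gt0// exprn_gt0.
move=> d /andP[d0]; rewrite le_min => /andP[dc dk].
have mg := measurable_cutoff' d0.
have mabs := measurable_abs_disc fi.
pose sq (w : R * R) := w.1 ^+ 2 + w.2 ^+ 2.
have msq : measurable_fun setT sq by apply: measurable_funD; exact: measurable_funX.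
have sqD w : ~ D w -> abs_disc f w = 0.
  by move=> nD; rewrite /abs_disc patchE memNset.
have abs1 w : 0 <= abs_disc f w * (1 - sq w).
  have [Dw|nD] := pselect (D w); last by rewrite sqD// mul0r.
  rewrite mulr_ge0 ?abs_disc_ge0// subr_ge0 ltW//.
  by move: Dw; rewrite discE.
pose I1 (w : R * R) : R := (r0 ^+ 2 < sq w)%R%:R.
have mI1 : measurable_fun setT I1.
  have -> : I1 = \1_[set w : R * R | r0 ^+ 2 < sq w].
    by apply/funext => w; rewrite indicE /I1; case: ltP => H; [rewrite mem_set|rewrite memNset//= ltNge H].
  apply: measurable_indic; rewrite -[X in measurable X]setTI.
  by apply: (measurable_fun_ltr (f := cst (r0 ^+ 2)) (g := sq)) => //; exact: measurable_cst.
have I10 w : 0 <= I1 w <= 1 by rewrite /I1; case: ltP; rewrite lexx ler01.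
pose G0 w := abs_disc f w * (d * c^-1 ^+ 2).
pose G1 w := I1 w * (abs_disc f w * (cutoff' d w * (1 - sq w))).
have G00 w : 0 <= G0 w.
  by rewrite mulr_ge0 ?abs_disc_ge0// mulr_ge0 ?(ltW d0)// exprn_ge0// invr_ge0 ltW.
have Gp w : 0 <= abs_disc f w * (cutoff' d w * (1 - sq w)).
  by rewrite mulrCA mulr_ge0 ?cutoff'_ge0.
have G10 w : 0 <= G1 w by rewrite mulr_ge0//; case/andP: (I10 w).
have mG0 : measurable_fun setT G0 by exact: measurable_funM.
have mGp : measurable_fun setT (fun w => abs_disc f w * (cutoff' d w * (1 - sq w))).
  exact: measurable_cutoff_integrand.
have mG1 : measurable_fun setT G1 by exact: measurable_funM.
have split01 w : abs_disc f w * (cutoff' d w * (1 - sq w)) <= G0 w + G1 w.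
  rewrite /G1 /I1; case: ltP => H; first by rewrite mul1r lerDr.
  rewrite mul0r addr0 /G0; have [Dw|nD] := pselect (D w); last by rewrite sqD// !mul0r.
  apply: ler_wpM2l; first exact: abs_disc_ge0.
  have s0 : 0 <= sq w by rewrite addr_ge0 ?sqr_ge0.
  apply: (@le_trans _ _ (cutoff' d w)).
    by rewrite ler_piMr ?cutoff'_ge0// gerBl.
  rewrite /cutoff' bump'0E ler_wpM2l ?(ltW d0)//; apply: bump2_le => //.
  rewrite /radial_gap -/(sq w); lra.
apply: (@le_trans _ _ (\int[A]_w ((G0 w)%:E + (G1 w)%:E))%E).
  apply: ge0_le_integral => //.
  - by move=> w _; rewrite lee_fin.
  - exact/measurable_EFinP.
  - by apply: emeasurable_funD; exact/measurable_EFinP.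
  - by move=> w _; rewrite -EFinD lee_fin.
rewrite ge0_integralD//; last 4 first.
- by move=> w _; rewrite lee_fin.
- exact/measurable_EFinP.
- by move=> w _; rewrite lee_fin.
- exact/measurable_EFinP.
have first : (\int[A]_w (G0 w)%:E <= (ka / 4)%:E)%E.
  rewrite /G0; under eq_integral do rewrite EFinM.
  rewrite ge0_integralZr//; last 3 first.
  - exact/measurable_EFinP.
  - by move=> w _; rewrite lee_fin abs_disc_ge0.
  - by rewrite lee_fin mulr_ge0 ?(ltW d0)// exprn_ge0// invr_ge0 ltW.
  rewrite integral_abs_disc// -/L -EFinM lee_fin.
  move: dk; rewrite ler_pdivlMr ?mulr_gt0// => dk.
  have c2 : 0 < c ^+ 2 by rewrite exprn_gt0.
  rewrite exprVn mulrA ler_pdivrMr//; move: dk d0 L0; clear; nra.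
have pe0 : 0 <= 4 * pi * e by apply: mulr_ge0; [rewrite mulr_ge0// ltW|exact: ltW].
have second : (\int[A]_w (G1 w)%:E <= (ka / 4)%:E)%E.
  apply: le_trans (polar_le _ _ _) _.
  - exact/measurable_EFinP.
  - by move=> w; rewrite lee_fin.
  - by move=> w nD; rewrite /G1 sqD// mul0r mulr0.
  have mpm := @measurable_polar_map R.
  pose b x := x * (d * flat_bump d 2 (1 - d - x ^+ 2)) : R.
  pose k x := \1_(`]r0, 1[%classic) x * (b x * (2 * (1 - x))).
  have b0 x : 0 <= x -> 0 <= b x.
    by move=> x0; rewrite mulr_ge0// mulr_ge0 ?bump_ge0// ltW.
  have k0 x : 0 <= k x.
    rewrite /k indicE; have [|_] := boolP (x \in _); last by rewrite mul0r.
    rewrite mem_setE in_itv/= => /andP[x0 x1]; rewrite mul1r.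
    by rewrite mulr_ge0 ?b0 ?mulr_ge0 ?subr_ge0// ltW// (lt_trans r00).
  have mb : measurable_fun setT b.
    apply: measurable_funM => //; apply: measurable_funM => //.
    apply: (measurableT_comp (measurable_bump 2 d0)).
    by apply: continuous_measurable_fun; exact: (@continuous_one_sub_sqr d).
  have mk : measurable_fun setT k.
    apply: measurable_funM; first exact: measurable_indic.
    apply: measurable_funM => //; apply: measurable_funM => //; exact: measurable_funB.
  rewrite area_tonelli; last 2 first.
  - apply: emeasurable_funM.
      apply/measurable_EFinP; apply: measurable_funM => //.
      exact: measurable_indic measurable_polar_rect.
    by apply/measurable_EFinP; exact: (measurableT_comp mG1 mpm).
  - move=> u; rewrite mule_ge0 ?lee_fin// indicE; have [|_] := boolP (u \in polar_rect).
      by rewrite inE => -[/andP[u0 _] _]; rewrite mul1r ltW.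
    by rewrite mul0r.
  have polarE x y : toC (polar_map (x, y)) = polar x y :> R[i] by [].
  have Dpol x y : r0 < x < 1 -> D (polar_map (x, y)).
    move=> /andP[x0 x1]; rewrite /disc /cdisc/= polarE modulus_polar ger0_norm//.
    by rewrite ltW// (lt_trans r00).
  have sqE x y : sq (polar_map (x, y)) = x ^+ 2.
    by rewrite /sq /polar_map/= !exprMn -mulrDr cos2Dsin2 mulr1.
  have inner x : r0 < x < 1 -> measurable_fun setT (fun y => abs_disc f (polar_map (x, y))).
    by move=> _; apply: (measurableT_comp mabs); apply: (measurableT_comp mpm); exact: measurable_prodmk1.
  apply: (@le_trans _ _ (\int[mu]_x (\1_(`[0, 1]%classic : set R) x * (4 * pi * e * b x))%:E)%E).
    apply: ge0_le_integral => //.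
    - move=> x _; apply: integral_ge0 => y _.
      rewrite mule_ge0 ?lee_fin// indicE; have [|_] := boolP ((x, y) \in polar_rect).
        by rewrite inE => -[/andP[u0 _] _]; rewrite mul1r ltW.
      by rewrite mul0r.
    - apply: (measurable_fun_fubini_tonelli_F (m2 := mu) (fun u : R * R =>
        (\1_polar_rect u * u.1)%:E * (G1 (polar_map u))%:E)%E).
        apply: emeasurable_funM.
          apply/measurable_EFinP; apply: measurable_funM => //.
          exact: measurable_indic measurable_polar_rect.
        by apply/measurable_EFinP; exact: (measurableT_comp mG1 mpm).
      move=> u; rewrite mule_ge0 ?lee_fin// indicE; have [|_] := boolP (u \in polar_rect).
        by rewrite inE => -[/andP[u0 _] _]; rewrite mul1r ltW.
      by rewrite mul0r.
    - apply/measurable_EFinP; apply: measurable_funM; first exact: measurable_indic.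
      by apply: measurable_funM.
    move=> x _.
    have R0 : 0 <= \1_(`[0, 1]%classic : set R) x * (4 * pi * e * b x).
      rewrite indicE; have [|_] := boolP (x \in _); last by rewrite mul0r.
      rewrite mem_setE in_itv/= => /andP[x0 x1]; rewrite mul1r mulr_ge0 ?b0//.
    have [/andP[x0 x1]|nx] := boolP (0 < x < 1); last first.
      rewrite integral0_eq ?lee_fin// => y _; rewrite indicE memNset ?mul0r ?mul0e//.
      by move=> [xx _]; move: nx; rewrite xx.
    have [xr|rx] := leP x r0.
      rewrite integral0_eq ?lee_fin// => y _; rewrite /G1 /I1 sqE ltNge.
      by rewrite lerXn2r ?nnegrE ?(ltW x0) ?(ltW r00)//= mul0r mule0.
    have xr1 : r0 < x < 1 by rewrite rx.
    apply: (@le_trans _ _ ((b x * (2 * (1 - x)))%:E * \int[mu]_(y in J) (modulus (f (polar x y)))%:E)%E).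
      have bx0 : 0 <= b x * (2 * (1 - x)) by rewrite mulr_ge0 ?b0 ?(ltW x0)// mulr_ge0// subr_ge0 ltW.
      have mJf : measurable_fun J (fun y => (modulus (f (polar x y)))%:E).
        apply/measurable_EFinP; apply: measurable_funTS.
        rewrite (_ : (fun y => _) = fun y => abs_disc f (polar_map (x, y))); first exact: inner.
        by apply/funext => y; rewrite /abs_disc patchE mem_set//; exact: Dpol.
      rewrite -ge0_integralZl//; last by move=> y _; rewrite lee_fin modulus_ge0.
        rewrite [leRHS]integral_mkcond; apply: ge0_le_integral => //.
        + move=> y _; rewrite mule_ge0 ?lee_fin// indicE; have [|_] := boolP ((x, y) \in polar_rect).
            by rewrite inE => -[/andP[u0 _] _]; rewrite mul1r ltW.
          by rewrite mul0r.
        + apply: emeasurable_funM.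
            apply/measurable_EFinP; apply: measurable_funM => //.
            apply: (measurableT_comp (measurable_indic measurable_polar_rect)).
            exact: measurable_prodmk1.
          apply/measurable_EFinP; apply: (measurableT_comp mG1); apply: (measurableT_comp mpm).
          exact: measurable_prodmk1.
        + apply/(measurable_restrictT _ (measurable_itv _)).
          by apply: emeasurable_funM => //; exact: measurable_cst.
        move=> y _; rewrite patchE indicE polar_rectE in_setX/=.
        rewrite [x \in _]mem_set/= ?in_itv/= ?x0//; case: ifPn => yJ; last by rewrite mul0r mul0e.
        rewrite mul1r -!EFinM lee_fin /G1 /I1 sqE /abs_disc patchE [polar_map _ \in D]mem_set ?polarE; last exact: Dpol.
        have -> : r0 ^+ 2 < x ^+ 2 by rewrite ltrXn2r ?nnegrE ?(ltW x0) ?(ltW r00).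
        rewrite mul1r mulrCA mulrC; apply: ler_wpM2r; first exact: modulus_ge0.
        rewrite /cutoff' bump'0E /radial_gap -/(sq _) sqE.
        have -> : b x * (2 * (1 - x)) = x * (d * flat_bump d 2 (1 - d - x ^+ 2) * (2 * (1 - x))).
          by rewrite /b !mulrA.
        apply: ler_wpM2l; first exact: ltW.
        apply: ler_wpM2l; first by rewrite mulr_ge0 ?bump_ge0// ltW.
        nra.
    have bx0 : 0 <= b x * (2 * (1 - x)) by rewrite mulr_ge0 ?b0 ?(ltW x0)// mulr_ge0// subr_ge0 ltW.
    apply: le_trans.
      by apply: lee_wpmul2l (Hr x xr1); rewrite lee_fin.
    rewrite -EFinM lee_fin indicE mem_set/= ?in_itv/= ?(ltW x0) ?(ltW x1)// mul1r.
    rewrite le_eqVlt; apply/orP; left; apply/eqP; field.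
    by rewrite gt_eqF// subr_gt0.
  have -> : (\int[mu]_x (\1_(`[0, 1]%classic : set R) x * (4 * pi * e * b x))%:E)%E =
     ((4 * pi * e)%:E * \int[mu]_(x in `[0%R, 1%R]) (b x)%:E)%E.
    rewrite -ge0_integralZl//; last 2 first.
    - by apply/measurable_EFinP; exact: measurable_funTS.
    - by move=> x /=; rewrite in_itv/= => /andP[x0 _]; rewrite lee_fin b0.
    rewrite [RHS]integral_mkcond; apply: eq_integral => x _.
    by rewrite epatch_indic -!EFinM; congr EFin; ring.
  apply: le_trans.
    apply: lee_wpmul2l (radial_integral d0).
    by rewrite lee_fin pe0.
  rewrite -EFinM lee_fin /e.
  have E8 (P : R) : 0 < P -> 4 * P * (ka / (8 * P)) * 2^-1 = ka / 4.
    by move=> P0; field; rewrite gt_eqF.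
  by rewrite E8.
apply: le_trans (leeD first second) _; rewrite -EFinD lee_fin; lra.
Qed.

Lemma cutoff_cvg (h : R * R -> R) : A.-integrable D (EFin \o h) -> (forall w, D w -> 0 <= h w) ->
  forall ka : R, 0 < ka -> exists N : nat, forall n, (N <= n)%N ->
  (\int[A]_(w in D) (h w * (1 - cutoff n.+2%:R^-1 w)))%R <= ka.
Proof.
move=> ih h0 ka ka0.
pose f_ (n : nat) (w : R * R) : \bar R := (h w * (1 - cutoff n.+2%:R^-1 w))%:E.
have n0 n : 0 < n.+2%:R^-1 :> R by rewrite invr_gt0.
have mh : measurable_fun D h by apply/measurable_EFinP; exact: measurable_int ih.
have mf_ n : measurable_fun D (f_ n).
  apply/measurable_EFinP; apply: measurable_funM => //; apply: measurable_funTS.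
  by apply: measurable_funB => //; exact: (dbmeas_bump 0 _ (n0 n)).1.
have c01 n w : 0 <= 1 - cutoff n.+2%:R^-1 w <= 1.
  by rewrite subr_ge0 bump0_le1//= gerBl bump_ge0.
have bound n w : D w -> (`|f_ n w| <= (h w)%:E)%E.
  move=> Dw; have /andP[a b] := c01 n w.
  by rewrite /f_ lee_fin ger0_norm ?mulr_ge0 ?h0// ler_piMr ?h0.
have cv w : D w -> f_ ^~ w @ \oo --> 0%E.
  move=> Dw; have s1 : 0 < 1 - (w.1 ^+ 2 + w.2 ^+ 2).
    by rewrite subr_gt0; move: Dw; rewrite discE.
  set g := 1 - _ in s1.
  apply: cvg_EFin; first exact: nearW.
  apply/cvgr0Pnorm_le => e e0.
  have hw := h0 w Dw.
  have P0 : 0 < Num.min (g / 2) (e * (g / 2) / (h w + 1)).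
    by rewrite lt_min !divr_gt0 ?mulr_gt0 ?divr_gt0// ltr_wpDl.
  near=> n.
  have : n.+2%:R^-1 <= Num.min (g / 2) (e * (g / 2) / (h w + 1)) :> R.
    near: n; exists (Num.truncn (Num.min (g / 2) (e * (g / 2) / (h w + 1)))^-1).+1 => // n /= Nn.
    rewrite -[leRHS]invrK lef_pV2 ?posrE ?invr_gt0//.
    apply: le_trans (ltW (truncnS_gt _)) _; rewrite ler_nat.
    by rewrite (leq_trans Nn)// ltnW.
  rewrite le_min => /andP[d1 d2]; have d0 := n0 n.
  set d := n.+2%:R^-1 in d0 d1 d2 *.
  have gap : g / 2 <= radial_gap (1 - d) w by rewrite /radial_gap /g; rewrite /g in d1; lra.
  have gap0 : 0 < radial_gap (1 - d) w by apply: lt_le_trans gap; rewrite divr_gt0.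
  have /andP[a b] := c01 n w.
  rewrite /= ger0_norm ?mulr_ge0//.
  have : 1 - cutoff d w <= d / (g / 2).
    rewrite /cutoff /flat_bump gap0 expr0 mul1r.
    have := expR_ge1Dx (- d * (radial_gap (1 - d) w)^-1).
    have : d * (radial_gap (1 - d) w)^-1 <= d / (g / 2).
      by rewrite ler_wpM2l ?(ltW d0)// lef_pV2 ?posrE// divr_gt0.
    rewrite mulNr; lra.
  move=> H; apply: le_trans (ler_wpM2l hw H) _.
  move: d2; rewrite ler_pdivlMr ?ltr_wpDl// => d2.
  rewrite mulrA ler_pdivrMr ?divr_gt0//; nra.
have ae1 : {ae A, forall w, D w -> f_ ^~ w @ \oo --> (cst 0%E : R * R -> \bar R) w}.
  by apply: aeW => w; exact: cv.
have ae2 : {ae A, forall w n, D w -> (`|f_ n w| <= (EFin \o h) w)%E}.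
  by apply: aeW => w n; exact: bound.
have [_ _] := dominated_convergence mD mf_ (measurable_cst 0%E) ae1 ih ae2.
rewrite integral0 => /fine_cvgP[_] /cvgr0Pnorm_le/(_ ka ka0)[N _ HN].
exists N => n Nn; have := HN n Nn; rewrite /= => H.
by apply: le_trans H; rewrite /Rintegral ler_norm.
Unshelve. all: by end_near. Qed.

End cutoff.

(** * An identity for the Bergman kernel *)

Section identity.
Local Open Scope complex_scope.
Context {R : realType}.
Local Notation D := (@disc R).
Local Notation A := (area R).

Let mD : measurable (D : set (measurableTypeR R * measurableTypeR R)).
Proof. exact: measurable_disc. Qed.

Lemma cmeas_smoothz P dP : @smoothz R P dP -> cmeas P /\ cmeas dP.
Proof.
move=> [p [px [py [q [qx [qy [[_ [bp bpx bpy]] [_ [bq bqx bqy]] E dE]]]]]]]; split.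
  split; first by under eq_fun do rewrite E; exact: bp.1.
  by under eq_fun do rewrite E; exact: bq.1.
split; under eq_fun do rewrite dE /=.
  by apply: measurable_funM => //; apply: measurable_funD; [exact: bpx.1|exact: bqy.1].
by apply: measurable_funM => //; apply: measurable_funB; [exact: bqx.1|exact: bpy.1].
Qed.

Lemma cbounded_smoothz P dP : @smoothz R P dP -> cbounded P /\ cbounded dP.
Proof.
move=> [p [px [py [q [qx [qy [[_ [bp bpx bpy]] [_ [bq bqx bqy]] E dE]]]]]]].
have [_ [M1 h1]] := bp; have [_ [M2 h2]] := bpx; have [_ [M3 h3]] := bpy.
have [_ [N1 k1]] := bq; have [_ [N2 k2]] := bqx; have [_ [N3 k3]] := bqy.
split.
  exists (M1 + N1) => w Dw; apply: le_trans (modulus_le_ReIm _) _.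
  by rewrite E lerD ?h1 ?k1.
exists ((M2 + N3) + (N2 + M3)) => w Dw; apply: le_trans (modulus_le_ReIm _) _.
rewrite dE /=; have := h2 w Dw; have := h3 w Dw; have := k2 w Dw; have := k3 w Dw.
have H (a b M N : R) : `|a| <= M -> `|b| <= N -> `|(a + b) / 2| <= M + N /\ `|(a - b) / 2| <= M + N.
  by rewrite !ler_norml; lra.
move=> a1 a2 a3 a4; apply: lerD; first exact: (H _ _ _ _ a4 a1).1.
exact: (H _ _ _ _ a2 a3).2.
Qed.

Lemma modulus_cintegral_l1 V : cintegrable D V -> modulus (cintegral D V) <= 2 * l1 V.
Proof.
move=> iV; have := @modulus_cintegral_le R V (fun=> 1) 1 iV (cmeas_cst _).
under eq_cintegral do rewrite mulr1.
by rewrite mulr1; apply => w _; rewrite modulus1.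
Qed.

(** With [s = |w|^2], a solution [w h(s)] of the equation that its derivative in [z] be
    [3 (1 - s)^2 - 1], vanishing on the unit circle: the equation reads [(s h)' = 3 (1 - s)^2 - 1],
    so [s h = 1 - (1 - s)^3 - s = s (1 - s) (2 - s)]. The simpler choice [h = 1 - s] would leave
    [2 (1 - s)] in place of [3 (1 - s)^2], and one factor [1 - s] does not bound the kernel
    uniformly in [z]. *)
Definition weight1 (w : R * R) : R[i] :=
  toC w * (1 - toC w * (toC w)^*) * (2 - toC w * (toC w)^*).

Definition weight2 (w : R * R) : R[i] := 3 * (1 - toC w * (toC w)^*) ^+ 2.

Lemma toC_conj (w : R * R) : toC w * (toC w)^* = (w.1 ^+ 2 + w.2 ^+ 2)%:C.
Proof. by rewrite /toC; simpc => /=; congr (_ +i* _); ring. Qed.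

Let s1 := smoothzM (@smoothz_toC R) (@smoothz_conj R).
Let s2 := smoothzD (smoothz_cst 1) (smoothzM (smoothz_cst (-1)) s1).
Let s3 := smoothzD (smoothz_cst 2) (smoothzM (smoothz_cst (-1)) s1).

Lemma smoothz_weight1 : smoothz weight1 (fun w => weight2 w - 1).
Proof.
apply: eq_smoothz (smoothzM (smoothzM (@smoothz_toC R) s2) s3) _ _ => w.
  by rewrite /weight1; ring.
rewrite /weight2; ring.
Qed.

Lemma cmeas_weight1 : cmeas weight1. Proof. exact: (cmeas_smoothz smoothz_weight1).1. Qed.

Lemma cmeas_weight2 : cmeas weight2.
Proof.
have [] := cmeas_smoothz (smoothzM (smoothzM (smoothz_cst 3) s2) s2) => h _.
rewrite (_ : weight2 = fun w => 3 * (1 + -1 * (toC w * (toC w)^*)) * (1 + -1 * (toC w * (toC w)^*)))//.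
by apply/funext => w; rewrite /weight2; ring.
Qed.

Lemma modulus_weight1 w : D w ->
  modulus (weight1 w) <= 2 * (1 - (w.1 ^+ 2 + w.2 ^+ 2)).
Proof.
move=> Dw; have w1 := disc_modulus Dw; move: Dw; rewrite discE /= => s1'.
have s0 : 0 <= w.1 ^+ 2 + w.2 ^+ 2 by rewrite addr_ge0 ?sqr_ge0.
rewrite /weight1 toC_conj; set s := w.1 ^+ 2 + w.2 ^+ 2 in s0 s1' *.
rewrite !modulusM; have -> : 1 - s%:C = (1 - s)%:C by rewrite rmorphB.
have -> : 2 - s%:C = (2 - s)%:C by rewrite rmorphB rmorph_nat.
rewrite !modulus_real !ger0_norm; [|lra|lra].
have := modulus_ge0 (toC w); move: (modulus _) w1 => m m1 m0.
have h1 : 0 <= (1 - m) * ((1 - s) * (2 - s)) by rewrite !mulr_ge0//; lra.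
have h2 : 0 <= s * (1 - s) by rewrite mulr_ge0//; lra.
lra.
Qed.

Lemma modulus_weight2 w : D w ->
  modulus (weight2 w) <= 3 * (1 - (w.1 ^+ 2 + w.2 ^+ 2)) ^+ 2.
Proof.
move=> Dw; rewrite /weight2 toC_conj modulusM modulusX.
have -> : 1 - (w.1 ^+ 2 + w.2 ^+ 2)%:C = (1 - (w.1 ^+ 2 + w.2 ^+ 2))%:C by rewrite rmorphB.
by rewrite modulus_real modulus_nat real_normK ?num_real.
Qed.

Lemma disc_sq (w : R * R) : D w -> 0 <= w.1 ^+ 2 + w.2 ^+ 2 < 1.
Proof. by rewrite discE /= => ->; rewrite addr_ge0 ?sqr_ge0. Qed.

Lemma cbounded_weight1 : cbounded weight1.
Proof. exact: (cbounded_smoothz smoothz_weight1).1. Qed.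

Lemma cbounded_weight2 : cbounded weight2.
Proof.
exists 3 => w Dw; apply: le_trans (modulus_weight2 Dw) _.
have := disc_sq Dw; move: (_ + _) => s /andP[a b]; nra.
Qed.

Lemma cboundedM m m' : @cbounded R m -> cbounded m' -> cbounded (fun w => m w * m' w).
Proof.
move=> [M H] [M' H']; exists (M * M') => w Dw.
by rewrite modulusM ler_pM ?modulus_ge0 ?H ?H'.
Qed.

Lemma cintegrable_dz (f fx fy : R[i] -> R[i]) : sobolev11 f fx fy ->
  cintegrable D (dz fx fy \o @toC R).
Proof.
move=> [_ fxi fyi _].
have := cintegrableZ (2^-1) (cintegrableB fxi (cintegrableZ 'i fyi)).
by apply: eq_cintegrable => w _ /=; rewrite /dz [_ * 'i]mulrC.
Qed.

Lemma cutoff_gap d w : cutoff d w != 0 :> R -> w.1 ^+ 2 + w.2 ^+ 2 <= 1 - d.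
Proof.
rewrite /cutoff /flat_bump; case: ifP => [|_]; last by rewrite eqxx.
by rewrite /radial_gap => h _; lra.
Qed.

Lemma dbmeas_cutoff d : 0 < d -> dbmeas (@cutoff R d).
Proof. by move=> d0; exact: dbmeas_bump. Qed.

Lemma le_small (x K : R) : 0 <= K -> (forall e, 0 < e -> x <= K * e) -> x <= 0.
Proof.
move=> K0 H; rewrite leNgt; apply/negP => x0.
have K1 : 0 < 2 * (K + 1) by rewrite mulr_gt0// ltr_wpDl.
have := H (x / (2 * (K + 1))); rewrite divr_gt0// => /(_ isT); rewrite mulrA ler_pdivlMr//.
nra.
Qed.

(** Since [Q] has derivative 0 in [z], integration by parts of [weight1 * Q] times the cutoff yields
    the identity up to the term where the derivative falls on the cutoff. That term contains
    [weight1], which brings the factor [1 - |w|^2] needed by [cutoff_error]. *)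
Lemma antiholomorphic_identity (f fx fy : R[i] -> R[i]) Q :
  sobolev11 f fx fy ->
  (forall e : R, 0 < e ->
     \forall r \near 1^'-, (integral_mean 1 r f <= (e * (1 - r)^-1)%:E)%E) ->
  smoothz Q (fun=> 0) ->
  cintegral D (fun w => f (toC w) * Q w) =
  cintegral D (fun w => dz fx fy (toC w) * weight1 w * Q w) +
  cintegral D (fun w => f (toC w) * weight2 w * Q w).
Proof.
move=> W11 Hf sQ; have [fi _ _ _] := W11; have Gi := cintegrable_dz W11.
have [mQ _] := cmeas_smoothz sQ; have [bQ _] := cbounded_smoothz sQ.
have [Mq' HMq'] := bQ.
have [Mq Mq0 HMq] : exists2 Mq, 0 <= Mq & forall w, D w -> modulus (Q w) <= Mq.
  by exists `|Mq'| => // w Dw; apply: le_trans (HMq' w Dw) (ler_norm _).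
pose U w := f (toC w) * Q w - (dz fx fy (toC w) * weight1 w * Q w + f (toC w) * weight2 w * Q w).
have i1 : cintegrable D (fun w => f (toC w) * Q w) by exact: (cintegrableM fi mQ bQ).
have i2 : cintegrable D (fun w => dz fx fy (toC w) * weight1 w * Q w).
  exact: (cintegrableM (cintegrableM Gi cmeas_weight1 cbounded_weight1) mQ bQ).
have i3 : cintegrable D (fun w => f (toC w) * weight2 w * Q w).
  exact: (cintegrableM (cintegrableM fi cmeas_weight2 cbounded_weight2) mQ bQ).
have iU : cintegrable D U by apply: cintegrableB => //; exact: cintegrableD.
suff : modulus (cintegral D U) <= 0.
  move=> h; apply/eqP; rewrite -subr_eq0 -(cintegralD i2 i3) -(cintegralB i1 (cintegrableD i2 i3)).
  by rewrite -modulus_eq0 eq_le h modulus_ge0.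
(* [4 * Mq] is for the term with the derivative of the cutoff, [2] for the part of [U] that the
   cutoff removes. *)
apply: (@le_small _ (4 * Mq + 2)); first by rewrite addr_ge0// mulr_ge0.
move=> ka ka0.
have [d0 d00 Hd0] := cutoff_error fi Hf ka0.
have [N HN] := cutoff_cvg (integrable_modulus iU) (fun w _ => modulus_ge0 (U w)) ka0.
have [n [Nn nd]] : exists n : nat, (N <= n)%N /\ n.+2%:R^-1 <= d0.
  exists (maxn N (Num.truncn d0^-1).+1); rewrite leq_maxl; split=> //.
  rewrite -[leRHS]invrK lef_pV2 ?posrE ?invr_gt0//.
  apply: le_trans (ltW (truncnS_gt _)) _; rewrite ler_nat.
  by rewrite (leq_trans (leq_maxr N _))// -addn2 leq_addr.
have := HN n Nn; set d : R := n.+2%:R^-1 in nd *; move=> Hn.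
have dp : 0 < d by rewrite invr_gt0.
have Hd := Hd0 d; rewrite dp nd in Hd; have {}Hd := Hd isT.
have be := dbmeas_cutoff dp.
pose X w := weight1 w * Q w * - ((cutoff' d w)%:C * (toC w)^*).
have sP := smoothzM (smoothzM smoothz_weight1 sQ) (smoothz_bump (1 - d) dp).
have [mP mdP] := cmeas_smoothz sP; have [bP bdP] := cbounded_smoothz sP.
have d1 : 1 - d < 1 by rewrite gtrBl.
have IBP0 := disc_by_parts W11 sP d1.
have IBP : cintegral D (fun w => f (toC w) * (weight1 w * Q w *
      (- (flat_bump' d 0 (radial_gap (1 - d) w))%:C * (toC w)^*) +
      (flat_bump d 0 (radial_gap (1 - d) w))%:C * (weight1 w * 0 + Q w * (weight2 w - 1)))) =
    - cintegral D (fun w => dz fx fy (toC w) * (weight1 w * Q w * (cutoff d w)%:C)).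
  apply: IBP0 => w; rewrite mulf_eq0 negb_or => /andP[_ h]; apply: cutoff_gap.
  by move: h; rewrite /cutoff; apply: contra => /eqP ->.
have sX : cmeas X /\ cbounded X.
  have sB := smoothz_bump (1 - d) dp.
  have [_ m1] := cmeas_smoothz sB; have [_ b1] := cbounded_smoothz sB.
  have [mw bw] := (cmeas_weight1, cbounded_weight1).
  have -> : X = fun w => weight1 w * Q w * (- (flat_bump' d 0 (radial_gap (1 - d) w))%:C * (toC w)^*).
    by apply/funext => w; rewrite /X mulNr.
  split; first by apply: cmeasM m1; exact: cmeasM.
  by apply: cboundedM b1; exact: cboundedM.
have ifX : cintegrable D (fun w => f (toC w) * X w) by exact: (cintegrableM fi sX.1 sX.2).
have iUe := cintegrable_dbmeas iU be.
have bme : dbmeas (fun w => 1 - cutoff d w).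
  have := dbmeasD (dbmeas_cst 1) (dbmeasM (dbmeas_cst (-1)) be).
  by congr dbmeas; apply/funext => w /=; rewrite mulN1r.
have iUe' := cintegrable_dbmeas iU bme.
have ifd := cintegrableM fi mdP bdP.
have iGP := cintegrableM Gi mP bP.
(* After subtracting the integration by parts, only the derivative of the cutoff is left, and this
   is [X]. *)
have E1 : cintegral D (fun w => U w * (cutoff d w)%:C) = cintegral D (fun w => f (toC w) * X w).
  transitivity (cintegral D (fun w => f (toC w) * X w) -
    (cintegral D (fun w => f (toC w) * (weight1 w * Q w *
      (- (flat_bump' d 0 (radial_gap (1 - d) w))%:C * (toC w)^*) +
      (flat_bump d 0 (radial_gap (1 - d) w))%:C * (weight1 w * 0 + Q w * (weight2 w - 1)))) +
    cintegral D (fun w => dz fx fy (toC w) * (weight1 w * Q w * (cutoff d w)%:C)))).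
    rewrite -(cintegralD ifd iGP) -(cintegralB ifX (cintegrableD ifd iGP)).
    by apply: eq_cintegral => w _; rewrite /U /X /cutoff /cutoff' /=; ring.
  by rewrite IBP addNr subr0.
have E2 : cintegral D U = cintegral D (fun w => f (toC w) * X w) +
    cintegral D (fun w => U w * (1 - cutoff d w)%:C).
  rewrite -E1 -(cintegralD iUe iUe'); apply: eq_cintegral => w _.
  by rewrite rmorphB rmorph1; ring.
rewrite E2; apply: le_trans (modulusD _ _) _; rewrite mulrDl; apply: lerD.
  apply: le_trans (modulus_cintegral_l1 ifX) _.
  suff : l1 (fun w => f (toC w) * X w) <= 2 * Mq * ka by lra.
  rewrite -lee_fin l1E//.
  apply: (@le_trans _ _ (\int[A]_(w in D) ((2 * Mq)%:E *
    (abs_disc f w * (cutoff' d w * (1 - (w.1 ^+ 2 + w.2 ^+ 2))))%:E))%E).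
    apply: ge0_le_integral => //.
    - by move=> w _; rewrite lee_fin modulus_ge0.
    - exact: measurable_int (integrable_modulus ifX).
    - apply: emeasurable_funM; first exact: measurable_cst.
      by apply/measurable_EFinP; apply: measurable_funTS; exact: measurable_cutoff_integrand.
    move=> w Dw; rewrite -EFinM lee_fin /abs_disc patchE mem_set// /X.
    rewrite modulusM [modulus (weight1 w * Q w * _)]modulusM [modulus (weight1 w * Q w)]modulusM.
    rewrite modulusN [modulus (_%:C * _)]modulusM modulus_real modulus_conj ger0_norm ?cutoff'_ge0//.
    have h1 := modulus_weight1 Dw; have h2 := HMq w Dw; have h3 := ltW (disc_modulus Dw).
    have /andP[_ /ltW h4] := disc_sq Dw.
    have := cutoff'_ge0 w dp; move: (cutoff' d w) => c c0.
    move: h1 h2 h3 h4 (modulus_ge0 (f (toC w))) (modulus_ge0 (weight1 w)) (modulus_ge0 (Q w)) (modulus_ge0 (toC w)).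
    move: (modulus (f _)) (modulus (weight1 w)) (modulus (Q w)) (modulus (toC w)) (w.1 ^+ 2 + w.2 ^+ 2) => a b q m s.
    move=> h1 h2 h3 h4 a0 b0 q0 m0.
    have -> : 2 * Mq * (a * (c * (1 - s))) = a * (2 * (1 - s) * Mq * (c * 1)) by ring.
    apply: ler_wpM2l => //; apply: ler_pM; rewrite ?mulr_ge0//; first exact: ler_pM.
    by apply: ler_wpM2l.
  rewrite ge0_integralZl//; last 3 first.
  - by apply/measurable_EFinP; apply: measurable_funTS; exact: measurable_cutoff_integrand.
  - move=> w Dw; rewrite lee_fin mulr_ge0 ?abs_disc_ge0// mulr_ge0 ?cutoff'_ge0// subr_ge0.
    by have /andP[_ /ltW] := disc_sq Dw.
  - by rewrite lee_fin mulr_ge0.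
  rewrite [leRHS]EFinM; apply: lee_wpmul2l; first by rewrite lee_fin mulr_ge0.
  apply: le_trans Hd; rewrite integral_mkcond le_eqVlt; apply/orP; left; apply/eqP.
  apply: eq_integral => w _; rewrite patchE; case: ifPn => // nD.
  by rewrite /abs_disc patchE (negbTE nD) mul0r.
apply: le_trans (modulus_cintegral_l1 iUe') _; rewrite ler_wpM2l//.
apply: le_trans Hn; rewrite /l1 le_eqVlt; apply/orP; left; apply/eqP.
apply: eq_Rintegral => w _; rewrite modulusM modulus_real ger0_norm//.
by rewrite subr_ge0 bump0_le1.
Qed.

(** The kernel is [cauchy1 x + cauchy2 x] at [x = z * (toC w)^*], whose partial sums are polynomials
    in the conjugate of [w]. They converge uniformly on the disc because the modulus of [x] stays
    below that of [z]. *)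
Lemma bkern_approx (z : R[i]) : modulus z < 1 -> forall e : R, 0 < e ->
  exists Q, smoothz Q (fun=> 0) /\ forall w, D w -> modulus (Q w - bkern z w) <= e.
Proof.
move=> z1 e e0; have a1 : 0 <= modulus z < 1 by rewrite modulus_ge0.
have e2 : 0 < e / 2 by rewrite divr_gt0.
have [N1 H1] := cauchy1_approx a1 e2; have [N2 H2] := cauchy2_approx a1 e2.
pose N := maxn N1 N2.
exists (fun w => \sum_(n < N) n.+1%:R * (z * (toC w)^*) ^+ n); split.
  elim: N => [|k IH].
    by apply: eq_smoothz (smoothz_cst 0) _ _ => w //; rewrite big_ord0.
  apply: eq_smoothz (smoothzD IH (smoothzM (smoothz_cst (k.+1%:R * z ^+ k)) (smoothz_conjX k))) _ _ => w.
    by rewrite big_ord_recr/= exprMn mulrA.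
  by rewrite !mulr0 !addr0.
move=> w Dw; set x := z * (toC w)^*; have xz : modulus x <= modulus z by exact: modulus_mul_conj.
have -> : \sum_(n < N) n.+1%:R * x ^+ n - bkern z w =
   - ((cauchy1 x - \sum_(n < N) 1 * x ^+ n) + (cauchy2 x - \sum_(n < N) n%:R * x ^+ n)).
  have -> : \sum_(n < N) n.+1%:R * x ^+ n = \sum_(n < N) 1 * x ^+ n + \sum_(n < N) n%:R * x ^+ n.
    by rewrite -big_split/=; apply: eq_bigr => n _; rewrite -nat1r mulrDl.
  have nz : 1 - x != 0 by apply: one_sub_neq0; exact: le_lt_trans xz z1.
  have -> : bkern z w = cauchy1 x + cauchy2 x by rewrite /bkern /cauchy1 /cauchy2 -/x; field.
  by ring.
rewrite modulusN; apply: le_trans (modulusD _ _) _; rewrite [e]splitr.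
by apply: lerD; [apply: H1|apply: H2]; rewrite ?leq_maxl ?leq_maxr.
Qed.

Lemma bkern_identity (f fx fy : R[i] -> R[i]) z :
  sobolev11 f fx fy ->
  (forall e : R, 0 < e ->
     \forall r \near 1^'-, (integral_mean 1 r f <= (e * (1 - r)^-1)%:E)%E) ->
  modulus z < 1 ->
  cintegral D (fun w => f (toC w) * bkern z w) =
  cintegral D (fun w => dz fx fy (toC w) * weight1 w * bkern z w) +
  cintegral D (fun w => f (toC w) * weight2 w * bkern z w).
Proof.
move=> W11 Hf z1; have [fi _ _ _] := W11; have Gi := cintegrable_dz W11.
pose V1 w := f (toC w); pose V2 w := dz fx fy (toC w) * weight1 w.
pose V3 w := f (toC w) * weight2 w.
have iV1 : cintegrable D V1 by exact: fi.
have iV2 : cintegrable D V2 by exact: (cintegrableM Gi cmeas_weight1 cbounded_weight1).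
have iV3 : cintegrable D V3 by exact: (cintegrableM fi cmeas_weight2 cbounded_weight2).
have mk := cmeas_bkern z; have bk := cbounded_bkern z1.
apply/eqP; rewrite -subr_eq0 -modulus_eq0 eq_le modulus_ge0 andbT.
apply: (@le_small _ (2 * (l1 V1 + l1 V2 + l1 V3))).
  by rewrite mulr_ge0// !addr_ge0 ?l1_ge0.
move=> e e0; have [Q [sQ HQ]] := bkern_approx z1 e0.
have [mQ _] := cmeas_smoothz sQ; have [bQ _] := cbounded_smoothz sQ.
have mB : cmeas (fun w => Q w - bkern z w) by exact: cmeasB.
have step V : cintegrable D V -> exists2 x : R[i], modulus x <= 2 * e * l1 V &
    cintegral D (fun w => V w * Q w) = cintegral D (fun w => V w * bkern z w) + x.
  move=> iV; exists (cintegral D (fun w => V w * (Q w - bkern z w))).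
    exact: modulus_cintegral_le.
  have j1 := cintegrableM iV mQ bQ; have j2 := cintegrableM iV mk bk.
  rewrite (_ : cintegral D (fun w => V w * (Q w - bkern z w)) =
    cintegral D (fun w => V w * Q w) - cintegral D (fun w => V w * bkern z w)); first by rewrite addrC subrK.
  by rewrite -(cintegralB j1 j2); apply: eq_cintegral => w _; rewrite mulrBr.
have [x1 h1 E1] := step V1 iV1; have [x2 h2 E2] := step V2 iV2; have [x3 h3 E3] := step V3 iV3.
have := antiholomorphic_identity W11 Hf sQ.
rewrite -/(V1 _) in E1 *; rewrite [LHS]E1 [X in _ = X + _]E2 [X in _ = _ + X]E3 => E.
have -> : cintegral D (fun w => f (toC w) * bkern z w) -
  (cintegral D (fun w => dz fx fy (toC w) * weight1 w * bkern z w) +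
   cintegral D (fun w => f (toC w) * weight2 w * bkern z w)) = x2 + x3 - x1.
  move: E; rewrite /V1 /V2 /V3; move: (cintegral D _) (cintegral D _) (cintegral D _) => a b c E.
  by rewrite -[c](addrK x1) E; ring.
apply: le_trans (modulusB _ _) _; have := modulusD x2 x3; lra.
Qed.

End identity.

(** * The duality estimate *)

Section area_fubini.
Context {R : realType}.
Local Notation D := (@disc R).
Local Notation A := (area R).
Local Notation mu := (@lebesgue_measure R).
Local Notation J := (`[0, 2 * pi]%classic : set R).
Local Notation RR := (measurableTypeR R * measurableTypeR R)%type.

Let mD : measurable (D : set RR).
Proof. exact: measurable_disc. Qed.

Variables (V : R * R -> R) (K : R * RR -> R) (B : R).
Hypotheses (iV : A.-integrable D (EFin \o V)) (mK : measurable_fun setT K) (B0 : 0 <= B).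
Hypothesis KB : forall t w, D w -> `|K (t, w)| <= B.

Let V1 : RR -> R := V \_ D.
Let K1 (z : R * RR) := K z * \1_D z.2.

Let iV1 : A.-integrable setT (EFin \o V1).
Proof.
have /(integrable_mkcond _ mD) := iV; congr (A.-integrable _ _).
by apply/funext => w; rewrite /V1 /= !patchE; case: ifP.
Qed.

Let mV1 : measurable_fun setT V1.
Proof. by apply/measurable_EFinP; exact: measurable_int iV1. Qed.

Let mN1 : measurable_fun setT (fun w : RR => (`|V1 w|)%:E).
Proof. by apply/measurable_EFinP; exact: measurableT_comp. Qed.

Let bK1 : bmeas K1.
Proof.
split.
  apply: measurable_funM => //.
  by apply: (measurableT_comp (measurable_indic mD)); exact: measurable_snd.
exists B => -[t w]; rewrite /K1 indicE /=; have [wD|_] := boolP (w \in D); last by rewrite mulr0 normr0.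
by rewrite mulr1; apply: KB; rewrite inE in wD.
Qed.

Let K1B z : `|K1 z| <= B.
Proof.
case: z => t w; rewrite /K1 indicE /=; have [wD|_] := boolP (w \in D); last by rewrite mulr0 normr0.
by rewrite mulr1; apply: KB; rewrite inE in wD.
Qed.

Let iVK t : A.-integrable setT (EFin \o (fun w => V1 w * K1 (t, w))).
Proof.
apply: (@le_integrable _ _ _ A setT measurableT _ (EFin \o (fun w => B * V1 w))).
- apply/measurable_EFinP; apply: measurable_funM => //.
  exact: (bmeas_pair1 t bK1).1.
- move=> w _ /=; rewrite lee_fin mulrC normrM [`|B * _|]normrM ler_wpM2r//.
  by rewrite (le_trans (K1B _))// ler_norm.
- exact: (integrableZl measurableT B iV1).
Qed.

Definition disc_transform (t : R) : R := (\int[A]_(w in D) (V w * K (t, w)))%R.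

Let transformE t : (disc_transform t)%:E = (\int[A]_w (V1 w * K1 (t, w))%:E)%E.
Proof.
rewrite -(fineK (integrable_fin_num measurableT (iVK t))); congr EFin.
rewrite /disc_transform /Rintegral; congr fine; rewrite integral_mkcond.
apply: eq_integral => w _; rewrite /= /V1 /K1 !patchE indicE /=.
by case: ifPn => wD; rewrite ?mulr1// mul0r.
Qed.

Let mVK : measurable_fun setT (fun z : R * RR => V1 z.2 * K1 z).
Proof.
by apply: measurable_funM; [apply: (measurableT_comp mV1); exact: measurable_snd|exact: bK1.1].
Qed.

Lemma bmeas_disc_transform : bmeas disc_transform.
Proof.
split.
  pose f (z : R * RR) := (V1 z.2 * K1 z)%:E.
  have mf : measurable_fun setT f by apply/measurable_EFinP.
  rewrite (_ : disc_transform = fun t => fine (\int[@area_raw R]_w f^\+ (t, w) - \int[@area_raw R]_w f^\- (t, w))%E).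
    apply: (@measurableT_comp _ _ _ _ _ _ (@fine R)); first exact: fine_measurable.
    apply: emeasurable_funB.
      exact: (@measurable_fun_fubini_tonelli_F _ _ _ _ _ (@area_raw R) _ (measurable_funepos mf)).
    exact: (@measurable_fun_fubini_tonelli_F _ _ _ _ _ (@area_raw R) _ (measurable_funeneg mf)).
  apply/funext => t; apply: EFin_inj; rewrite transformE.
  have fn := integrable_fin_num measurableT (iVK t).
  rewrite -(fineK fn); congr (fine _)%:E; rewrite [LHS]integralE.
  by congr (_ - _)%E; apply: eq_integral => w _; rewrite ?funeposE ?funenegE.
exists (B * (\int[A]_w `|V1 w|)%R) => t.
rewrite -lee_fin EFinM.
have iN : A.-integrable setT (EFin \o (fun w => `|V1 w|)).
  exact: (integrable_norm iV1).
have -> : ((\int[A]_w `|V1 w|)%R)%:E = (\int[A]_w (`|V1 w|)%:E)%E.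
  by rewrite /Rintegral fineK//; exact: integrable_fin_num iN.
rewrite -abse_EFin transformE.
apply: le_trans (le_abse_integral _ measurableT _) _.
  exact: measurable_int (iVK t).
rewrite -ge0_integralZl//.
apply: ge0_le_integral => //.
- by apply: measurableT_comp => //; exact: measurable_int (iVK t).
- by apply: emeasurable_funM; [exact: measurable_cst|exact: mN1].
- by move=> w _; rewrite /= lee_fin mulrC normrM ler_wpM2r.
Qed.

(** Fubini moves [g] under the kernel. [W] is [V] times the adjoint transform of [g], in modulus; it
    is given as a measurable function on the whole plane, 0 outside the disc, ready for polar
    coordinates. *)
Lemma disc_transform_dual (g : R -> R) : bmeas g -> exists W : RR -> R,
  [/\ measurable_fun setT W,
      forall w, D w -> W w = `|V w| * `|circ_int (fun t => K (t, w) * g t)|,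
      forall w, ~ D w -> W w = 0 &
      ((circ_int (fun t => (disc_transform t * g t)%R))%:E <= \int[A]_w (W w)%:E)%E].
Proof.
move=> bg; have [mg [M gM]] := bg; have M0 : 0 <= M by exact: le_trans (gM 0).
pose F (z : R * RR) := (\1_J z.1 * g z.1 * (V1 z.2 * K1 z))%:E.
have m1J : measurable_fun setT (\1_J : R -> R) by exact: measurable_indic.
have mF : measurable_fun setT F.
  apply/measurable_EFinP; apply: measurable_funM => //; apply: measurable_funM.
    by apply: (measurableT_comp m1J); exact: measurable_fst.
  by apply: (measurableT_comp mg); exact: measurable_fst.
have I1 : (\int[A]_w (`|V1 w|)%:E < +oo)%E.
  by have /integrableP[_] := iV1; congr (_ < _)%E; apply: eq_integral.
have bound t w : (`|F (t, w)| <= (\1_J t * (M * B))%:E * (`|V1 w|)%:E)%E.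
  rewrite /F abse_EFin -EFinM lee_fin /= normrM [`|_ * g _|]normrM [`|V1 _ * _|]normrM.
  have j0 : 0 <= \1_J t :> R by rewrite indicE.
  rewrite ger0_norm// -!mulrA; apply: ler_wpM2l => //.
  by apply: ler_pM; rewrite ?mulr_ge0// mulrC ler_wpM2r.
have iF : (mu \x @area_raw R)%E.-integrable setT F.
  apply: (integrable12ltyP mu (@area_raw R) mF).2.
  apply: (@le_lt_trans _ _ (\int[mu]_t ((\1_J t * (M * B))%:E * \int[A]_w (`|V1 w|)%:E))%E).
    apply: ge0_le_integral => //.
    - by move=> t _; apply: integral_ge0.
    - apply: (@measurable_fun_fubini_tonelli_F _ _ _ _ _ (@area_raw R) (abse \o F)).
        exact: measurableT_comp.
      by move=> z; exact: abse_ge0.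
    - apply: emeasurable_funM; last exact: measurable_cst.
      by apply/measurable_EFinP; apply: measurable_funM => //; exact: measurable_cst.
    move=> t _; rewrite -ge0_integralZl//; last first.
    - by rewrite lee_fin mulr_ge0 ?mulr_ge0// indicE.
    apply: ge0_le_integral => //.
    - apply: measurableT_comp => //; apply: (measurableT_comp mF); exact: measurable_prodmk1.
    - by apply: emeasurable_funM; [exact: measurable_cst|exact: mN1].
  have i0 : (0 <= \int[A]_w (`|V1 w|)%:E)%E by apply: integral_ge0 => w _; rewrite lee_fin.
  rewrite ge0_integralZr//; last 2 first.
  - by apply/measurable_EFinP; apply: measurable_funM => //; exact: measurable_cst.
  - by move=> t _; rewrite lee_fin mulr_ge0 ?mulr_ge0// indicE.
  apply: lte_mul_pinfty => //.
  - by apply: integral_ge0 => t _; rewrite lee_fin mulr_ge0 ?mulr_ge0// indicE.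
  - rewrite (_ : (\int[mu]_x _)%E = (circ_int (fun=> M * B))%:E) ?fin_numE//.
    rewrite circ_intE; last exact: bmeas_cst.
    rewrite [RHS]integral_mkcond; apply: eq_integral => t _.
    by rewrite epatch_indic -EFinM mulrC.
have FUB := Fubini iF.
have bK1t w : bmeas (fun t : R => K1 (t, w)).
  by apply: (bmeas_comp bK1); apply: measurable_fun_pair => //; exact: measurable_cst.
have bKg w : bmeas (fun t : R => K1 (t, w) * g t) by exact: bmeasM.
have L : (circ_int (fun t => disc_transform t * g t))%:E = (\int[mu]_t \int[@area_raw R]_w F (t, w))%E.
  rewrite circ_intE; last by apply: bmeasM => //; exact: bmeas_disc_transform.
  rewrite integral_mkcond; apply: eq_integral => t _.
  rewrite epatch_indic EFinM transformE -muleA -EFinM -integralZr//; last exact: iVK.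
  by apply: eq_integral => w _; rewrite /F -EFinM /= mulrC [g t * _]mulrC.
have E w : (\int[mu]_t F (t, w))%E = (V1 w * circ_int (fun t => K1 (t, w) * g t))%:E.
  rewrite EFinM circ_intE// -integralZl//; last exact: bmeas_integrable (bKg w).
  rewrite [RHS]integral_mkcond; apply: eq_integral => t _.
  by rewrite epatch_indic -!EFinM /F /=; congr EFin; ring.
have mW : measurable_fun setT (fun w : RR => V1 w * circ_int (fun t => K1 (t, w) * g t)).
  apply: measurable_funM => //.
  have bf : bmeas (fun z : RR * R => K1 (z.2, z.1) * g z.2).
    apply: bmeasM.
      apply: (bmeas_comp (g := fun z : RR * R => (z.2, z.1)) bK1).
      by apply: measurable_fun_pair; [exact: measurable_snd|exact: measurable_fst].
    exact: (bmeas_comp bg measurable_snd).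
  exact: (bmeas_circ_int bf).1.
exists (fun w => `|V1 w * circ_int (fun t => K1 (t, w) * g t)|); split.
- exact: measurableT_comp.
- move=> w Dw; rewrite normrM /V1 patchE mem_set//; congr (_ * `|_|).
  by apply: eq_circ_int => t; rewrite /K1 indicE /= mem_set// mulr1.
- by move=> w nD; rewrite /V1 patchE memNset// mul0r normr0.
rewrite L FUB; under eq_integral do rewrite E.
apply: le_trans (lee_abs _) _.
by apply: le_trans (le_abse_integral _ measurableT _) _; first exact/measurable_EFinP.
Qed.

End area_fubini.

(** * From bounded densities to the square function *)

Section tent_square_function.
Context {R : realType}.
Local Notation D := (@disc R).
Local Notation A := (area R).
Local Notation mu := (@lebesgue_measure R).
Local Notation J := (`[0, 2 * pi]%classic : set R).
Local Notation RR := (measurableTypeR R * measurableTypeR R)%type.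

Lemma le_poweR (x y : \bar R) (r : R) : 0 <= r -> (0 <= x)%E -> (x <= y)%E ->
  (x `^ r <= y `^ r)%E.
Proof.
move=> r0 x0 xy; apply: gt0_ler_poweR => //; rewrite in_itv/= leey andbT//.
exact: le_trans xy.
Qed.

Section density.
Variable G : R[i] -> R[i].
Hypothesis iG : cintegrable D (G \o @toC R).

Definition polar_density (u : R * R) : R := \1_polar_rect u * abs_disc G (polar_map u).

(** Truncation makes the area function bounded, as the bilinear estimates require, and the
    truncations increase to the density. *)
Definition trunc_density (n : nat) (u : R * R) : R := Num.min (polar_density u) n%:R.

Lemma polar_density_ge0 u : 0 <= polar_density u.
Proof. by rewrite mulr_ge0 ?abs_disc_ge0// indicE. Qed.

Lemma trunc_density_ge0 n u : 0 <= trunc_density n u.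
Proof. by rewrite le_min polar_density_ge0 ler0n. Qed.

Lemma trunc_density_le n u : trunc_density n u <= n%:R.
Proof. by rewrite ge_min lexx orbT. Qed.

Lemma polar_density0 u : ~ polar_rect u -> polar_density u = 0.
Proof. by move=> nu; rewrite /polar_density indicE memNset// mul0r. Qed.

Lemma trunc_density0 n u : ~ polar_rect u -> trunc_density n u = 0.
Proof. by move=> nu; rewrite /trunc_density polar_density0//; apply/min_idPl. Qed.

Lemma measurable_abs_polar : measurable_fun setT (fun u => abs_disc G (polar_map u)).
Proof. by apply: (measurableT_comp (measurable_abs_disc iG)); exact: measurable_polar_map. Qed.

Lemma measurable_polar_density : measurable_fun setT polar_density.
Proof.
apply: measurable_funM; last exact: measurable_abs_polar.
exact: measurable_indic measurable_polar_rect.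
Qed.

Lemma measurable_trunc_density n : measurable_fun setT (trunc_density n).
Proof. by apply: measurable_minr; [exact: measurable_polar_density|exact: measurable_cst]. Qed.

Lemma disc_polar_map (u : R * R) : 0 < u.1 < 1 -> D (polar_map u).
Proof.
move=> /andP[u0 u1]; rewrite discE /polar_map/= !exprMn -mulrDr cos2Dsin2 mulr1.
by rewrite expr_lt1// ltW.
Qed.

Lemma measurable_Gamma t : measurable (@Gamma R t : set RR).
Proof.
have -> : @Gamma R t = (fun u => gam t u) @^-1` [set 1] `&` (`]0, 1[%classic `*` setT).
  apply/seteqP; split=> u; rewrite /Gamma /gam /= in_itv/=.
    by move=> [-> ->].
  by move=> [+ [-> _]]; case: ifP => // _ /esym/eqP; rewrite oner_eq0.
apply: measurableI; last exact: measurableX.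
by rewrite -[X in measurable X]setTI; exact: (bmeas_gam2 t).1.
Qed.

(** The cone may reach angles outside [[0, 2 * pi]], where the density has been set to 0; there and
    by the truncation the area function only decreases. *)
Lemma area_fun_le_square_fun n t :
  ((area_fun (trunc_density n) t)%:E <= square_fun G t)%E.
Proof.
set x := area_fun _ t; have x0 : 0 <= x by exact: sqrtr_ge0.
have -> : x%:E = ((x ^+ 2)%:E `^ 2^-1)%E.
  by rewrite poweR_EFin powR12_sqrt ?sqr_ge0// sqrtr_sqr ger0_norm.
apply: le_poweR; rewrite ?invr_ge0 ?lee_fin ?sqr_ge0//.
rewrite /x (area_fun_sqr (@measurable_trunc_density n) (trunc_density_ge0 n)
  (trunc_density_le n) (@trunc_density0 n)) /tent_int.
rewrite [leRHS](_ : _ = \int[A]_(u in @Gamma R t) (abs_disc G (polar_map u) ^+ 2)%:E)%E; last first.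
  apply: eq_integral => u; rewrite inE => -[_ u01].
  by rewrite /abs_disc patchE mem_set//; exact: disc_polar_map.
rewrite [leRHS]integral_mkcond; apply: ge0_le_integral => //.
- by move=> u _; rewrite lee_fin mulr_ge0 ?gam_ge0 ?sqr_ge0.
- apply/measurable_EFinP; apply: measurable_funM; first exact: (bmeas_gam2 t).1.
  by apply: measurable_funX; exact: measurable_trunc_density.
- apply/(measurable_restrictT _ (measurable_Gamma t)); apply: measurable_funTS.
  by apply/measurable_EFinP; apply: measurable_funX; exact: measurable_abs_polar.
move=> u _; have [Qu|nQ] := pselect (polar_rect u); last first.
  rewrite trunc_density0// expr0n/= mulr0 patchE; case: ifP => // _.
  by rewrite lee_fin sqr_ge0.
have [gu|ng] := pselect (`|t - u.2| < (1 - u.1) / 2); last first.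
  rewrite /gam; case: ifP => // _; rewrite mul0r patchE; case: ifP => // _.
  by rewrite lee_fin sqr_ge0.
rewrite patchE mem_set; last by split => //; case: Qu.
rewrite /gam gu mul1r lee_fin lerXn2r ?nnegrE ?trunc_density_ge0 ?abs_disc_ge0//.
by rewrite ge_min /polar_density indicE mem_set// mul1r lexx.
Qed.

Lemma circ_int_area_fun_le (p : R) n : 0 < p -> measurable_fun J (square_fun G) ->
  ((circ_int (fun t => area_fun (trunc_density n) t `^ p))%:E <=
   \int[mu]_(t in J) (`|square_fun G t| `^ p))%E.
Proof.
move=> p0 ms; have ba := bmeas_area_fun (@measurable_trunc_density n) (trunc_density_ge0 n)
  (trunc_density_le n) (@trunc_density0 n).
have a0 t : 0 <= area_fun (trunc_density n) t by exact: sqrtr_ge0.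
have bap := bmeas_powR (ltW p0) a0 ba.
rewrite circ_intE//; apply: ge0_le_integral => //.
- by move=> t _; rewrite lee_fin powR_ge0.
- by apply/measurable_EFinP; apply: measurable_funTS; exact: bap.1.
- by apply: (measurableT_comp (measurable_poweR p)); exact: measurableT_comp.
move=> t _; have s0 : (0 <= square_fun G t)%E by exact: poweR_ge0.
rewrite -poweR_EFin gee0_abs//; apply: le_poweR; rewrite ?(ltW p0) ?lee_fin//.
exact: area_fun_le_square_fun.
Qed.

Lemma tent_bilinear_cvg (k : R -> R -> R) (r : R) (h : R -> R) : deriv_kernel k -> 2^-1 <= r < 1 ->
  bmeas h ->
  tent_bilinear k r h (trunc_density n) @[n --> \oo] --> tent_bilinear k r h polar_density.
Proof.
move=> dk r1 bh.
pose g' (n : nat) (u : RR) := ((1 - u.1) * trunc_density n u * `|kern_int k (r * clip u.1) h u.2|)%:E.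
have pos (u : R * R) (a b : R) : 0 <= a -> (~ polar_rect u -> a = 0) -> 0 <= b -> 0 <= (1 - u.1) * a * b.
  move=> a0 au b0; have [[/andP[_ u1] _]|/au ->] := pselect (polar_rect u).
    by rewrite mulr_ge0// mulr_ge0// subr_ge0 ltW.
  by rewrite mulr0 mul0r.
have mg' n : measurable_fun setT (g' n).
  by apply/measurable_EFinP; apply: measurable_tent_integrand => //; exact: measurable_trunc_density.
have g'0 n x : [set: RR] x -> (0 <= g' n x)%E.
  by move=> _; rewrite lee_fin pos ?trunc_density_ge0//; exact: trunc_density0.
have nd : forall x, [set: RR] x -> nondecreasing_seq (g'^~ x).
  move=> x _ m n mn; rewrite lee_fin; apply: ler_wpM2r => //.
  have [[/andP[_ u1] _]|nx] := pselect (polar_rect x); last by rewrite !trunc_density0.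
  apply: ler_wpM2l; first by rewrite subr_ge0 ltW.
  by rewrite le_min !ge_min lexx/= ler_nat mn orbT.
have := cvg_monotone_convergence (mu := A) measurableT mg' g'0 nd.
rewrite /tent_bilinear; congr (_ --> _); apply: eq_integral => u _.
apply: cvg_lim => //; apply: (@cvg_near_cst); near=> n.
rewrite /g' /trunc_density (min_idPl _)//.
near: n; exists (Num.truncn (polar_density u)).+1 => // n /= un.
by apply: le_trans (ltW (truncnS_gt _)) _; rewrite ler_nat.
Unshelve. all: by end_near. Qed.

End density.

Lemma tent_square (p : R) : 1 < p -> exists2 C : R, 0 <= C &
  forall (k : R -> R -> R) (r : R) (h : R -> R) (G : R[i] -> R[i]) (Y : R),
  deriv_kernel k -> 2^-1 <= r < 1 -> bmeas h -> (forall t, 0 <= h t) ->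
  cintegrable D (G \o @toC R) -> measurable_fun J (square_fun G) ->
  (\int[mu]_(t in J) (`|square_fun G t| `^ p) <= Y%:E)%E ->
  (tent_bilinear k r h (polar_density G) <=
   (C * (Y + circ_int (fun t => h t `^ (p / (p - 1)))))%:E)%E.
Proof.
move=> p1; have [C C0 H] := tent_est p1; exists C => // k r h G Y dk r1 bh h0 iG ms HY.
have cv := tent_bilinear_cvg iG dk r1 bh.
rewrite -(cvg_lim _ cv)//; apply: lime_le; first by apply/cvg_ex; eexists; exact: cv.
apply: nearW => n; apply: le_trans (H k r h _ _ dk r1 bh h0 (measurable_trunc_density iG n)
  (trunc_density_ge0 G n) (trunc_density_le G n) (@trunc_density0 G n)) _.
rewrite lee_fin ler_wpM2l// lerD2r -lee_fin; apply: le_trans HY.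
by apply: circ_int_area_fun_le => //; rewrite (lt_trans ltr01).
Qed.

Lemma kern_intB (k : R -> R -> R) a (f g : R -> R) phi : deriv_kernel k -> 0 <= a < 1 ->
  bmeas f -> bmeas g -> kern_int k a (fun t => f t - g t) phi = kern_int k a f phi - kern_int k a g phi.
Proof.
move=> dk a1 bf bg; have b1 := bmeas_kern_mul phi dk a1 bf; have b2 := bmeas_kern_mul phi dk a1 bg.
rewrite /kern_int -(circ_intB b1 b2); apply: eq_circ_int => t; exact: mulrBr.
Qed.

(** The kernel integral is linear in [h], so the positive and negative parts are estimated
    separately; both lie below [g], whence the factor 2. *)
Lemma tent_signed (p : R) : 1 < p -> exists2 C : R, 0 <= C &
  forall (k : R -> R -> R) (r : R) (h g : R -> R) (G : R[i] -> R[i]) (Y : R),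
  deriv_kernel k -> 2^-1 <= r < 1 -> bmeas h -> bmeas g -> (forall t, `|h t| <= g t) ->
  cintegrable D (G \o @toC R) -> measurable_fun J (square_fun G) ->
  (\int[mu]_(t in J) (`|square_fun G t| `^ p) <= Y%:E)%E ->
  (tent_bilinear k r h (polar_density G) <=
   (C * (Y + circ_int (fun t => g t `^ (p / (p - 1)))))%:E)%E.
Proof.
move=> p1; have [C C0 H] := tent_square p1; exists (2 * C); first by rewrite mulr_ge0.
have [q1 _ _] := conj_exp p1; set q := p / (p - 1) in q1 H *.
have q0 : 0 <= q by lra.
move=> k r h g G Y dk r1 bh bg hg iG ms HY.
have g0 t : 0 <= g t by exact: le_trans (hg t).
pose h1 t := Num.max (h t) 0; pose h2 t := Num.max (- h t) 0.
have b1 : bmeas h1.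
  apply: (bmeas_le _ bg) => [|t]; first by apply: measurable_maxr => //; exact: bh.1.
  by have := hg t; have := g0 t; rewrite /h1 maxEle; case: ifP => // _; rewrite normr0.
have b2 : bmeas h2.
  apply: (bmeas_le _ bg) => [|t]; first by apply: measurable_maxr => //; apply: measurableT_comp => //; exact: bh.1.
  by have := hg t; have := g0 t; rewrite /h2 maxEle; case: ifP => // _; rewrite ?normr0 ?normrN.
have p1' t : 0 <= h1 t by rewrite le_max lexx orbT.
have p2' t : 0 <= h2 t by rewrite le_max lexx orbT.
have le1 t : h1 t <= g t by rewrite ge_max g0 andbT; exact: le_trans (ler_norm _) (hg t).
have le2 t : h2 t <= g t by rewrite ge_max g0 andbT; apply: le_trans (ler_norm _) _; rewrite normrN.
have hE : h = fun t => h1 t - h2 t.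
  apply/funext => t; rewrite /h1 /h2 !maxEle oppr_le0.
  by case: (leP (h t) 0) => a; case: (leP 0 (h t)) => b; lra.
have bgq := bmeas_powR q0 g0 bg.
have up (f : R -> R) : bmeas f -> (forall t, 0 <= f t) -> (forall t, f t <= g t) ->
    (tent_bilinear k r f (polar_density G) <= (C * (Y + circ_int (fun t => g t `^ q)))%:E)%E.
  move=> bf f0 fg; apply: le_trans (H k r f G Y dk r1 bf f0 iG ms HY) _.
  rewrite lee_fin; apply: ler_wpM2l => //; rewrite lerD2l.
  by apply: (le_circ_int (bmeas_powR q0 f0 bf) bgq) => t; rewrite ge0_ler_powR ?nnegrE.
have mt f : bmeas f -> measurable_fun setT (fun u : R * R =>
    ((1 - u.1) * polar_density G u * `|kern_int k (r * clip u.1) f u.2|)%:E).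
  move=> bf; apply/measurable_EFinP; apply: measurable_tent_integrand => //.
  exact: measurable_polar_density.
have pos (u : R * R) (b : R) : 0 <= b -> 0 <= (1 - u.1) * polar_density G u * b.
  move=> b0; have [[/andP[_ u1] _]|/(polar_density0 G) ->] := pselect (polar_rect u).
    by rewrite mulr_ge0// mulr_ge0 ?polar_density_ge0// subr_ge0 ltW.
  by rewrite mulr0 mul0r.
apply: (@le_trans _ _ (tent_bilinear k r h1 (polar_density G) + tent_bilinear k r h2 (polar_density G))%E).
  rewrite /tent_bilinear -ge0_integralD//; last 4 first.
  - by move=> u _; rewrite lee_fin pos.
  - exact: mt.
  - by move=> u _; rewrite lee_fin pos.
  - exact: mt.
  apply: ge0_le_integral => //.
  - by move=> u _; rewrite lee_fin pos.
  - exact: mt.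
  - by apply: emeasurable_funD; exact: mt.
  move=> u _; rewrite -EFinD lee_fin -mulrDr.
  have [[/andP[_ u1] _]|/(polar_density0 G) ->] := pselect (polar_rect u); last by rewrite mulr0 !mul0r.
  apply: ler_wpM2l; first by rewrite mulr_ge0 ?polar_density_ge0// subr_ge0 ltW.
  have a1 : 0 <= r * clip u.1 < 1.
    by apply: mul01; [case/andP: r1 => ? ->; rewrite andbT; lra|exact: clip01].
  by rewrite {1}hE kern_intB//; exact: ler_normB.
apply: le_trans (leeD (up h1 b1 p1' le1) (up h2 b2 p2' le2)) _.
rewrite -EFinD lee_fin; lra.
Qed.

End tent_square_function.

(** * Duality on a circle and absorption *)

Section dual_estimate.
Local Open Scope complex_scope.
Context {R : realType}.
Local Notation D := (@disc R).
Local Notation A := (area R).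
Local Notation mu := (@lebesgue_measure R).
Local Notation J := (`[0, 2 * pi]%classic : set R).
Local Notation RR := (measurableTypeR R * measurableTypeR R)%type.

Definition cpart (b : bool) (z : R[i]) : R := if b then complex.Re z else complex.Im z.

Lemma cpart_le b z : `|cpart b z| <= modulus z.
Proof. by case: b; [exact: Re_le_modulus|exact: Im_le_modulus]. Qed.

Lemma ckernN (a x : R) : ckern a (- x) = ckern a x.
Proof. by rewrite /ckern /poisson_den !cosN. Qed.

Lemma skernN (a x : R) : skern a (- x) = - skern a x.
Proof. by rewrite /skern /poisson_den !cosN sinN mulrN mulNr. Qed.

(** At [x = polar (r * rho) (t - phi)] the kernel [1 / (1 - x) ^+ 2] is [cauchy2 x] divided by [x],
    and [cauchy2 x] is [r * rho] times the pair of derivative kernels. These are written at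
    [phi - t], as in [kern_int]; [skern] being odd, its signs change. *)
Lemma bkern_polar (r rho t phi : R) : 0 < r * rho < 1 ->
  bkern (polar r t) (polar_map (rho, phi)) =
  (cos (t - phi) * ckern (r * rho) (phi - t) - sin (t - phi) * skern (r * rho) (phi - t)) +i*
  (- sin (t - phi) * ckern (r * rho) (phi - t) - cos (t - phi) * skern (r * rho) (phi - t)).
Proof.
move=> /andP[a0 a1]; set a := r * rho in a0 a1 *; set y := t - phi.
have aw : 0 <= a < 1 by rewrite ltW.
have -> : phi - t = - y by rewrite opprB.
rewrite ckernN skernN /bkern.
have -> : polar r t * Num.conj (toC (polar_map (rho, phi))) = polar a y.
  have -> : Num.conj (toC (polar_map (rho, phi))) = polar rho (- phi) by exact: conj_polar.
  by rewrite polarM.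
have y1 : modulus (polar a y) < 1 by rewrite modulus_polar ger0_norm// ltW.
have nz := one_sub_neq0 y1.
have xz : polar a y != 0 by rewrite -modulus_eq0 modulus_polar normr_eq0 gt_eqF.
have inv1 : polar a^-1 (- y) * polar a y = 1.
  by rewrite polarM mulVf ?gt_eqF// addNr polar0.
have -> : 1 / (1 - polar a y) ^+ 2 = polar a^-1 (- y) * cauchy2 (polar a y).
  by rewrite /cauchy2 mulrA inv1.
rewrite cauchy2_kern// /polar cosN sinN; simpc => /=.
by congr (_ +i* _); field; rewrite gt_eqF.
Qed.

Lemma circ_int_lin4 (c1 c2 c3 c4 : R) (f1 f2 f3 f4 : R -> R) :
  bmeas f1 -> bmeas f2 -> bmeas f3 -> bmeas f4 ->
  circ_int (fun t => c1 * f1 t + c2 * f2 t + (c3 * f3 t + c4 * f4 t)) =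
  c1 * circ_int f1 + c2 * circ_int f2 + (c3 * circ_int f3 + c4 * circ_int f4).
Proof.
move=> b1 b2 b3 b4.
have z1 := bmeasZ c1 b1; have z2 := bmeasZ c2 b2; have z3 := bmeasZ c3 b3; have z4 := bmeasZ c4 b4.
rewrite (circ_intD (bmeasD z1 z2) (bmeasD z3 z4)) (circ_intD z1 z2) (circ_intD z3 z4).
by rewrite !circ_intZ.
Qed.

Lemma norm_lin4 (c1 c2 c3 c4 x1 x2 x3 x4 : R) :
  `|c1| <= 1 -> `|c2| <= 1 -> `|c3| <= 1 -> `|c4| <= 1 ->
  `|c1 * x1 + c2 * x2 + (c3 * x3 + c4 * x4)| <= `|x1| + `|x2| + (`|x3| + `|x4|).
Proof.
have H (c x : R) : `|c| <= 1 -> `|c * x| <= `|x| by move=> c1'; rewrite normrM ler_piMl.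
move=> h1 h2 h3 h4; apply: le_trans (ler_normD _ _) _; apply: lerD.
  by apply: le_trans (ler_normD _ _) _; apply: lerD; exact: H.
by apply: le_trans (ler_normD _ _) _; apply: lerD; exact: H.
Qed.

(** The rotation by [t - phi] in [bkern_polar] is split by the addition formulas: the factors in
    [phi] are bounded by 1 and the factors in [t] are absorbed into [g], which leaves four integrals
    against pure convolution kernels. *)
Lemma kern_part_le (b : bool) (r rho phi : R) (g : R -> R) : 0 < r * rho < 1 -> bmeas g ->
  `|circ_int (fun t => cpart b (bkern (polar r t) (polar_map (rho, phi))) * g t)| <=
  `|kern_int (@ckern R) (r * rho) (fun t => g t * cos t) phi| +
  `|kern_int (@ckern R) (r * rho) (fun t => g t * sin t) phi| +
  (`|kern_int (@skern R) (r * rho) (fun t => g t * cos t) phi| +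
  `|kern_int (@skern R) (r * rho) (fun t => g t * sin t) phi|).
Proof.
move=> a01 bg; have aw : 0 <= r * rho < 1 by case/andP: a01 => /ltW -> ->.
have bc : bmeas (fun t : R => g t * cos t) by apply: bmeasM => //; apply: bmeas_cos; exact: measurable_id.
have bs : bmeas (fun t : R => g t * sin t) by apply: bmeasM => //; apply: bmeas_sin; exact: measurable_id.
have k1 := bmeas_kern_mul phi (@deriv_kernel_ckern R) aw bc.
have k2 := bmeas_kern_mul phi (@deriv_kernel_ckern R) aw bs.
have k3 := bmeas_kern_mul phi (@deriv_kernel_skern R) aw bc.
have k4 := bmeas_kern_mul phi (@deriv_kernel_skern R) aw bs.
have nc : `|cos phi| <= 1 by rewrite ler_norml cos_geN1 cos_le1.
have ns : `|sin phi| <= 1 by rewrite ler_norml sin_geN1 sin_le1.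
rewrite /kern_int; case: b.
  rewrite (@eq_circ_int _ _ (fun t =>
    cos phi * (ckern (r * rho) (phi - t) * (g t * cos t)) +
    sin phi * (ckern (r * rho) (phi - t) * (g t * sin t)) +
    (sin phi * (skern (r * rho) (phi - t) * (g t * cos t)) +
     (- cos phi) * (skern (r * rho) (phi - t) * (g t * sin t))))); last first.
    by move=> t; rewrite (bkern_polar _ _ a01) /= cosB sinB; ring.
  by rewrite (circ_int_lin4 _ _ _ _ k1 k2 k3 k4); apply: norm_lin4; rewrite ?normrN.
rewrite (@eq_circ_int _ _ (fun t =>
    sin phi * (ckern (r * rho) (phi - t) * (g t * cos t)) +
    (- cos phi) * (ckern (r * rho) (phi - t) * (g t * sin t)) +
    ((- cos phi) * (skern (r * rho) (phi - t) * (g t * cos t)) +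
     (- sin phi) * (skern (r * rho) (phi - t) * (g t * sin t))))); last first.
  by move=> t; rewrite (bkern_polar _ _ a01) /= cosB sinB; ring.
by rewrite (circ_int_lin4 _ _ _ _ k1 k2 k3 k4); apply: norm_lin4; rewrite ?normrN.
Qed.

Definition circle_kernel (b : bool) (r : R) (z : R * RR) : R := cpart b (bkern (polar r z.1) z.2).

Lemma measurable_circle_kernel b r : measurable_fun setT (circle_kernel b r).
Proof.
have mp : cmeas (fun z : R * RR => polar r z.1).
  split => /=; apply: measurable_funM => //.
    by apply: measurable_cos_comp; exact: measurable_fst.
  by apply: measurable_sin_comp; exact: measurable_fst.
have mw : cmeas (fun z : R * RR => toC z.2).
  split => /=; first exact: (measurableT_comp measurable_fst measurable_snd).
  exact: (measurableT_comp measurable_snd measurable_snd).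
have : cmeas (fun z : R * RR => bkern (polar r z.1) z.2).
  apply: cmeasM; first exact: cmeas_cst.
  apply: cmeasV; apply: cmeasX; apply: cmeasB; first exact: cmeas_cst.
  by apply: cmeasM => //; exact: cmeas_conj.
by move=> [m1 m2]; case: b.
Qed.

Lemma circle_kernel_le b r t w : 0 <= r < 1 -> D w -> `|circle_kernel b r (t, w)| <= (1 - r) ^- 2.
Proof.
move=> /andP[r0 r1] Dw; apply: le_trans (cpart_le _ _) _.
have m : modulus (polar r t) = r by rewrite modulus_polar ger0_norm.
by have := @bkern_le _ (polar r t) w; rewrite m; apply.
Qed.

(** [lam] times the extremal function of Hoelder's inequality for [Phi], assembled from the positive
    and negative parts of [Phi] so that measurability is immediate. *)
Lemma signed_power (p lam : R) (Phi : R -> R) : 1 < p -> 0 <= lam -> bmeas Phi ->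
  exists g : R -> R, [/\ bmeas g, forall t, Phi t * g t = lam * `|Phi t| `^ p &
    forall t, `|g t| = lam * `|Phi t| `^ (p - 1)].
Proof.
move=> p1 l0 bP; have p10 : p - 1 != 0 by rewrite gt_eqF// subr_gt0.
have pe (x : R) : 0 <= x -> x * x `^ (p - 1) = x `^ p.
  rewrite le_eqVlt => /predU1P[<-|x0]; first by rewrite mul0r powR0// gt_eqF// (lt_trans ltr01).
  by rewrite -{1}(powRr1 (ltW x0)) -powRD ?(gt_eqF x0) ?implybT//; congr (_ `^ _); ring.
pose g t := lam * (Num.max (Phi t) 0 `^ (p - 1) - Num.max (- Phi t) 0 `^ (p - 1)).
have gE t : [\/ 0 <= Phi t /\ g t = lam * Phi t `^ (p - 1) |
              Phi t < 0 /\ g t = - (lam * (- Phi t) `^ (p - 1))].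
  rewrite /g; case: (leP 0 (Phi t)) => h; [left|right]; split=> //.
    have -> : Num.max (- Phi t) 0 = 0 by apply/max_idPr; rewrite oppr_le0.
    by rewrite powR0// subr0.
  have -> : Num.max (- Phi t) 0 = - Phi t by apply/max_idPl; rewrite oppr_ge0 ltW.
  by rewrite powR0// sub0r mulrN.
have ng t : `|g t| = lam * `|Phi t| `^ (p - 1).
  case: (gE t) => -[h ->]; first by rewrite ger0_norm ?mulr_ge0 ?powR_ge0// ger0_norm.
  by rewrite normrN ger0_norm ?mulr_ge0 ?powR_ge0// ltr0_norm.
exists g; split=> //; last first.
  move=> t; case: (gE t) => -[h ->]; first by rewrite ger0_norm// mulrCA pe.
  by rewrite mulrN -mulNr mulrCA pe ?ltr0_norm// oppr_ge0 ltW.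
have bn := bmeas_norm bP.
have p1' : 0 <= p - 1 by rewrite subr_ge0 ltW.
apply: (bmeas_le _ (bmeasZ lam (bmeas_powR p1' (fun t => normr_ge0 (Phi t)) bn))) => [|t]; last by rewrite ng.
apply: measurable_funM => //; apply: measurable_funB.
  apply: (measurableT_comp (measurable_powR (p - 1))).
  by apply: measurable_maxr => //; exact: bP.1.
apply: (measurableT_comp (measurable_powR (p - 1))); apply: measurable_maxr => //.
by apply: measurableT_comp => //; exact: bP.1.
Qed.

(** The Jacobian [rho] is bounded by 1 and [1 - rho ^+ 2] by [2 * (1 - rho)]. *)
Lemma dual_pointwise (rho m v x s : R) : 0 < rho < 1 -> 0 <= m -> 0 <= v ->
  v <= 2 * (1 - rho ^+ 2) * m -> 0 <= x -> x <= s ->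
  rho * (v * x) <= 4 * ((1 - rho) * m * s).
Proof.
move=> /andP[r0 r1] m0 v0 vm x0 xs; have s0 : 0 <= s by exact: le_trans xs.
apply: (@le_trans _ _ (v * x)); first by rewrite ler_piMl ?mulr_ge0// ltW.
apply: (@le_trans _ _ (2 * (1 - rho ^+ 2) * m * s)); first exact: ler_pM.
rewrite !mulrA; apply: ler_wpM2r => //; apply: ler_wpM2r => //; nra.
Qed.

Lemma integral_add4 (a b c d : RR -> \bar R) : measurable_fun setT a -> measurable_fun setT b ->
  measurable_fun setT c -> measurable_fun setT d -> (forall u, 0 <= a u)%E -> (forall u, 0 <= b u)%E ->
  (forall u, 0 <= c u)%E -> (forall u, 0 <= d u)%E ->
  (\int[A]_u (a u + b u + (c u + d u)) =
   \int[A]_u a u + \int[A]_u b u + (\int[A]_u c u + \int[A]_u d u))%E.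
Proof.
move=> ma mb mc md a0 b0 c0 d0.
have I (f g : RR -> \bar R) : measurable_fun setT f -> measurable_fun setT g ->
    (forall u, 0 <= f u)%E -> (forall u, 0 <= g u)%E ->
    (\int[A]_u (f u + g u) = \int[A]_u f u + \int[A]_u g u)%E.
  by move=> mf mg f0 g0; rewrite ge0_integralD.
rewrite (I (fun u => a u + b u)%E (fun u => c u + d u)%E) ?I//.
- exact: emeasurable_funD.
- exact: emeasurable_funD.
- by move=> u; exact: adde_ge0.
- by move=> u; exact: adde_ge0.
Qed.

(** With [X] the integral of the power [p] of the transform, testing against [signed_power] pairs to
    [lam * X], while the dual integral of [g] is the power [q] of [lam] times [X]. The transform is
    bounded for [r < 1], so [X] is finite and can be absorbed. *)
Lemma transform_estimate (p : R) : 1 < p -> exists2 C : R, 0 <= C &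
  forall (b : bool) (r : R) (V : R * R -> R) (G : R[i] -> R[i]) (Y : R), 2^-1 <= r < 1 ->
  cintegrable D (G \o @toC R) -> measurable_fun J (square_fun G) ->
  (\int[mu]_(t in J) (`|square_fun G t| `^ p) <= Y%:E)%E ->
  A.-integrable D (EFin \o V) ->
  (forall w, D w -> `|V w| <= 2 * (1 - (w.1 ^+ 2 + w.2 ^+ 2)) * modulus (G (toC w))) ->
  circ_int (fun t => `|disc_transform V (circle_kernel b r) t| `^ p) <= C * Y.
Proof.
move=> p1; have [C1 C10 tent] := tent_signed p1.
have [q1 pq _] := conj_exp p1; set q := p / (p - 1) in q1 pq tent.
(* Four kernel integrals from [kern_part_le], each with the factor 4 of [dual_pointwise]. *)
pose C0 := 16 * C1; have C00 : 0 <= C0 by rewrite mulr_ge0.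
(* Chosen so that the power [q - 1] of [lam] is [(2 * C0 + 1)^-1]: then [C0] times the power [q] of
   [lam] is at most [lam / 2], and half of [lam * X] survives the absorption. *)
pose lam := (2 * C0 + 1) `^ (- (q - 1)^-1).
have B0 : 0 < 2 * C0 + 1 by lra.
have lam0 : 0 < lam by rewrite powR_gt0.
have lamq : lam `^ (q - 1) = (2 * C0 + 1)^-1.
  rewrite /lam -powRrM mulNr mulVf ?powRN ?powRr1 ?(ltW B0)//.
  by rewrite gt_eqF// subr_gt0.
have lamE : lam `^ q = lam * (2 * C0 + 1)^-1.
  rewrite -lamq -{2}(powRr1 (ltW lam0)) -powRD ?(gt_eqF lam0) ?implybT//.
  by congr (_ `^ _); ring.
exists (2 * C0 / lam); first by rewrite divr_ge0// ?mulr_ge0// ltW.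
move=> b r V G Y r1 iG ms HY iV HV.
have r01 : 0 <= r < 1 by lra.
have mK := measurable_circle_kernel b r.
have KB t w : D w -> `|circle_kernel b r (t, w)| <= (1 - r) ^- 2 by exact: circle_kernel_le.
have B0' : 0 <= (1 - r) ^- 2 by rewrite invr_ge0 sqr_ge0.
have bP := bmeas_disc_transform iV mK B0' KB.
set Phi := disc_transform V (circle_kernel b r) in bP *.
have [g [bg gP gn]] := signed_power p1 (ltW lam0) bP.
have [W [mW WD Wout Wle]] := disc_transform_dual iV mK B0' KB bg.
have bn := bmeas_norm bP.
have p0 : 0 <= p by lra.
have bX := bmeas_powR p0 (fun t => normr_ge0 (Phi t)) bn.
set X := circ_int (fun t => `|Phi t| `^ p).
have X0 : 0 <= X by apply: circ_int_ge0 => t; exact: powR_ge0.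
have bng := bmeas_norm bg.
have gq : circ_int (fun t => `|g t| `^ q) = lam `^ q * X.
  rewrite -(circ_intZ _ bX); apply: eq_circ_int => t.
  by rewrite gn powRM ?powR_ge0 ?(ltW lam0)// -powRrM pq.
have bgc : bmeas (fun t : R => g t * cos t) by apply: bmeasM => //; apply: bmeas_cos; exact: measurable_id.
have bgs : bmeas (fun t : R => g t * sin t) by apply: bmeasM => //; apply: bmeas_sin; exact: measurable_id.
have gcle t : `|g t * cos t| <= `|g t|.
  by rewrite normrM ler_piMr// ler_norml cos_geN1 cos_le1.
have gsle t : `|g t * sin t| <= `|g t|.
  by rewrite normrM ler_piMr// ler_norml sin_geN1 sin_le1.
have T k h dk bh hg := tent k r h (fun t => `|g t|) G Y dk r1 bh bng hg iG ms HY.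
have T1 := T _ _ (@deriv_kernel_ckern R) bgc gcle.
have T2 := T _ _ (@deriv_kernel_ckern R) bgs gsle.
have T3 := T _ _ (@deriv_kernel_skern R) bgc gcle.
have T4 := T _ _ (@deriv_kernel_skern R) bgs gsle.
rewrite gq in T1 T2 T3 T4.
have W0 w : 0 <= W w.
  by have [/WD ->|/Wout ->] := pselect (D w); rewrite ?mulr_ge0.
have mWE : measurable_fun setT (fun w => (W w)%:E) by exact/measurable_EFinP.
have pol := polar_le mWE (fun w => W0 w : (0 <= (W w)%:E)%E) (fun w nD => congr1 EFin (Wout w nD)).
have mt k h : deriv_kernel k -> bmeas h -> measurable_fun setT (fun u : R * R =>
    ((1 - u.1) * polar_density G u * `|kern_int k (r * clip u.1) h u.2|)%:E).
  move=> dk bh; apply/measurable_EFinP; apply: measurable_tent_integrand => //.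
  exact: measurable_polar_density.
have m1 := mt _ _ (@deriv_kernel_ckern R) bgc.
have m2 := mt _ _ (@deriv_kernel_ckern R) bgs.
have m3 := mt _ _ (@deriv_kernel_skern R) bgc.
have m4 := mt _ _ (@deriv_kernel_skern R) bgs.
have pos (u : R * R) (x : R) : 0 <= x -> 0 <= (1 - u.1) * polar_density G u * x.
  move=> x0; have [[/andP[_ u1] _]|/(polar_density0 G) ->] := pselect (polar_rect u).
    by rewrite mulr_ge0// mulr_ge0 ?polar_density_ge0// subr_ge0 ltW.
  by rewrite mulr0 mul0r.
have main : ((lam * X)%:E <= 4%:E * ((tent_bilinear (@ckern R) r (fun t => (g t * cos t)%R) (polar_density G) +
    tent_bilinear (@ckern R) r (fun t => (g t * sin t)%R) (polar_density G)) +
   (tent_bilinear (@skern R) r (fun t => (g t * cos t)%R) (polar_density G) +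
    tent_bilinear (@skern R) r (fun t => (g t * sin t)%R) (polar_density G))))%E.
  have -> : lam * X = circ_int (fun t => Phi t * g t).
    by rewrite -(circ_intZ _ bX); apply: eq_circ_int => t; rewrite gP.
  apply: le_trans Wle _; apply: le_trans pol _.
  pose I k h (u : R * R) := ((1 - u.1) * polar_density G u * `|kern_int k (r * clip u.1) h u.2|)%:E.
  have I0 k h u : (0 <= I k h u)%E by rewrite lee_fin pos.
  rewrite /tent_bilinear -(integral_add4 m1 m2 m3 m4); [|exact: I0..].
  rewrite -ge0_integralZl//; last 2 first.
  - by apply: emeasurable_funD; exact: emeasurable_funD.
  - by move=> u _; rewrite !adde_ge0//; exact: I0.
  apply: ge0_le_integral => //.
  - move=> u _; rewrite mule_ge0 ?lee_fin// indicE; have [|_] := boolP (u \in polar_rect).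
      by rewrite inE => -[/andP[u0 _] _]; rewrite mul1r ltW.
    by rewrite mul0r.
  - apply: emeasurable_funM.
      apply/measurable_EFinP; apply: measurable_funM => //.
      exact: measurable_indic measurable_polar_rect.
    exact: (measurableT_comp mWE (@measurable_polar_map R)).
  - apply: emeasurable_funM; first exact: measurable_cst.
    by apply: emeasurable_funD; exact: emeasurable_funD.
  move=> u _; have [Qu|nQ] := pselect (polar_rect u); last first.
    rewrite indicE memNset// !mul0r mul0e; apply: mule_ge0 => //.
    by rewrite !adde_ge0//; exact: I0.
  have [u01 _] := Qu; have /andP[u0 u1] := u01.
  rewrite indicE mem_set// mul1r -!EFinD -!EFinM lee_fin.
  have Du := disc_polar_map u01.
  rewrite WD// -!mulrDr clipE//.
  have a01 : 0 < r * u.1 < 1.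
    have rp : 0 < r by apply: lt_le_trans (andP r1).1; rewrite invr_gt0.
    by rewrite mulr_gt0//=; apply: lt_trans u1; rewrite gtr_pMl//; case/andP: r01.
  have := kern_part_le b u.2 a01 bg.
  have := HV _ Du; rewrite /polar_density indicE mem_set// mul1r /abs_disc patchE mem_set//.
  have -> : (polar_map u).1 ^+ 2 + (polar_map u).2 ^+ 2 = u.1 ^+ 2.
    by rewrite /polar_map/= !exprMn -mulrDr cos2Dsin2 mulr1.
  rewrite -surjective_pairing /circle_kernel /=.
  move=> h1 h2; apply: dual_pointwise h2 => //; exact: modulus_ge0.
have : lam * X <= C0 * (Y + lam `^ q * X).
  rewrite -lee_fin; apply: le_trans main _.
  apply: le_trans.
    by apply: lee_wpmul2l (leeD (leeD T1 T2) (leeD T3 T4)); rewrite lee_fin.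
  rewrite -!EFinD -EFinM lee_fin /C0; move: (lam `^ q * X); clear => x; lra.
rewrite lamE => H.
have H2 : lam * X <= C0 * Y + lam * X / 2.
  apply: le_trans H _; rewrite mulrDr lerD2l.
  have -> : C0 * (lam * (2 * C0 + 1)^-1 * X) = (lam * X) * (C0 / (2 * C0 + 1)) by ring.
  rewrite ler_wpM2l ?mulr_ge0 ?(ltW lam0)//.
  by rewrite ler_pdivrMr//; move: (C0) C00; clear => c; lra.
by rewrite mulrAC ler_pdivlMr// mulrC; move: H2; move: (lam * X) (C0); clear => x c; lra.
Qed.

End dual_estimate.

(** * Means of the Bergman projection on circles *)

Section assembly.
Local Open Scope complex_scope.
Context {R : realType}.
Local Notation D := (@disc R).
Local Notation A := (area R).
Local Notation mu := (@lebesgue_measure R).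
Local Notation J := (`[0, 2 * pi]%classic : set R).

Let mD : measurable (D : set (measurableTypeR R * measurableTypeR R)).
Proof. exact: measurable_disc. Qed.

Definition re_im_transform (b1 b2 : bool) (r : R) (V : R * R -> R[i]) : R -> R :=
  disc_transform (fun w => cpart b1 (V w)) (circle_kernel b2 r).

Lemma integrable_cpart b V : cintegrable D V -> A.-integrable D (EFin \o (fun w => cpart b (V w))).
Proof. by move=> [V1 V2]; case: b. Qed.

Lemma bmeas_re_im_transform b1 b2 r V : 0 <= r < 1 -> cintegrable D V ->
  bmeas (re_im_transform b1 b2 r V).
Proof.
move=> r01 iV; have KB t w : D w -> `|circle_kernel b2 r (t, w)| <= (1 - r) ^- 2.
  exact: circle_kernel_le.
have B0 : 0 <= (1 - r) ^- 2 by rewrite invr_ge0 sqr_ge0.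
exact: (bmeas_disc_transform (integrable_cpart b1 iV) (measurable_circle_kernel b2 r) B0 KB).
Qed.

Lemma cintegral_bkern r t V : 0 <= r < 1 -> cintegrable D V ->
  cintegral D (fun w => V w * bkern (polar r t) w) =
  (re_im_transform true true r V t - re_im_transform false false r V t) +i*
  (re_im_transform true false r V t + re_im_transform false true r V t).
Proof.
move=> r01 iV.
have z1 : modulus (polar r t) < 1 by rewrite modulus_polar ger0_norm; case/andP: r01.
have ik b1 b2 : A.-integrable D (EFin \o (fun w => cpart b1 (V w) * circle_kernel b2 r (t, w))).
  apply: (integrable_bound (M := (1 - r) ^- 2) (integrable_cpart b1 iV)).
    apply: (measurableT_comp (measurable_circle_kernel b2 r)); exact: measurable_prodmk1.
  by move=> w Dw; exact: circle_kernel_le.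
rewrite /cintegral /re_im_transform /disc_transform; congr (_ +i* _).
  rewrite -(RintegralB mD (ik true true) (ik false false)).
  by apply: eq_Rintegral => w _; rewrite Re_mul.
rewrite -(RintegralD mD (ik true false) (ik false true)).
by apply: eq_Rintegral => w _; rewrite Im_mul.
Qed.

Lemma modulus_lin4 (a b c d : R) :
  modulus ((a - b) +i* (c + d)) <= `|a| + `|b| + (`|c| + `|d|).
Proof.
apply: le_trans (modulus_le_ReIm _) _; apply: lerD; [exact: ler_normB|exact: ler_normD].
Qed.

Lemma modulus_divpi (z : R[i]) : modulus (z / (pi : R)%:C) <= modulus z.
Proof.
have p1 : 1 <= pi :> R by have := pi_ge2 R; lra.
rewrite modulusM modulusV modulus_real ger0_norm ?pi_ge0// ler_piMr ?modulus_ge0//.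
by rewrite invf_le1// pi_gt0.
Qed.

Lemma bmeas_modulus_bergman r (f : R[i] -> R[i]) : 0 <= r < 1 -> cintegrable D (f \o @toC R) ->
  bmeas (fun t : R => modulus (bergman f (polar r t))).
Proof.
move=> r01 fi.
have z1 (t : R) : modulus (polar r t) < 1 by rewrite modulus_polar ger0_norm; case/andP: r01.
have b b1 b2 := @bmeas_re_im_transform b1 b2 r (f \o @toC R) r01 fi.
have E t : bergman f (polar r t) =
   ((re_im_transform true true r (f \o @toC R) t - re_im_transform false false r (f \o @toC R) t) +i*
  (re_im_transform true false r (f \o @toC R) t + re_im_transform false true r (f \o @toC R) t)) / (pi : R)%:C.
  by rewrite bergmanE// -cintegral_bkern.
have m : measurable_fun setT (fun t : R => modulus (bergman f (polar r t))).
  apply: cmeas_modulus; rewrite (funext E); apply: cmeasM; last exact: cmeas_cst.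
  by split; [apply: measurable_funB; exact: (b _ _).1|apply: measurable_funD; exact: (b _ _).1].
have bb := bmeasD (bmeasD (bmeas_norm (b true true)) (bmeas_norm (b false false)))
  (bmeasD (bmeas_norm (b true false)) (bmeas_norm (b false true))).
apply: (bmeas_le m bb) => t; rewrite ger0_norm ?modulus_ge0// E.
by apply: le_trans (modulus_divpi _) _; exact: modulus_lin4.
Qed.

Lemma weight2_bkern_le z w : modulus z < 1 -> D w -> modulus (weight2 w * bkern z w) <= 12.
Proof.
move=> z1 Dw; have w1 := disc_modulus Dw; have w0 := modulus_ge0 (toC w).
have d0 : 0 < 1 - modulus (toC w) by rewrite subr_gt0.
have H : 1 - modulus (toC w) <= modulus (1 - z * (toC w)^*).
  apply: one_sub_modulus; rewrite modulusM modulus_conj ler_piMl// ltW//.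
have kE : modulus (bkern z w) = (modulus (1 - z * (toC w)^*) ^+ 2)^-1.
  by rewrite /bkern modulusM modulus1 mul1r modulusV modulusX.
rewrite modulusM kE.
have m0 : 0 < modulus (1 - z * (toC w)^*) by exact: lt_le_trans H.
rewrite ler_pdivrMr ?exprn_gt0//; apply: le_trans (modulus_weight2 Dw) _.
have <- : modulus (toC w) ^+ 2 = w.1 ^+ 2 + w.2 ^+ 2 by rewrite sqr_modulus.
move: (modulus (toC w)) (modulus (1 - _)) w1 w0 d0 H m0 => m v m1 m0 d0 H v0.
apply: (@le_trans _ _ (12 * (1 - m) ^+ 2)); last first.
  by rewrite ler_wpM2l// lerXn2r ?nnegrE// ltW.
have -> : 1 - m ^+ 2 = (1 - m) * (1 + m) by ring.
rewrite exprMn; have : (1 + m) ^+ 2 <= 4 by nra.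
have := sqr_ge0 (1 - m); move: ((1 - m) ^+ 2) ((1 + m) ^+ 2) => x y; nra.
Qed.

Lemma bkern_small r t w : 0 <= r <= 2^-1 -> D w -> modulus (bkern (polar r t) w) <= 4 :> R.
Proof.
move=> /andP[r0 r1] Dw; have m : modulus (polar r t) = r by rewrite modulus_polar ger0_norm.
apply: le_trans (bkern_le _ Dw) _; first by rewrite m; lra.
rewrite m; have h : 2^-1 <= 1 - r by lra.
have h0 : 0 < 1 - r by lra.
rewrite -[leRHS]invrK lef_pV2 ?posrE ?exprn_gt0 ?invr_gt0//; nra.
Qed.

Definition weighted (G : R[i] -> R[i]) (w : R * R) : R[i] := G (toC w) * weight1 w.

Lemma bergman_pointwise_large (f fx fy : R[i] -> R[i]) r t :
  sobolev11 f fx fy ->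
  (forall e : R, 0 < e ->
     \forall r \near 1^'-, (integral_mean 1 r f <= (e * (1 - r)^-1)%:E)%E) ->
  0 <= r < 1 -> 
  modulus (bergman f (polar r t)) <=
  `|re_im_transform true true r (weighted (dz fx fy)) t| + `|re_im_transform false false r (weighted (dz fx fy)) t| +
  (`|re_im_transform true false r (weighted (dz fx fy)) t| + `|re_im_transform false true r (weighted (dz fx fy)) t|) +
  24 * l1 (f \o @toC R).
Proof.
move=> W11 Hf r01; pose V := weighted (dz fx fy); have [fi _ _ _] := W11; have Gi := cintegrable_dz W11.
have z1 : modulus (polar r t) < 1 by rewrite modulus_polar ger0_norm; case/andP: r01.
have iV : cintegrable D V by exact: (cintegrableM Gi cmeas_weight1 cbounded_weight1).
rewrite bergmanE//; apply: le_trans (modulus_divpi _) _.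
rewrite (bkern_identity W11 Hf z1); apply: le_trans (modulusD _ _) _; apply: lerD.
  by rewrite -/V (cintegral_bkern t r01 iV); exact: modulus_lin4.
have mm : cmeas (fun w => weight2 w * bkern (polar r t) w).
  by apply: cmeasM; [exact: cmeas_weight2|exact: cmeas_bkern].
have := modulus_cintegral_le fi mm (fun w => @weight2_bkern_le (polar r t) w z1).
rewrite (_ : 2 * 12 = 24 :> R); last by ring.
by apply: le_trans; rewrite le_eqVlt; apply/orP; left; apply/eqP; congr modulus;
  apply: eq_cintegral => w _ /=; rewrite mulrA.
Qed.

(** The square function estimates need [r >= 1 / 2], since the reproducing formula loses the factor
    [r]. On smaller circles the kernel itself is bounded by 4, and the [L^1] norm suffices. *)
Lemma bergman_pointwise_small (f : R[i] -> R[i]) r t : cintegrable D (f \o @toC R) ->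
  0 <= r <= 2^-1 -> modulus (bergman f (polar r t)) <= 24 * l1 (f \o @toC R).
Proof.
move=> fi r01; have r1 : 0 <= r < 1 by lra.
have z1 : modulus (polar r t) < 1 by rewrite modulus_polar ger0_norm; case/andP: r1.
rewrite bergmanE//; apply: le_trans (modulus_divpi _) _.
have := modulus_cintegral_le fi (cmeas_bkern _) (fun w => @bkern_small r t w r01).
have := l1_ge0 (f \o @toC R); move: (l1 _) => l l0 h; apply: le_trans h _; lra.
Qed.

Lemma powR_add5 (p a b c d e : R) : 0 <= p -> 0 <= a -> 0 <= b -> 0 <= c -> 0 <= d -> 0 <= e ->
  (a + b + (c + d) + e) `^ p <=
  2 `^ p * (2 `^ p * (2 `^ p * (a `^ p + b `^ p) + 2 `^ p * (c `^ p + d `^ p)) + e `^ p).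
Proof.
move=> p0 a0 b0 c0 d0 e0; have h := powR_ge0 2 p.
apply: le_trans (powR_addl_le p0 _ e0) _; first by rewrite !addr_ge0.
apply: ler_wpM2l => //; rewrite lerD2r.
apply: le_trans (powR_addl_le p0 _ _) _; rewrite ?addr_ge0//.
by apply: ler_wpM2l => //; apply: lerD; exact: powR_addl_le.
Qed.

Lemma le_mul_add (a b x y : R) : 0 <= a -> 0 <= b -> 0 <= x -> 0 <= y ->
  a * x + b * y <= (a + b) * (x + y).
Proof.
move=> a0 b0 x0 y0; have h1 : 0 <= a * y by rewrite mulr_ge0.
have h2 : 0 <= b * x by rewrite mulr_ge0.
lra.
Qed.

Lemma circ_int_addZ_le (c x y : R) (f g : R -> R) : 0 <= c -> bmeas f -> bmeas g ->
  circ_int f <= x -> circ_int g <= y -> circ_int (fun t => c * (f t + g t)) <= c * (x + y).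
Proof.
move=> c0 bf bg fx gy; rewrite (circ_intZ _ (bmeasD bf bg)) (circ_intD bf bg).
by apply: ler_wpM2l => //; exact: lerD.
Qed.

Lemma bergman_mean_estimate (p : R) : 1 < p -> exists2 C : R, 0 <= C &
  forall (f fx fy : R[i] -> R[i]) (Y r : R),
  sobolev11 f fx fy ->
  (forall e : R, 0 < e ->
     \forall r \near 1^'-, (integral_mean 1 r f <= (e * (1 - r)^-1)%:E)%E) ->
  measurable_fun J (square_fun (dz fx fy)) ->
  (\int[mu]_(t in J) (`|square_fun (dz fx fy) t| `^ p) <= Y%:E)%E -> 0 <= Y ->
  0 <= r < 1 ->
  circ_int (fun t => modulus (bergman f (polar r t)) `^ p) <= C * (Y + l1 (f \o @toC R) `^ p).
Proof.
move=> p1; have [C1 C10 H] := transform_estimate p1.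
have p0 : 0 <= p by lra.
pose c := 2 `^ p : R; have c1 : 1 <= c.
  by rewrite /c -[leLHS](powRr0 2) ler_powR ?ler1n//.
pose k := 24 `^ p * (2 * pi) : R.
have k0 : 0 <= k by rewrite mulr_ge0 ?powR_ge0 ?twopi_ge0.
exists (c * (c * (c * (C1 + C1) + c * (C1 + C1)) + k)).
  have c0 : 0 <= c by lra.
  by rewrite mulr_ge0// addr_ge0// mulr_ge0// addr_ge0// mulr_ge0// addr_ge0.
move=> f fx fy Y r W11 Hf ms HY Y0 r01; have [fi _ _ _] := W11; have Gi := cintegrable_dz W11.
set L := l1 _; have L0 : 0 <= L by exact: l1_ge0.
have bB := bmeas_modulus_bergman r01 fi.
have bBp := bmeas_powR p0 (fun t : R => modulus_ge0 (bergman f (polar r t))) bB.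
have cL : circ_int (fun=> (24 * L) `^ p) = k * L `^ p.
  by rewrite circ_int_cst powRM// /k; ring.
have Lp0 := powR_ge0 L p.
have [rs|rl] := leP r 2^-1.
  apply: (@le_trans _ _ (k * L `^ p)).
    rewrite -cL; apply: (le_circ_int bBp (bmeas_cst _ _)) => t.
    apply: ge0_ler_powR; rewrite ?nnegrE ?modulus_ge0// ?mulr_ge0//.
    by apply: bergman_pointwise_small => //; case/andP: r01 => ->.
  have : 0 <= c * (c * (c * (C1 + C1) + c * (C1 + C1))).
    have c0 : 0 <= c by lra.
    by rewrite mulr_ge0// mulr_ge0// addr_ge0// mulr_ge0// addr_ge0.
  rewrite [c * (_ + k)]mulrDr; move: (c * (c * _)) => z z0.
  have : k <= c * k by rewrite ler_peMl.
  move: (c * k) => k' kk; rewrite mulrDr !mulrDl.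
  have h1 : k * L `^ p <= k' * L `^ p by rewrite ler_wpM2r.
  have h2 : 0 <= z * Y by rewrite mulr_ge0.
  have h3 : 0 <= k' * Y by rewrite mulr_ge0// (le_trans k0).
  have h4 : 0 <= z * L `^ p by rewrite mulr_ge0.
  lra.
have r1 : 2^-1 <= r < 1 by rewrite (ltW rl); case/andP: r01.
pose V := weighted (dz fx fy).
have iV : cintegrable D V by exact: (cintegrableM Gi cmeas_weight1 cbounded_weight1).
have VG b w : D w -> `|cpart b (V w)| <= 2 * (1 - (w.1 ^+ 2 + w.2 ^+ 2)) * modulus (dz fx fy (toC w)).
  move=> Dw; apply: le_trans (cpart_le _ _) _; rewrite /V /weighted modulusM mulrC.
  by apply: ler_wpM2r; [exact: modulus_ge0|exact: modulus_weight1].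
have T b1 b2 := H b2 r _ _ Y r1 Gi ms HY (integrable_cpart b1 iV) (VG b1).
have bT b1 b2 := bmeas_norm (bmeas_re_im_transform b1 b2 r01 iV).
have bTp b1 b2 := bmeas_powR p0 (fun t => normr_ge0 (re_im_transform b1 b2 r V t)) (bT b1 b2).
pose a b1 b2 (t : R) := `|re_im_transform b1 b2 r V t| `^ p.
have ba b1 b2 : bmeas (a b1 b2) by exact: bTp.
have c0 : 0 <= c by lra.
have Ta b1 b2 : circ_int (a b1 b2) <= C1 * Y by exact: T.
have b1 := bmeasZ c (bmeasD (ba true true) (ba false false)).
have b2 := bmeasZ c (bmeasD (ba true false) (ba false true)).
have b3 := bmeasZ c (bmeasD b1 b2).
have bcL : bmeas (fun _ : R => (24 * L) `^ p) by exact: bmeas_cst.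
have b4 := bmeasZ c (bmeasD b3 bcL).
apply: (@le_trans _ _ (circ_int (fun t => c * (c * (c * (a true true t + a false false t) +
    c * (a true false t + a false true t)) + (24 * L) `^ p)))).
  apply: (le_circ_int bBp b4) => t.
  apply: le_trans (powR_add5 p0 _ _ _ _ _); rewrite ?mulr_ge0//.
  apply: ge0_ler_powR; rewrite ?nnegrE ?modulus_ge0//.
    by rewrite !addr_ge0// mulr_ge0.
  exact: (bergman_pointwise_large t W11 Hf r01).
have e1 := circ_int_addZ_le c0 (ba true true) (ba false false) (Ta true true) (Ta false false).
have e2 := circ_int_addZ_le c0 (ba true false) (ba false true) (Ta true false) (Ta false true).
have e3 := circ_int_addZ_le c0 b1 b2 e1 e2.
have e4 : circ_int (fun=> (24 * L) `^ p) <= k * L `^ p by rewrite cL.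
apply: le_trans (circ_int_addZ_le c0 b3 bcL e3 e4) _.
rewrite -mulrA; apply: ler_wpM2l => //.
have -> : c * (c * (C1 * Y + C1 * Y) + c * (C1 * Y + C1 * Y)) = c * (c * (C1 + C1) + c * (C1 + C1)) * Y by ring.
have : 0 <= c * (c * (C1 + C1) + c * (C1 + C1)).
  by rewrite mulr_ge0// addr_ge0// mulr_ge0// addr_ge0.
move: (c * (c * _ + _)) => z z0.
exact: le_mul_add.
Qed.

End assembly.

(** * Norms and conclusion *)

Section final.
Context {R : realType}.
Local Notation D := (@disc R).
Local Notation A := (area R).
Local Notation mu := (@lebesgue_measure R).
Local Notation J := (`[0, 2 * pi]%classic : set R).

Let mD : measurable (D : set (measurableTypeR R * measurableTypeR R)).
Proof. exact: measurable_disc. Qed.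

Lemma Lnorm_disc_fin (q : R) : 0 < q -> ('N[A]_(q%:E)[EFin \o (\1_D : R * R -> R)] < +oo)%E.
Proof.
move=> q0; rewrite unlock; apply: poweR_lty.
rewrite (_ : (\int[A]_x _)%E = A D); first exact: area_disc_lty.
have <- : (\int[A]_w (\1_D w : R)%:E)%E = A D by rewrite integral_indic// setIT.
apply: eq_integral => w _ /=.
rewrite indicE; case: (w \in D); rewrite ?normr1 ?normr0 ?powR1//.
by rewrite powR0// gt_eqF.
Qed.

(** Hoelder's inequality against the indicator of the disc, which has finite area. *)
Lemma l1_le_disc_norm (q : R) : 1 < q -> exists2 c : R, 0 <= c &
  forall f : R[i] -> R[i], cintegrable D (f \o @toC R) ->
    ((l1 (f \o @toC R))%:E <= c%:E * disc_norm q f)%E.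
Proof.
move=> q1; have q0 : 0 < q by lra.
pose q' := q / (q - 1); have q'0 : 0 < q' by rewrite divr_gt0// subr_gt0.
have qq : q^-1 + q'^-1 = 1.
  by rewrite /q' invf_div -{1}[q^-1]mul1r -mulrDl addrC subrK mulfV// gt_eqF.
set n := ('N[A]_(q'%:E)[EFin \o (\1_D : R * R -> R)])%E.
have nfin : n \is a fin_num by rewrite ge0_fin_numE ?Lnorm_ge0// Lnorm_disc_fin.
exists (fine n); first by rewrite fine_ge0 ?Lnorm_ge0.
move=> f fi; rewrite (fineK nfin) muleC.
have mI : measurable_fun setT (\1_D : measurableTypeR R * measurableTypeR R -> R).
  exact: measurable_indic.
have := hoelder A (measurable_abs_disc fi) mI q0 q'0 qq.
rewrite (_ : ('N[A]_1[_])%E = (l1 (f \o @toC R))%:E).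
  rewrite (_ : disc_norm q f = ('N[A]_(q%:E)[EFin \o abs_disc f])%E)//.
  rewrite /disc_norm; apply: eq_Lnorm => w /=.
  by rewrite /abs_disc !patchE; case: ifP.
rewrite Lnorm1 -integral_abs_disc//; apply: eq_integral => w _ /=.
rewrite ger0_norm ?mulr_ge0 ?abs_disc_ge0 ?indicE//.
by rewrite /abs_disc patchE; case: ifP => _; rewrite ?mulr1 ?mulr0.
Qed.

Lemma powR_inv_root (p x : R) : 0 < p -> 0 <= x -> (x `^ p) `^ p^-1 = x.
Proof. by move=> p0 x0; rewrite -powRrM mulfV ?gt_eqF// powRr1. Qed.

Lemma powR_root_inv (p x : R) : 0 < p -> 0 <= x -> (x `^ p^-1) `^ p = x.
Proof. by move=> p0 x0; rewrite -powRrM mulVf ?gt_eqF// powRr1. Qed.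

Lemma circle_norm_fin (p : R) (g : R -> \bar R) : 0 < p -> (circle_norm p g < +oo)%E ->
  exists Y : R, [/\ 0 <= Y, (\int[mu]_(t in J) (`|g t| `^ p))%E = Y%:E &
    circle_norm p g = (((2 * pi)^-1 * Y) `^ p^-1)%:E].
Proof.
move=> p0; have pi2 := @twopi_gt0 R; rewrite /circle_norm.
have : (0 <= \int[mu]_(t in J) (`|g t| `^ p))%E.
  by apply: integral_ge0 => t _; exact: poweR_ge0.
case: (\int[mu]_(t in J) (`|g t| `^ p))%E => [Y|_|//]; last first.
  by rewrite gt0_muley ?lte_fin ?invr_gt0// poweRyr ?gt_eqF ?invr_gt0.
by rewrite lee_fin => Y0 _; exists Y.
Qed.

Lemma hardy_norm_le (p K : R) (F : R[i] -> R[i]) : 0 < p -> 0 <= K ->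
  (forall r : R, 0 <= r < 1 -> bmeas (fun t : R => modulus (F (polar r t)))) ->
  (forall r : R, 0 <= r < 1 ->
     circ_int (fun t => modulus (F (polar r t)) `^ p) <= 2 * pi * K `^ p) ->
  (hardy_norm p F <= K%:E)%E.
Proof.
move=> p0 K0 bF H; have pi2 := @twopi_gt0 R.
apply: ub_ereal_sup => _ [r r01 <-]; rewrite /integral_mean /circle_norm.
have bp := bmeas_powR (ltW p0) (fun t : R => modulus_ge0 (F (polar r t))) (bF r r01).
rewrite (_ : (\int[mu]_(t in _) _)%E = (circ_int (fun t => modulus (F (polar r t)) `^ p))%:E).
  rewrite -EFinM poweR_EFin lee_fin -[leRHS](powR_inv_root p0)//.
  have X0 : 0 <= circ_int (fun t => modulus (F (polar r t)) `^ p).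
    by apply: circ_int_ge0 => t; exact: powR_ge0.
  apply: ge0_ler_powR; rewrite ?nnegrE ?powR_ge0 ?invr_ge0 ?mulr_ge0 ?invr_ge0 ?(ltW p0) ?(ltW pi2)//.
  by rewrite mulrC ler_pdivrMr// mulrC; exact: H.
rewrite (circ_intE bp); apply: eq_integral => t _.
by rewrite abse_EFin ger0_norm ?modulus_ge0// poweR_EFin.
Qed.

End final.

Theorem theorem2p1 (R : realType) (p : R) (p1 : 1 < p) :
  exists C : R, forall f fx fy : R[i] -> R[i],
    sobolev11 f fx fy ->
    (disc_norm (2 * p / (p + 1)) f < +oo)%E ->
    (forall e : R, 0 < e ->
       \forall r \near 1^'-, (integral_mean 1 r f <= (e * (1 - r)^-1)%:E)%E) ->
    in_circle_Lp p (square_fun (dz fx fy)) ->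
    in_hardy p (bergman f) /\
    (hardy_norm p (bergman f) <=
       C%:E * (circle_norm p (square_fun (dz fx fy)) +
               disc_norm (2 * p / (p + 1)) f))%E.
Proof.
have p0 : 0 < p by lra.
have [C0 C00 H] := bergman_mean_estimate p1.
have q1 : 1 < 2 * p / (p + 1) by rewrite ltr_pdivlMr; lra.
have [c c0 HN] := l1_le_disc_norm q1; set q := 2 * p / (p + 1) in q1 HN *.
(* The factor 2 accounts for bounding the sum of the powers [p] of [s] and [L] by twice that power
   of [s + L]. *)
pose B := (2 * C0) `^ p^-1; have B0 : 0 <= B by exact: powR_ge0.
have BE : B `^ p = 2 * C0 by rewrite powR_root_inv// mulr_ge0.
exists (B * (1 + c)) => f fx fy W11 Nf Hf [ms sf]; have [fi _ _ _] := W11.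
have [Y [Y0 YE SE]] := circle_norm_fin p0 sf.
set s := ((2 * pi)^-1 * Y) `^ p^-1 in SE; have s0 : 0 <= s by exact: powR_ge0.
have pi2 := @twopi_gt0 R.
have sE : Y = 2 * pi * s `^ p.
  rewrite powR_root_inv//; last by rewrite mulr_ge0// invr_ge0 ltW.
  by rewrite mulrA mulfV ?mul1r// gt_eqF.
have Nn : disc_norm q f \is a fin_num by rewrite ge0_fin_numE ?Lnorm_ge0.
set N := fine (disc_norm q f); have N0 : 0 <= N by rewrite fine_ge0 ?Lnorm_ge0.
have NE : disc_norm q f = N%:E by rewrite fineK.
set L := l1 (f \o @toC R); have L0 : 0 <= L by exact: l1_ge0.
have LN : L <= c * N by have := HN f fi; rewrite NE -EFinM lee_fin.
have est : (hardy_norm p (bergman f) <= (B * (s + L))%:E)%E.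
  apply: hardy_norm_le => //; first by rewrite mulr_ge0// addr_ge0.
    by move=> r r01; exact: bmeas_modulus_bergman.
  move=> r r01; apply: le_trans (H f fx fy Y r W11 Hf ms _ Y0 r01) _; first by rewrite YE.
  rewrite -/L powRM ?addr_ge0// BE sE.
  have h1 : s `^ p <= (s + L) `^ p.
    by apply: ge0_ler_powR; rewrite ?nnegrE ?(ltW p0) ?addr_ge0// lerDl.
  have h2 : L `^ p <= (s + L) `^ p.
    by apply: ge0_ler_powR; rewrite ?nnegrE ?(ltW p0) ?addr_ge0// lerDr.
  have pi1 : 1 <= 2 * pi :> R by have := pi_ge2 R; lra.
  have l0 := powR_ge0 L p.
  rewrite (_ : 2 * pi * (2 * C0 * _) = C0 * (2 * pi * (s + L) `^ p + 2 * pi * (s + L) `^ p)); last by ring.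
  apply: ler_wpM2l => //; apply: lerD; first by apply: ler_wpM2l => //; exact: ltW.
  apply: (@le_trans _ _ (2 * pi * L `^ p)); first by rewrite ler_peMl.
  by apply: ler_wpM2l => //; exact: ltW.
split; last first.
  apply: le_trans est _; rewrite SE NE -EFinD -EFinM lee_fin.
  rewrite -mulrA; apply: ler_wpM2l => //; nra.
split; first exact: bergman_analytic.
exact: le_lt_trans est (ltry _).
Qed.
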